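(* In the setting fixed in the context (in particular $\mu[\{b\}]>0$, $(\chi,\eta)\in\mathcal O$ with corresponding pair of roots $(t,s)$, $\theta\in(\frac13,\frac12)$, and $\xi>0$, $N\ge1$ satisfying conditions (N1)–(N3) and (L1)–(L6)), for all $n>N$, $$\left| n J_n-\frac{\exp( n f_n(t) - n \tilde f_n(s))}{4 \pi (t-s) D_n \tilde D_n} \right| < \frac{\exp( n f_n(t) - n \tilde f_n(s))}{4 \pi (t-s) D_n \tilde D_n}\, n^{1-3\theta} F_n + \frac{\exp(n f_n(t) - n \tilde f_n(s))}{t-s}\exp\!\big( - \tfrac14 n^{1-2\theta} (D_n^2 \wedge \tilde D_n^2)\big)\, n^{1-\theta} G_n ,$$ where $F_n>0$, $G_n>0$ are the quantities defined in the context, and $F_n=O(1)$ and $G_n=O(1)$ for all $n$ sufficiently large. Finally, if $r_n=s_n$ for all $n>N$, then for all $n>N$ one has $\phi_{r_n,s_n}(u_n,v_n)=0$ and $$K_n((u_n,r_n),(v_n,s_n)) = \big(1-\tfrac{s_n}n\big)\, nJ_n .$$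
   Context: **Measure and particles.** $\mu$ is a probability measure on $\mathbb R$ with compact support, $\operatorname{supp}(\mu)\subset[a,b]$, $a<b$, $\{a,b\}\subset\operatorname{supp}(\mu)$, and $\mu[\{b\}]>0$. $C(w):=\int_a^b\frac{\mu[dx]}{w-x}$ for $w\in\mathbb C\setminus\operatorname{supp}(\mu)$. For each $n\ge1$, $x^{(n)}\in\mathbb R^n$ satisfies $x^{(n)}_1>\dots>x^{(n)}_n$, and $\frac1n\sum_i\delta_{x_i^{(n)}}\to\mu$ weakly. $P_n:=\{x_1^{(n)},\dots,x_n^{(n)}\}$, $C_n(w):=\frac1n\sum_{x\in P_n}\frac1{w-x}$. **Kernel.** For $(u,r),(v,s)\in\mathbb R\times\{1,\dots,n-1\}$, $K_n((u,r),(v,s))=\widetilde K_n((u,r),(v,s))-\phi_{r,s}(u,v)$ with $$\widetilde K_n((u,r),(v,s))=\sum_{j=1}^n1_{(x_j^{(n)}>u)}\frac{(x_j^{(n)}-u)^{n-r-1}}{(n-r-1)!}\frac{\partial^{n-s}}{\partial v^{n-s}}\prod_{i\ne j}\Big(\frac{v-x_i^{(n)}}{x_j^{(n)}-x_i^{(n)}}\Big),$$ and $\phi_{r,s}(u,v)=1_{(v>u)}$ times: $0$ if $s\le r$; $1$ if $s=r+1$; $(v-u)^{s-r-1}/(s-r-1)!$ if $s>r+1$. ($K_n$ is the correlation kernel of the determinantal point process of uniformly random Gelfand–Tsetlin patterns of depth $n$ with top row $x^{(n)}$.) **The region $\mathcal O$.** For $(\chi,\eta)\in[a,b]\times[0,1]$,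 $f_{(\chi,\eta)}(w):=\int_a^b\log(w-x)\mu[dx]-(1-\eta)\log(w-\chi)$ (principal logarithm), with $f_{(\chi,\eta)}'(w)=C(w)-\frac{1-\eta}{w-\chi}$ on $(\mathbb C\setminus\mathbb R)\cup(b,+\infty)$. $\mathcal O$ is the set of $(\chi,\eta)\in[a,b]\times[0,1]$ with $\chi<b$, $\eta>0$, such that $f_{(\chi,\eta)}'$ has a root of multiplicity $1$ in $(b,+\infty)$. When $\mu[\{b\}]>0$ and $(\chi,\eta)\in\mathcal O$, one has $(\chi,\eta)\in(a,b)\times(0,1)$ and $f_{(\chi,\eta)}'$ has exactly two roots $t>s$ in $(b,+\infty)$, each simple; moreover $\chi=\chi_{\mathcal O}(t,s)=\frac{tC(t)-sC(s)}{C(t)-C(s)}$ and $\eta=\eta_{\mathcal O}(t,s)=1+\frac{C(t)C(s)(t-s)}{C(t)-C(s)}$. Fix $(\chi,\eta)\in\mathcal O$ and the corresponding $(t,s)$, and write $f_{(t,s)}:=f_{(\chi,\eta)}$. **Non-asymptotic quantities.** $\chi_n:=\frac{tC_n(t)-sC_n(s)}{C_n(t)-C_n(s)}$, $\eta_n:=1+\frac{C_n(t)C_n(s)(t-s)}{C_n(t)-C_n(s)}$, $f_{(t,s),n}'(w):=C_n(w)-\frac{1-\eta_n}{w-\chi_n}$. The positions $(u_n,r_n),(v_n,s_n)\in\mathbb R\times\{1,\dots,n-1\}$ satisfy $$(v_n,\tfrac{s_n-1}n)=(\chi_n,\eta_n)+m_n(1,C_n(t))n^{-1/2}+(y_{1,n},y_{2,n})n^{-1},$$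 $$(u_n,\tfrac{r_n+1}n)=(\chi_n,\eta_n)+\tilde m_n(1,C_n(s))n^{-1/2}+(\tilde y_{1,n},\tilde y_{2,n})n^{-1},$$ with $m_n,\tilde m_n,y_{1,n},y_{2,n},\tilde y_{1,n},\tilde y_{2,n}=O(1)$. Define $f_n(w):=\frac1n\sum_i\log(w-x_i^{(n)})-\frac{n-s_n+1}n\log(w-v_n)$ and $\tilde f_n(z):=\frac1n\sum_i\log(z-x_i^{(n)})-\frac{n-r_n-1}n\log(z-u_n)$, so $f_n'(w)=C_n(w)-\frac{1-\frac{s_n-1}n}{w-v_n}$ and $\tilde f_n'(w)=C_n(w)-\frac{1-\frac{r_n+1}n}{w-u_n}$. $$J_n:=\frac1{(2\pi i)^2}\int_{c_n}dw\int_{C_n}dz\,\frac1{w-z}\frac{(z-u_n)^{n-r_n-1}}{(w-v_n)^{n-s_n+1}}\prod_{i=1}^n\frac{w-x_i^{(n)}}{z-x_i^{(n)}},$$ where (in this formula only) $c_n$, $C_n$ are any counter-clockwise simple closed contours such that $C_n$ contains $\{x_j^{(n)}:x_j^{(n)}>u_n\}$ and none of $\{x_j^{(n)}:x_j^{(n)}<u_n\}$, and $c_n$ contains $v_n$ and $C_n$. $D_n:=(\frac12|f_n''(t)|)^{1/2}$, $\tilde D_n:=(\frac12|\tilde f_n''(s)|)^{1/2}$. $\alpha\wedge\beta$, $\alpha\vee\beta$ denote min and max. **Conditions on $\xi>0$ and $N\ge1$.** Fix $\theta\in(\frac13,\frac12)$. (N1) $t-4\xi>s+4\xi>s-4\xi>b+4\xi>b-4\xi>\chi+4\xi>\chi-4\xi>a+4\xi$,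 and $1-2\xi>1-\eta+2\xi>1-\eta-2\xi>2\xi$. (N2) For all $n>N$: $b+4\xi>x_1^{(n)}>b-4\xi$; $a+4\xi>x_n^{(n)}>a-4\xi$; each of $\chi_n,v_n,u_n$ lies in $(\chi-4\xi,\chi+4\xi)$; each of $1-\eta_n,\ 1-\frac{s_n-1}n,\ 1-\frac{r_n+1}n$ lies in $(1-\eta-2\xi,1-\eta+2\xi)$; $\{x\in P_n:x>v_n\vee u_n\}\ne\emptyset$ and $\{x\in P_n:x<v_n\wedge u_n\}\neq\emptyset$. (N3) For all $n>N$: $n^{\frac13-\theta}<\frac12$, $n^{-\frac12+\theta}<\frac12$, $n^{-\theta}<\xi$, $n^{-\frac12}<\frac12\xi$, $|v_n-u_n|<\frac12\xi$, $n^{-1}<\xi$; $n^{-\theta}<2^{-6}(t-\chi)(t-b)^3(b-a)^{-1}|f_{(t,s)}''(t)|$; and $n^{1-3\theta}(E_{2,n}+\tilde E_{2,n})<1$, where $E_{2,n}:=2n^{2\theta}|f_n'(t)|+\frac{2^6}{(t-b)^3}+\frac{2^5}{(t-\chi)^3}$ and $\tilde E_{2,n}:=2n^{2\theta}|\tilde f_n'(s)|+\frac{2^9}{(s-b)^3}+\frac{2^6}{(s-\chi)^3}$. For all $n>N$ (with $B(z,\rho)$ the open disc, roots counted with multiplicity): (L1) $f_{(t,s),n}''(t)>\frac12f_{(t,s)}''(t)>0$ and $f_{(t,s),n}''(s)<\frac12f_{(t,s)}''(s)<0$. (L2) $t$ and $s$ are the unique roots of $f_{(t,s),n}'$ in $B(t,\xi)$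 and $B(s,\xi)$ respectively. (L3) $f_n''(t)>\frac14f_{(t,s)}''(t)>0$ and $\tilde f_n''(s)<\frac14f_{(t,s)}''(s)<0$. (L4) $f_n'$ has exactly one root $t_n$ in $B(t,n^{-1/2})$ and exactly one root $s_n^\ast$ in $B(s,\xi)$; $t_n\in(t-n^{-1/2},t+n^{-1/2})\subset(t-\frac\xi2,t+\frac\xi2)$, $s_n^\ast\in(s-\xi,s+\xi)$. (L5) $\tilde f_n'$ has exactly one root $\tilde t_n$ in $B(t,\xi)$ and exactly one root $\tilde s_n$ in $B(s,n^{-1/2})$; $\tilde t_n\in(t-\xi,t+\xi)$, $\tilde s_n\in(s-n^{-1/2},s+n^{-1/2})\subset(s-\frac\xi2,s+\frac\xi2)$. (L6) $f_n''(t_n)>\frac14f_{(t,s)}''(t)>0$ and $\tilde f_n''(\tilde s_n)<\frac14f_{(t,s)}''(s)<0$. **Definition of $F_n$, $G_n$.** $G_n:=2^3(s-\chi)+2^3(t-\chi)+2^4\exp(-\frac14n^{1-2\theta}(D_n^2\wedge\tilde D_n^2))\,n^\theta(t-\chi)(s-\chi)$. Let $b_n:=|t_n+in^{-\theta}-t|n^\theta$, $\alpha_n:=\operatorname{Arg}(t_n+in^{-\theta}-t)$, $\tilde b_n:=|\tilde s_n+in^{-\theta}-s|n^\theta$, $\tilde\alpha_n:=\operatorname{Arg}(\tilde s_n+in^{-\theta}-s)$, $\rho_n:=n^{\frac12-\theta}b_nD_n$, $\tilde\rho_n:=n^{\frac12-\theta}\tilde b_n\tilde D_n$. Let $k_n$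 be the segment from $-i\rho_n$ to $i\rho_n$; let $c_n$ consist of the smallest arcs of $\partial B(0,\rho_n)$ from $\rho_ne^{-i\alpha_n}$ to $-i\rho_n$ and from $i\rho_n$ to $\rho_ne^{i\alpha_n}$; define $K_n$ and $C_n$ (as contours) likewise with $\tilde\rho_n,\tilde\alpha_n$. Let $n^{1-3\theta}g_n(w,z):=nf_n(t+n^{-\frac12}D_n^{-1}w)-nf_n(t)-w^2-n\tilde f_n(s+n^{-\frac12}\tilde D_n^{-1}z)+n\tilde f_n(s)-z^2$, $\Phi_n(w,z):=\frac{\exp(w^2+z^2+n^{1-3\theta}g_n(w,z))}{t-s+n^{-1/2}D_n^{-1}w-n^{-1/2}\tilde D_n^{-1}z}$, and $I_{1,n}:=-\int_{k_n}dw\int_{K_n}dz\frac{e^{w^2+z^2}}{t-s}$, $I_{2,n}:=-\int_{k_n}dw\int_{K_n}dz\frac{e^{w^2+z^2+n^{1-3\theta}g_n(w,z)}-e^{w^2+z^2}}{t-s}$, $I_{3,n}:=-\int_{k_n}dw\int_{K_n}dz\big(\Phi_n(w,z)-\frac{e^{w^2+z^2+n^{1-3\theta}g_n(w,z)}}{t-s}\big)$, $I_n^{(k,C)}:=-\int_{k_n}\int_{C_n}\Phi_n\,dz\,dw$, $I_n^{(c,K)}:=-\int_{c_n}\int_{K_n}\Phi_n\,dz\,dw$, $I_n^{(c,C)}:=-\int_{c_n}\int_{C_n}\Phi_n\,dz\,dw$. Then $$F_n:=n^{-1+3\theta}\,\tfrac{t-s}\pi\Big(\big|I_{1,n}-\tfrac\pi{t-s}\big|+|I_{2,n}|+|I_{3,n}|+|I_n^{(k,C)}|+|I_n^{(c,K)}|+|I_n^{(c,C)}|\Big).$$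 *)

(* Defs.v *)
From HB Require Import structures.
From mathcomp Require Import all_boot all_order all_algebra.
From mathcomp Require Import all_classical all_reals all_analysis.
Import Order.TTheory GRing.Theory Num.Theory.
Import numFieldNormedType.Exports.
From mathcomp Require Import complex.

Set Implicit Arguments.
Unset Strict Implicit.
Unset Printing Implicit Defensive.

Local Open Scope classical_set_scope.
Local Open Scope ring_scope.
Local Open Scope complex_scope.

(* Everything lives over R : realType and its complexification R[i].  The
   order of R[i] is the library's partial order: [z < w] holds when z and w
   have the same imaginary part and Re z < Re w. *)

Definition cmod (R : realType) (z : R[i]) : R := Re `|z|.

Definition cexp (R : realType) (z : R[i]) : R[i] :=
  (expR (Re z) * cos (Im z)) +i* (expR (Re z) * sin (Im z)).

(* Principal argument, with values in ]-pi, pi]. *)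
Definition carg (R : realType) (z : R[i]) : R :=
  if 0 <= Im z then acos (Re z / cmod z) else - acos (Re z / cmod z).

Definition clog (R : realType) (z : R[i]) : R[i] := ln (cmod z) +i* carg z.

(* The complex derivative: derive1n over the numFieldType R[i]. *)
Definition cderiven (R : realType) (k : nat) (g : R[i] -> R[i]) : R[i] -> R[i] :=
  @derive1n R[i] R[i]^o k g.

Definition cderive (R : realType) (g : R[i] -> R[i]) : R[i] -> R[i] :=
  cderiven 1 g.

(* For g holomorphic near w. *)
Definition root_of_mult (R : realType) (g : R[i] -> R[i]) (w : R[i]) (m : nat) :=
  (forall k, (k < m)%N -> cderiven k g w = 0) /\ cderiven m g w <> 0.

Definition cdisc (R : realType) (c : R[i]) (rho : R) : set R[i] :=
  [set w | cmod (w - c) < rho].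

(* z is the only root of g in the open disc B(c, rho), roots being counted with
   multiplicity. *)
Definition sole_root_in (R : realType) (g : R[i] -> R[i]) (c : R[i]) (rho : R)
    (z : R[i]) :=
  [/\ cdisc c rho z, root_of_mult g z 1
    & forall w, cdisc c rho w -> g w = 0 -> w = z].

Definition cintegral d (T : measurableType d) (R : realType)
    (m : {measure set T -> \bar R}) (A : set T) (f : T -> R[i]) : R[i] :=
  (\int[m]_(x in A) Re (f x)) +i* (\int[m]_(x in A) Im (f x)).

(* Curves are parametrized by [0, 1]; values outside [0, 1] are irrelevant. *)
Definition path_deriv (R : realType) (g : R -> R[i]) (x : R) : R[i] :=
  derive1 (fun y => Re (g y)) x +i* derive1 (fun y => Im (g y)) x.

Definition path_int (R : realType) (g : R -> R[i]) (h : R[i] -> R[i]) : R[i] :=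
  cintegral (@lebesgue_measure R) `[0, 1] (fun x => h (g x) * path_deriv g x).

Definition path_image (R : realType) (g : R -> R[i]) : set R[i] := g @` `[0, 1].

Definition C1_fun (R : realType) (h : R -> R) :=
  (forall x, derivable h x 1) /\ continuous (derive1 h).

(* On each interval of a subdivision of [0, 1] the curve coincides with a curve
   that is C1 on R, i.e. it is C1 up to the endpoints. *)
Definition piecewise_C1 (R : realType) (g : R -> R[i]) :=
  exists (m : nat) (p : nat -> R),
    [/\ p 0%N = 0, p m = 1, (forall k, (k < m)%N -> p k < p k.+1)
      & forall k, (k < m)%N -> exists h : R -> R[i],
          [/\ C1_fun (fun y => Re (h y)), C1_fun (fun y => Im (h y))
            & forall x, p k <= x <= p k.+1 -> g x = h x]].

Definition winding (R : realType) (g : R -> R[i]) (z : R[i]) : R[i] :=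
  path_int g (fun w => (w - z)^-1) / (0 +i* (2 * pi)).

(* A simple closed curve is counter-clockwise when its winding numbers are
   0 (outside) and 1 (inside). *)
Definition ccw_contour (R : realType) (g : R -> R[i]) :=
  [/\ piecewise_C1 g, g 0 = g 1,
      (forall x y, 0 <= x < 1 -> 0 <= y < 1 -> g x = g y -> x = y)
    & forall z, ~ path_image g z -> winding g z = 0 \/ winding g z = 1].

Definition inside (R : realType) (g : R -> R[i]) : set R[i] :=
  [set z | ~ path_image g z /\ winding g z = 1].

Definition outside (R : realType) (g : R -> R[i]) : set R[i] :=
  [set z | ~ path_image g z /\ winding g z = 0].

Definition segment_path (R : realType) (z w : R[i]) : R -> R[i] :=
  fun x => z + x%:C * (w - z).

(* Arc of the circle |z| = rho, the angle going linearly from al to be. *)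
Definition circle_arc (R : realType) (rho al be : R) : R -> R[i] :=
  fun x => rho%:C * cexp (0 +i* (al + x * (be - al))).

Definition msupport (R : realType) (mu : probability (measurableTypeR R) R) :
    set R :=
  [set y | forall U : set R, open U -> U y -> (0 < mu U)%E].

(* Weak convergence of the empirical measures of the points x n i to mu. *)
Definition empirical_cvg (R : realType) (x : forall n, 'I_n -> R)
    (mu : probability (measurableTypeR R) R) :=
  forall h : R -> R, continuous h -> (exists M, forall y, `|h y| <= M) ->
    (fun n : nat => n%:R^-1 * \sum_(i < n) h (x n i)) @ \oo -->
      \int[mu]_y h y.

Definition cauchy_transform (R : realType) (mu : probability (measurableTypeR R) R)
    (a b : R) (w : R[i]) : R[i] :=
  cintegral mu `[a, b] (fun y : R => (w - y%:C)^-1).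

Definition cauchy_transform_n (R : realType) (x : forall n, 'I_n -> R) (n : nat)
    (w : R[i]) : R[i] :=
  n%:R^-1 * \sum_(i < n) (w - (x n i)%:C)^-1.

(* The common shape of the derivatives of f_(chi,eta), f_(t,s),n, f_n and
   \tilde f_n : w |-> C(w) - (1 - eta) / (w - chi). *)
Definition fprime (R : realType) (C : R[i] -> R[i]) (chi eta : R) (w : R[i]) :
    R[i] :=
  C w - (1 - eta)%:C / (w - chi%:C).

Definition region_O (R : realType) (mu : probability (measurableTypeR R) R)
    (a b chi eta : R) :=
  [/\ a <= chi <= b, 0 <= eta <= 1, chi < b, 0 < eta
    & exists w : R,
        b < w /\ root_of_mult (fprime (cauchy_transform mu a b) chi eta) w%:C 1].

(* C_n at a real point, as a real number. *)
Definition cauchy_transform_nR (R : realType) (x : forall n, 'I_n -> R) (n : nat) (y : R) :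
    R :=
  Re (cauchy_transform_n x n y%:C).

Definition chi_n (R : realType) (x : forall n, 'I_n -> R) (t s : R) (n : nat) : R :=
  (t * cauchy_transform_nR x n t - s * cauchy_transform_nR x n s) /
  (cauchy_transform_nR x n t - cauchy_transform_nR x n s).

Definition eta_n (R : realType) (x : forall n, 'I_n -> R) (t s : R) (n : nat) : R :=
  1 + (cauchy_transform_nR x n t * cauchy_transform_nR x n s * (t - s)) /
      (cauchy_transform_nR x n t - cauchy_transform_nR x n s).

Definition npow (R : realType) (n : nat) (al : R) : R := n%:R `^ al.

(* w |-> 1/n sum_i log (w - x_i) - k/n log (w - v) : f_n is obtained for
   k = n - s_n + 1 and v = v_n, \tilde f_n for k = n - r_n - 1 and v = u_n. *)
Definition flog (R : realType) (x : forall n, 'I_n -> R) (n k : nat) (v : R)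
    (w : R[i]) : R[i] :=
  n%:R^-1 * \sum_(i < n) clog (w - (x n i)%:C)
  - (k%:R / n%:R) * clog (w - v%:C).

Definition J_integral (R : realType) (x : forall n, 'I_n -> R) (n r s : nat)
    (u v : R) (c C : R -> R[i]) : R[i] :=
  (0 +i* (2 * pi)) ^- 2 *
  path_int c (fun w => path_int C (fun z =>
    (w - z)^-1 * ((z - u%:C) ^+ (n - r - 1) / (w - v%:C) ^+ (n - s + 1)) *
    \prod_(i < n) ((w - (x n i)%:C) / (z - (x n i)%:C)))).

Definition J_contours (R : realType) (x : forall n, 'I_n -> R) (n : nat)
    (u v : R) (c C : R -> R[i]) :=
  [/\ ccw_contour c, ccw_contour C,
      (forall i, u < x n i -> inside C (x n i)%:C),
      (forall i, x n i < u -> outside C (x n i)%:C)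
    & inside c v%:C /\ path_image C `<=` inside c].

Definition phi (R : realType) (r s : nat) (u v : R) : R :=
  (if u < v then 1 else 0) *
  (if (s <= r)%N then 0
   else if s == r.+1 then 1
   else (v - u) ^+ (s - r - 1) / ((s - r - 1)`!)%:R).

Definition kernel_tilde (R : realType) (x : forall n, 'I_n -> R) (n : nat)
    (u : R) (r : nat) (v : R) (s : nat) : R :=
  \sum_(j < n) (if u < x n j then 1 else 0) *
    ((x n j - u) ^+ (n - r - 1) / ((n - r - 1)`!)%:R) *
    derive1n (n - s) (fun y : R =>
      \prod_(i < n | i != j) ((y - x n i) / (x n j - x n i))) v.

Definition kernel_n (R : realType) (x : forall n, 'I_n -> R) (n : nat)
    (u : R) (r : nat) (v : R) (s : nat) : R :=
  kernel_tilde x n u r v s - phi r s u v.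

Definition D_of (R : realType) (f' : R[i] -> R[i]) (y : R) : R :=
  Num.sqrt (2^-1 * cmod (cderive f' y%:C)).

Definition G_n (R : realType) (theta chi t s : R) (n : nat) (D Dt : R) : R :=
  2 ^+ 3 * (s - chi) + 2 ^+ 3 * (t - chi) +
  2 ^+ 4 * expR (- (4^-1 * npow n (1 - 2 * theta) * Num.min (D ^+ 2) (Dt ^+ 2))) *
  npow n theta * (t - chi) * (s - chi).

(* The point t_n + i n^-theta - t, and the quantities b_n, alpha_n, rho_n
   attached to the root t_n near t; the same with \tilde s_n and s. *)
Definition corner (R : realType) (theta : R) (n : nat) (root y : R) : R[i] :=
  (root - y) +i* npow n (- theta).

Definition b_of (R : realType) (theta : R) (n : nat) (root y : R) : R :=
  cmod (corner theta n root y) * npow n theta.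

Definition alpha_of (R : realType) (theta : R) (n : nat) (root y : R) : R :=
  carg (corner theta n root y).

Definition rho_of (R : realType) (theta : R) (n : nat) (root y D : R) : R :=
  npow n (2^-1 - theta) * b_of theta n root y * D.

Definition int_k (R : realType) (rho : R) (h : R[i] -> R[i]) : R[i] :=
  path_int (segment_path (0 +i* - rho) (0 +i* rho)) h.

(* Since alpha lies in ]0, pi[, going linearly in the angle from - alpha to
   - pi/2 and from pi/2 to alpha follows the smallest arcs. *)
Definition int_c (R : realType) (rho alpha : R) (h : R[i] -> R[i]) : R[i] :=
  path_int (circle_arc rho (- alpha) (- (pi / 2))) h +
  path_int (circle_arc rho (pi / 2) alpha) h.

Definition g_n (R : realType) (theta t s : R) (n : nat) (f ft : R[i] -> R[i])
    (D Dt : R) (w z : R[i]) : R[i] :=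
  (npow n (1 - 3 * theta))^-1%:C *
  (n%:R * f (t%:C + (npow n (- 2^-1) * D^-1)%:C * w) - n%:R * f t%:C - w ^+ 2
   - n%:R * ft (s%:C + (npow n (- 2^-1) * Dt^-1)%:C * z) + n%:R * ft s%:C
   - z ^+ 2).

Definition exp_g (R : realType) (theta t s : R) (n : nat) (f ft : R[i] -> R[i])
    (D Dt : R) (w z : R[i]) : R[i] :=
  cexp (w ^+ 2 + z ^+ 2 +
        (npow n (1 - 3 * theta))%:C * g_n theta t s n f ft D Dt w z).

Definition Phi_n (R : realType) (theta t s : R) (n : nat) (f ft : R[i] -> R[i])
    (D Dt : R) (w z : R[i]) : R[i] :=
  exp_g theta t s n f ft D Dt w z /
  ((t - s)%:C + (npow n (- 2^-1) * D^-1)%:C * w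
   - (npow n (- 2^-1) * Dt^-1)%:C * z).

(* The last two arguments are the roots t_n and \tilde s_n. *)
Definition F_n (R : realType) (theta t s : R) (n : nat) (f ft : R[i] -> R[i])
    (D Dt : R) (tn sn : R) : R :=
  let rho := rho_of theta n tn t D in
  let rhot := rho_of theta n sn s Dt in
  let al := alpha_of theta n tn t in
  let alt := alpha_of theta n sn s in
  let eg := exp_g theta t s n f ft D Dt in
  let Ph := Phi_n theta t s n f ft D Dt in
  let e0 := fun w z : R[i] => cexp (w ^+ 2 + z ^+ 2) in
  let ts := (t - s)%:C in
  let I1 := - int_k rho (fun w => int_k rhot (fun z => e0 w z / ts)) in
  let I2 := - int_k rho (fun w => int_k rhot (fun z => (eg w z - e0 w z) / ts)) in
  let I3 := - int_k rho (fun w => int_k rhot (fun z => Ph w z - eg w z / ts)) in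
  let IkC := - int_k rho (fun w => int_c rhot alt (Ph w)) in
  let IcK := - int_c rho al (fun w => int_k rhot (Ph w)) in
  let IcC := - int_c rho al (fun w => int_c rhot alt (Ph w)) in
  npow n (- 1 + 3 * theta) * ((t - s) / pi) *
  (cmod (I1 - (pi / (t - s))%:C) + cmod I2 + cmod I3 +
   cmod IkC + cmod IcK + cmod IcC).

(* Main.v *)
(* Expanding in partial fractions, the z-integral and then the w-integral of
   [J_n] are evaluated by residues, so that [J_n] depends on the contours only
   through the winding numbers of its poles: it may be computed on contours of
   our own choice.  We take a w-contour through t and a z-contour through s,
   each consisting of a local piece, which rescales to the contours defining
   [F_n], and of a remainder: the circle around v_n through t_n + i n^-theta,
   and the level curve of Re (log z + 1 / z) (rescaled so that 0 and 1 become
   u_n and \tilde s_n) through \tilde s_n + i n^-theta, which ends at u_n.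
   The local x local part is the main term plus an error bounded by [F_n], by
   the triangle inequality.  On the remainders the modulus of the integrand is
   at most its value at the corners t_n + i n^-theta, \tilde s_n + i n^-theta:
   on the circle by concavity of the logarithms of the squared distances to the
   x_i, on the level curve because the criticality of \tilde s_n splits
   \tilde f_n into terms that are each monotone.  The corner values are
   exponentially small by Taylor expansion, which gives the term with [G_n].
   That [F_n = O(1)] rests on f_n'(t), \tilde f_n'(s) = O(1 / n), obtained from
   f_(t,s),n'(t) = f_(t,s),n'(s) = 0, and on Gaussian integrals. *)
Require Import Defs.
From HB Require Import structures.
From mathcomp Require Import all_boot all_order all_algebra.
From mathcomp Require Import all_classical all_reals all_analysis.
Import Order.TTheory GRing.Theory Num.Theory.
Import numFieldNormedType.Exports.
From mathcomp Require Import complex.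
From mathcomp Require Import measurable_realfun ring lra.
Set Implicit Arguments.
Unset Strict Implicit.
Unset Printing Implicit Defensive.
Local Open Scope classical_set_scope.
Local Open Scope ring_scope.
Local Open Scope complex_scope.

(** * Complex exponential and logarithm *)

(** [J_contours] provides arbitrary curves of which only winding numbers are known, and it says
    nothing about a particle located at [u]. Both facts shape the proof. Every contour integral is
    evaluated through an explicit primitive, a power or a branch of the logarithm; from the
    arbitrary contours one only has to extract that the inner one does not wind around points of the
    outer one. A particle at [u] is harmless because the exponent [k] is at least 2, a consequence
    of 1 / n < xi: one factor cancels the pole and another still makes the integrand vanish at [u],
    where the level curve meets the real axis. The circle is centred at v_n so that the power of w -
    v_n has constant modulus on it; u_n is close enough to v_n for the z-contour to remain nearer to
    u_n than the w-contour. Away from t and s the integrand is handled as the rational function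
    [weight], free of cuts. The constants 8, 8 and 16 of G_n absorb the lengths of the explicit
    contours, the distance between them, a factor exp 1 <= 3 left by the cubic errors, and 1 / (2
    pi)^2. *)

Section ComplexBasics.
Context {R : realType}.
Implicit Types (z w : R[i]) (x y a b : R).

Lemma complex_eta z : z = Re z +i* Im z. Proof. by case: z. Qed.

Lemma eqC z w : Re z = Re w -> Im z = Im w -> z = w.
Proof. by case: z => a b; case: w => c d /= -> ->. Qed.

Lemma ReD z w : Re (z + w) = Re z + Re w. Proof. by case: z; case: w. Qed.
Lemma ImD z w : Im (z + w) = Im z + Im w. Proof. by case: z; case: w. Qed.
Lemma ReN z : Re (- z) = - Re z. Proof. by case: z. Qed.
Lemma ImN z : Im (- z) = - Im z. Proof. by case: z. Qed.
Lemma ReB z w : Re (z - w) = Re z - Re w. Proof. by rewrite ReD ReN. Qed.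
Lemma ImB z w : Im (z - w) = Im z - Im w. Proof. by rewrite ImD ImN. Qed.
Lemma ReM z w : Re (z * w) = Re z * Re w - Im z * Im w.
Proof. by case: z; case: w. Qed.
Lemma ImM z w : Im (z * w) = Re z * Im w + Im z * Re w.
Proof. by case: z; case: w. Qed.
Lemma ReV z : Re z^-1 = Re z / (Re z ^+ 2 + Im z ^+ 2).
Proof. by case: z. Qed.
Lemma ImV z : Im z^-1 = - Im z / (Re z ^+ 2 + Im z ^+ 2).
Proof. by case: z => a b; rewrite /= mulNr. Qed.
Lemma ReC x : Re (x%:C) = x. Proof. by []. Qed.
Lemma ImC x : Im (x%:C) = 0. Proof. by []. Qed.
Lemma Re0 : Re (0 : R[i]) = 0. Proof. by []. Qed.
Lemma Im0 : Im (0 : R[i]) = 0. Proof. by []. Qed.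
Lemma Re1 : Re (1 : R[i]) = 1. Proof. by []. Qed.
Lemma natCE n : (n%:R : R[i]) = (n%:R : R)%:C.
Proof. by rewrite rmorph_nat. Qed.
Lemma Re_J z : Re (conjc z) = Re z. Proof. by case: z. Qed.
Lemma Im_J z : Im (conjc z) = - Im z. Proof. by case: z. Qed.

Lemma cmodE z : cmod z = Num.sqrt (Re z ^+ 2 + Im z ^+ 2).
Proof. by rewrite /cmod normc_def. Qed.

Lemma cmod_normC z : (cmod z)%:C = `|z|.
Proof. by rewrite cmodE normc_def. Qed.

Lemma cmod_ge0 z : 0 <= cmod z. Proof. by rewrite cmodE sqrtr_ge0. Qed.

Lemma cmod_sqr z : cmod z ^+ 2 = Re z ^+ 2 + Im z ^+ 2.
Proof. by rewrite cmodE sqr_sqrtr// addr_ge0// sqr_ge0. Qed.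

Lemma cmodM z w : cmod (z * w) = cmod z * cmod w.
Proof. by apply: complexI; rewrite rmorphM/= !cmod_normC normrM. Qed.

Lemma cmodV z : cmod z^-1 = (cmod z)^-1.
Proof. by apply: complexI; rewrite fmorphV/= !cmod_normC normfV. Qed.

Lemma cmodX z n : cmod (z ^+ n) = cmod z ^+ n.
Proof. by apply: complexI; rewrite rmorphXn/= !cmod_normC normrX. Qed.

Lemma cmodN z : cmod (- z) = cmod z.
Proof. by apply: complexI; rewrite !cmod_normC normrN. Qed.

Lemma cmod_prod I (r : seq I) (P : pred I) (F : I -> R[i]) :
  cmod (\prod_(i <- r | P i) F i) = \prod_(i <- r | P i) cmod (F i).
Proof.
apply: complexI; rewrite cmod_normC normr_prod rmorph_prod.
by apply: eq_bigr => i _; rewrite -cmod_normC.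
Qed.

Lemma cmodD z w : cmod (z + w) <= cmod z + cmod w.
Proof. by rewrite -lecR rmorphD/= !cmod_normC ler_normD. Qed.

Lemma cmodB z w : cmod (z - w) <= cmod z + cmod w.
Proof. by rewrite (le_trans (cmodD _ _))// cmodN. Qed.

Lemma cmod_distC z w : cmod (z - w) = cmod (w - z).
Proof. by rewrite -cmodN opprB. Qed.

Lemma lerB_cmodD z w : cmod z - cmod w <= cmod (z + w).
Proof.
rewrite lerBlDr -{1}(addrK w z); apply: le_trans (cmodD _ _) _.
by rewrite cmodN.
Qed.

Lemma cmod0 : cmod (0 : R[i]) = 0.
Proof. by rewrite /cmod normr0. Qed.

Lemma cmod1 : cmod (1 : R[i]) = 1.
Proof. by rewrite /cmod normr1. Qed.

Lemma cmod_eq0 z : (cmod z == 0) = (z == 0).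
Proof. by rewrite -(inj_eq (@complexI R)) cmod_normC normr_eq0. Qed.

Lemma cmod_gt0 z : (0 < cmod z) = (z != 0).
Proof. by rewrite lt_def cmod_ge0 andbT cmod_eq0. Qed.

Lemma cmodR x : cmod x%:C = `|x|.
Proof. by rewrite cmodE/= expr0n addr0 sqrtr_sqr. Qed.

Lemma cmod_ler_sum I (r : seq I) (P : pred I) (F : I -> R[i]) :
  cmod (\sum_(i <- r | P i) F i) <= \sum_(i <- r | P i) cmod (F i).
Proof.
elim/big_rec2 : _ => [|i y1 y2 _ h]; first by rewrite cmod0.
by rewrite (le_trans (cmodD _ _))// lerD2l.
Qed.

Lemma Re_le_cmod z : `|Re z| <= cmod z.
Proof. by rewrite -lecR cmod_normC normc_ge_Re. Qed.

Lemma Im_le_cmod z : `|Im z| <= cmod z.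
Proof.
rewrite cmodE -sqrtr_sqr ler_sqrt ?addr_ge0 ?sqr_ge0// lerDr; exact: sqr_ge0.
Qed.

Lemma Re_le z : Re z <= cmod z.
Proof. exact: le_trans (ler_norm _) (Re_le_cmod z). Qed.

Lemma cmod_le_ReIm z : cmod z <= `|Re z| + `|Im z|.
Proof.
rewrite {1}(complexE z) (le_trans (cmodD _ _))// cmodM !cmodR.
have -> : cmod ('i : R[i]) = 1.
  by rewrite cmodE/= expr0n add0r expr1n sqrtr1.
by rewrite mul1r.
Qed.

Lemma cmodJ z : cmod (conjc z) = cmod z.
Proof. by rewrite !cmodE; case: z => a b /=; rewrite sqrrN. Qed.

Lemma scaleCE x z : x%:C * z = (x * Re z) +i* (x * Im z).
Proof. by apply: eqC; rewrite (ReM, ImM)/= mul0r ?subr0 ?addr0. Qed.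

Lemma Re_scale x z : Re (x%:C * z) = x * Re z. Proof. by rewrite scaleCE. Qed.
Lemma Im_scale x z : Im (x%:C * z) = x * Im z. Proof. by rewrite scaleCE. Qed.

Lemma cexpD z w : cexp (z + w) = cexp z * cexp w.
Proof.
apply: eqC; rewrite /cexp/= !ReD !ImD expRD ?cosD ?sinD; ring.
Qed.

Lemma cexp0 : cexp (0 : R[i]) = 1.
Proof. by apply: eqC; rewrite /= expR0 ?cos0 ?sin0 ?mulr1 ?mulr0. Qed.

Lemma cmod_cexp z : cmod (cexp z) = expR (Re z).
Proof.
rewrite cmodE /cexp/= !exprMn -mulrDr cos2Dsin2 mulr1 sqrtr_sqr.
by rewrite ger0_norm// expR_ge0.
Qed.

Lemma cexp_neq0 z : cexp z != 0.
Proof. by rewrite -cmod_gt0 cmod_cexp expR_gt0. Qed.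

Lemma cexpN z : cexp (- z) = (cexp z)^-1.
Proof.
apply: (mulfI (cexp_neq0 z)); rewrite -cexpD subrr cexp0 divff//.
exact: cexp_neq0.
Qed.

Lemma cexpB z w : cexp (z - w) = cexp z / cexp w.
Proof. by rewrite cexpD cexpN. Qed.

Lemma cexpMn z n : cexp (n%:R * z) = cexp z ^+ n.
Proof.
elim: n => [|n ih]; first by rewrite mul0r cexp0 expr0.
by rewrite -natr1 mulrDl mul1r cexpD ih exprSr.
Qed.

Lemma cexp_sum I (r : seq I) (P : pred I) (F : I -> R[i]) :
  cexp (\sum_(i <- r | P i) F i) = \prod_(i <- r | P i) cexp (F i).
Proof. by elim/big_rec2 : _ => [|i y1 y2 _ <-]; rewrite ?cexp0// cexpD. Qed.

Lemma cexpR x : cexp x%:C = (expR x)%:C.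
Proof. by apply: eqC; rewrite /= ?cos0 ?sin0 ?mulr1 ?mulr0. Qed.

Lemma cos_carg z : z != 0 -> cmod z * cos (carg z) = Re z.
Proof.
move=> z0; have m0 : 0 < cmod z by rewrite cmod_gt0.
have h : -1 <= Re z / cmod z <= 1.
  rewrite -ler_norml normrM normfV [X in _ / X]gtr0_norm//.
  by rewrite ler_pdivrMr// mul1r Re_le_cmod.
have -> : cos (carg z) = Re z / cmod z.
  by rewrite /carg; case: ifP => _; rewrite ?cosN acosK ?in_itv//.
by rewrite mulrC divfK ?gt_eqF.
Qed.

Lemma sin_carg z : z != 0 -> cmod z * sin (carg z) = Im z.
Proof.
move=> z0; have m0 : 0 < cmod z by rewrite cmod_gt0.
have h : -1 <= Re z / cmod z <= 1.
  rewrite -ler_norml normrM normfV [X in _ / X]gtr0_norm//.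
  by rewrite ler_pdivrMr// mul1r Re_le_cmod.
have e : cmod z * Num.sqrt (1 - (Re z / cmod z) ^+ 2) = `|Im z|.
  rewrite -[X in X * _]gtr0_norm// -sqrtr_sqr -sqrtrM ?sqr_ge0// -sqrtr_sqr.
  congr Num.sqrt; rewrite mulrBr mulr1 -exprMn mulrCA divff ?gt_eqF// mulr1.
  by rewrite cmod_sqr addrAC subrr add0r.
rewrite /carg; case: ifPn => [i0|]; first by rewrite sin_acos// e ger0_norm.
by rewrite -ltNge => i0; rewrite sinN mulrN sin_acos// e ltr0_norm// opprK.
Qed.

Lemma clogK z : z != 0 -> cexp (clog z) = z.
Proof.
move=> z0; apply: eqC; rewrite /cexp/clog/= lnK ?cos_carg ?sin_carg//.
  by rewrite posrE cmod_gt0.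
by rewrite posrE cmod_gt0.
Qed.

(** The moduli cancel, and the arguments are, up to sign, acos y and pi - acos y: the increments of
    the two branches [clog z] and [clog (- z)] add up to a full turn. A loop is cut at a point and
    its conjugate so that each half avoids the cut of one branch. *)
Lemma clog_subN z : 0 < Im z ->
  (clog z - clog (conjc z)) + (clog (- (conjc z)) - clog (- z)) = 0 +i* (2 * pi).
Proof.
case: z => a b /= b0; have m0 : 0 < cmod (a +i* b).
  by rewrite cmod_gt0; apply/eqP => -[_ /eqP]; rewrite gt_eqF.
have h : -1 <= a / cmod (a +i* b) <= 1.
  rewrite -ler_norml normrM normfV [X in _ / X]gtr0_norm//.
  by rewrite ler_pdivrMr// mul1r (Re_le_cmod (a +i* b)).
have e1 : cmod (a -i* b) = cmod (a +i* b) by rewrite !cmodE/= sqrrN.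
have e2 : cmod (- (a -i* b)) = cmod (a +i* b) by rewrite cmodN.
have e3 : cmod (- (a +i* b)) = cmod (a +i* b) by rewrite cmodN.
rewrite /clog e1 e2 e3 /carg e1 e2 e3 /= opprK oppr_ge0 (ltW b0).
rewrite leNgt b0/= mulNr acosN//; apply: eqC => /=; ring.
Qed.

Lemma carg_real x : 0 < x -> carg x%:C = 0.
Proof.
by move=> x0; rewrite /carg lexx cmodR gtr0_norm// divff ?gt_eqF// acos1.
Qed.

Lemma clog_real x : 0 < x -> clog x%:C = (ln x)%:C.
Proof. by move=> x0; rewrite /clog carg_real// cmodR gtr0_norm. Qed.

End ComplexBasics.

(** * Differentiation along real curves *)

Section RealDer.
Context {R : realType}.
Implicit Types (f g : R -> R) (x d e : R).

Lemma rder_eq f x d e : is_derive x 1 f d -> d = e -> is_derive x 1 f e.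
Proof. by move=> h <-. Qed.

Lemma rder_fun f g x d : (f = g) -> is_derive x 1 f d -> is_derive x 1 g d.
Proof. by move=> ->. Qed.

Lemma rder_cst (c x : R) : is_derive x 1 (fun _ : R => c) 0.
Proof. exact: is_derive_cst. Qed.

Lemma rder_id x : is_derive x (1 : R) (fun y : R => y) 1.
Proof. exact: is_derive_id. Qed.

Lemma rderD f g x d e : is_derive x 1 f d -> is_derive x 1 g e ->
  is_derive x 1 (fun y => f y + g y) (d + e).
Proof. exact: is_deriveD. Qed.

Lemma rderN f x d : is_derive x 1 f d -> is_derive x 1 (fun y => - f y) (- d).
Proof. exact: is_deriveN. Qed.

Lemma rderB f g x d e : is_derive x 1 f d -> is_derive x 1 g e ->
  is_derive x 1 (fun y => f y - g y) (d - e).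
Proof. exact: is_deriveB. Qed.

Lemma rderM f g x d e : is_derive x 1 f d -> is_derive x 1 g e ->
  is_derive x 1 (fun y => f y * g y) (d * g x + f x * e).
Proof.
move=> hf hg; apply: (rder_eq (is_deriveM hf hg)).
by rewrite addrC -[g x *: d]/(g x * d) mulrC.
Qed.

Lemma rderZ f x d (c : R) : is_derive x 1 f d ->
  is_derive x 1 (fun y => c * f y) (c * d).
Proof. by move=> h; apply: rder_eq (rderM (rder_cst c x) h) _; rewrite mul0r add0r. Qed.

Lemma rder_comp f g x d e : is_derive (g x) 1 f d -> is_derive x 1 g e ->
  is_derive x 1 (fun y => f (g y)) (d * e).
Proof. exact: is_derive1_comp. Qed.

Lemma rderX f x d n : is_derive x 1 f d ->
  is_derive x 1 (fun y => f y ^+ n) (n%:R * f x ^+ n.-1 * d).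
Proof. by move=> h; rewrite -[fun y => _]exprfctE; exact: (rder_eq (is_deriveX n h)). Qed.

Lemma rderV f x d : f x != 0 -> is_derive x 1 f d ->
  is_derive x 1 (fun y => (f y)^-1) (- d / f x ^+ 2).
Proof.
move=> f0 [h <-]; split; first exact: derivableV.
by rewrite deriveV// -[_ *: _]/(_ * _) mulrC mulrN mulNr.
Qed.

Lemma rder_exp f x d : is_derive x 1 f d ->
  is_derive x 1 (fun y => expR (f y)) (expR (f x) * d).
Proof. by move=> h; apply: (rder_comp (f := expR)). Qed.

Lemma rder_ln f x d : 0 < f x -> is_derive x 1 f d ->
  is_derive x 1 (fun y => ln (f y)) (d / f x).
Proof.
move=> f0 h; apply: rder_eq (rder_comp (is_derive1_ln f0) h) _.
by rewrite mulrC.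
Qed.

Lemma rder_sqrt f x d : 0 < f x -> is_derive x 1 f d ->
  is_derive x 1 (fun y => Num.sqrt (f y)) (d / (2 * Num.sqrt (f x))).
Proof.
move=> f0 h; apply: rder_eq (rder_comp (is_derive1_sqrt f0) h) _.
by rewrite mulrC.
Qed.

Lemma rder_cos f x d : is_derive x 1 f d ->
  is_derive x 1 (fun y => cos (f y)) (- sin (f x) * d).
Proof. by move=> h; apply: (rder_comp (f := cos)). Qed.

Lemma rder_sin f x d : is_derive x 1 f d ->
  is_derive x 1 (fun y => sin (f y)) (cos (f x) * d).
Proof. by move=> h; apply: (rder_comp (f := sin)). Qed.

Lemma rder_atan f x d : is_derive x 1 f d ->
  is_derive x 1 (fun y => atan (f y)) (d / (1 + f x ^+ 2)).
Proof.
move=> h; apply: rder_eq (rder_comp (is_derive1_atan (f x)) h) _.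
by rewrite mulrC.
Qed.

Lemma rder_near f g x d : (\forall y \near x, f y = g y) ->
  is_derive x 1 f d -> is_derive x 1 g d.
Proof. exact: near_eq_is_derive. Qed.

Lemma rder_cont f x d : is_derive x 1 f d -> {for x, continuous f}.
Proof.
move=> [h _]; apply: differentiable_continuous.
exact/derivable1_diffP.
Qed.

End RealDer.

Section RealCont.
Context {R : realType}.
Implicit Types (f g : R -> R) (x : R).

Lemma rcont_fun f g x : f = g -> {for x, continuous f} -> {for x, continuous g}.
Proof. by move=> ->. Qed.

Lemma rcont_cst (c x : R) : {for x, continuous (fun _ : R => c)}.
Proof. exact: cvg_cst. Qed.

Lemma rcont_id x : {for x, continuous (fun y : R => y)}.
Proof. exact: cvg_id. Qed.

Lemma rcontD f g x : {for x, continuous f} -> {for x, continuous g} ->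
  {for x, continuous (fun y => f y + g y)}.
Proof. exact: cvgD. Qed.

Lemma rcontN f x : {for x, continuous f} -> {for x, continuous (fun y => - f y)}.
Proof. exact: cvgN. Qed.

Lemma rcontB f g x : {for x, continuous f} -> {for x, continuous g} ->
  {for x, continuous (fun y => f y - g y)}.
Proof. exact: cvgB. Qed.

Lemma rcontM f g x : {for x, continuous f} -> {for x, continuous g} ->
  {for x, continuous (fun y => f y * g y)}.
Proof. exact: cvgM. Qed.

Lemma rcontV f x : f x != 0 -> {for x, continuous f} ->
  {for x, continuous (fun y => (f y)^-1)}.
Proof. by move=> h; apply: cvgV. Qed.

Lemma rcont_comp (f g : R -> R) x :
  {for x, continuous g} -> {for g x, continuous f} ->
  {for x, continuous (fun y => f (g y))}.
Proof. exact: continuous_comp. Qed.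

Lemma rcontX f x n : {for x, continuous f} ->
  {for x, continuous (fun y => f y ^+ n)}.
Proof.
by move=> h; apply: (rcont_comp (f := fun y => y ^+ n)) => //; exact: exprn_continuous.
Qed.

Lemma rcont_sqrt f x : {for x, continuous f} ->
  {for x, continuous (fun y => Num.sqrt (f y))}.
Proof.
by move=> h; apply: (rcont_comp (f := Num.sqrt)) => //; exact: sqrt_continuous.
Qed.

Lemma rcont_near f g x : (\forall y \near x, f y = g y) ->
  {for x, continuous f} -> {for x, continuous g}.
Proof.
move=> fg h; have fx : f x = g x := nbhs_singleton fg.
rewrite /prop_for /continuous_at -fx; apply: cvg_trans h.
by apply: near_eq_cvg; near=> y; rewrite (near fg y).
Unshelve. all: by end_near. Qed.

Lemma rcont_pos f x : {for x, continuous f} -> 0 < f x ->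
  \forall y \near x, 0 < f y.
Proof. by move=> h f0; exact: (cvgr_gt (f x) h). Qed.

End RealCont.

(** * Curves in the complex plane, and functions tested along curves *)

Section Paths.
Context {R : realType}.
Implicit Types (g h : R -> R[i]) (x : R) (d e z w : R[i]).

(** Stated on real and imaginary parts, as is [cder], so that the calculus of functions R -> R
    applies. *)
Definition ccont g x :=
  {for x, continuous (fun y => Re (g y))} /\ {for x, continuous (fun y => Im (g y))}.

Definition cder g x d :=
  is_derive x 1 (fun y => Re (g y)) (Re d) /\ is_derive x 1 (fun y => Im (g y)) (Im d).

Lemma cder_eq g x d e : cder g x d -> d = e -> cder g x e.
Proof. by move=> h <-. Qed.

Lemma cder_path_deriv g x d : cder g x d -> path_deriv g x = d.
Proof.
by move=> [[_ h1] [_ h2]]; apply: eqC; rewrite /path_deriv/= derive1E.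
Qed.

Lemma cder_cont g x d : cder g x d -> ccont g x.
Proof. by move=> [h1 h2]; split; [exact: rder_cont h1|exact: rder_cont h2]. Qed.

Lemma cder_near g h x d : (\forall y \near x, g y = h y) -> cder g x d -> cder h x d.
Proof.
move=> gh [h1 h2]; split.
  by apply: rder_near h1; near=> y; rewrite (near gh y).
by apply: rder_near h2; near=> y; rewrite (near gh y).
Unshelve. all: by end_near. Qed.

Lemma cder_cst z x : cder (fun _ => z) x 0.
Proof. by split; exact: rder_cst. Qed.

Lemma cderD g h x d e : cder g x d -> cder h x e ->
  cder (fun y => g y + h y) x (d + e).
Proof.
move=> [g1 g2] [h1 h2]; split.
  by rewrite ReD; apply: rder_fun (rderD g1 h1); apply/funext => y; rewrite ReD.
by rewrite ImD; apply: rder_fun (rderD g2 h2); apply/funext => y; rewrite ImD.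
Qed.

Lemma cderN g x d : cder g x d -> cder (fun y => - g y) x (- d).
Proof.
move=> [g1 g2]; split.
  by rewrite ReN; apply: rder_fun (rderN g1); apply/funext => y; rewrite ReN.
by rewrite ImN; apply: rder_fun (rderN g2); apply/funext => y; rewrite ImN.
Qed.

Lemma cderB g h x d e : cder g x d -> cder h x e ->
  cder (fun y => g y - h y) x (d - e).
Proof. by move=> hg hh; apply: cderD => //; exact: cderN. Qed.

Lemma cderM g h x d e : cder g x d -> cder h x e ->
  cder (fun y => g y * h y) x (d * h x + g x * e).
Proof.
move=> [g1 g2] [h1 h2]; split.
  apply: (@rder_fun _ (fun y => Re (g y) * Re (h y) - Im (g y) * Im (h y))).
    by apply/funext => y; rewrite ReM.
  apply: rder_eq (rderB (rderM g1 h1) (rderM g2 h2)) _.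
  by rewrite ReD !ReM; ring.
apply: (@rder_fun _ (fun y => Re (g y) * Im (h y) + Im (g y) * Re (h y))).
  by apply/funext => y; rewrite ImM.
apply: rder_eq (rderD (rderM g1 h2) (rderM g2 h1)) _.
by rewrite ImD !ImM; ring.
Qed.

Lemma cderZ g x d (c : R[i]) : cder g x d -> cder (fun y => c * g y) x (c * d).
Proof.
by move=> h; apply: cder_eq (cderM (cder_cst c x) h) _; rewrite mul0r add0r.
Qed.

Lemma cder_real (f : R -> R) x (d : R) : is_derive x 1 f d ->
  cder (fun y => (f y)%:C) x d%:C.
Proof. by move=> h; split => //=; exact: rder_cst. Qed.

Lemma sqr_norm_neq0 z : z != 0 -> Re z ^+ 2 + Im z ^+ 2 != 0.
Proof. by move=> z0; rewrite -cmod_sqr expf_neq0// cmod_eq0. Qed.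

Lemma cderV g x d : g x != 0 -> cder g x d ->
  cder (fun y => (g y)^-1) x (- d / g x ^+ 2).
Proof.
move=> g0 [g1 g2]; have n0 := sqr_norm_neq0 g0.
pose N y := Re (g y) ^+ 2 + Im (g y) ^+ 2.
have hN : is_derive x 1 N (2 * Re (g x) * Re d + 2 * Im (g x) * Im d).
  by apply: rder_eq (rderD (rderX 2 g1) (rderX 2 g2)) _; rewrite /= !expr1.
have hNV := rderV (f := N) n0 hN.
have e : - d / g x ^+ 2 = - d * (conjc (g x)) ^+ 2 / ((N x) ^+ 2)%:C.
  have c0 : (conjc (g x)) != 0 by rewrite conjc_eq0.
  rewrite rmorphXn/= (_ : (N x)%:C = g x * (conjc (g x))); first by field; rewrite g0 c0.
  by rewrite /N; case: (g x) => a b; apply: eqC => /=; ring.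
have eR : Re (- d / g x ^+ 2) = (- Re d * (Re (g x) ^+ 2 - Im (g x) ^+ 2)
   - 2 * Im d * Re (g x) * Im (g x)) / N x ^+ 2.
  rewrite e -fmorphV/= mulrC Re_scale mulrC; congr (_ / _).
  by case: (g x) (d) => a b [d1 d2] /=; ring.
have eI : Im (- d / g x ^+ 2) = (- Im d * (Re (g x) ^+ 2 - Im (g x) ^+ 2)
   + 2 * Re d * Re (g x) * Im (g x)) / N x ^+ 2.
  rewrite e -fmorphV/= mulrC Im_scale mulrC; congr (_ / _).
  by case: (g x) (d) => a b [d1 d2] /=; ring.
have Nx : N x != 0 by [].
split.
  apply: (@rder_fun _ (fun y => Re (g y) * (N y)^-1)).
    by apply/funext => y; rewrite ReV.
  apply: rder_eq (rderM g1 hNV) _; rewrite eR.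
  by move: Nx; rewrite /N => Nx; field.
apply: (@rder_fun _ (fun y => - Im (g y) * (N y)^-1)).
  by apply/funext => y; rewrite ImV.
apply: rder_eq (rderM (rderN g2) hNV) _; rewrite eI.
by move: Nx; rewrite /N => Nx; field.
Qed.

Lemma cderX g x d n : cder g x d ->
  cder (fun y => g y ^+ n) x (n%:R * g x ^+ n.-1 * d).
Proof.
move=> h; elim: n => [|n ih].
  apply: cder_eq (_ : cder _ _ 0) _; last by rewrite !mul0r.
  by rewrite [X in cder X](_ : _ = fun=> 1); [exact: cder_cst|apply/funext => y; rewrite expr0].
rewrite [X in cder X](_ : _ = fun y => g y * g y ^+ n); last first.
  by apply/funext => y; rewrite exprS.
apply: cder_eq (cderM h ih) _ => /=.
case: n {ih} => [|n]; first by rewrite !mul0r mulr0 addr0 expr0; ring.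
by rewrite /= -[in RHS]natr1 exprS; ring.
Qed.

Lemma cder_exp g x d : cder g x d -> cder (fun y => cexp (g y)) x (cexp (g x) * d).
Proof.
move=> [g1 g2]; split.
  apply: rder_eq (rderM (rder_exp g1) (rder_cos g2)) _.
  by rewrite ReM /=; ring.
apply: rder_eq (rderM (rder_exp g1) (rder_sin g2)) _.
by rewrite ImM /=; ring.
Qed.

Lemma ccont_cst z x : ccont (fun _ => z) x.
Proof. by split; exact: rcont_cst. Qed.

Lemma ccontP g x (f1 f2 : R -> R) : (forall y, g y = f1 y +i* f2 y) ->
  {for x, continuous f1} -> {for x, continuous f2} -> ccont g x.
Proof.
move=> e h1 h2; split.
  by apply: rcont_fun h1; apply/funext => y; rewrite e.
by apply: rcont_fun h2; apply/funext => y; rewrite e.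
Qed.

Lemma ccontD g h x : ccont g x -> ccont h x -> ccont (fun y => g y + h y) x.
Proof.
move=> [g1 g2] [h1 h2]; apply: ccontP (rcontD g1 h1) (rcontD g2 h2) => y.
by apply: eqC; rewrite ?ReD ?ImD.
Qed.

Lemma ccontN g x : ccont g x -> ccont (fun y => - g y) x.
Proof.
move=> [g1 g2]; apply: ccontP (rcontN g1) (rcontN g2) => y.
by apply: eqC; rewrite ?ReN ?ImN.
Qed.

Lemma ccontB g h x : ccont g x -> ccont h x -> ccont (fun y => g y - h y) x.
Proof. by move=> hg hh; apply: ccontD => //; exact: ccontN. Qed.

Lemma ccontM g h x : ccont g x -> ccont h x -> ccont (fun y => g y * h y) x.
Proof.
move=> [g1 g2] [h1 h2].
apply: ccontP (rcontB (rcontM g1 h1) (rcontM g2 h2))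
              (rcontD (rcontM g1 h2) (rcontM g2 h1)) => y.
by apply: eqC; rewrite ?ReM ?ImM.
Qed.

Lemma ccontV g x : g x != 0 -> ccont g x -> ccont (fun y => (g y)^-1) x.
Proof.
move=> g0 [g1 g2]; have n0 := sqr_norm_neq0 g0.
have hN := rcontV (f := fun y => Re (g y) ^+ 2 + Im (g y) ^+ 2) n0
  (rcontD (rcontX (n := 2) g1) (rcontX (n := 2) g2)).
apply: ccontP (rcontM g1 hN) (rcontM (rcontN g2) hN) => y.
by apply: eqC; rewrite ?ReV ?ImV.
Qed.

Lemma ccontX g x n : ccont g x -> ccont (fun y => g y ^+ n) x.
Proof.
move=> h; elim: n => [|n ih].
  by rewrite [X in ccont X](_ : _ = fun=> 1); [exact: ccont_cst|apply/funext => y; rewrite expr0].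
rewrite [X in ccont X](_ : _ = fun y => g y * g y ^+ n); first exact: ccontM.
by apply/funext => y; rewrite exprS.
Qed.

Lemma ccont_real (f : R -> R) x : {for x, continuous f} -> ccont (fun y => (f y)%:C) x.
Proof. by move=> h; split => //; exact: rcont_cst. Qed.

Lemma ccont_exp g x : ccont g x -> ccont (fun y => cexp (g y)) x.
Proof.
move=> [g1 g2].
have e := rcont_comp g1 (@continuous_expR R _).
have c := rcont_comp g2 (@continuous_cos R _).
have s := rcont_comp g2 (@continuous_sin R _).
exact: ccontP (rcontM e c) (rcontM e s).
Qed.

Lemma ccont_cmod g x : ccont g x -> {for x, continuous (fun y => cmod (g y))}.
Proof.
move=> [g1 g2]; apply: (@rcont_fun _ (fun y => Num.sqrt (Re (g y) ^+ 2 + Im (g y) ^+ 2))).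
  by apply/funext => y; rewrite cmodE.
by apply: rcont_sqrt; apply: rcontD; apply: rcontX.
Qed.

(* A complex function is handled through its compositions with real curves, so
   that only derivatives and limits along the reals are needed. *)
Variant hcont (f : R[i] -> R[i]) z : Prop :=
  Hcont of forall g x, g x = z -> ccont g x -> ccont (fun y => f (g y)) x.

Variant hder (f : R[i] -> R[i]) z d : Prop :=
  Hder of forall g x e, g x = z -> cder g x e -> cder (fun y => f (g y)) x (d * e).

Lemma hcontP (f : R[i] -> R[i]) z g x : hcont f z -> g x = z -> ccont g x ->
  ccont (fun y => f (g y)) x.
Proof. by case=> h; exact: h. Qed.

Lemma hderP (f : R[i] -> R[i]) z d g x e : hder f z d -> g x = z -> cder g x e ->
  cder (fun y => f (g y)) x (d * e).
Proof. by case=> h; exact: h. Qed.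

End Paths.

(** * The principal logarithm on the slit plane *)

Section SlitPlane.
Context {R : realType}.
Implicit Types (z w p : R[i]) (x y a b : R).

(** An angle in ]-pi, pi] is determined by its cosine and sine. This links [carg], defined through
    acos, with the atan formulas below. *)
Lemma carg_unique z (th : R) : z != 0 -> - pi < th <= pi ->
  cmod z * cos th = Re z -> cmod z * sin th = Im z -> carg z = th.
Proof.
move=> z0 /andP[h1 h2] hc hs.
have m0 : 0 < cmod z by rewrite cmod_gt0.
have e : Re z / cmod z = cos th by rewrite -hc mulrC mulKf// gt_eqF.
rewrite /carg e -hs pmulr_rge0//; case: ifPn => [s0|].
  case: (leP 0 th) => t0; first by rewrite cosK// in_itv/= t0 h2.
  exfalso; have : 0 < sin (- th) by apply: sin_gt0_pi; rewrite oppr_gt0 t0 ltrNl.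
  by rewrite sinN oppr_gt0 ltNge s0.
rewrite -ltNge => s0; case: (leP 0 th) => t0; last first.
  by rewrite cosKN ?opprK// (ltW h1) ltW.
exfalso; have : 0 <= sin th by apply: sin_ge0_pi; rewrite t0.
by rewrite leNgt s0.
Qed.

Lemma cmod_Re_pos a b : 0 < a -> cmod (a +i* b) = a * Num.sqrt (1 + (b / a) ^+ 2).
Proof.
move=> a0; rewrite cmodE/= -[X in X * _]gtr0_norm// -sqrtr_sqr -sqrtrM ?sqr_ge0//.
by congr Num.sqrt; field; rewrite gt_eqF.
Qed.

Lemma sqrt1D_gt0 x : 0 < Num.sqrt (1 + x ^+ 2).
Proof. by rewrite sqrtr_gt0 ltr_pwDl// sqr_ge0. Qed.

Lemma sin_atan x : sin (atan x) = x / Num.sqrt (1 + x ^+ 2).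
Proof.
have c0 : cos (atan x) != 0 by rewrite cos_atan invr_eq0 gt_eqF// sqrt1D_gt0.
have e := atanK x; rewrite /tan in e.
by rewrite -[in RHS]e -cos_atan e -[X in X * cos _]e divfK.
Qed.

(** The acos in [carg] is not differentiable at -1 and 1, that is for z on the real axis. The right,
    upper and lower half-planes cover the slit plane, and on each of them [carg] is a smooth
    function of a quotient. *)
Lemma carg_Re z : 0 < Re z -> carg z = atan (Im z / Re z).
Proof.
case: z => a b /= a0; have s0 := sqrt1D_gt0 (b / a).
apply: carg_unique.
- by apply/eqP => -[/eqP]; rewrite gt_eqF.
- have := atan_gtNpi2 (b / a); have := atan_ltpi2 (b / a); have := @pi_gt0 R.
  by move=> h1 h2 h3; apply/andP; split; lra.
- by rewrite cos_atan cmod_Re_pos// /= mulfK// gt_eqF.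
- by rewrite sin_atan cmod_Re_pos//= mulrACA -mulrA divff ?mulr1 ?gt_eqF// mulrCA divff ?mulr1 ?gt_eqF.
Qed.

Lemma cmod_swap a b : cmod (a +i* b) = cmod (b +i* a).
Proof. by rewrite !cmodE/= addrC. Qed.

Lemma carg_Im_gt0 z : 0 < Im z -> carg z = pi / 2 - atan (Re z / Im z).
Proof.
case: z => a b /= b0; have s0 := sqrt1D_gt0 (a / b).
apply: carg_unique.
- by apply/eqP => -[_ /eqP]; rewrite gt_eqF.
- have := atan_gtNpi2 (a / b); have := atan_ltpi2 (a / b); have := @pi_gt0 R.
  by move=> h1 h2 h3; apply/andP; split; lra.
- rewrite addrC cosDpihalf sinN opprK sin_atan cmod_swap cmod_Re_pos//.
  by rewrite /= mulrACA -mulrA divff ?mulr1 ?gt_eqF// mulrCA divff ?mulr1 ?gt_eqF.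
- rewrite addrC sinDpihalf cosN cos_atan cmod_swap cmod_Re_pos//.
  by rewrite /= mulfK// gt_eqF.
Qed.

Lemma carg_Im_lt0 z : Im z < 0 -> carg z = - (pi / 2) - atan (Re z / Im z).
Proof.
move=> b0.
have z0 : z != 0 by apply: contraTneq b0 => ->; rewrite ltxx.
have zn0 : - z != 0 by rewrite oppr_eq0.
have m0 : 0 < cmod z by rewrite cmod_gt0.
have h := @carg_Im_gt0 (- z); rewrite ImN ReN oppr_gt0 invrN mulrNN in h.
have {}h := h b0.
have hc := cos_carg zn0; have hs := sin_carg zn0.
rewrite cmodN h ReN in hc; rewrite cmodN h ImN in hs.
apply: carg_unique => //.
- have := atan_gtNpi2 (Re z / Im z); have := atan_ltpi2 (Re z / Im z); have := @pi_gt0 R.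
  by move=> h1 h2 h3; apply/andP; split; lra.
- have -> : - (pi / 2) - atan (Re z / Im z) = (pi / 2 - atan (Re z / Im z)) - pi by field.
  set th := pi / 2 - _ in hc *.
  have -> : cos (th - pi) = - cos th by rewrite -[in RHS](subrK pi th) cosDpi opprK.
  by apply: oppr_inj; rewrite -hc mulrN opprK.
- have -> : - (pi / 2) - atan (Re z / Im z) = (pi / 2 - atan (Re z / Im z)) - pi by field.
  set th := pi / 2 - _ in hs *.
  have -> : sin (th - pi) = - sin th by rewrite -[in RHS](subrK pi th) sinDpi opprK.
  by apply: oppr_inj; rewrite -hs mulrN opprK.
Qed.

Definition slit z := (0 < Re z) || (Im z != 0).

Lemma slit_neq0 z : slit z -> z != 0.
Proof. by apply: contraTneq => ->; rewrite /slit/= ltxx eqxx. Qed.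

Lemma cder_lncmod (g : R -> R[i]) x e : g x != 0 -> cder g x e ->
  is_derive x 1 (fun y => ln (cmod (g y))) (Re (e / g x)).
Proof.
move=> g0 [h1 h2].
have n0 : 0 < Re (g x) ^+ 2 + Im (g x) ^+ 2 by rewrite -cmod_sqr exprn_gt0// cmod_gt0.
have s0 : 0 < Num.sqrt (Re (g x) ^+ 2 + Im (g x) ^+ 2) by rewrite sqrtr_gt0.
apply: (@rder_fun _ (fun y => ln (Num.sqrt (Re (g y) ^+ 2 + Im (g y) ^+ 2)))).
  by apply/funext => y; rewrite cmodE.
apply: rder_eq (rder_ln (f := fun y => Num.sqrt (Re (g y) ^+ 2 + Im (g y) ^+ 2)) s0
  (rder_sqrt (f := fun y => Re (g y) ^+ 2 + Im (g y) ^+ 2) n0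
    (rderD (rderX 2 h1) (rderX 2 h2)))) _.
rewrite ReM ReV ImV /= !expr1.
rewrite -[X in _ = X](_ : (2 * Re (g x) * Re e + 2 * Im (g x) * Im e) /
  (2 * Num.sqrt (Re (g x) ^+ 2 + Im (g x) ^+ 2) ^+ 2) = _); last first.
  by rewrite sqr_sqrtr ?(ltW n0)//; field; rewrite gt_eqF.
by field; rewrite gt_eqF.
Qed.

Lemma hder_clog z : slit z -> hder (@clog R) z z^-1.
Proof.
move=> sz; split=> g x e gx hg; have g0 : g x != 0 by rewrite gx slit_neq0.
have [h1 h2] := hg; have [c1 c2] := cder_cont hg.
split; first by rewrite mulrC -gx; apply: (cder_lncmod g0 hg).
rewrite mulrC -gx /clog/=.
have N0 := sqr_norm_neq0 g0.
have [r0|r0] : 0 < Re (g x) \/ Re (g x) <= 0 /\ Im (g x) != 0.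
- by rewrite gx; move: sz; rewrite /slit; case: ltP => /= H1 H2; [left|right].
- apply: (@rder_near _ (fun y => atan (Im (g y) / Re (g y)))).
    by near=> y; rewrite carg_Re//; near: y; exact: rcont_pos.
  apply: rder_eq (rder_atan (rderM h2 (rderV (f := fun y => Re (g y)) _ h1))) _.
    by rewrite gt_eqF.
  by rewrite ImM ReV ImV; field; rewrite N0 gt_eqF//= mulr1.
case: r0 => r0 i0; have [i1|i1|/eqP] := ltrgtP (Im (g x)) 0; last by rewrite (negPf i0).
- apply: (@rder_near _ (fun y => - (pi / 2) - atan (Re (g y) / Im (g y)))).
    near=> y; rewrite carg_Im_lt0// -oppr_gt0; near: y.
    apply: (rcont_pos (f := fun y => - Im (g y))); [exact: rcontN|by rewrite oppr_gt0].
  apply: rder_eq (rderB (rder_cst _ _) (rder_atan (rderM h1 (rderV (f := fun y => Im (g y)) _ h2)))) _.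
    by rewrite lt_eqF.
  by rewrite ImM ReV ImV; field; rewrite ?N0 ?i0.
- apply: (@rder_near _ (fun y => pi / 2 - atan (Re (g y) / Im (g y)))).
    by near=> y; rewrite carg_Im_gt0//; near: y; exact: rcont_pos.
  apply: rder_eq (rderB (rder_cst _ _) (rder_atan (rderM h1 (rderV (f := fun y => Im (g y)) _ h2)))) _.
    by rewrite gt_eqF.
  by rewrite ImM ReV ImV; field; rewrite ?N0 ?i0.
Unshelve. all: by end_near. Qed.

Lemma rcont_ln (f : R -> R) x : 0 < f x -> {for x, continuous f} ->
  {for x, continuous (fun y => ln (f y))}.
Proof.
by move=> f0 h; apply: (rcont_comp (f := @ln R)) => //; exact: continuous_ln.
Qed.

Lemma rcont_atan (f : R -> R) x : {for x, continuous f} ->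
  {for x, continuous (fun y => atan (f y))}.
Proof.
by move=> h; apply: (rcont_comp (f := @atan R)) => //; exact: continuous_atan.
Qed.

Lemma hcont_clog z : slit z -> hcont (@clog R) z.
Proof.
move=> sz; split=> g x gx hg; have g0 : g x != 0 by rewrite gx slit_neq0.
have [c1 c2] := hg.
have hl : {for x, continuous (fun y => ln (cmod (g y)))}.
  by apply: rcont_ln; [rewrite cmod_gt0|exact: ccont_cmod].
have [r0|r0] : 0 < Re (g x) \/ Re (g x) <= 0 /\ Im (g x) != 0.
- by rewrite gx; move: sz; rewrite /slit; case: ltP => /= H1 H2; [left|right].
- split => //; apply: (@rcont_near _ (fun y => atan (Im (g y) / Re (g y)))).
    by near=> y; rewrite /clog/= carg_Re//; near: y; exact: rcont_pos.
  by apply/rcont_atan/rcontM => //; apply: rcontV => //; rewrite gt_eqF.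
case: r0 => r0 i0; have [i1|i1|/eqP] := ltrgtP (Im (g x)) 0; last by rewrite (negPf i0).
- split => //; apply: (@rcont_near _ (fun y => - (pi / 2) - atan (Re (g y) / Im (g y)))).
    near=> y; rewrite /clog/= carg_Im_lt0// -oppr_gt0; near: y.
    apply: (rcont_pos (f := fun y => - Im (g y))); [exact: rcontN|by rewrite oppr_gt0].
  by apply: rcontB; [exact: rcont_cst|apply/rcont_atan/rcontM => //; exact: rcontV].
- split => //; apply: (@rcont_near _ (fun y => pi / 2 - atan (Re (g y) / Im (g y)))).
    by near=> y; rewrite /clog/= carg_Im_gt0//; near: y; exact: rcont_pos.
  by apply: rcontB; [exact: rcont_cst|apply/rcont_atan/rcontM => //; exact: rcontV].
Unshelve. all: by end_near. Qed.

End SlitPlane.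

(** * Path integrals *)

Section IntervalIntegral.
Context {R : realType}.
Notation mu := (@lebesgue_measure R).
Implicit Types (f g F : R -> R) (a b c x : R).

Definition ibl a b f := mu.-integrable `[a, b] (EFin \o f).

Lemma within_cont a b f : (forall x, a <= x <= b -> {for x, continuous f}) ->
  {within `[a, b], continuous f}.
Proof.
move=> h; apply: continuous_in_subspaceT => x.
by rewrite inE/= in_itv/= => /h.
Qed.

Lemma ibl_cont a b f : (forall x, a <= x <= b -> {for x, continuous f}) -> ibl a b f.
Proof.
move=> h; apply: continuous_compact_integrable; first exact: segment_compact.
exact: within_cont.
Qed.

Lemma ibl_oo a b f : ibl a b f -> mu.-integrable `]a, b[ (EFin \o f).
Proof.
by apply: integrableS => //; exact: subset_itv_oo_cc.
Qed.

(** The endpoints form a null set. They must be disregarded because [path_deriv] may take any value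
    at a subdivision point of a piecewise curve. *)
Lemma ibl_of_oo a b f : mu.-integrable `]a, b[ (EFin \o f) -> ibl a b f.
Proof.
move=> h; have mf : measurable_fun `[a, b] f.
  apply/measurable_fun_itv_bndo_bndcP/measurable_fun_itv_obnd_cbndP.
  by apply/measurable_EFinP; case/integrableP : h.
apply/(@negligible_integrable _ _ _ mu `[a, b] [set a; b]).
- by apply: measurableU.
- by [].
- exact/measurable_EFinP.
- by rewrite measureU0//; exact: lebesgue_measure_set1.
- apply: integrableS h => //; first by apply: measurableD => //; exact: measurableU.
  move=> x /= [] /[!in_itv]/= /andP[]; rewrite le_eqVlt => /orP[/eqP <-|ax].
    by move=> _ []; left.
  by rewrite le_eqVlt => /orP[/eqP ->|xb]; [case; right|rewrite ax xb].
Qed.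

Lemma eq_integrable_oo a b f g : (forall x, a < x < b -> f x = g x) ->
  mu.-integrable `]a, b[ (EFin \o f) -> mu.-integrable `]a, b[ (EFin \o g).
Proof.
move=> fg; apply: eq_integrable => // x; rewrite inE/= in_itv/= => /fg e.
by rewrite e.
Qed.

Lemma ibl_eqoo a b f g : (forall x, a < x < b -> f x = g x) ->
  ibl a b f -> ibl a b g.
Proof. by move=> fg /ibl_oo/(eq_integrable_oo fg)/ibl_of_oo. Qed.

Lemma Rint_oo a b f : ibl a b f ->
  \int[mu]_(x in `]a, b[) f x = \int[mu]_(x in `[a, b]) f x.
Proof.
move=> h; rewrite Rintegral_itv_obnd_cbnd; last exact: ibl_oo.
rewrite Rintegral_itv_bndo_bndc//.
by apply: integrableS h => //; exact: subset_itv_co_cc.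
Qed.

Lemma Rint_eqoo a b f g : (forall x, a < x < b -> f x = g x) ->
  ibl a b f -> \int[mu]_(x in `[a, b]) f x = \int[mu]_(x in `[a, b]) g x.
Proof.
move=> fg h; rewrite -(Rint_oo h) -(Rint_oo (ibl_eqoo fg h)).
by apply: eq_Rintegral => x; rewrite inE/= in_itv/= => /fg.
Qed.

Lemma itv_cat a b c : a <= b <= c -> `[a, c]%classic = `[a, b] `|` `]b, c].
Proof.
by move=> /andP[ab bc]; rewrite -itv_bndbnd_setU// bnd_simp.
Qed.

Lemma ibl_cat a b c f : a <= b <= c -> ibl a b f -> ibl b c f -> ibl a c f.
Proof.
move=> abc h1 h2; rewrite /ibl (itv_cat abc).
have h2' : mu.-integrable `]b, c] (EFin \o f).
  by apply: integrableS h2 => //; exact: subset_itv_oc_cc.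
have mf : measurable_fun (`[a, b] `|` `]b, c]) (EFin \o f).
  by apply/measurable_funU => //; split; [case/integrableP : h1|case/integrableP : h2'].
apply/integrableP; split => //.
rewrite ge0_integral_setU//=.
- by rewrite lte_add_pinfty//; [case/integrableP : h1|case/integrableP : h2'].
- by do 2 apply: measurableT_comp => //; exact/measurable_EFinP.
- apply/disj_setPS => y [/=]; rewrite 2!in_itv/= => /andP[_ yx] /andP[].
  by rewrite ltNge yx.
Qed.

Lemma Rint_cat a b c f : a <= b <= c -> ibl a b f -> ibl b c f ->
  \int[mu]_(x in `[a, c]) f x =
  \int[mu]_(x in `[a, b]) f x + \int[mu]_(x in `[b, c]) f x.
Proof.
move=> abc h1 h2; rewrite (itv_cat abc) Rintegral_setU//.
- rewrite Rintegral_itv_obnd_cbnd//.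
  by apply: integrableS h2 => //; exact: subset_itv_oc_cc.
- by have := ibl_cat abc h1 h2; rewrite /ibl (itv_cat abc).
- apply/disj_setPS => y [/=]; rewrite 2!in_itv/= => /andP[_ yx] /andP[].
  by rewrite ltNge yx.
Qed.

Lemma FTC a b f F : a < b -> (forall x, a <= x <= b -> {for x, continuous f}) ->
  (forall x, a <= x <= b -> {for x, continuous F}) ->
  (forall x, a < x < b -> is_derive x 1 F (f x)) ->
  \int[mu]_(x in `[a, b]) f x = F b - F a.
Proof.
move=> ab cf cF dF; rewrite /Rintegral (@continuous_FTC2 _ f F)//.
- exact: within_cont.
- split.
  + by move=> x; rewrite in_itv/= => /dF [].
  + by apply: cvg_at_right_filter; apply: cF; rewrite lexx ltW.
  + by apply: cvg_at_left_filter; apply: cF; rewrite lexx ltW.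
- by move=> x; rewrite in_itv/= => /dF [_ <-]; rewrite derive1E.
Qed.

Lemma iblD a b f g : ibl a b f -> ibl a b g -> ibl a b (fun x => f x + g x).
Proof. by move=> hf hg; have := integrableD _ hf hg; apply. Qed.

Lemma iblB a b f g : ibl a b f -> ibl a b g -> ibl a b (fun x => f x - g x).
Proof. by move=> hf hg; have := integrableB _ hf hg; apply. Qed.

Lemma iblZ a b (k : R) f : ibl a b f -> ibl a b (fun x => k * f x).
Proof. by move=> hf; have := integrableZl _ k hf; apply. Qed.

Lemma le_Rint a b f g : ibl a b f -> ibl a b g ->
  (forall x, a < x < b -> f x <= g x) ->
  \int[mu]_(x in `[a, b]) f x <= \int[mu]_(x in `[a, b]) g x.
Proof.
move=> hf hg fg; rewrite -(Rint_oo hf) -(Rint_oo hg).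
have hf' := ibl_oo hf; have hg' := ibl_oo hg.
by apply: le_Rintegral => // x; rewrite /= in_itv/= => /fg.
Qed.

Lemma Rint_cst a b (k : R) : a <= b -> \int[mu]_(x in `[a, b]) k = k * (b - a).
Proof.
rewrite le_eqVlt => /orP[/eqP <-|ab]; first by rewrite set_itv1 Rintegral_set1 subrr mulr0.
rewrite mulrBr; apply: (FTC ab (F := fun x => k * x)).
- by move=> x _; exact: rcont_cst.
- by move=> x _; apply: rcontM; [exact: rcont_cst|exact: rcont_id].
- by move=> x _; apply: rder_eq (rderZ _ (rder_id _)) _; rewrite mulr1.
Qed.

End IntervalIntegral.

Section ComplexIntegral.
Context {R : realType}.
Notation mu := (@lebesgue_measure R).
Implicit Types (f g h : R -> R[i]) (a b c x : R).

Definition cibl a b f := ibl a b (fun x => Re (f x)) /\ ibl a b (fun x => Im (f x)).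

Definition cint a b f := cintegral mu `[a, b] f.

Lemma cibl_cont a b f : (forall x, a <= x <= b -> ccont f x) -> cibl a b f.
Proof. by move=> h; split; apply: ibl_cont => x /h []. Qed.

Lemma cibl_eqoo a b f g : (forall x, a < x < b -> f x = g x) -> cibl a b f -> cibl a b g.
Proof. by move=> fg [h1 h2]; split; [move: h1|move: h2]; apply: ibl_eqoo => x /fg ->. Qed.

Lemma cibl_pt a f : cibl a a f.
Proof.
apply: (@cibl_eqoo a a (fun=> 0)) => [x|]; first by case: ltgtP.
by apply: cibl_cont => x _; exact: ccont_cst.
Qed.

Lemma cint_eqoo a b f g : (forall x, a < x < b -> f x = g x) -> cibl a b f ->
  cint a b f = cint a b g.
Proof.
move=> fg [h1 h2]; apply: eqC.
  by apply: Rint_eqoo => // x /fg ->.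
by apply: Rint_eqoo => // x /fg ->.
Qed.

Lemma cibl_cat a b c f : a <= b <= c -> cibl a b f -> cibl b c f -> cibl a c f.
Proof.
by move=> abc [h1 h2] [h3 h4]; split; [exact: ibl_cat h1 h3|exact: ibl_cat h2 h4].
Qed.

Lemma cint_cat a b c f : a <= b <= c -> cibl a b f -> cibl b c f ->
  cint a c f = cint a b f + cint b c f.
Proof.
move=> abc [h1 h2] [h3 h4]; apply: eqC; rewrite (ReD, ImD) /=.
  exact: Rint_cat.
exact: Rint_cat.
Qed.

Lemma cintD a b f g : cibl a b f -> cibl a b g ->
  cint a b (fun x => f x + g x) = cint a b f + cint a b g.
Proof.
move=> [f1 f2] [g1 g2]; apply: eqC; rewrite (ReD, ImD) /= -RintegralD//.
  by apply: eq_Rintegral => x _; rewrite ReD.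
by apply: eq_Rintegral => x _; rewrite ImD.
Qed.

Lemma ciblZ a b k f : cibl a b f -> cibl a b (fun x => k * f x).
Proof.
move=> [f1 f2]; split.
  by apply: ibl_eqoo (iblB (iblZ (Re k) f1) (iblZ (Im k) f2)) => x _; rewrite ReM.
by apply: ibl_eqoo (iblD (iblZ (Re k) f2) (iblZ (Im k) f1)) => x _; rewrite ImM.
Qed.

Lemma cintZ a b k f : cibl a b f -> cint a b (fun x => k * f x) = k * cint a b f.
Proof.
move=> [f1 f2]; apply: eqC; rewrite (ReM, ImM) /=.
  rewrite -RintegralZl// -[X in _ - X]RintegralZl// -RintegralB//.
  - by apply: eq_Rintegral => x _; rewrite ReM.
  - exact: iblZ.
  - exact: iblZ.
rewrite -RintegralZl// -[X in _ + X]RintegralZl// -RintegralD//.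
- by apply: eq_Rintegral => x _; rewrite ImM.
- exact: iblZ.
- exact: iblZ.
Qed.

Lemma cint_real a b (f : R -> R) :
  cint a b (fun x => (f x)%:C) = (\int[mu]_(x in `[a, b]) f x)%:C.
Proof.
apply: eqC => //=; rewrite /Rintegral.
by rewrite integral0.
Qed.

(** Multiplication by the unit number [u], the conjugate of the integral divided by its modulus,
    makes the integral real and nonnegative; it then suffices to compare real parts. *)
Lemma cmod_cint_le a b f (B : R -> R) : cibl a b f -> ibl a b B ->
  (forall x, a < x < b -> cmod (f x) <= B x) ->
  cmod (cint a b f) <= \int[mu]_(x in `[a, b]) B x.
Proof.
move=> hf hB fB; set I := cint a b f.
have [I0|I0] := eqVneq I 0.
  rewrite I0 cmod0 -(Rint_oo hB); apply: Rintegral_ge0 => x /=.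
  by rewrite in_itv/= => /fB; apply: le_trans; exact: cmod_ge0.
pose u := ((conjc I) / (cmod I)%:C).
have cI0 : cmod I != 0 by rewrite cmod_eq0.
have cIc : (cmod I)%:C != 0 :> R[i] by rewrite -(rmorph0 (real_complex R)) (inj_eq (@complexI R)).
have u1 : cmod u = 1.
  by rewrite /u cmodM cmodV cmodJ cmodR ger0_norm ?cmod_ge0// divff.
have uI : u * I = (cmod I)%:C.
  apply: (mulIf cIc); rewrite /u mulrAC (divfK cIc) -rmorphM -expr2 cmod_sqr.
  have mJ (z : R[i]) : (conjc z) * z = (Re z ^+ 2 + Im z ^+ 2)%:C.
    by case: z => p q; apply: eqC => /=; ring.
  exact: mJ.
have -> : cmod I = Re (cint a b (fun x => u * f x)) by rewrite cintZ// uI.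
have [h _] := ciblZ u hf.
apply: le_Rint => // x xab; apply: le_trans (Re_le _) _.
by rewrite cmodM u1 mul1r fB.
Qed.

Lemma cFTC a b f F : a < b -> (forall x, a <= x <= b -> ccont f x) ->
  (forall x, a <= x <= b -> ccont F x) ->
  (forall x, a < x < b -> cder F x (f x)) -> cint a b f = F b - F a.
Proof.
move=> ab cf cF dF; apply: eqC; rewrite (ReB, ImB) /=.
  by apply: (FTC ab (F := fun x => Re (F x))) => x hx; [case: (cf x hx)|case: (cF x hx)|case: (dF x hx)].
by apply: (FTC ab (F := fun x => Im (F x))) => x hx;
  [case: (cf x hx)|case: (cF x hx)|case: (dF x hx)].
Qed.

End ComplexIntegral.

Section PathIntegral.
Context {R : realType}.
Implicit Types (g : R -> R[i]) (f F : R[i] -> R[i]) (x y : R) (z w : R[i]).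

(* Piecewise C1 curve whose pieces need only be differentiable inside. *)
Definition gpath g := exists (m : nat) (p : nat -> R),
  [/\ p 0%N = 0, p m = 1, (forall k, (k < m)%N -> p k < p k.+1)
    & forall k, (k < m)%N -> exists h H : R -> R[i],
      [/\ forall x, p k <= x <= p k.+1 -> ccont h x /\ g x = h x,
          forall x, p k <= x <= p k.+1 -> ccont H x
        & forall x, p k < x < p k.+1 -> cder h x (H x)]].

Lemma gpath_intro g (H : R -> R[i]) : (forall x, 0 <= x <= 1 -> ccont g x) ->
  (forall x, 0 <= x <= 1 -> ccont H x) -> (forall x, 0 < x < 1 -> cder g x (H x)) ->
  gpath g.
Proof.
move=> h1 h2 h3; exists 1%N, (fun k => k%:R); split => //.
  by move=> k _; rewrite ltr_nat.
by case=> // _; exists g, H; split => // x /h1.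
Qed.

Lemma piecewise_gpath g : piecewise_C1 g -> gpath g.
Proof.
move=> [m [p [p0 pm pk hk]]]; exists m, p; split => // k km.
have [h [[d1 c1] [d2 c2] e]] := hk k km.
have dh x : cder h x (path_deriv h x).
  by split; rewrite /path_deriv/= derive1E; split.
exists h, (path_deriv h); split.
- by move=> x hx; split; [exact: cder_cont (dh x)|exact: e].
- by move=> x _; split; [exact: c1|exact: c2].
- by move=> x _; exact: dh.
Qed.

Lemma open_itv_near (a b x : R) : a < x < b -> \forall y \near x, a < y < b.
Proof.
move=> h; have := @near_in_itv R a b x; rewrite in_itv/= => /(_ h).
by apply: filterS => y; rewrite in_itv.
Qed.

Lemma piece_near g (h : R -> R[i]) (a b x : R) :
  (forall x, a <= x <= b -> g x = h x) -> a < x < b ->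
  \forall y \near x, h y = g y.
Proof.
move=> e hx; near=> y; apply/esym/e.
have : a < y < b by near: y; exact: open_itv_near.
by move=> /andP[/ltW -> /ltW ->].
Unshelve. all: by end_near. Qed.

Lemma subdiv_le (m : nat) (p : nat -> R) k :
  (forall k, (k < m)%N -> p k < p k.+1) -> (k <= m)%N -> p 0%N <= p k.
Proof.
move=> pk; elim: k => // k ih km; apply: (le_trans (ih (ltnW km))).
exact/ltW/pk.
Qed.

Lemma subdiv_le1 (m : nat) (p : nat -> R) k :
  (forall k, (k < m)%N -> p k < p k.+1) -> (k <= m)%N -> p k <= p m.
Proof.
move=> pk; elim: m pk k => [|m ih] pk k; first by rewrite leqn0 => /eqP ->.
rewrite leq_eqVlt => /orP[/eqP ->//|km].
apply: (le_trans (ih _ _ km)); last exact/ltW/pk.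
by move=> j jm; apply: pk; rewrite ltnS ltnW.
Qed.

(** Induction over the subdivision, [P b] being a statement about the part of the curve over [0, b].
    The step supplies a piece [h] with derivative [H] and identifies the two integrands in the open
    interval only, where [path_deriv g] is meaningful. *)
Lemma gpath_ind g f (P : R -> Prop) : gpath g ->
  (forall x, 0 <= x <= 1 -> hcont f (g x)) -> P 0 ->
  (forall a b (h H : R -> R[i]), 0 <= a < b -> b <= 1 -> P a ->
    (forall x, a <= x <= b -> ccont h x /\ g x = h x) ->
    (forall x, a <= x <= b -> ccont (fun y => f (h y) * H y) x) ->
    (forall x, a < x < b -> cder h x (H x)) ->
    (forall x, a < x < b -> f (h x) * H x = f (g x) * path_deriv g x) -> P b) -> P 1.
Proof.
move=> [m [p [p0 pm pk hk]]] fc P0 Pstep.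
have : forall k, (k <= m)%N -> P (p k).
  elim=> [|k ih] km; first by rewrite p0.
  have [h [H [e cH dh]]] := hk k km.
  have ak : 0 <= p k by rewrite -p0; exact: subdiv_le pk (ltnW km).
  have bk : p k.+1 <= 1 by rewrite -pm; exact: subdiv_le1 pk km.
  apply: (Pstep (p k) (p k.+1) h H) => //.
  - by rewrite ak pk.
  - exact: ih (ltnW km).
  - move=> x hx; apply: ccontM; last exact: cH.
    have [ch gh] := e x hx; apply: hcontP ch => //; rewrite -gh; apply: fc.
    by move: hx => /andP[/(le_trans ak) -> /le_trans]; apply.
  - move=> x hx; have hx' : p k <= x <= p k.+1 by move: hx => /andP[/ltW -> /ltW ->].
    have [_ ->] := e x hx'; congr (_ * _); apply/esym/cder_path_deriv.
    apply: cder_near (dh x hx); apply: (piece_near _ hx) => y /e [_].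
    by [].
by move=> /(_ m (leqnn m)); rewrite pm.
Qed.

Lemma gpath_cibl g f : gpath g -> (forall x, 0 <= x <= 1 -> hcont f (g x)) ->
  cibl 0 1 (fun x => f (g x) * path_deriv g x).
Proof.
move=> gg fc; apply: (gpath_ind (P := fun b => cibl 0 b (fun x => f (g x) * path_deriv g x)) gg fc).
  exact: cibl_pt.
move=> a b h H /andP[a0 ab] _ ih e cH dh eH.
apply: cibl_cat ih _; first by rewrite a0 ltW.
by apply: cibl_eqoo eH _; exact: cibl_cont.
Qed.

Lemma path_int_FTC g f F : gpath g -> (forall x, 0 <= x <= 1 -> hcont f (g x)) ->
  (forall x, 0 <= x <= 1 -> hcont F (g x)) ->
  (forall x, 0 <= x <= 1 -> hder F (g x) (f (g x))) ->
  path_int g f = F (g 1) - F (g 0).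
Proof.
move=> gg fc Fc dF; rewrite /path_int -/(cint 0 1 _).
suff [] : cibl 0 1 (fun x => f (g x) * path_deriv g x) /\
  cint 0 1 (fun x => f (g x) * path_deriv g x) = F (g 1) - F (g 0) by [].
apply: (gpath_ind (P := fun b => cibl 0 b (fun x => f (g x) * path_deriv g x) /\
  cint 0 b (fun x => f (g x) * path_deriv g x) = F (g b) - F (g 0)) gg fc).
  split; first exact: cibl_pt.
  by rewrite subrr; apply: eqC; rewrite /= set_itv1 Rintegral_set1.
move=> a b h H /andP[a0 ab] b1 [ih1 ih2] e cH dh eH.
have c2 : cibl a b (fun x => f (g x) * path_deriv g x).
  by apply: cibl_eqoo eH _; exact: cibl_cont.
have a0b : 0 <= a <= b by rewrite a0 ltW.
split; first exact: cibl_cat ih1 c2.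
rewrite (cint_cat a0b ih1 c2) ih2 addrC.
have in01 x : a <= x <= b -> 0 <= x <= 1.
  by move=> /andP[/(le_trans a0) -> /le_trans]; apply.
rewrite -(cint_eqoo eH); last exact: cibl_cont.
rewrite (cFTC ab (F := fun x => F (h x))) //.
- have hb : a <= b <= b by rewrite lexx ltW.
  have ha : a <= a <= b by rewrite lexx ltW.
  have [_ eb] := e b hb; have [_ ea] := e a ha.
  by rewrite eb ea addrA subrK.
- by move=> x hx; have [ch gh] := e x hx; apply: hcontP ch => //; rewrite -gh; apply: Fc; exact: in01.
- move=> x hx; have hx' : a <= x <= b by move: hx => /andP[/ltW -> /ltW ->].
  have [_ gh] := e x hx'; have := dF x (in01 x hx'); rewrite gh => hd.
  exact: hderP hd _ (dh x hx).
Qed.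

Lemma path_int_ext g f f' : (forall x, 0 <= x <= 1 -> f (g x) = f' (g x)) ->
  path_int g f = path_int g f'.
Proof.
move=> e; apply: eqC; apply: eq_Rintegral => x; rewrite inE/= in_itv/= => /e -> //.
Qed.

Lemma path_intD g f f' : gpath g -> (forall x, 0 <= x <= 1 -> hcont f (g x)) ->
  (forall x, 0 <= x <= 1 -> hcont f' (g x)) ->
  path_int g (fun z => f z + f' z) = path_int g f + path_int g f'.
Proof.
move=> gg h h'; rewrite /path_int -!/(cint 0 1 _) -cintD; try exact: gpath_cibl.
by apply: eqC; apply: eq_Rintegral => x _; rewrite mulrDl.
Qed.

Lemma path_intZ g f k : gpath g -> (forall x, 0 <= x <= 1 -> hcont f (g x)) ->
  path_int g (fun z => k * f z) = k * path_int g f.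
Proof.
move=> gg h; rewrite /path_int -!/(cint 0 1 _) -cintZ; last exact: gpath_cibl.
by apply: eqC; apply: eq_Rintegral => x _; rewrite mulrA.
Qed.

Lemma path_int0 g : path_int g (fun=> 0) = 0.
Proof.
rewrite /path_int [X in cintegral _ _ X](_ : _ = fun=> 0); last first.
  by apply/funext => x; rewrite mul0r.
by apply: eqC; rewrite /= /Rintegral integral0.
Qed.

Lemma path_int_le g f (B : R -> R) : gpath g ->
  (forall x, 0 <= x <= 1 -> hcont f (g x)) -> ibl 0 1 B ->
  (forall x, 0 < x < 1 -> cmod (f (g x)) * cmod (path_deriv g x) <= B x) ->
  cmod (path_int g f) <= \int[@lebesgue_measure R]_(x in `[0, 1]) B x.
Proof.
move=> gg fc hB fB; apply: cmod_cint_le hB _; first exact: gpath_cibl.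
by move=> x hx; rewrite cmodM fB.
Qed.

Lemma path_int_le_cst g f (M : R) : gpath g ->
  (forall x, 0 <= x <= 1 -> hcont f (g x)) ->
  (forall x, 0 < x < 1 -> cmod (f (g x)) * cmod (path_deriv g x) <= M) ->
  cmod (path_int g f) <= M.
Proof.
move=> gg fc fB; have := path_int_le gg fc (B := fun=> M) _ fB.
rewrite Rint_cst// subr0 mulr1; apply.
by apply: ibl_cont => x _; exact: rcont_cst.
Qed.

End PathIntegral.

(** * Calculus of functions of a complex variable along curves *)

Section Holomorphic.
Context {R : realType}.
Implicit Types (f h : R[i] -> R[i]) (z w p d e : R[i]) (g : R -> R[i]).

Lemma hcont_id z : hcont (fun z => z) z. Proof. by split. Qed.

Lemma hcont_ext f h z : f =1 h -> hcont f z -> hcont h z.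
Proof. by move=> /funext ->. Qed.

Lemma hcont_cst (c z : R[i]) : hcont (fun _ => c) z.
Proof. by split=> g x _ _; exact: ccont_cst. Qed.

Lemma hcontD f h z : hcont f z -> hcont h z -> hcont (fun z => f z + h z) z.
Proof. by move=> hf hh; split=> g x gx hg; apply: ccontD; [exact: hcontP hf _ _|exact: hcontP hh _ _]. Qed.

Lemma hcontN f z : hcont f z -> hcont (fun z => - f z) z.
Proof. by move=> hf; split=> g x gx hg; apply: ccontN; exact: hcontP hf _ _. Qed.

Lemma hcontB f h z : hcont f z -> hcont h z -> hcont (fun z => f z - h z) z.
Proof. by move=> hf hh; apply: hcontD => //; exact: hcontN. Qed.

Lemma hcontM f h z : hcont f z -> hcont h z -> hcont (fun z => f z * h z) z.
Proof. by move=> hf hh; split=> g x gx hg; apply: ccontM; [exact: hcontP hf _ _|exact: hcontP hh _ _]. Qed.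

Lemma hcontX f n z : hcont f z -> hcont (fun z => f z ^+ n) z.
Proof. by move=> hf; split=> g x gx hg; apply: ccontX; exact: hcontP hf _ _. Qed.

Lemma hcontV f z : f z != 0 -> hcont f z -> hcont (fun z => (f z)^-1) z.
Proof. by move=> f0 hf; split=> g x gx hg; apply: ccontV; [rewrite gx|exact: hcontP hf _ _]. Qed.

Lemma hcont_exp f z : hcont f z -> hcont (fun z => cexp (f z)) z.
Proof. by move=> hf; split=> g x gx hg; apply: ccont_exp; exact: hcontP hf _ _. Qed.

Lemma hcont_prod (I : Type) (r : seq I) (P : pred I) (F : I -> R[i] -> R[i]) z :
  (forall i, P i -> hcont (F i) z) -> hcont (fun z => \prod_(i <- r | P i) F i z) z.
Proof.
move=> h; elim: r => [|i r ih].
  by apply: (hcont_ext _ (hcont_cst 1 z)) => w; rewrite big_nil.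
case: (boolP (P i)) => Pi; last by apply: (hcont_ext _ ih) => w; rewrite big_cons (negPf Pi).
by apply: (hcont_ext _ (hcontM (h i Pi) ih)) => w; rewrite big_cons Pi.
Qed.

Lemma hcont_comp f h z : hcont h z -> hcont f (h z) -> hcont (fun z => f (h z)) z.
Proof.
move=> hh hf; split=> g x gx hg; apply: (hcontP (g := fun y => h (g y)) hf); first by rewrite gx.
exact: hcontP hh _ _.
Qed.

Lemma hcont_sub p z : hcont (fun z => z - p) z.
Proof. by apply: hcontB; [exact: hcont_id|exact: hcont_cst]. Qed.

Lemma hcont_subV p z : z != p -> hcont (fun z => (z - p)^-1) z.
Proof. by move=> zp; apply: hcontV; [rewrite subr_eq0|exact: hcont_sub]. Qed.

Lemma hder_eq f z d e : hder f z d -> d = e -> hder f z e.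
Proof. by move=> h <-. Qed.

Lemma hder_id z : hder (fun z => z) z 1.
Proof. by split=> g x e _ hg; rewrite mul1r. Qed.

Lemma hder_cst c z : hder (fun _ => c) z 0.
Proof. by split=> g x e _ _; rewrite mul0r; exact: cder_cst. Qed.

Lemma hderZ f z d (c : R[i]) : hder f z d -> hder (fun z => c * f z) z (c * d).
Proof. by move=> hf; split=> g x e gx hg; rewrite -mulrA; apply: cderZ; exact: hderP hf _ _. Qed.

Lemma hderD f h z d e : hder f z d -> hder h z e -> hder (fun z => f z + h z) z (d + e).
Proof.
by move=> hf hh; split=> g x k gx hg; rewrite mulrDl; apply: cderD; [exact: hderP hf _ _|exact: hderP hh _ _].
Qed.

Lemma hder_comp f h z d e : hder h z e -> hder f (h z) d ->
  hder (fun z => f (h z)) z (d * e).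
Proof.
move=> hh hf; split=> g x k gx hg; rewrite -mulrA.
apply: (hderP (g := fun y => h (g y)) hf); first by rewrite gx.
exact: hderP hh _ _.
Qed.

Lemma hder_sub p z : hder (fun z => z - p) z 1.
Proof. by apply: hder_eq (hderD (hder_id z) (hder_cst (- p) z)) _; rewrite addr0. Qed.

Lemma hderX n z : hder (fun z => z ^+ n) z (n%:R * z ^+ n.-1).
Proof. by split=> g x e gx hg; have := cderX n hg; rewrite gx. Qed.

Lemma hderV z : z != 0 -> hder (fun z => z^-1) z (- z ^- 2).
Proof.
move=> z0; split=> g x e gx hg; have g0 : g x != 0 by rewrite gx.
by apply: cder_eq (cderV g0 hg) _; rewrite gx !mulNr mulrC.
Qed.

Lemma hder_clog_sub p z : slit (z - p) -> hder (fun z => clog (z - p)) z (z - p)^-1.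
Proof.
move=> s; have h := hder_comp (f := @clog R) (hder_sub p z) (hder_clog s).
by apply: hder_eq h _; rewrite mulr1.
Qed.

Lemma hcont_clog_sub p z : slit (z - p) -> hcont (fun z => clog (z - p)) z.
Proof. by move=> s; apply: (hcont_comp (f := @clog R)); [exact: hcont_sub|exact: hcont_clog]. Qed.

Lemma hder_subr p z : hder (fun z => p - z) z (-1).
Proof.
split=> g x e gx hg; rewrite mulN1r; apply: cder_eq (cderB (cder_cst p x) hg) _.
by rewrite sub0r.
Qed.

(** A second primitive of 1 / (z - p), whose cut lies to the right of p instead of to its left. *)
Lemma hder_clog_subr p z : slit (p - z) -> hder (fun z => clog (p - z)) z (z - p)^-1.
Proof.
move=> s; have h := hder_comp (f := @clog R) (hder_subr p z) (hder_clog s).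
by apply: hder_eq h _; rewrite mulrN1 -invrN opprB.
Qed.

Lemma hcont_clog_subr p z : slit (p - z) -> hcont (fun z => clog (p - z)) z.
Proof.
move=> s; apply: (hcont_comp (f := @clog R)); last exact: hcont_clog.
by apply: hcontB; [exact: hcont_cst|exact: hcont_id].
Qed.

End Holomorphic.

(** * Chains of paths *)

Section Chains.
Context {R : realType}.
Implicit Types (f h F : R[i] -> R[i]) (z w p : R[i]) (g : R -> R[i]) (L : seq (R -> R[i])).

Definition chain_int L f := \sum_(g <- L) path_int g f.

Fixpoint linked L z w : Prop :=
  if L is g :: L' then g 0 = z /\ linked L' (g 1) w else z = w.

Fixpoint gchain L : Prop := if L is g :: L' then gpath g /\ gchain L' else True.

Fixpoint on_chain L (P : R[i] -> Prop) : Prop :=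
  if L is g :: L' then (forall x, 0 <= x <= 1 -> P (g x)) /\ on_chain L' P else True.

Lemma on_chainW L (P Q : R[i] -> Prop) : (forall z, P z -> Q z) ->
  on_chain L P -> on_chain L Q.
Proof. by move=> PQ; elim: L => //= g L ih [h1 /ih]; split => // x /h1/PQ. Qed.

Lemma on_chain_and L (P Q : R[i] -> Prop) : on_chain L P -> on_chain L Q ->
  on_chain L (fun z => P z /\ Q z).
Proof.
by elim: L => //= g L ih [h1 /ih h2] [h3 /h2]; split => // x hx; split; [exact: h1|exact: h3].
Qed.

Lemma on_chain_all L (P : R[i] -> Prop) : (forall z, P z) -> on_chain L P.
Proof. by move=> h; elim: L. Qed.

Lemma chain_FTC L f F z w : gchain L -> linked L z w ->
  on_chain L (hcont f) -> on_chain L (hcont F) -> on_chain L (fun z => hder F z (f z)) ->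
  chain_int L f = F w - F z.
Proof.
rewrite /chain_int; elim: L z => [|g L ih] z /=; first by rewrite big_nil => _ ->; rewrite subrr.
move=> [gg gL] [<- lk] [h1 h2] [h3 h4] [h5 h6]; rewrite big_cons (ih _ gL lk)//.
by rewrite (path_int_FTC gg h1 h3 h5) addrC addrA subrK.
Qed.

Lemma chain_int_closed L f F z : gchain L -> linked L z z ->
  on_chain L (hcont f) -> on_chain L (hcont F) -> on_chain L (fun z => hder F z (f z)) ->
  chain_int L f = 0.
Proof. by move=> gL lk h1 h2 h3; rewrite (chain_FTC gL lk h1 h2 h3) subrr. Qed.

Lemma chain_int_ext L f h : on_chain L (fun z => f z = h z) ->
  chain_int L f = chain_int L h.
Proof.
rewrite /chain_int; elim: L => [|g L ih] /=; first by rewrite !big_nil.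
by move=> [h1 /ih h2]; rewrite !big_cons h2; congr (_ + _); exact: path_int_ext.
Qed.

Lemma chain_intD L f h : gchain L -> on_chain L (hcont f) -> on_chain L (hcont h) ->
  chain_int L (fun z => f z + h z) = chain_int L f + chain_int L h.
Proof.
rewrite /chain_int; elim: L => [|g L ih] /=; first by rewrite !big_nil addr0.
move=> [gg gL] [h1 h2] [h3 h4]; rewrite !big_cons (ih gL h2 h4) path_intD//.
by rewrite addrACA.
Qed.

Lemma chain_intZ L f k : gchain L -> on_chain L (hcont f) ->
  chain_int L (fun z => k * f z) = k * chain_int L f.
Proof.
rewrite /chain_int; elim: L => [|g L ih] /=; first by rewrite !big_nil mulr0.
by move=> [gg gL] [h1 h2]; rewrite !big_cons (ih gL h2) path_intZ// mulrDr.
Qed.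

Lemma chain_int0 L : chain_int L (fun=> 0) = 0.
Proof. by rewrite /chain_int big1// => g _; exact: path_int0. Qed.

Lemma chain_int_sum (I : Type) (r : seq I) (P : pred I) (f : I -> R[i] -> R[i]) L :
  gchain L -> (forall i, P i -> on_chain L (hcont (f i))) ->
  chain_int L (fun z => \sum_(i <- r | P i) f i z) = \sum_(i <- r | P i) chain_int L (f i).
Proof.
move=> gL h.
have key : chain_int L (fun z => \sum_(i <- r | P i) f i z) = \sum_(i <- r | P i) chain_int L (f i)
   /\ on_chain L (hcont (fun z => \sum_(i <- r | P i) f i z)); last by case: key.
elim: r => [|i r [ih1 ih2]].
  have -> : (fun z => \sum_(i <- [::] | P i) f i z) = fun=> 0.
    by apply/funext => z; rewrite big_nil.
  rewrite big_nil; split; [exact: chain_int0|].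
  by apply: on_chain_all => z; exact: hcont_cst.
case: (boolP (P i)) => Pi; last first.
  have -> : (fun z => \sum_(i <- i :: r | P i) f i z) = fun z => \sum_(i <- r | P i) f i z.
    by apply/funext => z; rewrite big_cons (negPf Pi).
  by rewrite big_cons (negPf Pi).
have -> : (fun z => \sum_(i <- i :: r | P i) f i z) =
    fun z => f i z + \sum_(i <- r | P i) f i z.
  by apply/funext => z; rewrite big_cons Pi.
rewrite big_cons Pi; split; first by rewrite chain_intD ?ih1//; exact: h.
by apply: on_chainW (on_chain_and (h i Pi) ih2) => z [c1 c2]; exact: hcontD.
Qed.

Lemma chain_int_pow L z p k : gchain L -> linked L z z ->
  chain_int L (fun w => (w - p) ^+ k) = 0.
Proof.
move=> gL lk.
apply: (chain_int_closed (F := fun w => k.+1%:R^-1 * (w - p) ^+ k.+1) gL lk).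
- by apply: on_chain_all => w; apply: hcontX; exact: hcont_sub.
- apply: on_chain_all => w; apply: hcontM; first exact: hcont_cst.
  by apply: hcontX; exact: hcont_sub.
- apply: on_chain_all => w.
  have h := hderZ k.+1%:R^-1 (hder_comp (f := fun z => z ^+ k.+1) (hder_sub p w) (hderX k.+1 _)).
  by apply: hder_eq h _; rewrite mulr1 /= mulKf// pnatr_eq0.
Qed.

Lemma chain_int_powN L z p k : gchain L -> linked L z z ->
  on_chain L (fun w => w != p) ->
  chain_int L (fun w => (w - p) ^- k.+2) = 0.
Proof.
move=> gL lk np.
apply: (chain_int_closed (F := fun w => - k.+1%:R^-1 * ((w - p)^-1) ^+ k.+1) gL lk).
- apply: on_chainW np => w wp; apply: hcontV; first by rewrite expf_neq0// subr_eq0.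
  by apply: hcontX; exact: hcont_sub.
- apply: on_chainW np => w wp; apply: hcontM; first exact: hcont_cst.
  by apply: hcontX; exact: hcont_subV.
- apply: on_chainW np => w wp; have wp0 : w - p != 0 by rewrite subr_eq0.
  have h := hder_comp (f := fun z => z^-1) (hder_sub p w) (hderV wp0).
  have h' := hderZ (- k.+1%:R^-1) (hder_comp (f := fun z => z ^+ k.+1) h (hderX k.+1 _)).
  apply: hder_eq h' _; rewrite mulr1 /= mulNr mulrN mulrN opprK.
  rewrite mulrA mulKf ?pnatr_eq0// -!exprVn.
  by rewrite -exprD addn2.
Qed.

(** After Taylor expansion of q at p, every power of w - p except -1 has a single-valued primitive,
    so only the coefficient of degree m survives on a closed chain. *)
Lemma chain_int_poly L z p m (q : {poly R[i]}) : gchain L -> linked L z z ->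
  on_chain L (fun w => w != p) ->
  chain_int L (fun w => q.[w] / (w - p) ^+ m.+1) =
  q^`N(m).[p] * chain_int L (fun w => (w - p)^-1).
Proof.
move=> gL lk np.
have e w : q.[w] = \sum_(i < size q) q^`N(i).[p] * (w - p) ^+ i.
  rewrite -{1}(subrK p w) addrC nderiv_taylor//; exact: mulrC.
under eq_fun do rewrite e mulr_suml.
have hc i : on_chain L (hcont (fun w => (w - p) ^+ i / (w - p) ^+ m.+1)).
  apply: on_chainW np => w wp; apply: hcontM; first by apply: hcontX; exact: hcont_sub.
  by apply: hcontV; [rewrite expf_neq0// subr_eq0|apply: hcontX; exact: hcont_sub].
have one i : chain_int L (fun w => (w - p) ^+ i / (w - p) ^+ m.+1) =
  if i == m then chain_int L (fun w => (w - p)^-1) else 0.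
  case: ltngtP => [im|im|->].
  - rewrite -(chain_int_powN (m - i.+1) gL lk np); apply: chain_int_ext.
    apply: on_chainW np => w; rewrite -subr_eq0 => wp.
    have -> : m.+1 = (i + (m - i.+1).+2)%N by rewrite !addnS -addSn subnKC.
    by rewrite exprD invfM mulrA divff ?mul1r// expf_neq0.
  - rewrite -(chain_int_pow p (i - m.+1) gL lk); apply: chain_int_ext.
    apply: on_chainW np => w; rewrite -subr_eq0 => wp.
    by rewrite -{1}(subnKC im) exprD mulrAC divff ?mul1r// expf_neq0.
  - apply: chain_int_ext; apply: on_chainW np => w; rewrite -subr_eq0 => wp.
    by rewrite exprS invfM mulrCA divff ?mulr1// expf_neq0.
rewrite (chain_int_sum (P := xpredT) _ (f := fun i w => _))//; last first.
  move=> i _; apply: on_chainW (hc i) => w h.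
  by under eq_fun do rewrite -mulrA; apply: hcontM => //; exact: hcont_cst.
transitivity (\sum_(i < size q) if val i == m then q^`N(m).[p] * chain_int L (fun w => (w - p)^-1) else 0).
  apply: eq_bigr => i _; under eq_fun do rewrite -mulrA.
  by rewrite chain_intZ// one; case: eqP => [->|]; rewrite ?mulr0.
have [qm|mq] := ltnP m (size q).
  rewrite (bigD1 (Ordinal qm))//= eqxx big1 ?addr0// => i.
  by rewrite -val_eqE/= => /negPf ->.
rewrite big1 => [|i _]; last by case: eqP => // im; move: (ltn_ord i); rewrite im ltnNge mq.
by rewrite nderivn_poly0 ?horner0 ?mul0r.
Qed.

End Chains.

(** * Residues *)

(** Lagrange interpolation: the difference between q and its interpolant at the points [a i] has
    degree below #|P| and at least #|P| roots, hence is 0. Dividing by the product of the z - a i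
    gives the claim. *)
Lemma partial_fractions (F : fieldType) (I : finType) (P : pred I) (a : I -> F)
    (q : {poly F}) (z : F) :
  {in P &, injective a} -> (size q <= #|P|)%N -> (forall i, P i -> z != a i) ->
  q.[z] / \prod_(i | P i) (z - a i) =
  \sum_(i | P i) q.[a i] / \prod_(l | P l && (l != i)) (a i - a l) / (z - a i).
Proof.
move=> inj sq za.
pose d i := \prod_(l | P l && (l != i)) (a i - a l).
have d0 i : P i -> d i != 0.
  move=> Pi; rewrite prodf_seq_neq0; apply/allP => l _; apply/implyP => /andP[Pl li].
  by rewrite subr_eq0; apply: contra li => /eqP/inj ->.
pose B i : {poly F} := \prod_(l | P l && (l != i)) ('X - (a l)%:P).
have Bi i z' : (B i).[z'] = \prod_(l | P l && (l != i)) (z' - a l).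
  by rewrite /B horner_prod; apply: eq_bigr => l _; rewrite hornerXsubC.
have sB i : P i -> size (B i) = #|P|.
  move=> Pi; rewrite /B (eq_bigl [in [predD1 P & i]]) => [|l]; last by rewrite /= !inE andbC.
  by rewrite -big_enum size_prod_XsubC -cardE (cardD1 i P) unfold_in Pi.
pose p := \sum_(i | P i) (q.[a i] / d i) *: B i - q.
have p0 : p = 0.
  apply: (@roots_geq_poly_eq0 _ _ [seq a i | i <- enum P]).
  - rewrite all_map; apply/allP => i; rewrite mem_enum => Pi' /=.
    have Pi : P i := Pi'.
    rewrite rootE /p hornerD hornerN horner_sum (bigD1 i)//= big1 ?addr0.
      by rewrite hornerZ Bi -/(d i) divfK ?subrr// d0.
    move=> l /andP[Pl li]; rewrite hornerZ Bi (bigD1 i)/=; last by rewrite Pi eq_sym.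
    by rewrite subrr mul0r mulr0.
  - rewrite map_inj_in_uniq ?enum_uniq// => i l; rewrite !mem_enum; exact: inj.
  - rewrite size_map -cardE; apply: (leq_trans (size_polyD _ _)); rewrite size_polyN geq_max sq andbT.
    apply: (leq_trans (size_sum _ _ _)); apply/bigmax_leqP => i Pi.
    by apply: (leq_trans (size_scale_leq _ _)); rewrite sB.
have -> : q.[z] = \sum_(i | P i) q.[a i] / d i * (B i).[z].
  move/(congr1 (horner ^~ z)): p0; rewrite /= hornerD hornerN horner0 horner_sum => /subr0_eq <-.
  by apply: eq_bigr => i _; rewrite hornerZ.
rewrite mulr_suml; apply: eq_bigr => i Pi.
have zd l : P l -> z - a l != 0 by move=> /za; rewrite subr_eq0.
rewrite Bi [X in _ / X](bigD1 i)//= invfM -/(d i).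
have n0 : \prod_(l | P l && (l != i)) (z - a l) != 0.
  by rewrite prodf_seq_neq0; apply/allP => l _; apply/implyP => /andP[/zd].
by rewrite -!mulrA; congr (_ * (_ * _)); rewrite mulrCA mulfV// mulr1.
Qed.

Section ResidueEvaluation.
Context {R : realType}.

(** The value of J_n. The quotient is the residue at z = x_i; the divided derivative is the residue
    at w = v of what remains once the factor w - x_i has been cancelled by 1 / (w - z) at z =
    x_i. *)
Definition J_residues (n : nat) (x : 'I_n -> R) (u v : R) (k m : nat) : R :=
  \sum_(i | u < x i) (x i - u) ^+ k / \prod_(l | l != i) (x i - x l) *
    (\prod_(l | l != i) ('X - (x l)%:P))^`N(m).[v].

Lemma realC_neq (a b : R) : a != b -> a%:C != b%:C :> R[i].
Proof. by rewrite (inj_eq (@complexI R)). Qed.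

(** If some x_j equals u, one factor z - u cancels its pole and the expansion runs over the other
    points. With k >= 2 a factor z - u remains, so the identity also holds at z = u, where the left
    side is 0 by the convention on the inverse of 0. The z-contour used later passes through u. *)
Lemma kernel_partial_fractions (n : nat) (x : 'I_n -> R) (u : R) (k : nat) (z : R[i]) :
  injective x -> (2 <= k < n)%N -> (forall i, x i != u -> z != (x i)%:C) ->
  (z - u%:C) ^+ k * \prod_i (z - (x i)%:C)^-1 =
  \sum_(i | x i != u) ((x i - u) ^+ k / \prod_(l | l != i) (x i - x l))%:C / (z - (x i)%:C).
Proof.
move=> xinj; case: k => [|[|k]] //= kn zx.
have ainj : injective (fun i => (x i)%:C) by move=> i j /complexI/xinj.
have [j /eqP xj|nu] := pickP (fun j => x j == u); last first.
  have al i : (x i != u) = true by rewrite nu.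
  have h := @partial_fractions _ _ xpredT (fun i => (x i)%:C) (('X - u%:C%:P) ^+ k.+2) z.
  rewrite horner_exp hornerXsubC in h; rewrite prodfV h.
  - apply: eq_big => [i|i _]; first by rewrite al.
    rewrite horner_exp hornerXsubC fmorph_div/= rmorphXn/= rmorphB/= rmorph_prod.
    by congr (_ / _ / _); apply: eq_bigr => l _; rewrite rmorphB.
  - by move=> i l _ _ /ainj.
  - by rewrite size_exp_XsubC card_ord.
  - by move=> i _; apply: zx; rewrite al.
have e1 : (z - u%:C) ^+ k.+2 * \prod_i (z - (x i)%:C)^-1 =
    (z - u%:C) ^+ k.+1 / \prod_(i | x i != u) (z - (x i)%:C).
  rewrite prodfV (bigD1 j)//= xj (eq_bigl (fun i => x i != u)); last first.
    by move=> i; rewrite -xj (inj_eq xinj).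
  have [->|zu] := eqVneq z u%:C.
    by rewrite subrr mul0r invr0 mulr0 expr0n mul0r.
  rewrite exprSr invfM !mulrA mulfK// subr_eq0.
  exact: zu.
rewrite {}e1.
have h := @partial_fractions _ _ (fun i => x i != u) (fun i => (x i)%:C) (('X - u%:C%:P) ^+ k.+1) z.
rewrite horner_exp hornerXsubC in h; rewrite h.
- apply: eq_bigr => i xi; congr (_ / _).
  rewrite horner_exp hornerXsubC fmorph_div rmorphXn rmorphB rmorph_prod.
  have ij : j != i by apply: contra xi => /eqP <-; rewrite xj.
  have xu0 : (x i)%:C - u%:C != 0 by rewrite subr_eq0 realC_neq.
  rewrite [in RHS](bigD1 j)//= rmorphB xj [in RHS]exprS invfM mulrACA divff// mul1r.
  congr (_ / _); apply: eq_big => [l|l _]; last by rewrite rmorphB.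
  by rewrite andbC -xj (inj_eq xinj).
- by move=> i l _ _ /ainj.
- rewrite size_exp_XsubC.
  have := cardC (pred1 j); rewrite card1 card_ord add1n.
  move=> e; move: kn; rewrite -{1}e ltnS => h'; rewrite (leq_trans h')//.
  by apply/eq_leq/eq_card => i; rewrite !inE unfold_in -xj (inj_eq xinj).
- exact: zx.
Qed.

(** Partial fractions in z reduce the inner integral to winding numbers around the x_i and around w;
    the latter is 0. The outer integrand then has v as its only pole. *)
Lemma J_eval (n : nat) (x : 'I_n -> R) (u v : R) (k m : nat) (c C : seq (R -> R[i]))
    (zc zC : R[i]) :
  injective x -> (2 <= k < n)%N ->
  gchain c -> gchain C -> linked c zc zc -> linked C zC zC ->
  (forall i, x i != u -> on_chain C (fun z => z != (x i)%:C)) ->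
  (forall i, u < x i -> chain_int C (fun z => (z - (x i)%:C)^-1) = 0 +i* (2 * pi)) ->
  (forall i, x i < u -> chain_int C (fun z => (z - (x i)%:C)^-1) = 0) ->
  on_chain c (fun w => on_chain C (fun z => z != w) /\
                       chain_int C (fun z => (z - w)^-1) = 0) ->
  on_chain c (fun w => w != v%:C) ->
  chain_int c (fun w => (w - v%:C)^-1) = 0 +i* (2 * pi) ->
  chain_int c (fun w => chain_int C (fun z =>
    (w - z)^-1 * ((z - u%:C) ^+ k / (w - v%:C) ^+ m.+1) *
    \prod_(i < n) ((w - (x i)%:C) / (z - (x i)%:C)))) =
  (0 +i* (2 * pi)) ^+ 2 * (J_residues x u v k m)%:C.
Proof.
move=> xinj kn gc gC lc lC Cx C1 C0 Cc cv c1.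
set tpi := 0 +i* (2 * pi).
have tpi0 : tpi != 0.
  by apply/eqP => -[/eqP]; rewrite mulf_eq0 pnatr_eq0/= gt_eqF// pi_gt0.
pose A i : R := (x i - u) ^+ k / \prod_(l | l != i) (x i - x l).
pose Q i : {poly R[i]} := \prod_(l | l != i) ('X - (x l)%:C%:P).
have Qw i w : (Q i).[w] = \prod_(l | l != i) (w - (x l)%:C).
  by rewrite /Q horner_prod; apply: eq_bigr => l _; rewrite hornerXsubC.
have inner w : on_chain C (fun z => z != w) -> chain_int C (fun z => (z - w)^-1) = 0 ->
  w != v%:C ->
  chain_int C (fun z => (w - z)^-1 * ((z - u%:C) ^+ k / (w - v%:C) ^+ m.+1) *
    \prod_(i < n) ((w - (x i)%:C) / (z - (x i)%:C))) =
  \sum_(i | u < x i) tpi * (A i)%:C * ((Q i).[w] / (w - v%:C) ^+ m.+1).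
  move=> wC w0 wv.
  (* If w is some x_j, the integrand vanishes through the factor w - x_j. On the right the terms i
     != j vanish for the same reason, and i = j is excluded because C winds around x_i but not
     around w. *)
  have [j /eqP wj|wx] := pickP (fun j => w == (x j)%:C).
    rewrite [RHS]big1 => [|i ui].
      rewrite -[RHS](chain_int0 C); apply: chain_int_ext; apply: on_chain_all => z.
      by rewrite (bigD1 j)//= wj subrr mul0r mul0r mulr0.
    have [ij|ij] := eqVneq i j.
      by move: (C1 i ui); rewrite ij -wj w0 => /esym/eqP; rewrite (negPf tpi0).
    by rewrite Qw (bigD1 j) ?[j == i]eq_sym//= wj subrr mul0r mul0r mulr0.
  have wx0 i : w - (x i)%:C != 0 by rewrite subr_eq0 wx.
  have xCi : on_chain C (fun z => forall i, x i != u -> z != (x i)%:C).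
    elim: C Cx {C1 C0 Cc gC lC wC w0} => //= g L ih Cx; split.
      by move=> y hy i /Cx [+ _]; apply.
    by apply: ih => i /Cx [].
  pose B i : R[i] := (\prod_l (w - (x l)%:C)) / (w - v%:C) ^+ m.+1 * ((A i)%:C / (w - (x i)%:C)).
  transitivity (chain_int C (fun z => \sum_(i | x i != u)
      (B i * (z - (x i)%:C)^-1 + - B i * (z - w)^-1))).
    apply: chain_int_ext; apply: on_chainW (on_chain_and wC xCi) => z [zw zx].
    have -> : (w - z)^-1 * ((z - u%:C) ^+ k / (w - v%:C) ^+ m.+1) *
      (\prod_(i < n) ((w - (x i)%:C) / (z - (x i)%:C))) =
      (\prod_l (w - (x l)%:C)) / (w - v%:C) ^+ m.+1 * (w - z)^-1 *
      ((z - u%:C) ^+ k * \prod_i (z - (x i)%:C)^-1).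
      rewrite big_split/=; move: (\prod_l (w - _)) (\prod_i (z - _)^-1) => p q.
      by move: (w - z)^-1 (_ ^+ k) (_ ^+ m.+1)^-1 => a1 a2 a3; ring.
    rewrite kernel_partial_fractions// mulr_sumr; apply: eq_bigr => i xi.
    have zx0 : z - (x i)%:C != 0 by rewrite subr_eq0 zx.
    have zw0 : z - w != 0 by rewrite subr_eq0.
    have wz0 : w - z != 0 by rewrite -opprB oppr_eq0.
    have wi0 := wx0 i.
    rewrite /B -/(A i); move: (\prod_l _) (_ ^+ m.+1)^-1 (A i)%:C => p q r.
    by field; rewrite zw0 zx0 wz0 wi0.
  have off i : x i != u -> on_chain C (hcont (fun z => B i * (z - (x i)%:C)^-1)).
    move=> xi; apply: on_chainW (Cx i xi) => z zx; apply: hcontM; first exact: hcont_cst.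
    exact: hcont_subV.
  have offw i : on_chain C (hcont (fun z => - B i * (z - w)^-1)).
    apply: on_chainW wC => z zx; apply: hcontM; first exact: hcont_cst.
    exact: hcont_subV.
  rewrite chain_int_sum//; last first.
    move=> i xi; apply: on_chainW (on_chain_and (off i xi) (offw i)) => z [h1 h2].
    exact: hcontD.
  (* Points to the left of u have winding number 0 and drop out; the point at u itself, if any, is
     already absent from the sum. *)
  rewrite (bigID (fun i => u < x i))/= [X in _ + X]big1 ?addr0; last first.
    move=> i /andP[xi]; rewrite -leNgt => xu.
    rewrite chain_intD//; [|exact: off].
    rewrite !chain_intZ//; try by apply: on_chainW wC => z; exact: hcont_subV.
      by rewrite w0 C0 ?mulr0 ?addr0// lt_neqAle xi.
    by apply: on_chainW (Cx i xi) => z; exact: hcont_subV.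
  apply: eq_big => [i|i /andP[xi ui]]; first by case: ltgtP.
  rewrite chain_intD//; [|exact: off].
  rewrite !chain_intZ//; try by apply: on_chainW wC => z; exact: hcont_subV.
    rewrite w0 C1// mulr0 addr0 /B (bigD1 i)//= -Qw -/tpi.
    have wi0 := wx0 i; move: (Q i).[w] (_ ^+ m.+1)^-1 (A i)%:C => p q r.
    by field.
  by apply: on_chainW (Cx i xi) => z; exact: hcont_subV.
transitivity (chain_int c (fun w => \sum_(i | u < x i) tpi * (A i)%:C * ((Q i).[w] / (w - v%:C) ^+ m.+1))).
  by apply: chain_int_ext; apply: on_chainW (on_chain_and Cc cv) => w [[h1 h2] h3]; exact: inner.
have hq i : on_chain c (hcont (fun w => (Q i).[w] / (w - v%:C) ^+ m.+1)).
  apply: on_chainW cv => w wv; apply: hcontM.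
    apply: (@hcont_ext _ (fun w => \prod_(l | l != i) (w - (x l)%:C))) => [w'|]; first by rewrite Qw.
    by apply: hcont_prod => l _; exact: hcont_sub.
  by apply: hcontV; [rewrite expf_neq0// subr_eq0|apply: hcontX; exact: hcont_sub].
rewrite chain_int_sum//; last first.
  by move=> i ui; apply: on_chainW (hq i) => w h; apply: hcontM => //; exact: hcont_cst.
rewrite /J_residues rmorph_sum mulr_sumr; apply: eq_bigr => i ui.
rewrite chain_intZ// (chain_int_poly _ _ gc lc cv) c1 -/tpi [X in _ = _ * X]rmorphM -/(A i) expr2.
have -> : Q i = map_poly (real_complex R) (\prod_(l | l != i) ('X - (x l)%:P)).
  by rewrite rmorph_prod; apply: eq_bigr => l _; rewrite rmorphB/= map_polyX map_polyC.
by rewrite nderivn_map horner_map; ring.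
Qed.

End ResidueEvaluation.

(** * Compactness of curves and continuity of Cauchy integrals *)

Section CurveCompactness.
Context {R : realType}.
Implicit Types (g : R -> R[i]) (f : R[i] -> R[i]) (x y : R) (z w : R[i]).

Lemma gpath_pieces g (P : R -> Prop) : gpath g -> P 0 ->
  (forall a b (h : R -> R[i]), 0 <= a < b -> b <= 1 -> P a ->
    (forall x, a <= x <= b -> ccont h x /\ g x = h x) -> P b) -> P 1.
Proof.
move=> gg P0 st; apply: (gpath_ind (f := fun=> 0) gg) => //.
  by move=> x _; exact: hcont_cst.
by move=> a b h H ab b1 Pa e _ _ _; exact: (st a b h).
Qed.

(** The extreme value theorem is applied piece by piece, to the continuous representative [h] of
    each piece; [u] has to be continuous only at points of the curve. *)
Lemma gpath_max g (u : R[i] -> R) : gpath g ->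
  (forall h x, ccont h x -> (exists y, 0 <= y <= 1 /\ h x = g y) -> {for x, continuous (fun y => u (h y))}) ->
  exists2 x, 0 <= x <= 1 & forall y, 0 <= y <= 1 -> u (g y) <= u (g x).
Proof.
move=> gg cu.
suff [x /andP[h1 h2] h3] : exists2 x, 0 <= x <= 1 & forall y, 0 <= y <= 1 -> u (g y) <= u (g x).
  by exists x => //; rewrite h1.
apply: (gpath_pieces (P := fun b => exists2 x, 0 <= x <= b & forall y, 0 <= y <= b -> u (g y) <= u (g x)) gg).
  by exists 0; [rewrite lexx|move=> y; rewrite -eq_le => /eqP <-].
move=> a b h /andP[a0 ab] b1 [x0 hx0 mx0] e.
have in01 y : a <= y <= b -> 0 <= y <= 1.
  by move=> /andP[/(le_trans a0) -> /le_trans]; apply.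
have [x1 hx1 mx1] := @EVT_max R (fun y => u (h y)) a b (ltW ab) (within_cont (fun y hy =>
  cu h y (e y hy).1 (ex_intro _ y (conj (in01 y hy) (esym (e y hy).2))))).
have hx1' : a <= x1 <= b by move: hx1; rewrite in_itv.
have [ux|ux] := leP (u (g x0)) (u (g x1)).
  exists x1 => [|y /andP[y0 yb]].
    by move: hx1' => /andP[/(le_trans a0) -> ->].
  case: (leP y a) => ya; first by apply: le_trans ux; apply: mx0; rewrite y0.
  have hy : a <= y <= b by rewrite ltW.
  by rewrite (e y hy).2 (e x1 hx1').2; apply: mx1; rewrite in_itv.
exists x0 => [|y /andP[y0 yb]].
  by move: hx0 => /andP[-> /le_trans]; apply; exact: ltW.
case: (leP y a) => ya; first by apply: mx0; rewrite y0.
have hy : a <= y <= b by rewrite ltW.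
apply: (le_trans _ (ltW ux)); rewrite (e y hy).2 (e x1 hx1').2; apply: mx1.
by rewrite in_itv.
Qed.

Lemma gpath_bounded g f : gpath g -> (forall x, 0 <= x <= 1 -> hcont f (g x)) ->
  exists2 B, 0 <= B & forall x, 0 <= x <= 1 -> cmod (f (g x)) <= B.
Proof.
move=> gg fc; have [|x hx mx] := @gpath_max g (fun z => cmod (f z)) gg.
  move=> h x ch [y [hy e]]; apply: ccont_cmod; exact: hcontP (fc y hy) e ch.
by exists (cmod (f (g x))) => //; exact: cmod_ge0.
Qed.

Lemma gpath_dist g w : gpath g -> (forall x, 0 <= x <= 1 -> g x != w) ->
  exists2 d, 0 < d & forall x, 0 <= x <= 1 -> d <= cmod (g x - w).
Proof.
move=> gg gw; have [|x hx mx] := @gpath_max g (fun z => - cmod (z - w)) gg.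
  move=> h x ch _; apply: rcontN; apply: ccont_cmod; apply: ccontB => //.
  exact: ccont_cst.
exists (cmod (g x - w)); first by rewrite cmod_gt0 subr_eq0 gw.
by move=> y /mx; rewrite lerN2.
Qed.

Lemma ibl_abs a b (f : R -> R) : ibl a b f -> ibl a b (fun x => `|f x|).
Proof. by move=> h; have := integrable_abse h; apply. Qed.

(** [M] is the integral of |Re g'| + |Im g'|, a substitute for the length. It is chosen before the
    integrand, so that it can serve in a Lipschitz estimate with varying integrands. *)
Lemma path_int_sup g : gpath g -> exists2 M, 0 <= M &
  forall f K, (forall x, 0 <= x <= 1 -> hcont f (g x)) ->
    (forall x, 0 <= x <= 1 -> cmod (f (g x)) <= K) -> cmod (path_int g f) <= K * M.
Proof.
move=> gg; have [|h1 h2] := gpath_cibl (f := fun=> 1) gg.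
  by move=> x _; exact: hcont_cst.
have hB := iblD (ibl_abs h1) (ibl_abs h2).
exists (\int[@lebesgue_measure R]_(x in `[0, 1]) (`|Re (1 * path_deriv g x)| + `|Im (1 * path_deriv g x)|)).
  by apply: Rintegral_ge0 => x _; rewrite addr_ge0.
move=> f K fc fK; have := path_int_le gg fc (iblZ K hB).
rewrite RintegralZl//; apply => x hx.
have hx' : 0 <= x <= 1 by move: hx => /andP[/ltW -> /ltW ->].
apply: ler_pM; rewrite ?cmod_ge0 ?fK//.
by have := cmod_le_ReIm (1 * path_deriv g x); rewrite {1}mul1r.
Qed.

Lemma ccont_lip (G g : R -> R[i]) x (L : R) :
  (\forall y \near x, cmod (G y - G x) <= L * cmod (g y - g x)) ->
  ccont g x -> ccont G x.
Proof.
move=> hL hg.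
have c0 : {for x, continuous (fun y => L * cmod (g y - g x))}.
  apply: rcontM; first exact: rcont_cst.
  by apply: ccont_cmod; apply: ccontB => //; exact: ccont_cst.
rewrite /prop_for /continuous_at subrr cmod0 mulr0 in c0.
have key (p : R -> R) : (forall y, `|p y - p x| <= cmod (G y - G x)) -> {for x, continuous p}.
  move=> hp; apply/cvgrPdist_lt => e e0.
  move/cvgrPdist_lt : c0 => /(_ e e0) c1.
  near=> y; rewrite distrC; apply: le_lt_trans (hp y) _.
  apply: (@le_lt_trans _ _ (L * cmod (g y - g x))); first by near: y.
  have : `|0 - L * cmod (g y - g x)| < e by near: y.
  by rewrite sub0r normrN; apply: le_lt_trans; exact: ler_norm.
split; apply: key => y; rewrite -(ReB, ImB).
  exact: Re_le_cmod.
exact: Im_le_cmod.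
Unshelve. all: by end_near. Qed.

(** With [d] the distance from w0 to the curve, two kernels at w and w0 differ by at most 2 |w - w0|
    / d^2 as soon as |w - w0| < d / 2. The Cauchy integral is therefore Lipschitz near w0. *)
Lemma cauchy_hcont g f w0 : gpath g -> (forall x, 0 <= x <= 1 -> hcont f (g x)) ->
  (forall x, 0 <= x <= 1 -> g x != w0) ->
  hcont (fun w => path_int g (fun z => (w - z)^-1 * f z)) w0.
Proof.
move=> gg fc gw; have [d d0 hd] := gpath_dist gg gw.
have [B B0 hB] := gpath_bounded gg fc; have [M M0 hM] := path_int_sup gg.
split=> p x px cp.
apply: (@ccont_lip _ p x (2 / d ^+ 2 * B * M)) => //.
have nb : \forall y \near x, cmod (p y - p x) < d / 2.
  have c0 : {for x, continuous (fun y => cmod (p y - p x))}.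
    by apply: ccont_cmod; apply: ccontB => //; exact: ccont_cst.
  apply: (@cvgr_lt R _ _ _ _ _ c0).
  by rewrite subrr cmod0 divr_gt0.
near=> y.
have py : cmod (p y - p x) < d / 2 by near: y.
rewrite px in py *.
have dy t : 0 <= t <= 1 -> d / 2 <= cmod (p y - g t).
  move=> /hd h; have := cmodD (w0 - p y) (p y - g t); rewrite addrA subrK.
  by rewrite (cmod_distC w0 (p y)); rewrite cmod_distC in h; lra.
have ny t : 0 <= t <= 1 -> p y - g t != 0.
  by move=> ht; rewrite -cmod_gt0; apply: lt_le_trans (dy t ht); rewrite divr_gt0.
have n0 t : 0 <= t <= 1 -> w0 - g t != 0.
  by move=> ht; rewrite subr_eq0 eq_sym gw.
have hc w : (forall t, 0 <= t <= 1 -> w - g t != 0) ->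
    forall t, 0 <= t <= 1 -> hcont (fun z => (w - z)^-1) (g t).
  move=> h t ht; apply: hcontV; first exact: h.
  by apply: hcontB; [exact: hcont_cst|exact: hcont_id].
have hcf w (h : forall t, 0 <= t <= 1 -> w - g t != 0) t (ht : 0 <= t <= 1) :
  hcont (fun z => (w - z)^-1 * f z) (g t) := hcontM (hc w h t ht) (fc t ht).
have -> : path_int g (fun z => (p y - z)^-1 * f z) - path_int g (fun z => (w0 - z)^-1 * f z)
  = path_int g (fun z => (p y - z)^-1 * f z + (-1) * ((w0 - z)^-1 * f z)).
  rewrite path_intD// ?path_intZ ?mulN1r//; [exact: hcf|exact: hcf|].
  by move=> t ht; apply: hcontM; [exact: hcont_cst|exact: hcf].
have -> : 2 / d ^+ 2 * B * M * cmod (p y - w0) = (2 / d ^+ 2 * cmod (p y - w0) * B) * M by ring.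
apply: hM => t ht; first by apply: hcontD; [exact: hcf|apply: hcontM; [exact: hcont_cst|exact: hcf]].
have -> : (p y - g t)^-1 * f (g t) + -1 * ((w0 - g t)^-1 * f (g t)) =
  (w0 - p y) / ((p y - g t) * (w0 - g t)) * f (g t).
  by field; rewrite ny// n0.
rewrite cmodM; apply: ler_pM; rewrite ?cmod_ge0 ?hB//.
rewrite cmodM cmodV cmodM cmod_distC mulrC; apply: ler_wpM2r; first exact: cmod_ge0.
have -> : 2 / d ^+ 2 = (d / 2 * d)^-1 by field; rewrite gt_eqF.
rewrite lef_pV2 ?posrE ?mulr_gt0 ?divr_gt0 ?cmod_gt0 ?ny ?n0//.
apply: ler_pM; rewrite ?divr_ge0 ?(ltW d0)//; first exact: dy.
by rewrite cmod_distC hd.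
Unshelve. all: by end_near. Qed.

End CurveCompactness.

(** * Winding numbers of nested contours *)

Section NestedContours.
Context {R : realType}.
Implicit Types (g c C : R -> R[i]) (x y : R) (z w : R[i]).

Lemma twopii_neq0 : 0 +i* (2 * pi) != 0 :> R[i].
Proof.
by apply/eqP => -[/eqP]; rewrite mulf_eq0 pnatr_eq0/= gt_eqF// pi_gt0.
Qed.

Lemma on_path_image g x : 0 <= x <= 1 -> path_image g (g x).
Proof. by move=> hx; exists x => //=; rewrite in_itv. Qed.

Lemma off_path_image g w : ~ path_image g w -> forall x, 0 <= x <= 1 -> g x != w.
Proof. by move=> nw x hx; apply/eqP => gx; apply: nw; rewrite -gx; exact: on_path_image. Qed.

(** No point of the curve lies strictly to the right of w, so [clog (w - z)] is a primitive along
    the whole curve. *)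
Lemma path_int_right g w : gpath g -> g 0 = g 1 ->
  (forall x, 0 <= x <= 1 -> g x != w) -> (forall x, 0 <= x <= 1 -> Re (g x) <= Re w) ->
  path_int g (fun z => (z - w)^-1) = 0.
Proof.
move=> gg g01 gw gr.
have s x : 0 <= x <= 1 -> slit (w - g x).
  move=> hx; rewrite /slit ReB subr_gt0 lt_neqAle gr// andbT.
  have := gw x hx; apply: contraNT; rewrite negb_or !negbK => /andP[/eqP e1 /eqP e2].
  by apply/eqP/eqC => //; move: e2; rewrite ImB => /subr0_eq.
rewrite (path_int_FTC (F := fun z => clog (w - z)) gg) ?g01 ?subrr//.
- by move=> x hx; apply: hcont_subV; exact: gw.
- by move=> x hx; apply: hcont_clog_subr; exact: s.
- by move=> x hx; apply: hder_clog_subr; exact: s.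
Qed.

Lemma winding_hcont g w : gpath g -> (forall x, 0 <= x <= 1 -> g x != w) ->
  hcont (winding g) w.
Proof.
move=> gg gw; have h := cauchy_hcont (f := fun=> -1) gg _ gw.
apply: (@hcont_ext _ (fun w => path_int g (fun z => (w - z)^-1 * -1) * (0 +i* (2 * pi))^-1)).
  move=> z; rewrite /winding; congr (_ / _); apply: path_int_ext => x _.
  by rewrite mulrN1 -invrN opprB.
apply: hcontM; last exact: hcont_cst.
by apply: h => x _; exact: hcont_cst.
Qed.

(** A replacement for Jordan's theorem. The rightmost point of c is to the right of all of C, hence
    has winding number 0; along c the winding number around C is continuous with values in {0, 1},
    hence constant. *)
Lemma nested_winding c C : ccw_contour c -> ccw_contour C ->
  path_image C `<=` inside c ->
  forall x, 0 <= x <= 1 -> ~ path_image C (c x) /\ winding C (c x) = 0.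
Proof.
move=> [pc c01 _ wc] [pC C01 _ wC] Cc.
have gc := piecewise_gpath pc; have gC := piecewise_gpath pC.
have off x : 0 <= x <= 1 -> ~ path_image C (c x).
  by move=> hx /Cc [h _]; apply: h; exact: on_path_image.
have mR h x : ccont h x -> {for x, continuous (fun y => Re (h y))} by case.
have [x1 hx1 mx1] := gpath_max (u := @Re R) gc (fun h x k _ => mR h x k).
have [y1 hy1 my1] := gpath_max (u := @Re R) gC (fun h x k _ => mR h x k).
have Wx1 : winding C (c x1) = 0.
  (* In the other case no point of c is to the right of the rightmost point of C, which would then
     have winding number 0 with respect to c although it is inside c. *)
  have [le|lt] := leP (Re (c x1)) (Re (C y1)); last first.
    rewrite /winding path_int_right ?mul0r//; first exact: off_path_image (off x1 hx1).
    by move=> y /my1 /le_trans; apply; exact: ltW.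
  have [h1 h2] := Cc _ (on_path_image C hy1).
  exfalso; move/eqP: h2; rewrite /winding path_int_right//.
  - by rewrite mul0r eq_sym oner_eq0.
  - exact: off_path_image.
  - by move=> y /mx1 /le_trans; apply.
have Wc : forall x, 0 <= x <= 1 -> winding C (c x) = winding C (c 0).
  apply: (gpath_pieces (P := fun b => forall x, 0 <= x <= b -> winding C (c x) = winding C (c 0)) gc).
    by move=> x; rewrite -eq_le => /eqP <-.
  move=> a b h /andP[a0 ab] b1 ih e x /andP[x0 xb].
  have [xa|ax] := leP x a; first by apply: ih; rewrite x0.
  have ha : a <= a <= b by rewrite lexx ltW.
  have hx : a <= x <= b by rewrite ltW.
  have in01 y : a <= y <= b -> 0 <= y <= 1.
    by move=> /andP[/(le_trans a0) -> /le_trans]; apply.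
  rewrite -(ih a); last by rewrite a0 lexx.
  have ch y : a <= y <= b -> {for y, continuous (fun y => Re (winding C (h y)))}.
    move=> hy; have [cy ey] := e y hy.
    suff [] : ccont (fun y => winding C (h y)) y by [].
    apply: (hcontP (z := h y)) => //; apply: winding_hcont => //.
    by rewrite -ey; apply: off_path_image; apply/off/in01.
  have val y : a <= y <= b -> winding C (c y) = 0 \/ winding C (c y) = 1.
    by move=> hy; apply/wC/off/in01.
  (* Between the values 0 and 1 the continuous winding number would have to take the value 1 / 2. *)
  have noIVT y y' : winding C (c y) = 0 -> winding C (c y') = 1 ->
      a <= Num.min y y' -> Num.max y y' <= b -> False.
    move=> w0 w1 h1 h2.
    have ay : a <= y by apply: le_trans h1 _; rewrite ge_min lexx.
    have ay' : a <= y' by apply: le_trans h1 _; rewrite ge_min lexx orbT.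
    have yb : y <= b by apply: le_trans h2; rewrite le_max lexx.
    have yb' : y' <= b by apply: le_trans h2; rewrite le_max lexx orbT.
    have hy : a <= y <= b by rewrite ay.
    have hy' : a <= y' <= b by rewrite ay'.
    have [|||z] := @IVT R (fun y => Re (winding C (h y))) (Num.min y y') (Num.max y y') 2^-1.
    - by rewrite ge_min !le_max lexx.
    - by apply: within_cont => t /andP[t1 t2]; apply: ch; rewrite (le_trans h1 t1) (le_trans t2 h2).
    - have [_ ey] := e y hy; have [_ ey'] := e y' hy'.
      have half0 : (0 : R) <= 2^-1 by rewrite invr_ge0.
      have half1 : (2^-1 : R) <= 1 by rewrite invf_le1// ler1n.
      rewrite /Num.min /Num.max; case: (y < y'); rewrite -ey -ey' w0 w1/= ?ltr01 ?ltr10 ?half0//.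
    - rewrite in_itv/= => /andP[t1 t2].
      have hz : a <= z <= b by rewrite (le_trans h1 t1) (le_trans t2 h2).
      move=> hv; have : Re (winding C (c z)) = 2^-1 by rewrite (e z hz).2.
      by case: (val z hz) => ->; rewrite ?Re0 ?Re1; lra.
  have m1 : a <= Num.min x a by rewrite le_min lexx ltW.
  have m2 : a <= Num.min a x by rewrite le_min lexx ltW.
  have m3 : Num.max x a <= b by rewrite /Num.max; case: ifP => // _; exact: ltW.
  have m4 : Num.max a x <= b by rewrite /Num.max; case: ifP => // _; exact: ltW.
  case: (val x hx) => wx; case: (val a ha) => wa; rewrite wx wa//.
    by case: (noIVT x a wx wa m1 m3).
  by case: (noIVT a x wa wx m2 m4).
by move=> x hx; split; [exact: off|rewrite Wc// -(Wc x1)].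
Qed.

Lemma winding_path_int g z k : winding g z = k ->
  path_int g (fun w => (w - z)^-1) = k * (0 +i* (2 * pi)).
Proof. by move=> <-; rewrite /winding divfK// twopii_neq0. Qed.

Lemma J_contours_eval (n : nat) (x : forall n, 'I_n -> R) (u v : R) (k m : nat)
    (c C : R -> R[i]) :
  injective (x n) -> (2 <= k < n)%N -> J_contours x n u v c C ->
  path_int c (fun w => path_int C (fun z =>
    (w - z)^-1 * ((z - u%:C) ^+ k / (w - v%:C) ^+ m.+1) *
    \prod_(i < n) ((w - (x n i)%:C) / (z - (x n i)%:C)))) =
  (0 +i* (2 * pi)) ^+ 2 * (J_residues (x n) u v k m)%:C.
Proof.
move=> xinj kn [cc cC hin hout [[vc1 vc2] Cc]].
have nest := nested_winding cc cC Cc.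
have [pc c01 _ _] := cc; have [pC C01 _ _] := cC.
have gc := piecewise_gpath pc; have gC := piecewise_gpath pC.
have sg (g : R -> R[i]) f : chain_int [:: g] f = path_int g f by rewrite /chain_int big_seq1.
rewrite -(@J_eval R n (x n) u v k m [:: c] [:: C] (c 0) (C 0) xinj kn)//=.
- by rewrite [RHS]sg; congr (path_int _ _); apply/funext => w; rewrite sg.
- move=> i xi; split => //; apply: off_path_image.
  by case: (ltgtP (x n i) u) xi => // h _; [case: (hout i h)|case: (hin i h)].
- by move=> i ui; rewrite sg; have [_ /winding_path_int ->] := hin i ui; rewrite mul1r.
- by move=> i ui; rewrite sg; have [_ /winding_path_int ->] := hout i ui; rewrite mul0r.
- split=> // y hy; have [h1 h2] := nest y hy; split.
    by split => //; exact: off_path_image.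
  by rewrite sg (winding_path_int h2) mul0r.
- by split => //; exact: off_path_image.
- by rewrite sg (winding_path_int vc2) mul1r.
Qed.

Lemma derive1n_horner (p : {poly R}) m (v : R) :
  derive1n m (horner p) v = p^`(m).[v].
Proof.
suff -> : derive1n m (horner p) = horner p^`(m) by [].
elim: m => [|m ih]; first by [].
rewrite derive1nS ih derivnS; apply/funext => y.
by rewrite derive1E; have [_ ->] := is_derive_poly p^`(m) y.
Qed.

(** The derivative of order n - s of a Lagrange basis polynomial is (n - s)! times the divided
    derivative that occurs in the residues. *)
Lemma kernel_tilde_residues (x : forall n, 'I_n -> R) (n : nat) (u v : R) (r s : nat) :
  kernel_tilde x n u r v s =
  (n - s)`!%:R / (n - r - 1)`!%:R * J_residues (x n) u v (n - r - 1) (n - s).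
Proof.
rewrite /kernel_tilde /J_residues mulr_sumr [RHS]big_mkcond/=; apply: eq_bigr => j _.
case: ifP => _; last by rewrite !mul0r.
rewrite mul1r.
set P := \prod_(i | i != j) ('X - (x n i)%:P); set d := \prod_(i | i != j) (x n j - x n i).
have -> : (fun y : R => \prod_(i < n | i != j) ((y - x n i) / (x n j - x n i))) =
    horner (d^-1 *: P).
  apply/funext => y; rewrite hornerZ /P horner_prod mulrC big_split/= prodfV.
  by congr (_ / _); apply: eq_bigr => l _; rewrite hornerXsubC.
rewrite derive1n_horner derivnZ hornerZ nderivn_def hornerMn -mulr_natr.
by ring.
Qed.

End NestedContours.

(** * The complex derivative of f_n' *)

Section ComplexDerivative.
Context {R : realType}.
Implicit Types (w p : R[i]).
Local Notation C := (R[i]).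

Lemma cderive_subV (p w : C) : w != p ->
  is_derive (w : C^o) (1 : C^o) (fun z : C^o => (z - p)^-1 : C^o) (- (w - p) ^- 2 : C^o).
Proof.
move=> wp; have h0 : w - p != 0 by rewrite subr_eq0.
have h1 : is_derive (w : C^o) (1 : C^o) (fun z : C^o => z - p : C^o) (1 : C^o).
  have h := is_deriveB (is_derive_id (w : C^o) (1 : C^o)) (is_derive_cst (p : C^o) (w : C^o) (1 : C^o)).
  by rewrite subr0 in h.
have [h2 h3] := h1; split; first exact: derivableV.
by rewrite deriveV// h3 /GRing.scale/= mulr1.
Qed.

Lemma cderive_fprime (x : forall n, 'I_n -> R) (n : nat) (v e : R) w :
  (forall i, w != (x n i)%:C) -> w != v%:C ->
  cderive (fprime (cauchy_transform_n x n) v e) w =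
  - (n%:R^-1 * \sum_(i < n) (w - (x n i)%:C) ^- 2) + (1 - e)%:C * (w - v%:C) ^- 2.
Proof.
move=> wx wv; rewrite /cderive /cderiven derive1n1 derive1E.
have hs := is_derive_sum (fun i => cderive_subV (wx i)).
have h1 := is_deriveZ (n%:R^-1 : C) hs.
have h2 := is_deriveZ (1 - e)%:C (cderive_subV wv).
have [_ h3] := is_deriveB h1 h2.
rewrite [LHS](_ : _ = n%:R^-1 *: \sum_(i < n) - (w - (x n i)%:C) ^- 2 -
  (1 - e)%:C *: (- (w - v%:C) ^- 2 : C^o)).
  by rewrite /GRing.scale/= sumrN mulrN mulrN opprK.
rewrite -h3. 

apply: (congr1 (fun g : C^o -> C^o => 'D_(1 : C^o) g (w : C^o))).
apply/funext => z. rewrite /fprime /cauchy_transform_n.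
rewrite fctE. congr (_ - _). rewrite /=. rewrite fct_sumE. by [].
Qed.

End ComplexDerivative.

(** * Quadratic expansion of the logarithm of the integrand *)

Section LogExpansion.
Context {R : realType}.
Implicit Types (d w z : R[i]) (y t v : R).

Lemma Re_ge_cmod z : - cmod z <= Re z.
Proof. by have := Re_le_cmod z; rewrite ler_norml => /andP[]. Qed.

(** The left side is the integral over y in [0, 1] of (y d)^2 d / (1 + y d), and |1 + y d| >= 1 / 2
    there. *)
Lemma clog1p_bound d : cmod d <= 2^-1 ->
  cmod (clog (1 + d) - d + 2^-1 * d ^+ 2) <= 2 * cmod d ^+ 3.
Proof.
move=> hd.
pose F (y : R) := clog (1 + y%:C * d) - y%:C * d + 2^-1 * (y%:C * d) ^+ 2.
pose f (y : R) := (y%:C * d) ^+ 2 * d / (1 + y%:C * d).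
have small y : 0 <= y <= 1 -> cmod (y%:C * d) <= 2^-1.
  move=> /andP[y0 y1]; rewrite cmodM cmodR ger0_norm//.
  by apply: le_trans hd; apply: ler_piMl => //; exact: cmod_ge0.
have half y : 0 <= y <= 1 -> 2^-1 <= Re (1 + y%:C * d).
  by move=> hy; rewrite ReD Re1; have := Re_ge_cmod (y%:C * d); have := small y hy; lra.
have s y : 0 <= y <= 1 -> slit (1 + y%:C * d).
  by move=> /half h; rewrite /slit (lt_le_trans _ h)// invr_gt0.
have dl y : cder (fun y => y%:C * d) y d.
  apply: cder_eq (cderM (cder_real (rder_id y)) (cder_cst d y)) _.
  by rewrite mul1r mulr0 addr0.
have d1 y : cder (fun y => 1 + y%:C * d) y d.
  by apply: cder_eq (cderD (cder_cst 1 y) (dl y)) _; rewrite add0r.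
have dF y : 0 <= y <= 1 -> cder F y (f y).
  move=> hy; have n0 := slit_neq0 (s y hy).
  have hl := hderP (hder_clog (s y hy)) (erefl _) (d1 y).
  apply: cder_eq (cderD (cderB hl (dl y)) (cderZ 2^-1 (cderX 2 (dl y)))) _.
  by rewrite /f /= expr1; field.
have e : cint 0 1 f = clog (1 + d) - d + 2^-1 * d ^+ 2.
  rewrite (cFTC ltr01 (F := F)).
  - rewrite /F rmorph0 rmorph1 !mul0r !mul1r addr0.
    have -> : clog (1 : R[i]) = 0 by rewrite (clog_real ltr01) ln1.
    by rewrite expr0n mulr0 addr0 subr0 subr0.
  - move=> y hy; apply: ccontM; last first.
      by apply: ccontV; [exact: slit_neq0 (s y hy)|exact: cder_cont (d1 y)].
    by apply: ccontM; [apply/ccontX/(cder_cont (dl y))|exact: ccont_cst].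
  - by move=> y hy; exact: cder_cont (dF y hy).
  - by move=> y /andP[/ltW y0 /ltW y1]; apply: dF; rewrite y0.
rewrite -e; have := @cmod_cint_le _ 0 1 f (fun=> 2 * cmod d ^+ 3).
rewrite Rint_cst// subr0 mulr1; apply.
- apply: cibl_cont => y hy; apply: ccontM; last first.
    by apply: ccontV; [exact: slit_neq0 (s y hy)|exact: cder_cont (d1 y)].
  by apply: ccontM; [apply/ccontX/(cder_cont (dl y))|exact: ccont_cst].
- by apply: ibl_cont => y _; exact: rcont_cst.
move=> y /andP[/ltW y0 /ltW y1]; have hy : 0 <= y <= 1 by rewrite y0.
rewrite /f cmodM cmodM cmodX cmodV mulrC; apply: ler_pM.
- by rewrite invr_ge0 cmod_ge0.
- by rewrite mulr_ge0// ?exprn_ge0 ?cmod_ge0.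
- rewrite -[leRHS]invrK lef_pV2 ?posrE ?invr_gt0//; last by rewrite cmod_gt0 slit_neq0// s.
  exact: le_trans (half y hy) (Re_le _).
rewrite [leRHS]exprSr; apply: ler_wpM2r; first exact: cmod_ge0.
rewrite ler_sqr ?nnegrE ?cmod_ge0// cmodM cmodR ger0_norm//.
by apply: ler_piMl => //; exact: cmod_ge0.
Qed.

(** This is exp (n f) for [f] the corresponding [flog]. As a rational function it has no cut,
    whereas the w-contour turns around v and crosses the cut of [flog]. *)
Definition weight (n : nat) (x : 'I_n -> R) (v : R) (m : nat) (w : R[i]) : R[i] :=
  \prod_(i < n) (w - (x i)%:C) / (w - v%:C) ^+ m.

Lemma weight_neq0 (n : nat) (x : 'I_n -> R) (v : R) (m : nat) (w : R[i]) :
  (forall i, w != (x i)%:C) -> w != v%:C -> weight x v m w != 0.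
Proof.
move=> wx wv; rewrite /weight mulf_neq0//.
  by apply/prodf_neq0 => i _; rewrite subr_eq0.
by rewrite invr_eq0 expf_neq0// subr_eq0.
Qed.

Lemma cexp_flog (x : forall n, 'I_n -> R) (n m : nat) (v : R) (w : R[i]) : (0 < n)%N ->
  (forall i, w != (x n i)%:C) -> w != v%:C ->
  cexp (n%:R * flog x n m v w) = weight (x n) v m w.
Proof.
move=> n0 wx wv; have nn : n%:R != 0 :> R[i] by rewrite pnatr_eq0 -lt0n.
rewrite /flog mulrBr mulVKf// mulrA.
have -> : n%:R * (m%:R / n%:R) = m%:R :> R[i] by rewrite mulrCA divff ?mulr1.
rewrite cexpB cexp_sum cexpMn clogK ?subr_eq0//; congr (_ / _).
by apply: eq_bigr => i _; rewrite clogK ?subr_eq0.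
Qed.

(** Each factor is w - y = (t - y) (1 + d) with d = (w - t) / (t - y). The conditions 2 |w - t| <= t
    - y say |d| <= 1 / 2, the range of [clog1p_bound]. *)
Lemma weight_expansion (n : nat) (x : 'I_n -> R) (v t : R) (m : nat) (w : R[i]) :
  (forall i, x i < t) -> v < t ->
  (forall i, 2 * cmod (w - t%:C) <= t - x i) -> 2 * cmod (w - t%:C) <= t - v ->
  exists2 e, weight x v m w = weight x v m t%:C * cexp (
     (\sum_i (t - x i)^-1 - m%:R / (t - v))%:C * (w - t%:C)
     + (2^-1 * (m%:R * (t - v) ^- 2 - \sum_i (t - x i) ^- 2))%:C * (w - t%:C) ^+ 2 + e)
   & cmod e <= 2 * (\sum_i (t - x i) ^- 3 + m%:R * (t - v) ^- 3) * cmod (w - t%:C) ^+ 3.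
Proof.
move=> xt vt hx hv; set W := w - t%:C.
pose rem d := clog (1 + d) - d + 2^-1 * d ^+ 2 : R[i].
have factor y : y < t -> 2 * cmod W <= t - y -> exists2 e : R[i],
    w - y%:C = (t%:C - y%:C) * cexp ((t - y)^-1%:C * W - (2^-1 * (t - y) ^- 2)%:C * W ^+ 2 + e)
    & cmod e <= 2 * (t - y) ^- 3 * cmod W ^+ 3.
  move=> yt hy; have ty0 : 0 < t - y by rewrite subr_gt0.
  pose d := (t - y)^-1%:C * W.
  have cd : cmod d = (t - y)^-1 * cmod W by rewrite cmodM cmodR gtr0_norm// invr_gt0.
  have hd : cmod d <= 2^-1.
    rewrite cd mulrC ler_pdivrMr//; lra.
  exists (rem d); last first.
    apply: (le_trans (clog1p_bound hd)); rewrite cd exprMn exprVn mulrA; exact: lexx.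
  have -> : (t - y)^-1%:C * W - (2^-1 * (t - y) ^- 2)%:C * W ^+ 2 + rem d = clog (1 + d).
    rewrite /rem /d; have -> : (2^-1 * (t - y) ^- 2)%:C = 2^-1 * ((t - y)^-1%:C) ^+ 2 :> R[i].
      by rewrite rmorphM -exprVn rmorphXn fmorphV rmorph_nat.
    by ring.
  have n1 : 1 + d != 0.
    rewrite -cmod_gt0; apply: lt_le_trans (lerB_cmodD 1 d).
    by rewrite cmod1 subr_gt0 (le_lt_trans hd)// invf_lt1// ltr1n.
  rewrite clogK// /d fmorphV/= rmorphB/=.
  have : t%:C - y%:C != 0 :> R[i] by rewrite subr_eq0 realC_neq// gt_eqF.
  by move=> h; rewrite /W; field.
have [ev Ev bv] := factor v vt hv.
pose ex i := projT1 (cid2 (factor (x i) (xt i) (hx i))).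
have Ex i : w - (x i)%:C = (t%:C - (x i)%:C) * cexp ((t - x i)^-1%:C * W - (2^-1 * (t - x i) ^- 2)%:C * W ^+ 2 + ex i).
  by rewrite /ex; case: cid2.
have bx i : cmod (ex i) <= 2 * (t - x i) ^- 3 * cmod W ^+ 3.
  by rewrite /ex; case: cid2.
exists (\sum_i ex i - m%:R * ev).
  rewrite /weight Ev (eq_bigr _ (fun i _ => Ex i)) big_split/= -cexp_sum exprMn -cexpMn.
  rewrite invfM mulrACA -cexpB; congr (_ * cexp _).
  rewrite big_split sumrB/= -!mulr_suml -!rmorph_sum.
  have -> : (\sum_i (t - x i)^-1 - m%:R / (t - v))%:C =
      (\sum_i (t - x i)^-1)%:C - m%:R * (t - v)^-1%:C :> R[i].
    by rewrite rmorphB rmorphM rmorph_nat.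
  have -> : (2^-1 * (m%:R * (t - v) ^- 2 - \sum_i (t - x i) ^- 2))%:C =
      m%:R * (2^-1 * (t - v) ^- 2)%:C - (\sum_i 2^-1 * (t - x i) ^- 2)%:C :> R[i].
    by rewrite -mulr_sumr -(rmorph_nat (real_complex R)) -rmorphM -rmorphB; congr _%:C; ring.
  by ring.
apply: (le_trans (cmodB _ _)); rewrite mulrDr mulrDl; apply: lerD.
  apply: (le_trans (cmod_ler_sum _ _ _)); rewrite mulr_sumr mulr_suml.
  by apply: ler_sum => i _; exact: bx.
rewrite cmodM natCE cmodR ger0_norm//.
by rewrite (mulrCA 2) -(mulrA m%:R); apply: ler_wpM2l.
Qed.

End LogExpansion.

(** * Descent along circles and level curves *)

Section DescentCurves.
Context {R : realType}.
Implicit Types (w z : R[i]) (r y t u v : R).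

Lemma cmod_sub_sqr w y v :
  cmod (w - y%:C) ^+ 2 = cmod (w - v%:C) ^+ 2 + (y - v) ^+ 2 - 2 * (y - v) * Re (w - v%:C).
Proof. by rewrite !cmod_sqr; case: w => p q /=; rewrite !subr0; ring. Qed.

Lemma ler_sqr_cmod w z : (cmod w <= cmod z) = (cmod w ^+ 2 <= cmod z ^+ 2).
Proof. by rewrite ler_sqr// nnegrE cmod_ge0. Qed.

(* On a circle around v the squared distances to the x_i are affine in
   Re (w - v), so [ln] of their product is concave in Re (w - v). *)
Lemma weight_circle_le (n : nat) (x : 'I_n -> R) (v : R) (m : nat) w w0 :
  (forall i, w0 != (x i)%:C) -> cmod (w - v%:C) = cmod (w0 - v%:C) ->
  Re w <= Re w0 -> \sum_i (x i - v) / cmod (w0 - (x i)%:C) ^+ 2 <= 0 ->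
  cmod (weight x v m w) <= cmod (weight x v m w0).
Proof.
move=> w0x ew rw S0; rewrite /weight !cmodM !cmodV !cmodX ew.
apply: ler_wpM2r; first by rewrite invr_ge0 exprn_ge0// cmod_ge0.
rewrite ler_sqr_cmod !cmod_prod -!prodrXl.
have N0 i : 0 < cmod (w0 - (x i)%:C) ^+ 2.
  by rewrite exprn_gt0// cmod_gt0 subr_eq0.
(* |w - x_i|^2 exceeds |w0 - x_i|^2 by p (x_i - v). By 1 + y <= exp y the quotient of the products
   is at most the exponential of p times the sum in [S0], which is nonpositive. *)
pose p := 2 * (Re w0 - Re w).
have p0 : 0 <= p by rewrite mulr_ge0// subr_ge0.
have one i : cmod (w - (x i)%:C) ^+ 2 <=
    cmod (w0 - (x i)%:C) ^+ 2 * expR (p * ((x i - v) / cmod (w0 - (x i)%:C) ^+ 2)).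
  rewrite -[leLHS](@divfK _ (cmod (w0 - (x i)%:C) ^+ 2)) ?gt_eqF// mulrC.
  apply: ler_wpM2l; first exact: ltW.
  apply: (le_trans _ (expR_ge1Dx _)).
  rewrite ler_pdivrMr// mulrDl mul1r -!mulrA mulVf ?gt_eqF// mulr1.
  rewrite (cmod_sub_sqr w (x i) v) (cmod_sub_sqr w0 (x i) v) ew !ReB /= /p; lra.
apply: (@le_trans _ _ (\prod_i (cmod (w0 - (x i)%:C) ^+ 2 * expR (p * ((x i - v) / cmod (w0 - (x i)%:C) ^+ 2))))).
  by apply: ler_prod => i _; rewrite one exprn_ge0// cmod_ge0.
rewrite big_split/= -expR_sum -mulr_sumr.
apply: ler_piMr; first by apply: prodr_ge0 => i _; exact: ltW.
by rewrite expR_le1 mulr_ge0_le0.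
Qed.

(* The level curve [Re (log z + 1 / z) = g0], written [Re z = |z| ^ 2 (g0 - ln |z|)].
   Along it [ln |z - y| - (1 - y)^-1 ln |z|] is monotone for every real y < 1: with
   [psi = log z + 1 / z] one has
   [d (log (z - y) - (1 - y)^-1 log z) = - y / (1 - y) * z / (z - y) * d psi]
   and [d psi] is purely imaginary on the curve. *)
Definition curve_cos (g0 r : R) := r * (g0 - ln r).

(** The expression is |z - y|^2 for z of modulus r whose argument has cosine [curve_cos g0 r]; z is
    not real, as this cosine lies strictly between -1 and 1. *)
Lemma curve_dist_gt0 (g0 r y : R) : 0 < r -> -1 < curve_cos g0 r < 1 ->
  0 < r ^+ 2 + y ^+ 2 - 2 * y * (r * curve_cos g0 r).
Proof.
move=> r0 /andP[c1 c2]; set c := curve_cos g0 r in c1 c2 *.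
have -> : r ^+ 2 + y ^+ 2 - 2 * y * (r * c) = (y - r * c) ^+ 2 + r ^+ 2 * ((1 - c) * (1 + c)).
  by ring.
apply: ltr_wpDl; first exact: sqr_ge0.
by rewrite mulr_gt0 ?exprn_gt0// mulr_gt0//; lra.
Qed.

(** Twice [ln |z - y| - (1 - y)^-1 ln |z|] at the point of modulus [p] of the curve: the first
    logarithm is that of a squared distance. *)
Definition curve_potential (g0 y p : R) :=
  ln (p ^+ 2 + y ^+ 2 - 2 * y * (p * curve_cos g0 p)) - 2 / (1 - y) * ln p.

Lemma curve_term (g0 r0 r y : R) : 0 < r <= r0 -> y < 1 ->
  (forall p, r <= p <= r0 -> -1 < curve_cos g0 p < 1) ->
  curve_potential g0 y r0 <= curve_potential g0 y r.
Proof.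
move=> /andP[rpos rr0] y1 hc; pose h := curve_potential g0 y.
(* The factor 1 - 2 c p + p^2 is |z - 1|^2, the squared distance to the critical point of psi, and
   the denominator is positive for y < 1. This settles the sign. *)
pose h' p := - 2 * y ^+ 2 * (1 - 2 * curve_cos g0 p * p + p ^+ 2) /
  ((p ^+ 2 + y ^+ 2 - 2 * y * (p * curve_cos g0 p)) * p * (1 - y)).
have dh p : r <= p <= r0 -> is_derive p 1 h (h' p).
  move=> hp; have p0 : 0 < p by move: hp => /andP[/(lt_le_trans rpos)].
  have q0 := curve_dist_gt0 y p0 (hc p hp).
  have dl := is_derive1_ln p0.
  have dc : is_derive p 1 (curve_cos g0) (g0 - ln p - 1).
    apply: rder_eq (rderM (rder_id p) (rderB (rder_cst g0 p) dl)) _.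
    by rewrite sub0r mul1r mulrN mulfV// gt_eqF.
  have dq : is_derive p 1 (fun p => p ^+ 2 + y ^+ 2 - 2 * y * (p * curve_cos g0 p))
      (2 * p - 2 * y * (2 * curve_cos g0 p - p)).
    apply: rder_eq (rderB (rderD (rderX 2 (rder_id p)) (rder_cst _ p))
      (rderZ (2 * y) (rderM (rder_id p) dc))) _.
    by rewrite /= /curve_cos; ring.
  apply: rder_eq (rderB (rder_ln (f := fun p => p ^+ 2 + y ^+ 2 - 2 * y * (p * curve_cos g0 p)) q0 dq)
    (rderZ (2 / (1 - y)) dl)) _.
  rewrite /h' /=; have y0 : 1 - y != 0 by rewrite gt_eqF// subr_gt0.
  move: (curve_cos g0 p) q0 => c q0.
  by field; rewrite ?y0 ?(gt_eqF q0) ?(gt_eqF p0).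
have h'0 p : r <= p <= r0 -> h' p <= 0.
  move=> hp; have p0 : 0 < p by move: hp => /andP[/(lt_le_trans rpos)].
  have q0 := curve_dist_gt0 y p0 (hc p hp).
  rewrite /h' mulr_le0_ge0//; last first.
    by rewrite invr_ge0 mulr_ge0 ?mulr_ge0 ?(ltW q0) ?(ltW p0)// subr_ge0 ltW.
  rewrite mulr_le0_ge0//; first by rewrite mulNr oppr_le0 mulr_ge0// sqr_ge0.
  have /andP[c1 c2] := hc p hp.
  have : 0 <= (p - curve_cos g0 p) ^+ 2 := sqr_ge0 _.
  have : 0 < (1 - curve_cos g0 p) * (1 + curve_cos g0 p) by rewrite mulr_gt0//; lra.
  move: (curve_cos g0 p) => c; rewrite !expr2; lra.
have d1 p : p \in `]r, r0[ -> derivable h p 1.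
  by rewrite in_itv/= => /andP[/ltW p1 /ltW p2]; have [] := dh p (introT andP (conj p1 p2)).
have d2 p : p \in `]r, r0[ -> derive1 h p <= 0.
  rewrite in_itv/= => /andP[/ltW p1 /ltW p2].
  have hp : r <= p <= r0 by rewrite p1.
  by rewrite derive1E; have [_ ->] := dh p hp; exact: h'0.
have d3 : {within `[r, r0], continuous h}.
  by apply: within_cont => p hp; exact: rder_cont (dh p hp).
by apply: (ler0_derive1_le_cc (f := h) d1 d2 d3); rewrite ?in_itv/= ?lexx ?rr0.
Qed.

(** With y_i = (x_i - u) / (s - u), criticality of s reads k = sum of the 1 / (1 - y_i). The power
    |z - u|^k can thus be distributed over the factors |z - x_i|, and each quotient is monotone
    along the curve by [curve_term]. *)
Lemma weight_curve_ge (n : nat) (x : 'I_n -> R) (u s : R) (k : nat) (g0 r0 r : R) z z0 :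
  u < s -> (forall i, x i < s) -> \sum_i (s - x i)^-1 = k%:R / (s - u) ->
  0 < r <= r0 -> (forall p, r <= p <= r0 -> -1 < curve_cos g0 p < 1) ->
  cmod (z - u%:C) = (s - u) * r -> Re (z - u%:C) = (s - u) * (r * curve_cos g0 r) ->
  cmod (z0 - u%:C) = (s - u) * r0 -> Re (z0 - u%:C) = (s - u) * (r0 * curve_cos g0 r0) ->
  cmod (weight x u k z0) <= cmod (weight x u k z).
Proof.
move=> us xs crit hr hc m1 e1 m0 e0.
have /andP[rp rr0] := hr; have r0p := lt_le_trans rp rr0.
set S := s - u in crit m1 e1 m0 e0 *; have S0 : 0 < S by rewrite subr_gt0.
pose y i := (x i - u) / S.
have xy i : x i - u = S * y i by rewrite /y mulrC divfK// gt_eqF.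
pose q p i := p ^+ 2 + y i ^+ 2 - 2 * y i * (p * curve_cos g0 p).
have hr0 : r <= r0 <= r0 by rewrite rr0 lexx.
have hrr : r <= r <= r0 by rewrite rr0 lexx.
have q1 i : 0 < q r i by apply: curve_dist_gt0 => //; exact: hc.
have q0 i : 0 < q r0 i by apply: curve_dist_gt0 => //; exact: hc.
have d1 i : cmod (z - (x i)%:C) ^+ 2 = S ^+ 2 * q r i.
  by rewrite (cmod_sub_sqr _ _ u) m1 e1 xy /q; ring.
have d0 i : cmod (z0 - (x i)%:C) ^+ 2 = S ^+ 2 * q r0 i.
  by rewrite (cmod_sub_sqr _ _ u) m0 e0 xy /q; ring.
have term i := @curve_term g0 r0 r (y i) hr _ hc.
have y1 i : y i < 1 by rewrite /y ltr_pdivrMr// mul1r ltrD2r.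
have k1 : k%:R = \sum_i (1 - y i)^-1.
  have -> : k%:R = S * \sum_i (s - x i)^-1 by rewrite crit mulrC divfK// gt_eqF.
  rewrite mulr_sumr; apply: eq_bigr => i _; rewrite /y.
  have h : s - x i != 0 by rewrite subr_eq0 gt_eqF.
  have h' : S != 0 by rewrite gt_eqF.
  have -> : 1 - (x i - u) / S = (s - x i) / S.
    by apply: (mulIf h'); rewrite mulrBl !divfK// /S; ring.
  by rewrite invfM invrK mulrC.
have key : \prod_i q r0 i / r0 ^+ (2 * k) <= \prod_i q r i / r ^+ (2 * k).
  have lq p : (forall i, 0 < q p i) -> 0 < p ->
      \prod_i q p i / p ^+ (2 * k) = expR (\sum_i (ln (q p i) - 2 / (1 - y i) * ln p)).
    move=> qp pp; rewrite sumrB expRB expR_sum; congr (_ / _).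
      by apply: eq_bigr => i _; rewrite lnK ?posrE.
    rewrite -mulr_suml -mulr_sumr -k1 mulrC -natrM expRM_natr.
    by rewrite lnK ?posrE.
  rewrite lq// lq// ler_expR; apply: ler_sum => i _; exact: term.
have sq p w : 0 < p -> cmod (w - u%:C) = S * p ->
    (forall i, cmod (w - (x i)%:C) ^+ 2 = S ^+ 2 * q p i) ->
    cmod (weight x u k w) ^+ 2 =
      (\prod_(i < n) S ^+ 2) / S ^+ (2 * k) * (\prod_i q p i / p ^+ (2 * k)).
  move=> pp mw dw; rewrite /weight cmodM cmodV cmodX cmod_prod exprMn -prodrXl.
  rewrite (eq_bigr _ (fun i _ => dw i)) big_split/= mw exprVn -exprM mulnC exprMn invfM.
  by rewrite mulrACA.
rewrite ler_sqr_cmod (sq r0 z0)// (sq r z)//; apply: ler_wpM2l => //.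
rewrite mulr_ge0 ?invr_ge0 ?exprn_ge0 ?(ltW S0)//.
by apply: prodr_ge0 => i _; rewrite exprn_ge0// ltW.
Qed.

(** For E = e^2 this is the modulus of the rescaled corner 1 + i e, and [curve_level E] is the value
    of Re (log z + 1 / z) at this point. *)
Definition curve_top (E : R) : R := Num.sqrt (1 + E).
Definition curve_level (E : R) : R := (1 + E)^-1 + ln (curve_top E).

Lemma curve_top_ge1 (E : R) : 0 < E -> E <= 100^-1 ->
  1 <= curve_top E.
Proof. by move=> E0 E1; rewrite -[leLHS]sqrtr1 ler_sqrt ?addr_ge0 ?lerDl// ltW. Qed.

Lemma curve_top_sqr (E : R) : 0 < E -> E <= 100^-1 ->
  curve_top E ^+ 2 = 1 + E.
Proof. by move=> E0 E1; rewrite sqr_sqrtr// addr_ge0// ltW. Qed.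

Lemma curve_top_le (E : R) : 0 < E -> E <= 100^-1 ->
  curve_top E <= 201 / 200.
Proof.
move=> E0 E1.
have h1 := curve_top_ge1 E0 E1; have h2 := curve_top_sqr E0 E1.
rewrite leNgt; apply/negP => h3.
have : 0 < (curve_top E - 201 / 200) * (curve_top E + 201 / 200) by apply: mulr_gt0; lra.
by move: h2; rewrite expr2; lra.
Qed.

Lemma ln_curve_top (E : R) : 0 < E -> E <= 100^-1 ->
  ln (curve_top E) <= E / 2 /\ E / (1 + E) <= 2 * ln (curve_top E).
Proof.
move=> E0 E1.
have h : 2 * ln (curve_top E) = ln (1 + E).
  by rewrite -(curve_top_sqr E0 E1) lnXn ?mulr_natl// (lt_le_trans _ (curve_top_ge1 E0 E1)).
split; first by have := @le_ln1Dx R E; rewrite -h; lra.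
have := @le_ln1Dx R ((1 + E)^-1 - 1).
have -> : 1 + ((1 + E)^-1 - 1) = (1 + E)^-1 by ring.
rewrite lnV ?posrE; last by lra.
have i0 : 0 < (1 + E)^-1 by rewrite invr_gt0; lra.
have -> : E / (1 + E) = 1 - (1 + E)^-1 by field; lra.
by rewrite h; lra.
Qed.

(** Both d and ln (curve_top E) are E / 2 up to second order; E <= 1 / 100 leaves room for the
    factor 6 / 5. *)
Lemma curve_level_bounds (E : R) : 0 < E -> E <= 100^-1 ->
  let d := 1 - curve_level E in
  [/\ 0 < d, d <= 200^-1 & ln (curve_top E) <= 6 / 5 * d].
Proof.
move=> E0 E1.
have [h1 h2] := ln_curve_top E0 E1; rewrite /curve_level.
have e : (1 + E)^-1 = 1 - E / (1 + E) by field; lra.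
have e2 : E / (1 + E) = E - E ^+ 2 / (1 + E) by field; lra.
have b1 : E ^+ 2 / (1 + E) <= E ^+ 2.
  by apply: ler_piMr; [exact: sqr_ge0|rewrite invf_le1; lra].
have b2 : E ^+ 2 <= E / 100.
  by rewrite expr2; apply: ler_wpM2l; lra.
by rewrite e; split; lra.
Qed.

(** The level is below 1, the maximum of r (1 - ln r), so [c] stays below 1 and is the cosine of an
    angle: the curve exists for every modulus up to that of the corner. The last inequality is what
    bounds the speed of the curve when it is parametrized by r. *)
Lemma curve_cos_facts (E r : R) : 0 < E -> E <= 100^-1 ->
  0 < r <= curve_top E ->
  let c := curve_cos (curve_level E) r in
  [/\ 0 < c, c < 1 & (c - r) ^+ 2 <= 8 * (1 - c ^+ 2)].
Proof.
move=> E0 E1.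
move=> /andP[rp rr]; have [d0 d1 d2] := curve_level_bounds E0 E1; have t1 := curve_top_le E0 E1.
have lr : ln r <= ln (curve_top E) by rewrite ler_ln ?posrE// (lt_le_trans rp rr).
have gl : 0 < curve_level E - ln r by lra.
have c0 : 0 < curve_cos (curve_level E) r by rewrite mulr_gt0.
suff [c1 h] : curve_cos (curve_level E) r < 1 /\ (curve_cos (curve_level E) r - r) ^+ 2 <= 8 * (1 - curve_cos (curve_level E) r).
  split=> //; apply: (le_trans h); rewrite ler_pM2l// lerD2l lerN2.
  by rewrite expr2 ler_piMl// ltW.
have [r1|r1] := leP r 1.
  pose t := - ln r; have t0 : 0 <= t by rewrite oppr_ge0 ln_le0.
  have er : expR t = r^-1 by rewrite expRN lnK.
  (* The square of 1 + t / 2 <= exp (t / 2). The quadratic term matters because c - r = r (t - d),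
     whose square must be controlled by 1 - c. *)
  have ex : 1 + t + t ^+ 2 / 4 <= r^-1.
    rewrite -er (_ : t = 2%:R * (t / 2)); last by field.
    rewrite expRM_natl; have := expR_ge1Dx (t / 2) => h.
    apply: (@le_trans _ _ ((1 + t / 2) ^+ 2)); first by rewrite expr2; lra.
    by rewrite ler_sqr ?nnegrE ?expR_ge0//; lra.
  have e1 : 1 - curve_cos (curve_level E) r = r * (r^-1 - 1 - t + (1 - curve_level E)).
    by rewrite /curve_cos /t; field; rewrite gt_eqF.
  have low : r * (t ^+ 2 / 4 + (1 - curve_level E)) <= 1 - curve_cos (curve_level E) r.
    by rewrite e1; apply: ler_wpM2l; [exact: ltW|lra].
  have lowp : 0 < r * (t ^+ 2 / 4 + (1 - curve_level E)).
    by apply: mulr_gt0 => //; have := sqr_ge0 t; lra.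
  split; first by lra.
  have -> : curve_cos (curve_level E) r - r = r * (t - (1 - curve_level E)) by rewrite /curve_cos /t; ring.
  set d := 1 - curve_level E in d0 d1 low lowp *.
  apply: (@le_trans _ _ (r * (t ^+ 2 + d))); last first.
    by move: low; set q := curve_cos (curve_level E) r; have := sqr_ge0 t; nra.
  rewrite exprMn expr2 -mulrA; apply: ler_wpM2l; first exact: ltW.
  have : (t - d) ^+ 2 <= t ^+ 2 + d by rewrite !expr2; nra.
  have := sqr_ge0 (t - d); nra.
(* For r between 1 and the top, ln r <= 6 / 5 d: then |c - r| is at most 3 d, while 1 - c is at
   least d. *)
set d := 1 - curve_level E in d0 d1 d2 *.
have l0 : 0 <= ln r by apply: ln_ge0; exact: ltW.
have low : d <= 1 - curve_cos (curve_level E) r.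
  have := @le_ln1Dx R (r^-1 - 1); have -> : 1 + (r^-1 - 1) = r^-1 by ring.
  rewrite lnV ?posrE//.
  have i0 : 0 < r^-1 by rewrite invr_gt0.
  have h : -1 < r^-1 - 1 by lra.
  move=> /(_ h) h2; have : r * (1 - r^-1) <= r * ln r by apply: ler_wpM2l; lra.
  have -> : r * (1 - r^-1) = r - 1 by field; rewrite gt_eqF.
  have : 0 <= (r - 1) * d by apply: mulr_ge0; lra.
  by rewrite /curve_cos /d; lra.
split; first by lra.
have -> : curve_cos (curve_level E) r - r = - (r * (d + ln r)) by rewrite /curve_cos /d; ring.
rewrite sqrrN; apply: (@le_trans _ _ (8 * d)); last by lra.
have b : r * (d + ln r) <= 3 * d by nra.
have b0 : 0 <= r * (d + ln r) by apply: mulr_ge0; lra.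
apply: (@le_trans _ _ ((3 * d) ^+ 2)); first by rewrite ler_sqr ?nnegrE//; lra.
rewrite expr2; nra.
Qed.

End DescentCurves.

(** * Explicit paths: segments, arcs and the level curve *)

Section ConcretePaths.
Context {R : realType}.
Implicit Types (z w p a : R[i]) (g : R -> R[i]) (f : R[i] -> R[i]).

Lemma cder_linear (al be : R) x : cder (fun x : R => 0 +i* (al + x * (be - al))) x (0 +i* (be - al)).
Proof.
split; first exact: rder_cst.
apply: rder_eq (rderD (rder_cst al x) (rderM (rder_id x) (rder_cst _ x))) _.
by rewrite mul1r mulr0 addr0 add0r.
Qed.

Lemma cder_segment z w x : cder (segment_path z w) x (w - z).
Proof.
apply: cder_eq (cderD (cder_cst z x) (cderM (cder_real (rder_id x)) (cder_cst _ x))) _.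
by rewrite mul1r mulr0 addr0 add0r.
Qed.

Definition arc_deriv (rho al be x : R) : R[i] :=
  rho%:C * (cexp (0 +i* (al + x * (be - al))) * (0 +i* (be - al))).

Lemma cder_arc (rho al be x : R) : cder (circle_arc rho al be) x (arc_deriv rho al be x).
Proof. exact: cderZ (cder_exp (cder_linear al be x)). Qed.

Lemma ccont_arc_deriv (rho al be x : R) : ccont (arc_deriv rho al be) x.
Proof.
apply: ccontM; first exact: ccont_cst.
by apply: ccontM; [exact: ccont_exp (cder_cont (cder_linear al be x))|exact: ccont_cst].
Qed.

Lemma gpath_segment z w : gpath (segment_path z w).
Proof.
apply: (gpath_intro (H := fun=> w - z)) => x _; [exact: cder_cont (cder_segment z w x)|exact: ccont_cst|exact: cder_segment].
Qed.

Lemma gpath_arc (rho al be : R) : gpath (circle_arc rho al be).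
Proof.
apply: (gpath_intro (H := arc_deriv rho al be)) => x _; [exact: cder_cont (cder_arc rho al be x)|exact: ccont_arc_deriv|exact: cder_arc].
Qed.

Lemma cmod_segment_deriv z w x : cmod (path_deriv (segment_path z w) x) = cmod (w - z).
Proof. by rewrite (cder_path_deriv (cder_segment z w x)). Qed.

Lemma cmod_imag (b : R) : cmod (0 +i* b : R[i]) = `|b|.
Proof. by rewrite cmodE/= expr0n add0r sqrtr_sqr. Qed.

Lemma cmod_arc_deriv (rho al be x : R) : 0 <= rho ->
  cmod (path_deriv (circle_arc rho al be) x) = rho * `|be - al|.
Proof.
move=> r0; rewrite (cder_path_deriv (cder_arc rho al be x)) /arc_deriv !cmodM cmod_cexp /=.
by rewrite expR0 mul1r cmodR cmod_imag ger0_norm.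
Qed.

Definition aff_path (t : R) (k : R) g : R -> R[i] := fun x => t%:C + k%:C * g x.

Lemma cder_aff t k g x d : cder g x d -> cder (aff_path t k g) x (k%:C * d).
Proof.
move=> h; apply: cder_eq (cderD (cder_cst t%:C x) (cderZ k%:C h)) _.
by rewrite add0r.
Qed.

Lemma ccont_aff t k g x : ccont g x -> ccont (aff_path t k g) x.
Proof.
by move=> h; apply: ccontD; [exact: ccont_cst|apply: ccontM => //; exact: ccont_cst].
Qed.

Lemma gpath_aff t k g : gpath g -> gpath (aff_path t k g).
Proof.
move=> [m [p [p0 pm pk hk]]]; exists m, p; split => // j jm.
have [h [H [e cH dh]]] := hk j jm.
exists (aff_path t k h), (fun x => k%:C * H x); split.
- by move=> x /e [ch gh]; split; [exact: ccont_aff|rewrite /aff_path gh].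
- by move=> x /cH; apply: ccontM; exact: ccont_cst.
- by move=> x /dh; exact: cder_aff.
Qed.

Lemma path_int_aff t k g f : (forall x, exists d, cder g x d) ->
  path_int (aff_path t k g) f = path_int g (fun z => k%:C * f (t%:C + k%:C * z)).
Proof.
move=> dg; rewrite /path_int; congr cintegral; apply/funext => x.
have [d hd] := dg x; rewrite (cder_path_deriv (cder_aff t k hd)) (cder_path_deriv hd).
by rewrite /aff_path mulrCA mulrA.
Qed.

Lemma path_deriv_aff t k g x d : cder g x d -> path_deriv (aff_path t k g) x = k%:C * path_deriv g x.
Proof. by move=> hd; rewrite (cder_path_deriv (cder_aff t k hd)) (cder_path_deriv hd). Qed.

(* The curve of [curve_cos], traversed by its modulus r. *)
Definition curve_pt (E r : R) : R[i] :=
  let c := curve_cos (curve_level E) r in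
  (r * c) +i* (r * Num.sqrt (1 - c ^+ 2)).

(** Derivative with respect to the modulus, simplified by c' = c / r - 1; in this form it extends
    continuously to r = 0. *)
Definition curve_pt_deriv (E r : R) : R[i] :=
  let c := curve_cos (curve_level E) r in
  (2 * c - r) +i* ((1 - 2 * c ^+ 2 + c * r) / Num.sqrt (1 - c ^+ 2)).

(** For continuity of y ln y at 0. On the positive side it is ln s <= s at s = y^(-1/2); on the
    other side [ln] has the default value 0. *)
Lemma xlnx_bound (y : R) : y <= 1 -> `|y * ln y| <= 2 * Num.sqrt `|y|.
Proof.
move=> y1; have [y0|y0] := leP y 0.
  by rewrite ln0// mulr0 normr0 mulr_ge0// sqrtr_ge0.
have s0 : 0 < Num.sqrt y by rewrite sqrtr_gt0.
have h := ln_sublinear (x := (Num.sqrt y)^-1); rewrite invr_gt0 in h.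
have {}h := h s0; rewrite lnV ?posrE// in h.
have e : ln y = 2 * ln (Num.sqrt y).
  by rewrite -{1}(sqr_sqrtr (ltW y0)) lnXn// mulr_natl.
rewrite normrM (gtr0_norm y0) (ler0_norm (ln_le0 y1)) e.
rewrite -{1}(sqr_sqrtr (ltW y0)).
have -> : 2 * Num.sqrt y = Num.sqrt y ^+ 2 * (2 * (Num.sqrt y)^-1) by field; rewrite gt_eqF.
by apply: ler_wpM2l; [exact: sqr_ge0|lra].
Qed.

Lemma rcont_curve_cos (g0 r : R) : {for r, continuous (curve_cos g0)}.
Proof.
suff h : {for r, continuous (fun r : R => r * ln r)}.
  apply: (@rcont_fun _ (fun r => r * g0 - r * ln r)); first by apply/funext => y; rewrite /curve_cos mulrBr.
  by apply: rcontB => //; apply: rcontM; [exact: rcont_id|exact: rcont_cst].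
have [r0|r0|->] := ltgtP r 0.
- apply: (@rcont_near _ (fun=> 0)); last exact: rcont_cst.
  near=> y; have y0 : 0 < - y.
    near: y; apply: (rcont_pos (f := fun y : R => - y)); [by apply: rcontN; exact: rcont_id|by rewrite oppr_gt0].
  by rewrite ln0 ?mulr0// ltW// -oppr_gt0.
- by apply: rcontM; [exact: rcont_id|exact: continuous_ln].
- have c0 : {for 0, continuous (fun y : R => 2 * Num.sqrt `|y|)}.
    apply: rcontM; first exact: rcont_cst.
    by apply: rcont_sqrt; exact: (@norm_continuous R R 0).
  have c1 : \forall y \near (0 : R), 0 < 1 - y.
    apply: rcont_pos; last by rewrite subr0.
    by apply: rcontB; [exact: rcont_cst|exact: rcont_id].
  rewrite /prop_for /continuous_at normr0 sqrtr0 mulr0 in c0.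
  rewrite /prop_for /continuous_at mul0r; apply/cvgrPdist_lt => e e0.
  move/cvgrPdist_lt : c0 => /(_ e e0) c2.
  near=> y; rewrite sub0r normrN; apply: (@le_lt_trans _ _ (2 * Num.sqrt `|y|)).
    by apply: xlnx_bound; rewrite ltW// -subr_gt0; near: y.
  have : `|0 - 2 * Num.sqrt `|y| | < e by near: y.
  by rewrite sub0r normrN; apply: le_lt_trans; exact: ler_norm.
Unshelve. all: by end_near. Qed.

Lemma curve_facts (E r : R) : 0 < E -> E <= 100^-1 -> 0 <= r <= curve_top E ->
  let c := curve_cos (curve_level E) r in
  [/\ 0 <= c, c < 1 & 0 < 1 - c ^+ 2].
Proof.
move=> E0 E1 /andP[r0 r1] c.
suff [c0 c1] : 0 <= c /\ c < 1.
  split=> //; have -> : 1 - c ^+ 2 = (1 - c) * (1 + c) by ring.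
  by rewrite mulr_gt0//; lra.
move: r0; rewrite le_eqVlt => /orP[/eqP r0|r0].
  by rewrite /c -r0 /curve_cos mul0r.
have hr : 0 < r <= curve_top E by rewrite r0.
by have [h1 h2 _] := curve_cos_facts E0 E1 hr; split => //; exact: ltW.
Qed.

Lemma cder_curve_pt (E r : R) : 0 < E -> E <= 100^-1 -> 0 < r <= curve_top E ->
  cder (curve_pt E) r (curve_pt_deriv E r).
Proof.
move=> E0 E1 /andP[r0 r1]; have hr : 0 <= r <= curve_top E by rewrite ltW.
have [c0 c1 c2] := curve_facts E0 E1 hr.
set g0 := curve_level E in c0 c1 c2 *.
have dc : is_derive r 1 (curve_cos g0) (g0 - ln r - 1).
  apply: rder_eq (rderM (rder_id r) (rderB (rder_cst g0 r) (is_derive1_ln r0))) _.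
  by rewrite sub0r mul1r mulrN mulfV// gt_eqF.
have e : g0 - ln r - 1 = curve_cos g0 r / r - 1.
  by rewrite /curve_cos mulrC mulKf// gt_eqF.
split.
  apply: rder_eq (rderM (rder_id r) dc) _; rewrite /curve_pt_deriv/= -/g0 e.
  by field; rewrite gt_eqF.
have dq : is_derive r 1 (fun r : R => 1 - curve_cos g0 r ^+ 2) (- (2 * curve_cos g0 r * (g0 - ln r - 1))).
  by apply: rder_eq (rderB (rder_cst 1 r) (rderX 2 dc)) _; rewrite /= expr1 sub0r.
apply: rder_eq (rderM (rder_id r) (rder_sqrt (f := fun r => 1 - curve_cos g0 r ^+ 2) c2 dq)) _.
rewrite /curve_pt_deriv/= -/g0 e.
have s0 : 0 < Num.sqrt (1 - curve_cos g0 r ^+ 2) by rewrite sqrtr_gt0.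
have s2 := sqr_sqrtr (ltW c2).
move: s0 s2; set q := Num.sqrt _; set c := curve_cos g0 r => s0 s2.
have -> : 1 * q = (1 - c ^+ 2) / q by rewrite mul1r -s2 expr2 mulfK// gt_eqF.
by field; rewrite !gt_eqF.
Qed.

Lemma ccont_curve_pt (E r : R) : ccont (curve_pt E) r.
Proof.
have cc : {for r, continuous (curve_cos (curve_level E))} by exact: rcont_curve_cos.
split; apply: rcontM => //; try exact: rcont_id.
by apply/rcont_sqrt/rcontB; [exact: rcont_cst|exact: rcontX].
Qed.

Lemma ccont_curve_pt_deriv (E r : R) : 0 < E -> E <= 100^-1 -> 0 <= r <= curve_top E ->
  ccont (curve_pt_deriv E) r.
Proof.
move=> E0 E1 hr; have [c0 c1 c2] := curve_facts E0 E1 hr.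
have cc : {for r, continuous (curve_cos (curve_level E))} by exact: rcont_curve_cos.
split.
  by apply: rcontB; [apply: rcontM => //; exact: rcont_cst|exact: rcont_id].
apply: rcontM; last first.
  apply: rcontV; first by rewrite gt_eqF// sqrtr_gt0.
  by apply/rcont_sqrt/rcontB; [exact: rcont_cst|exact: rcontX].
apply: rcontD; last by apply: rcontM => //; exact: rcont_id.
apply: rcontB; first exact: rcont_cst.
by apply: rcontM; [exact: rcont_cst|exact: rcontX].
Qed.

(** The squared speed is 1 + (c - r)^2 / (1 - c^2), and [curve_cos_facts] bounds the quotient by
    8. *)
Lemma cmod_curve_pt_deriv (E r : R) : 0 < E -> E <= 100^-1 -> 0 < r <= curve_top E ->
  cmod (curve_pt_deriv E r) <= 3.
Proof.
move=> E0 E1 hr; have [c0 c1 h] := curve_cos_facts E0 E1 hr.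
have hr' : 0 <= r <= curve_top E by case/andP: hr => /ltW ->.
have [_ _ c2] := curve_facts E0 E1 hr'.
rewrite -(@ler_sqr _ (cmod _)) ?nnegrE ?cmod_ge0// cmod_sqr /=.
move: c0 c1 h c2; set c := curve_cos _ r => c0 c1 h c2.
rewrite exprMn exprVn sqr_sqrtr ?(ltW c2)//.
have -> : (2 * c - r) ^+ 2 + (1 - 2 * c ^+ 2 + c * r) ^+ 2 / (1 - c ^+ 2) =
  1 + (c - r) ^+ 2 / (1 - c ^+ 2) by field; rewrite gt_eqF.
rewrite -lerBrDl ler_pdivrMr//; apply: (le_trans h); lra.
Qed.

Lemma curve_pt0 (E : R) : curve_pt E 0 = 0.
Proof. by apply: eqC; rewrite /= mul0r. Qed.

Lemma curve_pt_top (e : R) : 0 < e -> curve_pt (e ^+ 2) (curve_top (e ^+ 2)) = 1 +i* e.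
Proof.
move=> e0; have E0 : 0 < e ^+ 2 by rewrite exprn_gt0.
have s2 : curve_top (e ^+ 2) ^+ 2 = 1 + e ^+ 2 by rewrite sqr_sqrtr// addr_ge0// ltW.
have t0 : 0 < curve_top (e ^+ 2) by rewrite sqrtr_gt0 addr_gt0.
have cE : curve_cos (curve_level (e ^+ 2)) (curve_top (e ^+ 2)) = (curve_top (e ^+ 2))^-1.
  rewrite /curve_cos /curve_level addrK -s2; move: (curve_top _) t0 => q q0.
  by field; rewrite gt_eqF.
rewrite /curve_pt cE; apply: eqC => /=; first by rewrite mulfV// gt_eqF.
move: s2 t0; set q := curve_top _ => s2 t0.
rewrite -{1}(gtr0_norm t0) -sqrtr_sqr -sqrtrM ?sqr_ge0//.
have -> : q ^+ 2 * (1 - q^-1 ^+ 2) = e ^+ 2.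
  by rewrite mulrBr mulr1 -exprMn mulfV ?gt_eqF// expr1n s2 addrAC subrr add0r.
by rewrite sqrtr_sqr gtr0_norm.
Qed.

Lemma cmod_curve_pt (E r : R) : 0 < E -> E <= 100^-1 -> 0 <= r <= curve_top E ->
  cmod (curve_pt E r) = r.
Proof.
move=> E0 E1 hr; have [c0 c1 c2] := curve_facts E0 E1 hr.
rewrite cmodE /curve_pt/=; move: (curve_cos _ r) c2 => c c2.
rewrite !exprMn sqr_sqrtr ?(ltW c2)// -mulrDr addrC subrK mulr1.
by rewrite sqrtr_sqr ger0_norm//; case/andP: hr.
Qed.

(** Runs from the corner to u with decreasing modulus; [curve_up] returns from u along the conjugate
    curve. *)
Definition curve_down (u S E : R) : R -> R[i] :=
  aff_path u S (fun x => curve_pt E (curve_top E * (1 - x))).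

Definition curve_up (u S E : R) : R -> R[i] :=
  aff_path u S (fun x => conjc (curve_pt E (curve_top E * x))).

Lemma cder_reparam (g : R -> R[i]) (h : R -> R) x (d : R[i]) (e : R) :
  cder g (h x) d -> is_derive x 1 h e -> cder (fun y => g (h y)) x (e%:C * d).
Proof.
move=> [g1 g2] dh; split.
  apply: rder_eq (rder_comp (f := fun y => Re (g y)) g1 dh) _.
  by rewrite Re_scale mulrC.
apply: rder_eq (rder_comp (f := fun y => Im (g y)) g2 dh) _.
by rewrite Im_scale mulrC.
Qed.

Lemma ccont_reparam (g : R -> R[i]) (h : R -> R) x :
  ccont g (h x) -> {for x, continuous h} -> ccont (fun y => g (h y)) x.
Proof.
move=> [g1 g2] ch; split; first exact: (rcont_comp (f := fun y => Re (g y))).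
exact: (rcont_comp (f := fun y => Im (g y))).
Qed.

Lemma ccontJ (g : R -> R[i]) x : ccont g x -> ccont (fun y => (conjc (g y))) x.
Proof.
move=> [g1 g2]; apply: ccontP g1 (rcontN g2) => y.
by apply: eqC; rewrite ?Re_J ?Im_J.
Qed.

Lemma cderJ (g : R -> R[i]) x d : cder g x d -> cder (fun y => (conjc (g y))) x (conjc d).
Proof.
move=> [g1 g2]; split.
  by rewrite Re_J; apply: rder_fun g1; apply/funext => y; rewrite Re_J.
by rewrite Im_J; apply: rder_fun (rderN g2); apply/funext => y; rewrite Im_J.
Qed.

Section Curves.
Context (u S E : R).

Let rder_1B (x : R) : is_derive x 1 (fun x : R => curve_top E * (1 - x)) (- curve_top E).
Proof.
by apply: rder_eq (rderZ _ (rderB (rder_cst 1 x) (rder_id x))) _; rewrite sub0r mulrN1.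
Qed.

Let rder_S (x : R) : is_derive x 1 (fun x : R => curve_top E * x) (curve_top E).
Proof. by apply: rder_eq (rderZ _ (rder_id x)) _; rewrite mulr1. Qed.

Lemma curve_down_gpath : 0 < E -> E <= 100^-1 -> gpath (curve_down u S E) /\
  forall x, 0 < x < 1 -> cmod (path_deriv (curve_down u S E) x) <= `|S| * (curve_top E * 3).
Proof.
move=> E0 E1; have t1 := curve_top_ge1 E0 E1; have t0 : 0 < curve_top E by lra.
have din x : 0 < x < 1 -> 0 < curve_top E * (1 - x) <= curve_top E.
  by move=> /andP[x0 x1]; rewrite mulr_gt0 ?subr_gt0//= ler_piMr//; lra.
have din' x : 0 <= x <= 1 -> 0 <= curve_top E * (1 - x) <= curve_top E.
  by move=> /andP[x0 x1]; rewrite mulr_ge0 ?subr_ge0 ?(ltW t0)//= ler_piMr//; lra.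
pose H x := S%:C * ((- curve_top E)%:C * curve_pt_deriv E (curve_top E * (1 - x))).
have dd x : 0 < x < 1 -> cder (curve_down u S E) x (H x).
  move=> hx; apply: cder_aff; apply: (cder_reparam (g := curve_pt E) _ (rder_1B x)).
  exact: cder_curve_pt (din x hx).
split.
  apply: (gpath_intro (H := H)) => // x hx.
    by apply: ccont_aff; apply: (ccont_reparam (g := curve_pt E)); [exact: ccont_curve_pt|exact: rder_cont (rder_1B x)].
  do 2 (apply: ccontM; first exact: ccont_cst).
  apply: (ccont_reparam (g := curve_pt_deriv E)); last exact: rder_cont (rder_1B x).
  exact: ccont_curve_pt_deriv (din' x hx).
move=> x hx; rewrite (cder_path_deriv (dd x hx)) /H !cmodM !cmodR normrN (gtr0_norm t0).
apply: ler_wpM2l => //; apply: ler_wpM2l; first exact: ltW.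
exact: cmod_curve_pt_deriv (din x hx).
Qed.

Lemma curve_up_gpath : 0 < E -> E <= 100^-1 -> gpath (curve_up u S E) /\
  forall x, 0 < x < 1 -> cmod (path_deriv (curve_up u S E) x) <= `|S| * (curve_top E * 3).
Proof.
move=> E0 E1; have t1 := curve_top_ge1 E0 E1; have t0 : 0 < curve_top E by lra.
have din x : 0 < x < 1 -> 0 < curve_top E * x <= curve_top E.
  by move=> /andP[x0 x1]; rewrite mulr_gt0//= ler_piMr//; lra.
have din' x : 0 <= x <= 1 -> 0 <= curve_top E * x <= curve_top E.
  by move=> /andP[x0 x1]; rewrite mulr_ge0 ?(ltW t0)//= ler_piMr//; lra.
pose H x := S%:C * conjc ((curve_top E)%:C * curve_pt_deriv E (curve_top E * x)).
have dd x : 0 < x < 1 -> cder (curve_up u S E) x (H x).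
  move=> hx; apply: cder_aff; apply: cderJ.
  apply: (cder_reparam (g := curve_pt E) _ (rder_S x)).
  exact: cder_curve_pt (din x hx).
split.
  apply: (gpath_intro (H := H)) => // x hx.
    apply: ccont_aff; apply: ccontJ; apply: (ccont_reparam (g := curve_pt E)); [exact: ccont_curve_pt|exact: rder_cont (rder_S x)].
  apply: ccontM; first exact: ccont_cst.
  apply: ccontJ; apply: ccontM; first exact: ccont_cst.
  apply: (ccont_reparam (g := curve_pt_deriv E)); last exact: rder_cont (rder_S x).
  exact: ccont_curve_pt_deriv (din' x hx).
move=> x hx; rewrite (cder_path_deriv (dd x hx)) /H cmodM cmodJ !cmodM !cmodR (gtr0_norm t0).
apply: ler_wpM2l => //; apply: ler_wpM2l; first exact: ltW.
exact: cmod_curve_pt_deriv (din x hx).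
Qed.

End Curves.

End ConcretePaths.

(** * Winding numbers and double integrals on chains *)

Section ChainTools.
Context {R : realType}.
Implicit Types (f h phi psi : R[i] -> R[i]) (z w a : R[i]) (g : R -> R[i]) (L M : seq (R -> R[i])).

Lemma chain_int_cat L M f : chain_int (L ++ M) f = chain_int L f + chain_int M f.
Proof. by rewrite /chain_int big_cat. Qed.

Lemma gchain_cat L M : gchain (L ++ M) <-> gchain L /\ gchain M.
Proof.
elim: L => [|g L ih] /=; first by split => // -[].
by rewrite ih; split=> [[h1 [h2 h3]]|[[h1 h2] h3]].
Qed.

Lemma linked_cat L M z w a : linked L z w -> linked M w a -> linked (L ++ M) z a.
Proof.
elim: L z => [|g L ih] z /=; first by move=> ->.
by move=> [h1 h2] h3; split => //; exact: ih.
Qed.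

Lemma on_chain_cat L M (P : R[i] -> Prop) :
  on_chain (L ++ M) P <-> on_chain L P /\ on_chain M P.
Proof.
elim: L => [|g L ih] /=; first by split => // -[].
by rewrite ih; split=> [[h1 [h2 h3]]|[[h1 h2] h3]].
Qed.

(** L avoids the half-line to the left of p and M the one to the right, so [clog (z - p)] and
    [clog (p - z)] are primitives on them. By [clog_subN] their increments add up to 2 pi i. *)
Lemma chain_int_winding L M (p : R) a : gchain L -> gchain M ->
  linked L (conjc a) a -> linked M a (conjc a) -> 0 < Im a ->
  on_chain L (fun z => slit (z - p%:C)) -> on_chain M (fun z => slit (p%:C - z)) ->
  chain_int (L ++ M) (fun z => (z - p%:C)^-1) = 0 +i* (2 * pi).
Proof.
move=> gL gM lL lM ia sL sM; rewrite chain_int_cat.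
have nz z : slit (z - p%:C) -> z != p%:C by move=> /slit_neq0; rewrite subr_eq0.
have nz' z : slit (p%:C - z) -> z != p%:C by move=> /slit_neq0; rewrite subr_eq0 eq_sym.
rewrite (chain_FTC (F := fun z => clog (z - p%:C)) gL lL).
- rewrite (chain_FTC (F := fun z => clog (p%:C - z)) gM lM).
  + have iz : 0 < Im (a - p%:C) by rewrite ImB subr0.
    have e : conjc (a - p%:C) = (conjc a) - p%:C by case: (a) => p1 p2; apply: eqC => /=; ring.
    have := clog_subN iz; rewrite e !opprB => <-.
    by [].
  + by apply: on_chainW sM => z /nz' h; exact: hcont_subV.
  + by apply: on_chainW sM => z h; exact: hcont_clog_subr.
  + by apply: on_chainW sM => z h; exact: hder_clog_subr.
- by apply: on_chainW sL => z /nz h; exact: hcont_subV.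
- by apply: on_chainW sL => z h; exact: hcont_clog_sub.
- by apply: on_chainW sL => z h; exact: hder_clog_sub.
Qed.

Lemma chain_int_outside L (p : R) a : gchain L -> linked L a a ->
  on_chain L (fun z => slit (z - p%:C)) ->
  chain_int L (fun z => (z - p%:C)^-1) = 0.
Proof.
move=> gL lL sL.
have nz z : slit (z - p%:C) -> z != p%:C by move=> /slit_neq0; rewrite subr_eq0.
apply: (chain_int_closed (F := fun z => clog (z - p%:C)) gL lL).
- by apply: on_chainW sL => z /nz h; exact: hcont_subV.
- by apply: on_chainW sL => z h; exact: hcont_clog_sub.
- by apply: on_chainW sL => z h; exact: hder_clog_sub.
Qed.

(** As |z - u| < |w - u|, the quotient (w - z) / (w - u) has positive real part, and its logarithm
    is a primitive. If w = u no point of the chain satisfies the assumption, whence the replacement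
    of the integrand by 0. *)
Lemma chain_int_far L (u : R) w a : gchain L -> linked L a a ->
  on_chain L (fun z => cmod (z - u%:C) < cmod (w - u%:C)) ->
  chain_int L (fun z => (z - w)^-1) = 0.
Proof.
move=> gL lL far.
have [w0|w0] := eqVneq w u%:C.
  rewrite -[RHS](chain_int0 L); apply: chain_int_ext; apply: on_chainW far => z.
  by rewrite w0 subrr cmod0 ltNge cmod_ge0.
pose k := (w - u%:C)^-1.
have wu0 : w - u%:C != 0 by rewrite subr_eq0.
have s z : cmod (z - u%:C) < cmod (w - u%:C) -> slit ((w - z) * k).
  move=> h; rewrite /slit; suff -> : 0 < Re ((w - z) * k) by [].
  have -> : (w - z) * k = 1 - (z - u%:C) * k by rewrite /k; field.
  rewrite ReB Re1 subr_gt0; apply: le_lt_trans (Re_le _) _.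
  by rewrite cmodM cmodV ltr_pdivrMr ?mul1r// cmod_gt0.
have zw z : cmod (z - u%:C) < cmod (w - u%:C) -> z != w.
  by apply: contraTneq => ->; rewrite ltxx.
apply: (chain_int_closed (F := fun z => clog ((w - z) * k)) gL lL).
- by apply: on_chainW far => z /zw h; exact: hcont_subV.
- apply: on_chainW far => z /s h; apply: (hcont_comp (f := @clog R)); last exact: hcont_clog.
  apply: hcontM; last exact: hcont_cst.
  by apply: hcontB; [exact: hcont_cst|exact: hcont_id].
- apply: on_chainW far => z hz; have zw0 : z - w != 0 by rewrite subr_eq0 zw.
  have h1 : hder (fun z => (w - z) * k) z (k * -1).
    split=> g x e gx hg; have := hderP (hderZ k (hder_subr w z)) gx hg.
    by rewrite (_ : (fun y => (w - g y) * k) = fun y => k * (w - g y))//; apply/funext => y; rewrite mulrC.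
  have := hder_comp (f := @clog R) h1 (hder_clog (s z hz)).
  move/hder_eq; apply; have wz0 : w - z != 0 by rewrite -opprB oppr_eq0.
  have k0 : k != 0 by rewrite invr_eq0.
  by field; rewrite zw0 k0 wz0.
Qed.

(** The parameter interval has length 1, so a bound on the speed of a path also bounds its
    length. *)
Fixpoint chain_len L (l : seq R) : Prop :=
  match L, l with
  | g :: L', a :: l' => (forall x, 0 < x < 1 -> cmod (path_deriv g x) <= a) /\ chain_len L' l'
  | [::], [::] => True
  | _, _ => False
  end.

Lemma chain_int_le L l f (K : R) : gchain L -> chain_len L l -> on_chain L (hcont f) ->
  on_chain L (fun z => cmod (f z) <= K) -> cmod (chain_int L f) <= K * \sum_(a <- l) a.
Proof.
rewrite /chain_int; elim: L l => [|g L ih] [|a l] //=.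
  by rewrite !big_nil mulr0 cmod0.
move=> [gg gL] [ha hl] [cg cL] [kg kL]; rewrite !big_cons mulrDr.
apply: (le_trans (cmodD _ _)); apply: lerD; last exact: ih.
apply: path_int_le_cst => // x /[dup] hx /andP[/ltW x0 /ltW x1].
by apply: ler_pM; rewrite ?cmod_ge0 ?ha//; apply: kg; rewrite x0.
Qed.

Lemma chain_cauchy_hcont M psi w : gchain M -> on_chain M (hcont psi) ->
  on_chain M (fun z => z != w) ->
  hcont (fun w => chain_int M (fun z => (w - z)^-1 * psi z)) w.
Proof.
elim: M => [|g M ih] /=.
  move=> _ _ _; apply: (hcont_ext _ (hcont_cst 0 w)) => w'.
  by rewrite /chain_int big_nil.
move=> [gg gM] [cg cM] [ng nM].
apply: (@hcont_ext _ (fun w => path_int g (fun z => (w - z)^-1 * psi z) + chain_int M (fun z => (w - z)^-1 * psi z))).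
  by move=> w'; rewrite /chain_int big_cons.
by apply: hcontD; [exact: cauchy_hcont|exact: ih].
Qed.

(** The form of J_n up to its constant: the integrand is a function of w times a function of z times
    the Cauchy kernel. The factor phi w stays outside the inner integral, so that continuity in w is
    that of a Cauchy integral. *)
Definition double_int L M phi psi :=
  chain_int L (fun w => phi w * chain_int M (fun z => (w - z)^-1 * psi z)).

Lemma cauchy_kernel_hcont psi w z : z != w -> hcont psi z ->
  hcont (fun z => (w - z)^-1 * psi z) z.
Proof.
move=> zw cp; apply: hcontM => //; apply: hcontV.
  by rewrite subr_eq0 eq_sym.
by apply: hcontB; [exact: hcont_cst|exact: hcont_id].
Qed.

Lemma double_int_outer_hcont L M phi psi : gchain M -> on_chain L (hcont phi) ->
  on_chain M (hcont psi) -> on_chain L (fun w => on_chain M (fun z => z != w)) ->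
  on_chain L (hcont (fun w => phi w * chain_int M (fun z => (w - z)^-1 * psi z))).
Proof.
move=> gM cp cs sep; apply: on_chainW (on_chain_and cp sep) => w [h1 h2].
by apply: hcontM => //; exact: chain_cauchy_hcont.
Qed.

Lemma double_int_catl L L' M phi psi :
  double_int (L ++ L') M phi psi = double_int L M phi psi + double_int L' M phi psi.
Proof. exact: chain_int_cat. Qed.

Lemma double_int_catr L M M' phi psi : gchain L -> gchain M -> gchain M' ->
  on_chain L (hcont phi) -> on_chain M (hcont psi) -> on_chain M' (hcont psi) ->
  on_chain L (fun w => on_chain M (fun z => z != w)) ->
  on_chain L (fun w => on_chain M' (fun z => z != w)) ->
  double_int L (M ++ M') phi psi = double_int L M phi psi + double_int L M' phi psi.
Proof.
move=> gL gM gM' cp cs cs' sep sep'; rewrite /double_int -chain_intD//.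
- apply: chain_int_ext; apply: on_chain_all => w.
  by rewrite chain_int_cat mulrDr.
- exact: double_int_outer_hcont.
- exact: double_int_outer_hcont.
Qed.

Lemma double_int_le L M l m phi psi (d P Q : R) : gchain L -> gchain M ->
  chain_len L l -> chain_len M m -> 0 < d -> 0 <= P -> 0 <= Q ->
  on_chain L (hcont phi) -> on_chain M (hcont psi) ->
  on_chain L (fun w => cmod (phi w) <= P) -> on_chain M (fun z => cmod (psi z) <= Q) ->
  on_chain L (fun w => on_chain M (fun z => d <= cmod (w - z))) ->
  cmod (double_int L M phi psi) <= P * Q / d * (\sum_(a <- l) a) * (\sum_(a <- m) a).
Proof.
move=> gL gM lL lM d0 P0 Q0 cp cs bp bs sep.
have sep' : on_chain L (fun w => on_chain M (fun z => z != w)).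
  apply: on_chainW sep => w; apply: on_chainW => z.
  by apply: contraTneq => ->; rewrite subrr cmod0 -ltNge.
have -> : P * Q / d * (\sum_(a <- l) a) * (\sum_(a <- m) a) =
  P * (d^-1 * Q * (\sum_(a <- m) a)) * (\sum_(a <- l) a) by ring.
apply: chain_int_le => //; first exact: double_int_outer_hcont.
apply: on_chainW (on_chain_and (on_chain_and bp sep) sep') => w [[h1 h2] h3].
rewrite cmodM; apply: ler_pM; rewrite ?cmod_ge0//.
apply: chain_int_le => //.
  by apply: on_chainW (on_chain_and h3 cs) => z [h4 h5]; exact: cauchy_kernel_hcont.
apply: on_chainW (on_chain_and h2 bs) => z [h4 h5].
rewrite cmodM cmodV; apply: ler_pM; rewrite ?invr_ge0 ?cmod_ge0//.
by rewrite lef_pV2// posrE// (lt_le_trans d0).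
Qed.

Lemma pole_cancel (n : nat) (x : 'I_n -> R) (u : R) (k : nat) (j : 'I_n) z :
  injective x -> x j = u ->
  (z - u%:C) ^+ k.+2 * \prod_i (z - (x i)%:C)^-1 =
  (z - u%:C) ^+ k.+1 * \prod_(i | x i != u) (z - (x i)%:C)^-1.
Proof.
move=> xinj xj; rewrite (bigD1 j)//= xj (eq_bigl (fun i => x i != u)); last first.
  by move=> i; rewrite -xj (inj_eq xinj).
have [->|zu] := eqVneq z u%:C.
  by rewrite subrr !expr0n !mul0r.
by rewrite exprSr mulrA mulfK// subr_eq0.
Qed.

(** The reciprocal of [weight] with (z - u)^k in front: for k > 0 it is 0 at u, and for k >= 2 it is
    continuous there even if some x_i equals u. *)
Definition inv_weight (n : nat) (x : 'I_n -> R) (u : R) (k : nat) z : R[i] :=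
  (z - u%:C) ^+ k * \prod_i (z - (x i)%:C)^-1.

Lemma inv_weightE (n : nat) (x : 'I_n -> R) (u : R) (k : nat) z :
  inv_weight x u k z = (weight x u k z)^-1.
Proof. by rewrite /inv_weight /weight invfM invrK mulrC prodfV. Qed.

Lemma inv_weight_hcont (n : nat) (x : 'I_n -> R) (u : R) (k : nat) z :
  injective x -> (2 <= k)%N -> (forall i, x i != u -> z != (x i)%:C) ->
  hcont (inv_weight x u k) z.
Proof.
move=> xinj; case: k => [|[|k]] // _ zx.
have hV i : x i != u -> hcont (fun z => (z - (x i)%:C)^-1) z.
  by move=> xi; apply: hcont_subV; exact: zx.
have [j /eqP xj|nu] := pickP (fun j => x j == u).
  apply: (@hcont_ext _ (fun z => (z - u%:C) ^+ k.+1 * \prod_(i | x i != u) (z - (x i)%:C)^-1)).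
    by move=> w; rewrite /inv_weight (pole_cancel _ _ xinj xj).
  by apply: hcontM; [apply: hcontX; exact: hcont_sub|exact: hcont_prod].
apply: hcontM; first by apply: hcontX; exact: hcont_sub.
by apply: hcont_prod => i _; apply: hV; rewrite nu.
Qed.

Lemma weight_hcont (n : nat) (x : 'I_n -> R) (v : R) (m : nat) w :
  w != v%:C -> hcont (weight x v m) w.
Proof.
move=> wv; apply: hcontM; first by apply: hcont_prod => i _; exact: hcont_sub.
apply: hcontV; first by rewrite expf_neq0// subr_eq0.
by apply: hcontX; exact: hcont_sub.
Qed.

End ChainTools.

(** * The local contours *)

Section LocalChain.
Context {R : realType}.
Implicit Types (f : R[i] -> R[i]) (z w : R[i]) (t k rho al : R).

(** The paths of [int_c] and [int_k] in order of travel, from angle - al up to angle al. *)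
Definition local_paths (rho al : R) : seq (R -> R[i]) :=
  [:: circle_arc rho (- al) (- (pi / 2)); segment_path (0 +i* - rho) (0 +i* rho);
      circle_arc rho (pi / 2) al].

Definition local_chain (t k rho al : R) := [seq aff_path t k g | g <- local_paths rho al].

Lemma chain_int3 (a b c : R -> R[i]) f :
  chain_int [:: a; b; c] f = path_int b f + (path_int a f + path_int c f).
Proof.
rewrite /chain_int !big_cons big_nil.
by move: (path_int a f) (path_int b f) (path_int c f) => p q r; rewrite addr0 addrCA.
Qed.

Lemma local_chain_int t k rho al f :
  chain_int (local_chain t k rho al) f =
  int_k rho (fun z => k%:C * f (t%:C + k%:C * z)) +
  int_c rho al (fun z => k%:C * f (t%:C + k%:C * z)).
Proof.
have dA (a b x : R) : exists d, cder (circle_arc rho a b) x d by eexists; exact: cder_arc.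
have dS (z w : R[i]) (x : R) : exists d, cder (segment_path z w) x d.
  by eexists; exact: cder_segment.
rewrite chain_int3 (path_int_aff _ _ _ (dA _ _)) (path_int_aff _ _ _ (dA _ _)) (path_int_aff _ _ _ (dS _ _)).
by [].
Qed.

Lemma local_gchain t k rho al : gchain (local_chain t k rho al).
Proof.
by do 3 (split; first by apply: gpath_aff; first [exact: gpath_arc|exact: gpath_segment]).
Qed.

Lemma circle_arc0 (rho al be : R) : circle_arc rho al be 0 = rho%:C * cexp (0 +i* al).
Proof. by rewrite /circle_arc mul0r addr0. Qed.

Lemma circle_arc1 (rho al be : R) : circle_arc rho al be 1 = rho%:C * cexp (0 +i* be).
Proof. by rewrite /circle_arc mul1r addrC subrK. Qed.

Lemma cexp_imag (b : R) : cexp (0 +i* b) = cos b +i* sin b.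
Proof. by apply: eqC; rewrite /= expR0 mul1r. Qed.

Lemma local_linked t k rho al :
  linked (local_chain t k rho al) (conjc (t%:C + k%:C * (rho%:C * cexp (0 +i* al))))
    (t%:C + k%:C * (rho%:C * cexp (0 +i* al))).
Proof.
have e1 : rho%:C * cexp (0 +i* - (pi / 2)) = 0 +i* - rho :> R[i].
  by rewrite cexp_imag cosN sinN cos_pihalf sin_pihalf scaleCE; apply: eqC => /=; ring.
have e2 : rho%:C * cexp (0 +i* (pi / 2)) = 0 +i* rho :> R[i].
  by rewrite cexp_imag cos_pihalf sin_pihalf scaleCE; apply: eqC => /=; ring.
have s0 : segment_path (0 +i* - rho) (0 +i* rho) 0 = 0 +i* - rho :> R[i].
  by rewrite /segment_path rmorph0 mul0r addr0.
have s1 : segment_path (0 +i* - rho) (0 +i* rho) 1 = 0 +i* rho :> R[i].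
  by rewrite /segment_path rmorph1 mul1r addrC subrK.
rewrite /local_chain /= /aff_path !circle_arc0 !circle_arc1 s0 s1 e1 e2.
split=> //; rewrite !cexp_imag cosN sinN.
apply: eqC; rewrite ?Re_J ?Im_J !(ReD, ImD) !(Re_scale, Im_scale) /= ?expR0; ring.
Qed.

End LocalChain.

Section LocalPoints.
Context {R : realType}.
Implicit Types (f : R[i] -> R[i]) (z w : R[i]) (t k rho al : R).

(** What the estimates retain of a local contour: the segment lies on the imaginary axis, and on the
    arcs |Re z| is largest at the corner. *)
Definition near_axis rho al z :=
  (Re z = 0 /\ `|Im z| <= rho) \/ (cmod z = rho /\ `|Re z| <= rho * `|cos al|).

Lemma near_axis_cmod rho al z : 0 <= rho -> near_axis rho al z -> cmod z <= rho.
Proof.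
move=> r0 [[e h]|[-> //]].
by rewrite (complex_eta z) e cmod_imag.
Qed.

Lemma cos_between al (x : R) : 0 <= al <= pi -> 0 <= x <= 1 ->
  `|cos (pi / 2 + x * (al - pi / 2))| <= `|cos al|.
Proof.
move=> /andP[a0 ap] /andP[x0 x1]; have p0 := @pi_gt0 R.
have mono (a b : R) : 0 <= a <= b -> b <= pi -> cos b <= cos a.
  move=> /andP[h1 h2] h3; have [->//|ab] := eqVneq a b.
  by rewrite ltW// ltr_cos ?in_itv/= ?h1 ?h3 ?(le_trans h1)// ?(le_trans h2)// lt_neqAle ab.
have [h|h] := leP al (pi / 2).
  have b1 : al <= pi / 2 + x * (al - pi / 2) by nra.
  have b2 : pi / 2 + x * (al - pi / 2) <= pi / 2 by nra.
  have c1 := mono al (pi / 2 + x * (al - pi / 2)).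
  have c2 := mono (pi / 2 + x * (al - pi / 2)) (pi / 2); rewrite cos_pihalf in c2.
  have d2 : 0 <= cos (pi / 2 + x * (al - pi / 2)) by apply: c2; lra.
  have d1 : cos (pi / 2 + x * (al - pi / 2)) <= cos al by apply: c1; lra.
  by rewrite !ger0_norm// (le_trans d2).
have b1 : pi / 2 <= pi / 2 + x * (al - pi / 2) by nra.
have b2 : pi / 2 + x * (al - pi / 2) <= al by nra.
have c1 := mono (pi / 2 + x * (al - pi / 2)) al.
have c2 := mono (pi / 2) (pi / 2 + x * (al - pi / 2)); rewrite cos_pihalf in c2.
have d2 : cos (pi / 2 + x * (al - pi / 2)) <= 0 by apply: c2; lra.
have d1 : cos al <= cos (pi / 2 + x * (al - pi / 2)) by apply: c1; lra.
by rewrite !ler0_norm ?lerN2// (le_trans d1).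
Qed.

Lemma cmod_circle_arc rho (a b x : R) : 0 <= rho -> cmod (circle_arc rho a b x) = rho.
Proof. by move=> r0; rewrite cmodM cmod_cexp cmodR expR0 mulr1 ger0_norm. Qed.

Lemma Re_circle_arc rho (a b x : R) : Re (circle_arc rho a b x) = rho * cos (a + x * (b - a)).
Proof. by rewrite Re_scale /= expR0 mul1r. Qed.

Lemma Im_circle_arc rho (a b x : R) : Im (circle_arc rho a b x) = rho * sin (a + x * (b - a)).
Proof. by rewrite Im_scale /= expR0 mul1r. Qed.

Lemma local_paths_near_axis rho al : 0 <= rho -> 0 <= al <= pi ->
  on_chain (local_paths rho al) (near_axis rho al).
Proof.
move=> r0 ha; split; last split; last split => //.
- move=> x hx; right; rewrite cmod_circle_arc//; split => //.
  rewrite Re_circle_arc normrM ger0_norm//; apply: ler_wpM2l => //.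
  have -> : - al + x * (- (pi / 2) - - al) = - (pi / 2 + (1 - x) * (al - pi / 2)) by ring.
  by rewrite cosN; apply: cos_between => //; lra.
- move=> x hx; left; rewrite /segment_path.
  have -> : (0 +i* - rho) + x%:C * ((0 +i* rho) - (0 +i* - rho)) = 0 +i* (rho * (2 * x - 1)) :> R[i].
    by apply: eqC => /=; ring.
  split=> //=; rewrite normrM ger0_norm//; apply: ler_piMr => //.
  by rewrite ler_norml; lra.
- move=> x hx; right; rewrite cmod_circle_arc//; split => //.
  rewrite Re_circle_arc normrM ger0_norm//; apply: ler_wpM2l => //.
  exact: cos_between.
Qed.

Lemma on_local_chain t k rho al (P : R[i] -> Prop) : 0 <= rho -> 0 <= al <= pi ->
  (forall z, near_axis rho al z -> P (t%:C + k%:C * z)) -> on_chain (local_chain t k rho al) P.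
Proof.
move=> r0 ha h; have [h1 [h2 [h3 _]]] := local_paths_near_axis r0 ha.
by split; [|split; [|split]] => // x hx; apply: h; [exact: h1|exact: h2|exact: h3].
Qed.

Lemma local_chain_len t k rho al : 0 <= rho -> 0 <= k -> 0 <= al <= pi ->
  chain_len (local_chain t k rho al) [:: 2 * (k * rho); 2 * (k * rho); 2 * (k * rho)].
Proof.
move=> r0 k0 /andP[a0 ap]; have p2 := @pihalf_lt2 R; have p0 := @pi_gt0 R.
have kr : 0 <= k * rho by rewrite mulr_ge0.
have arc (a b x : R) : `|b - a| <= 2 ->
    cmod (path_deriv (aff_path t k (circle_arc rho a b)) x) <= 2 * (k * rho).
  move=> h; rewrite (path_deriv_aff _ _ (cder_arc _ _ _ _)) cmodM cmodR cmod_arc_deriv// ger0_norm//.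
  by rewrite mulrA [leRHS]mulrC; apply: ler_wpM2l.
split; [|split; [|split]] => //.
- by move=> x _; apply: arc; rewrite ler_norml; lra.
- move=> x _; rewrite (path_deriv_aff _ _ (cder_segment _ _ _)) cmodM cmodR cmod_segment_deriv ger0_norm//.
  have -> : (0 +i* rho) - (0 +i* - rho) = 0 +i* (2 * rho) :> R[i] by apply: eqC => /=; ring.
  by rewrite cmod_imag ger0_norm ?mulr_ge0// mulrCA.
- by move=> x _; apply: arc; rewrite ler_norml; lra.
Qed.

(** From sin y <= y at 3 / 8, two duplications give cos (3 / 4) >= 23 / 32 and cos (3 / 2) > 0. The
    numerical constants of G_n need this precision. *)
Lemma pi_ge3 : 3 <= pi :> R.
Proof.
have sin_le (y : R) : 0 <= y -> sin y <= y.
  move=> y0; have [->|yn] := eqVneq y 0; first by rewrite sin0.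
  have yp : 0 < y by rewrite lt_neqAle eq_sym yn.
  have dd (p : R) : is_derive p 1 (fun p : R => p - sin p) (1 - cos p) by apply: rderB.
  have [|c _ e] := MVT yp (fun p _ => dd p).
    by apply: within_cont => p _; apply: (rder_cont (dd p)).
  move: e; rewrite sin0 !subr0 => e; rewrite -subr_ge0 e mulr_ge0// subr_ge0; exact: cos_le1.
have c38 : 23 / 32 <= cos (3 / 4 : R).
  have -> : (3 / 4 : R) = (3 / 8) *+ 2 by rewrite -mulr_natr; field.
  rewrite cos_mulr2n cos2sin2 -mulr_natr.
  have h0 : 0 <= sin (3 / 8 : R).
    by apply: sin_ge0_pi; have := @pi_ge2 R; lra.
  have h1 : sin (3 / 8 : R) <= 3 / 8 by apply: sin_le; lra.
  have : sin (3 / 8 : R) ^+ 2 <= (3 / 8) ^+ 2 by rewrite ler_sqr ?nnegrE//; lra.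
  lra.
have c15 : 0 < cos (3 / 2 : R).
  have -> : (3 / 2 : R) = (3 / 4) *+ 2 by rewrite -mulr_natr; field.
  rewrite cos_mulr2n -mulr_natr.
  have : (23 / 32 : R) ^+ 2 <= cos (3 / 4) ^+ 2 by rewrite ler_sqr ?nnegrE//; lra.
  lra.
rewrite leNgt; apply/negP => p3; have p2 := @pi_ge2 R.
have : cos (3 / 2 : R) < cos (pi / 2).
  rewrite ltr_cos ?in_itv/=; lra.
by rewrite cos_pihalf; lra.
Qed.

(** From exp (- 1 / 8) >= 7 / 8, since (8 / 7)^8 <= 3. *)
Lemma expR1_le3 : expR 1 <= 3 :> R.
Proof.
have h := @expR_ge1Dx R (- 8^-1).
have e : expR (1 : R) = (expR (- 8^-1))^-1 ^+ 8.
  by rewrite -expRN opprK -expRM_natl; congr expR; field.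
have c : (8 / 7 : R) ^+ 8 <= 3 by lra.
rewrite e; apply: (le_trans _ c).
apply: lerXn2r; rewrite ?nnegrE ?invr_ge0 ?expR_ge0//.
have -> : (8 / 7 : R) = (7 / 8)^-1 by field.
by rewrite lef_pV2 ?posrE ?expR_gt0//; lra.
Qed.

End LocalPoints.

(** * The contours *)

Section RestOfContours.
Context {R : realType}.
Implicit Types (w z : R[i]) (q u v s : R).

Lemma ler_cos_pi (a b : R) : 0 <= a -> a <= b -> b <= pi -> cos b <= cos a.
Proof.
move=> a0 ab bp.
have ia : a \in `[0, pi] by rewrite in_itv/= a0 (le_trans ab).
have ib : b \in `[0, pi] by rewrite in_itv/= bp (le_trans a0).
by rewrite leNgt ltr_cos// -leNgt.
Qed.

Lemma cos_reflect (y : R) : cos (2 * pi - y) = cos y.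
Proof. by rewrite cosB mulr_natl cos2pi sin2pi mul1r mul0r addr0. Qed.

Lemma sin_reflect (y : R) : sin (2 * pi - y) = - sin y.
Proof. by rewrite sinB mulr_natl cos2pi sin2pi mul1r mul0r add0r. Qed.

(** The circle around v is run from w0 to its conjugate through the left of v. On this arc Re w <=
    Re w0, as [weight_circle_le] requires, and the half-line to the right of v is not met. *)
Lemma circle_rest (n : nat) (x : 'I_n -> R) v (m : nat) w0 : 0 < Im w0 ->
  \sum_i (x i - v) / cmod (w0 - (x i)%:C) ^+ 2 <= 0 ->
  exists Rw : seq (R -> R[i]), [/\ gchain Rw, linked Rw w0 (conjc w0),
    chain_len Rw [:: 2 * pi * cmod (w0 - v%:C)]
  & on_chain Rw (fun w => [/\ slit (v%:C - w), cmod (w - v%:C) = cmod (w0 - v%:C)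
      & cmod (weight x v m w) <= cmod (weight x v m w0)])].
Proof.
move=> I0 hsum; set a := w0 - v%:C; set rr := cmod a; set ph := carg a.
have Ia : 0 < Im a by rewrite ImB ImC subr0.
have a0 : a != 0 by apply: contraTneq Ia => ->; rewrite Im0 ltxx.
have r0 : 0 < rr by rewrite cmod_gt0.
have p0 := @pi_gt0 R.
have [ph0 php] : 0 < ph /\ ph < pi.
  rewrite /ph (carg_Im_gt0 Ia).
  have := atan_gtNpi2 (Re a / Im a); have := atan_ltpi2 (Re a / Im a); lra.
have ang (y : R) : 0 <= y <= 1 -> cos (ph + y * (2 * pi - ph - ph)) <= cos ph.
  move=> hy; have [yh|yh] := leP y (1 / 2).
    have h : y * (2 * pi - ph - ph) <= (1 / 2) * (2 * pi - ph - ph) by apply: ler_wpM2r; lra.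
    have h' : 0 <= y * (2 * pi - ph - ph) by apply: mulr_ge0; lra.
    by apply: ler_cos_pi; lra.
  have h : (1 / 2) * (2 * pi - ph - ph) <= y * (2 * pi - ph - ph) by apply: ler_wpM2r; lra.
  have h' : y * (2 * pi - ph - ph) <= 1 * (2 * pi - ph - ph) by apply: ler_wpM2r; lra.
  by rewrite -(cos_reflect (ph + _)); apply: ler_cos_pi; lra.
have ec : rr * cos ph = Re a by rewrite cos_carg.
have es : rr * sin ph = Im a by rewrite sin_carg.
(* Keeps the arc off the half-line to the right of v, where the cosine of the angle would be 1. *)
have cph : cos ph < 1.
  rewrite lt_neqAle cos_le1 andbT; apply/eqP => c1.
  move: es; have /eqP -> : sin ph == 0 by rewrite -norm_cos_eq1 c1 normr1.
  by rewrite mulr0 => e; move: Ia; rewrite -e ltxx.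
have pt (z : R[i]) : v%:C + 1%:C * z - v%:C = z by rewrite addrC addKr; case: z => zr zi; apply: eqC => /=; ring.
exists [:: aff_path v 1 (circle_arc rr ph (2 * pi - ph))]; split => /=.
- by split=> //; apply/gpath_aff/gpath_arc.
- have eR : Re a = Re w0 - v by rewrite ReB ReC.
  have eI : Im a = Im w0 by rewrite ImB ImC subr0.
  rewrite /aff_path circle_arc0 circle_arc1 !cexp_imag; split.
    by apply: eqC => /=; rewrite ?mul0r ?subr0 ?addr0 ?add0r !mul1r ?ec ?es; lra.
  rewrite cos_reflect sin_reflect; apply: eqC; rewrite ?Re_J ?Im_J /=.
    by rewrite ?mul0r ?subr0 ?addr0 ?add0r !mul1r ?ec ?es; lra.
  by rewrite ?mul0r ?subr0 ?addr0 ?add0r !mul1r mulrN es; lra.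
- split=> // y _; rewrite (path_deriv_aff _ _ (cder_arc _ _ _ _)) cmodM cmodR normr1 mul1r.
  rewrite cmod_arc_deriv; last exact: ltW.
  rewrite [leRHS]mulrC; apply: ler_wpM2l; first exact: ltW.
  by rewrite ger0_norm; lra.
- split=> // y hy; set z := circle_arc rr ph (2 * pi - ph) y.
  have ez : aff_path v 1 (circle_arc rr ph (2 * pi - ph)) y - v%:C = z by rewrite /aff_path pt.
  have cz : cmod z = rr by rewrite cmod_circle_arc// ltW.
  split.
  + rewrite -opprB ez /slit ReN ImN Re_circle_arc Im_circle_arc oppr_eq0 mulf_eq0 gt_eqF//=.
    have [sn|] := eqVneq; last by rewrite orbT.
    rewrite orbF -mulrN mulr_gt0// oppr_gt0.
    have /eqP c1 : `|cos (ph + y * (2 * pi - ph - ph))| == 1 by rewrite norm_cos_eq1 sn.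
    have := ang y hy; rewrite real_ltNge ?num_real//; apply: contraL => c0.
    by rewrite (ger0_norm c0) in c1; rewrite c1 -ltNge.
  + by rewrite ez.
  + apply: weight_circle_le => //; last 1 first.
    * have := ang y hy; rewrite -(ler_pM2l r0) ec -Re_circle_arc -/z -ez !ReB ReC; lra.
    * by move=> i; apply: contraTneq I0 => ->; rewrite ImC ltxx.
    * by rewrite ez.
Qed.

Lemma inv_weight_u (n : nat) (x : 'I_n -> R) u (k : nat) : (0 < k)%N ->
  inv_weight x u k u%:C = 0.
Proof. by move=> k0; rewrite /inv_weight subrr expr0n gtn_eqF// mul0r. Qed.

(** Here s is the critical point itself. In the variable (z - u) / (s - u) the curve is [curve_pt E]
    with E = (q / (s - u))^2, and 10 q <= s - u gives E <= 1 / 100. Each half has speed at most (s -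
    u) times 201 / 200, for the range of the modulus, times 3. The curve meets the real axis only at
    u, where [inv_weight] is 0. *)
Lemma curve_rest (n : nat) (x : 'I_n -> R) u s q (k : nat) :
  u < s -> 0 < q -> 10 * q <= s - u -> (forall i, x i < s) ->
  \sum_i (s - x i)^-1 = k%:R / (s - u) -> (0 < k)%N ->
  exists Rz : seq (R -> R[i]), [/\ gchain Rz, linked Rz (s +i* q) (conjc (s +i* q)),
    chain_len Rz [:: (s - u) * (201 / 200 * 3); (s - u) * (201 / 200 * 3)]
  & on_chain Rz (fun z => [/\ cmod (z - u%:C) <= cmod (s +i* q - u%:C),
      u <= Re z, (Im z != 0) || (z == u%:C)
      & cmod (inv_weight x u k z) <= cmod (inv_weight x u k (s +i* q))])].
Proof.
move=> us q0 qS xs crit k0; set S := s - u; have S0 : 0 < S by rewrite subr_gt0.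
set e := q / S; set E := e ^+ 2; set z0 := s +i* q.
have e0 : 0 < e by rewrite divr_gt0.
have e1 : e <= 10^-1 by rewrite /e ler_pdivrMr//; rewrite -/S in qS; lra.
have E0 : 0 < E by rewrite exprn_gt0.
have E1 : E <= 100^-1.
  have : E <= (10^-1) ^+ 2 by rewrite /E ler_sqr ?nnegrE; lra.
  lra.
set r0 := curve_top E; set c := curve_cos (curve_level E).
have r1 : 1 <= r0 by apply: curve_top_ge1.
have ep0 : u%:C + S%:C * curve_pt E r0 = z0.
  rewrite curve_pt_top//; apply: eqC => /=; rewrite ?mul0r ?subr0 ?addr0 ?add0r ?mulr1 /S; first by ring.
  by rewrite /e -/S mulrCA mulfV ?gt_eqF// mulr1.
have sub (z : R[i]) : u%:C + S%:C * z - u%:C = S%:C * z by rewrite addrC addKr.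
have cpt r : 0 <= r <= r0 -> cmod (u%:C + S%:C * curve_pt E r - u%:C) = S * r.
  by move=> hr; rewrite sub cmodM cmodR gtr0_norm// cmod_curve_pt.
have repts r : Re (u%:C + S%:C * curve_pt E r) = u + S * (r * c r).
  by rewrite /= mul0r subr0.
have impts r : Im (u%:C + S%:C * curve_pt E r) = S * (r * Num.sqrt (1 - c r ^+ 2)).
  by rewrite /= mul0r addr0 add0r.
have P r : 0 <= r <= r0 -> let z := u%:C + S%:C * curve_pt E r in
    [/\ cmod (z - u%:C) <= cmod (z0 - u%:C), u <= Re z, (Im z != 0) || (z == u%:C)
      & cmod (inv_weight x u k z) <= cmod (inv_weight x u k z0)].
  move=> hr z; have [c0 c1 c2] := curve_facts E0 E1 hr.
  have rr0 : 0 <= r <= r0 by [].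
  have {}rr0 : 0 <= r by case/andP: rr0.
  have r0r : r <= r0 by case/andP: hr.
  have cz0 : cmod (z0 - u%:C) = S * r0 by rewrite -ep0 cpt// lexx (le_trans _ r1).
  have ip : 0 < r -> Im z != 0.
    by move=> rp; rewrite impts mulf_neq0 ?gt_eqF// mulr_gt0 ?sqrtr_gt0.
  split.
  - by rewrite cz0 cpt// ler_pM2l.
  - by rewrite repts lerDl; apply: mulr_ge0; [exact: ltW|exact: mulr_ge0].
  - move: rr0; rewrite le_eqVlt => /orP[/eqP r00|/ip -> //].
    by rewrite {2}/z -r00 curve_pt0 mulr0 addr0 eqxx orbT.
  - move: rr0; rewrite le_eqVlt => /orP[/eqP r00|rp].
      by rewrite /z -r00 curve_pt0 mulr0 addr0 inv_weight_u// cmod0 cmod_ge0.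
    rewrite !inv_weightE !cmodV lef_pV2 ?posrE; first 1 last.
    + rewrite cmod_gt0; apply: weight_neq0 => [i|]; apply: contraNneq (ip rp) => ->; by rewrite ImC.
    + rewrite cmod_gt0; apply: weight_neq0 => [i|]; apply: contraTneq q0 => /(congr1 (@Im R)) /= ->; by rewrite ltxx.
    have hh p : r <= p <= r0 -> -1 < c p < 1.
      case/andP=> rp' pr0; have [|c0' c1' _] := @curve_facts _ E p E0 E1.
        by rewrite pr0 (le_trans (ltW rp)).
      by rewrite c1' andbT (lt_le_trans _ c0') ?ltrN10.
    apply: (@weight_curve_ge _ _ x u s k (curve_level E) r0 r) => //.
    + by rewrite rp.
    + exact: cpt.
    + by rewrite ReB repts ReC addrC addKr.
    + by rewrite -ep0 ReB repts ReC addrC addKr.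
have [gd ld] := curve_down_gpath u S E0 E1; have [gu lu] := curve_up_gpath u S E0 E1.
have lS : `|S| * (curve_top E * 3) <= S * (201 / 200 * 3).
  by rewrite gtr0_norm//; apply: ler_wpM2l; [exact: ltW|have := curve_top_le E0 E1; lra].
have conj (y : R) : curve_up u S E y = conjc (u%:C + S%:C * curve_pt E (r0 * y)).
  by rewrite /curve_up /aff_path -/r0; case: (curve_pt _ _) => p1 p2; apply: eqC => /=; ring.
have r00 : 0 <= r0 by rewrite (le_trans _ r1).
exists [:: curve_down u S E; curve_up u S E]; split.
- by split; last split.
- have d0 : curve_down u S E 0 = z0 by rewrite -ep0 /curve_down /aff_path subr0 mulr1.
  have d1 : curve_down u S E 1 = u%:C.
    by rewrite /curve_down /aff_path subrr mulr0 curve_pt0 mulr0 addr0.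
  have u0 : curve_up u S E 0 = u%:C.
    by rewrite conj mulr0 curve_pt0 mulr0 addr0; apply: eqC => /=; ring.
  split; first exact: d0.
  by split; [rewrite d1|rewrite /linked conj mulr1 ep0].
- by split; [|split] => // y hy; apply: le_trans lS; [exact: ld|exact: lu].
- split; [|split] => // y /andP[y0 y1].
    by apply: P; rewrite mulr_ge0 ?subr_ge0//= ler_piMr// lerBlDr lerDl.
  have hy : 0 <= r0 * y <= r0 by rewrite mulr_ge0//= ler_piMr.
  have := P _ hy; rewrite conj; set z := u%:C + _; cbv zeta.
  have J1 : cmod (conjc z - u%:C) = cmod (z - u%:C).
    by rewrite -cmodJ; congr cmod; case: (z) => p1 p2; apply: eqC => /=; ring.
  have J2 : cmod (inv_weight x u k (conjc z)) = cmod (inv_weight x u k z).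
    rewrite /inv_weight !cmodM !cmodX !cmod_prod J1; congr (_ * _).
    apply: eq_bigr => i _; rewrite !cmodV; congr (_^-1).
    by rewrite -cmodJ; congr cmod; case: (z) => p1 p2; apply: eqC => /=; ring.
  rewrite J1 J2 Re_J Im_J oppr_eq0 => -[h1 h2 /orP[h3|/eqP h3] h4]; split => //.
    by rewrite h3.
  apply/orP; right; apply/eqP; rewrite h3; apply: eqC => /=; ring.
Qed.
End RestOfContours.

(** * Deformation to the contours through the saddle points *)

Section SaddleContours.
Context {R : realType}.
Implicit Types (w z : R[i]) (f phi psi : R[i] -> R[i]) (q u v s t : R).

(** As |y - t| < q / 2, the radius |y - t + i q| is at most sqrt 5 / 2 times q, hence at most 9 / 8
    q. On the arcs |Re| <= |y - t| and so |Im| >= q: squares have nonpositive real part. *)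
Lemma near_axis_bounds t k rho al y q : 0 < q -> 0 <= k -> 0 <= rho ->
  k%:C * (rho%:C * cexp (0 +i* al)) = (y - t) +i* q -> `|y - t| < q / 2 ->
  [/\ k * rho = cmod ((y - t) +i* q), k * rho <= 9 / 8 * q
    & forall z, near_axis rho al z -> [/\ cmod (k%:C * z) <= 9 / 8 * q,
        `|k * Re z| <= q / 2 & Re ((k%:C * z) ^+ 2) <= 0]].
Proof.
move=> q0 k0 r0 ec hy.
have kr0 : 0 <= k * rho by rewrite mulr_ge0.
have ekr : k * rho = cmod ((y - t) +i* q).
  by rewrite -ec !cmodM !cmodR cmod_cexp /= expR0 mulr1 !ger0_norm.
have yq : (y - t) ^+ 2 <= (q / 2) ^+ 2.
  by rewrite -real_normK ?num_real// ler_sqr ?nnegrE ?normr_ge0 ?(ltW hy)// divr_ge0// ltW.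
have kr2 : (k * rho) ^+ 2 = (y - t) ^+ 2 + q ^+ 2 by rewrite ekr cmod_sqr.
have krq : k * rho <= 9 / 8 * q.
  rewrite -ler_sqr ?nnegrE//; last by rewrite mulr_ge0// ltW.
  rewrite kr2; have := sqr_ge0 q; lra.
have hc : k * rho * cos al = y - t.
  have := congr1 (@Re R) ec; rewrite Re_scale Re_scale cexp_imag /= => <-; ring.
split=> // z hz.
have im : k * Re z = 0 \/ (k * Re z) ^+ 2 + (k * Im z) ^+ 2 = (k * rho) ^+ 2 /\
    `|k * Re z| <= `|y - t|.
  case: hz => [[-> _]|[h1 h2]]; first by left; rewrite mulr0.
  right; split; first by rewrite !exprMn -mulrDr -cmod_sqr h1.
  rewrite -hc !normrM (ger0_norm k0) (ger0_norm r0) -mulrA; exact: ler_wpM2l.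
split.
- rewrite cmodM cmodR ger0_norm//; apply: le_trans krq.
  by apply: ler_wpM2l => //; exact: near_axis_cmod hz.
- case: im => [->|[_ h]]; first by rewrite normr0 divr_ge0// ltW.
  by rewrite (le_trans h)// ltW.
- rewrite expr2 ReM Re_scale Im_scale -!expr2.
  case: im => [->|[h1 h2]]; first by rewrite expr0n /= add0r oppr_le0 sqr_ge0.
  have : (k * Re z) ^+ 2 <= (y - t) ^+ 2.
    by rewrite -(real_normK (num_real (k * Re z))) -(real_normK (num_real (y - t))) ler_sqr ?nnegrE ?normr_ge0.
  have := sqr_ge0 q; lra.
Qed.

(** At the corner the square has real part (y - t)^2 - q^2 <= - 3 / 4 q^2. This is the exponential
    gain, which [circle_rest] and [curve_rest] carry over to the remaining contours. *)
Lemma local_bounds phi t k rho al y q Q ep : 0 < q -> 0 <= k -> 0 <= rho -> 0 <= al <= pi ->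
  k%:C * (rho%:C * cexp (0 +i* al)) = (y - t) +i* q -> `|y - t| < q / 2 -> 0 <= Q ->
  (forall w, cmod (w - t%:C) <= 9 / 8 * q ->
    exists2 e, phi w = phi t%:C * cexp (Q%:C * (w - t%:C) ^+ 2 + e) & cmod e <= ep) ->
  [/\ k * rho <= 9 / 8 * q,
      on_chain (local_chain t k rho al) (fun w => [/\ cmod (w - t%:C) <= 9 / 8 * q,
        `|Re w - t| <= q / 2 & cmod (phi w) <= cmod (phi t%:C) * expR ep])
    & cmod (phi (y +i* q)) <= cmod (phi t%:C) * expR (ep - 3 / 4 * (Q * q ^+ 2))].
Proof.
move=> q0 k0 r0 ha ec hy Q0 ex.
have [ekr krq bd] := near_axis_bounds q0 k0 r0 ec hy.
split=> //.
  apply: on_local_chain => // z hz; have [c1 re im] := bd z hz.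
  have ew : t%:C + k%:C * z - t%:C = k%:C * z by rewrite addrC addKr.
  split; first by rewrite ew.
    by rewrite ReD ReC Re_scale addrC addKr.
  have [|e -> he] := ex (t%:C + k%:C * z); first by rewrite ew.
  rewrite cmodM cmod_cexp; apply: ler_wpM2l; first exact: cmod_ge0.
  rewrite ew ler_expR ReD Re_scale.
  have := Re_le e; have : Q * Re ((k%:C * z) ^+ 2) <= 0 by rewrite mulr_ge0_le0.
  move: he; clear; lra.
have e1 : (y +i* q) - t%:C = (y - t) +i* q by apply: eqC => /=; ring.
have [|e -> he] := ex (y +i* q); first by rewrite e1 -ekr.
rewrite cmodM cmod_cexp; apply: ler_wpM2l; first exact: cmod_ge0.
rewrite ler_expR ReD Re_scale e1 expr2 ReM /= -!expr2.
have yq : (y - t) ^+ 2 <= (q / 2) ^+ 2.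
  by rewrite -real_normK ?num_real// ler_sqr ?nnegrE ?normr_ge0 ?(ltW hy)// divr_ge0// ltW.
have := Re_le e.
have : Q * ((y - t) ^+ 2 - q ^+ 2) <= Q * (- (3 / 4) * q ^+ 2) by apply: ler_wpM2l => //; lra.
lra.
Qed.

(** The z-chain is nearer to u than every w, so by [chain_int_far] it does not wind around w; this
    replaces the nesting hypothesis of the original contours. *)
Lemma residues_double_int (n : nat) (x : 'I_n -> R) u v (k m : nat) (c C : seq (R -> R[i]))
    (zc zC : R[i]) :
  injective x -> (2 <= k < n)%N ->
  gchain c -> gchain C -> linked c zc zc -> linked C zC zC ->
  (forall i, x i != u -> on_chain C (fun z => z != (x i)%:C)) ->
  (forall i, u < x i -> chain_int C (fun z => (z - (x i)%:C)^-1) = 0 +i* (2 * pi)) ->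
  (forall i, x i < u -> chain_int C (fun z => (z - (x i)%:C)^-1) = 0) ->
  on_chain c (fun w => on_chain C (fun z => cmod (z - u%:C) < cmod (w - u%:C))) ->
  on_chain c (fun w => w != v%:C) ->
  chain_int c (fun w => (w - v%:C)^-1) = 0 +i* (2 * pi) ->
  (0 +i* (2 * pi)) ^+ 2 * (J_residues x u v k m)%:C =
  double_int c C (weight x v m.+1) (inv_weight x u k).
Proof.
move=> xinj hk gc gC lc lC zx wi wo sep wv wiv.
have sepE : on_chain c (fun w => on_chain C (fun z => z != w)).
  apply: on_chainW sep => w; apply: on_chainW => z h.
  by apply: contraTneq h => ->; rewrite ltxx.
rewrite -(J_eval m xinj hk gc gC lc lC zx wi wo _ wv wiv); last first.
  apply: on_chainW (on_chain_and sepE sep) => w [h1 h2]; split => //.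
  exact: chain_int_far gC lC h2.
have cpsi : on_chain C (hcont (inv_weight x u k)).
  have all_i : on_chain C (fun z => forall i, x i != u -> z != (x i)%:C).
    elim: {gC lC sep sepE wi wo} C zx => //= g C ih h; split.
      by move=> y hy i xi; have [h1 _] := h i xi; exact: h1.
    by apply: ih => i xi; have [_ h2] := h i xi.
  by apply: on_chainW all_i => z h; apply: inv_weight_hcont => //; case/andP: hk.
apply: chain_int_ext; apply: on_chainW sepE => w hw.
transitivity (chain_int C (fun z => weight x v m.+1 w * ((w - z)^-1 * inv_weight x u k z))).
  apply: chain_int_ext; apply: on_chain_all => z.
  rewrite /weight /inv_weight big_split /=; ring.
rewrite chain_intZ//; apply: on_chainW (on_chain_and hw cpsi) => z [h1 h2].
exact: cauchy_kernel_hcont.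
Qed.

(** Of the four products of local and remaining chains, the three that involve a remaining chain
    gain a factor exp (- 3 / 4 Q q^2), with Q or Q'. Lengths: 27 / 4 q is three pieces of at most 2
    (9 / 8 q), [lw] is a full circle, and 603 / 100 is twice 201 / 200 times 3. *)
Lemma saddle_contours (n : nat) (x : 'I_n -> R) u v t s tn sn q Q Q' ep ep' d
    ka rho al ka' rho' al' (k m : nat) :
  injective x -> (2 <= k < n)%N -> 0 < q -> 0 < d ->
  (forall i, x i < s - q) -> u < s - q -> v < t - q -> 10 * q <= sn - u ->
  d <= (t - q / 2 - v) - (s - u + 9 / 8 * q) - `|u - v| ->
  0 <= ka -> 0 <= rho -> 0 <= al <= pi ->
  ka%:C * (rho%:C * cexp (0 +i* al)) = (tn - t) +i* q -> `|tn - t| < q / 2 ->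
  0 <= ka' -> 0 <= rho' -> 0 <= al' <= pi ->
  ka'%:C * (rho'%:C * cexp (0 +i* al')) = (sn - s) +i* q -> `|sn - s| < q / 2 ->
  0 <= Q -> 0 <= Q' ->
  let phi := weight x v m.+1 in let psi := inv_weight x u k in
  (forall w, cmod (w - t%:C) <= 9 / 8 * q ->
    exists2 e, phi w = phi t%:C * cexp (Q%:C * (w - t%:C) ^+ 2 + e) & cmod e <= ep) ->
  (forall w, cmod (w - s%:C) <= 9 / 8 * q ->
    exists2 e, psi w = psi s%:C * cexp (Q'%:C * (w - s%:C) ^+ 2 + e) & cmod e <= ep') ->
  \sum_i (x i - v) / cmod ((tn +i* q) - (x i)%:C) ^+ 2 <= 0 ->
  \sum_i (sn - x i)^-1 = k%:R / (sn - u) ->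
  let A := cmod (phi t%:C) * cmod (psi s%:C) * expR (ep + ep') / d in
  let lw := 2 * pi * cmod ((tn +i* q) - v%:C) in
  let lz := (sn - u) * (603 / 100) in
  exists2 rest, (0 +i* (2 * pi)) ^+ 2 * (J_residues x u v k m)%:C =
      double_int (local_chain t ka rho al) (local_chain s ka' rho' al') phi psi + rest
    & cmod rest <= A * (expR (- (3 / 4 * (Q' * q ^+ 2))) * (27 / 4 * q * lz) +
        expR (- (3 / 4 * (Q * q ^+ 2))) * (27 / 4 * q * lw) +
        expR (- (3 / 4 * (Q * q ^+ 2)) - 3 / 4 * (Q' * q ^+ 2)) * (lw * lz)).
Proof.
move=> xinj hk q0 d0 xs us vt qS hd ka0 rho0 hal ecw htn ka'0 rho'0 hal' ecz hsn Q0 Q'0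
  phi psi ew ez hcirc hcrit A lw lz.
have uss : u < sn by lra.
have xsn i : x i < sn by have := xs i; move: hsn; rewrite ltr_norml => /andP[]; lra.
have k0 : (0 < k)%N by case/andP: hk => /(leq_trans _) ->.
have [Rw [gRw lRw lenRw oRw]] := @circle_rest _ n x v m.+1 (tn +i* q) q0 hcirc.
have [Rz [gRz lRz lenRz oRz]] := curve_rest uss q0 qS xsn hcrit k0.
have [krw oLw bw0] := local_bounds q0 ka0 rho0 hal ecw htn Q0 ew.
have [krz oLz bz0] := local_bounds q0 ka'0 rho'0 hal' ecz hsn Q'0 ez.
set Lw := local_chain t ka rho al in oLw *; set Lz := local_chain s ka' rho' al' in oLz *.
have gLw : gchain Lw by apply: local_gchain.
have gLz : gchain Lz by apply: local_gchain.
have lLw : linked Lw (conjc (tn +i* q)) (tn +i* q).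
  have -> : tn +i* q = t%:C + ka%:C * (rho%:C * cexp (0 +i* al)).
    by rewrite ecw; apply: eqC => /=; ring.
  exact: local_linked.
have lLz : linked Lz (conjc (sn +i* q)) (sn +i* q).
  have -> : sn +i* q = s%:C + ka'%:C * (rho'%:C * cexp (0 +i* al')).
    by rewrite ecz; apply: eqC => /=; ring.
  exact: local_linked.
have dw : t - q / 2 - v <= cmod ((tn +i* q) - v%:C).
  apply: le_trans (Re_le _); rewrite ReB ReC /=; move: htn; rewrite ltr_norml => /andP[]; clear; lra.
have dz : cmod ((sn +i* q) - u%:C) <= s - u + 9 / 8 * q.
  have -> : (sn +i* q) - u%:C = (s - u)%:C + ((sn - s) +i* q) by apply: eqC => /=; ring.
  apply: (le_trans (cmodD _ _)); rewrite cmodR ger0_norm; last by move: us q0; clear; lra.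
  rewrite lerD2l; apply: le_trans krz.
  by rewrite -ecz !cmodM !cmodR cmod_cexp /= expR0 mulr1 !ger0_norm.
(* The z-contour stays in a disc around u and the w-contour outside one around v; |u - v| is the
   cost of the different centres. *)
have far z w : cmod (z - u%:C) <= s - u + 9 / 8 * q -> t - q / 2 - v <= cmod (w - v%:C) ->
    cmod (z - u%:C) + d <= cmod (w - u%:C) /\ d <= cmod (w - z).
  move=> hz hw.
  have h1 : cmod (w - v%:C) <= cmod (w - u%:C) + `|u - v|.
    have -> : w - v%:C = (w - u%:C) + (u - v)%:C by rewrite rmorphB /=; ring.
    by rewrite -cmodR; exact: cmodD.
  have h2 : cmod (w - u%:C) <= cmod (w - z) + cmod (z - u%:C).
    have -> : w - u%:C = (w - z) + (z - u%:C) by ring.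
    exact: cmodD.
  by split; move: hd h1 h2 hz hw; clear; lra.
have Lw_far : on_chain Lw (fun w => [/\ t - q / 2 - v <= cmod (w - v%:C), slit (w - v%:C)
    & cmod (phi w) <= cmod (phi t%:C) * expR ep]).
  apply: on_chainW oLw => w [h1 h2 h3]; move: h2; rewrite ler_norml => /andP[h2 h2'].
  split=> //; first by apply: le_trans (Re_le _); rewrite ReB ReC; move: h2; clear; lra.
  by rewrite /slit ReB ReC; apply/orP; left; move: h2 vt q0; clear; lra.
have Lz_far : on_chain Lz (fun z => [/\ cmod (z - u%:C) <= s - u + 9 / 8 * q,
    (forall y, y < s - q / 2 -> slit (z - y%:C))
    & cmod (psi z) <= cmod (psi s%:C) * expR ep']).
  apply: on_chainW oLz => z [h1 h2 h3]; move: h2; rewrite ler_norml => /andP[h2 h2'].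
  split=> //; last by move=> y hy; rewrite /slit ReB ReC; apply/orP; left; move: h2 hy; clear; lra.
  have -> : z - u%:C = (s - u)%:C + (z - s%:C) by rewrite rmorphB /=; ring.
  apply: (le_trans (cmodD _ _)); rewrite cmodR ger0_norm; last by move: us q0; clear; lra.
  by rewrite lerD2l.
have Rw_far : on_chain Rw (fun w => [/\ t - q / 2 - v <= cmod (w - v%:C), slit (v%:C - w)
    & cmod (phi w) <= cmod (phi t%:C) * expR (ep - 3 / 4 * (Q * q ^+ 2))]).
  apply: on_chainW oRw => w [h1 h2 h3]; split=> //; first by rewrite h2.
  exact: le_trans h3 bw0.
have Rz_far : on_chain Rz (fun z => [/\ cmod (z - u%:C) <= s - u + 9 / 8 * q,
    (forall y, u < y -> slit (y%:C - z)) , (forall y, y < u -> slit (z - y%:C))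
    & cmod (psi z) <= cmod (psi s%:C) * expR (ep' - 3 / 4 * (Q' * q ^+ 2))]).
  apply: on_chainW oRz => z [h1 h2 h3 h4]; split=> //; [exact: le_trans h1 dz| | |exact: le_trans h4 bz0].
    move=> y uy; rewrite /slit; case/orP: h3 => [h3|/eqP ->].
      by rewrite ImB ImC sub0r oppr_eq0 h3 orbT.
    by rewrite ReB !ReC subr_gt0 uy.
  by move=> y uy; rewrite /slit ReB ReC subr_gt0 (lt_le_trans uy).
have slitN (y z : R[i]) : slit (z - y) -> z != y by move/slit_neq0; rewrite subr_eq0.
have c_far : on_chain (Lw ++ Rw) (fun w => t - q / 2 - v <= cmod (w - v%:C)).
  by apply/on_chain_cat; split; [apply: on_chainW Lw_far|apply: on_chainW Rw_far] => w [].
have C_far : on_chain (Lz ++ Rz) (fun z => cmod (z - u%:C) <= s - u + 9 / 8 * q).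
  by apply/on_chain_cat; split; [apply: on_chainW Lz_far|apply: on_chainW Rz_far] => z [].
have C_x i : x i != u -> on_chain (Lz ++ Rz) (fun z => z != (x i)%:C).
  move=> xu; apply/on_chain_cat; split.
    by apply: on_chainW Lz_far => z [_ h _]; apply/slitN/h; move: (xs i) q0; clear; lra.
  apply: on_chainW Rz_far => z [_ h1 h2 _].
  by case: (ltgtP (x i) u) xu => // xu _; [exact/slitN/h2|rewrite eq_sym; exact/slitN/h1].
have sepL L M : on_chain L (fun w => t - q / 2 - v <= cmod (w - v%:C)) ->
    on_chain M (fun z => cmod (z - u%:C) <= s - u + 9 / 8 * q) ->
    on_chain L (fun w => on_chain M (fun z => d <= cmod (w - z))).
  move=> hL hM; apply: on_chainW hL => w hw; apply: on_chainW hM => z hz.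
  by have [] := far z w hz hw.
have Eq : (0 +i* (2 * pi)) ^+ 2 * (J_residues x u v k m)%:C = double_int (Lw ++ Rw) (Lz ++ Rz) phi psi.
  apply: (@residues_double_int n x u v k m _ _ (conjc (tn +i* q)) (conjc (sn +i* q))) => //.
  - by apply/gchain_cat.
  - by apply/gchain_cat.
  - exact: linked_cat lLw lRw.
  - exact: linked_cat lLz lRz.
  - move=> i ui; apply: (chain_int_winding gLz gRz lLz lRz) => //.
      by apply: on_chainW Lz_far => z [_ h _]; apply: h; move: (xs i) q0; clear; lra.
    by apply: on_chainW Rz_far => z [_ h _ _]; exact: h.
  - move=> i ui; apply: (chain_int_outside (a := conjc (sn +i* q))).
    + by apply/gchain_cat.
    + exact: linked_cat lLz lRz.
    + apply/on_chain_cat; split; first by apply: on_chainW Lz_far => z [_ h _]; apply: h; move: ui us q0; clear; lra.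
      by apply: on_chainW Rz_far => z [_ _ h _]; exact: h.
  - apply: on_chainW c_far => w hw; apply: on_chainW C_far => z hz.
    by have [h _] := far z w hz hw; move: h d0; clear; lra.
  - apply: on_chainW c_far => w hw; rewrite -subr_eq0 -cmod_gt0; apply: lt_le_trans hw; move: vt q0; clear; lra.
  - apply: (chain_int_winding gLw gRw lLw lRw) => //.
      by apply: on_chainW Lw_far => w [].
    by apply: on_chainW Rw_far => w [].
move: c_far C_far => /on_chain_cat[Lwf Rwf] /on_chain_cat[Lzf Rzf].
have cphi L : on_chain L (fun w => t - q / 2 - v <= cmod (w - v%:C)) -> on_chain L (hcont phi).
  apply: on_chainW => w hw; apply: weight_hcont.
  by rewrite -subr_eq0 -cmod_gt0; apply: lt_le_trans hw; move: vt q0; clear; lra.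
have cpsi : on_chain (Lz ++ Rz) (hcont psi).
  have all_i : on_chain (Lz ++ Rz) (fun z => forall i, x i != u -> z != (x i)%:C).
    elim: (Lz ++ Rz) C_x => //= g C ih h; split.
      by move=> y hy i xi; have [h1 _] := h i xi; exact: h1.
    by apply: ih => i xi; have [_ h2] := h i xi.
  by apply: on_chainW all_i => z h; apply: inv_weight_hcont => //; case/andP: hk.
move: cpsi => /on_chain_cat[cLz cRz].
have neq L M : on_chain L (fun w => on_chain M (fun z => d <= cmod (w - z))) ->
    on_chain L (fun w => on_chain M (fun z => z != w)).
  apply: on_chainW => w; apply: on_chainW => z; apply: contraTneq => ->.
  by rewrite subrr cmod0 -ltNge.
exists (double_int Lw Rz phi psi + (double_int Rw Lz phi psi + double_int Rw Rz phi psi)).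
  rewrite Eq double_int_catl !double_int_catr//; try by [exact: cphi|apply: neq; exact: sepL].
  by rewrite !addrA.
have P0 : 0 <= cmod (phi t%:C) by exact: cmod_ge0.
have S0 : 0 <= cmod (psi s%:C) by exact: cmod_ge0.
have b L M l l' e1 e2 : gchain L -> gchain M -> chain_len L l -> chain_len M l' ->
    on_chain L (fun w => t - q / 2 - v <= cmod (w - v%:C)) ->
    on_chain M (fun z => cmod (z - u%:C) <= s - u + 9 / 8 * q) ->
    on_chain M (hcont psi) ->
    on_chain L (fun w => cmod (phi w) <= cmod (phi t%:C) * expR (ep - e1)) ->
    on_chain M (fun z => cmod (psi z) <= cmod (psi s%:C) * expR (ep' - e2)) ->
    cmod (double_int L M phi psi) <= A * (expR (- e1 - e2) * ((\sum_(a <- l) a) * \sum_(a <- l') a)).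
  move=> gL gM hl hl' hL hM cM pL pM.
  have := double_int_le gL gM hl hl' d0 _ _ (cphi _ hL) cM pL pM (sepL _ _ hL hM).
  rewrite !mulr_ge0 ?expR_ge0// => /(_ erefl erefl) h; apply: (le_trans h).
  rewrite /A le_eqVlt; apply/orP; left; apply/eqP.
  have -> : ep + ep' = (ep - e1) + (ep' - e2) + (e1 + e2) by ring.
  have -> : - e1 - e2 = - (e1 + e2) by ring.
  rewrite !expRD !expRN !expRD; field.
  by rewrite !gt_eqF ?expR_gt0//.
have lLw6 : \sum_(a <- [:: 2 * (ka * rho); 2 * (ka * rho); 2 * (ka * rho)]) a <= 27 / 4 * q.
  by rewrite !big_cons big_nil; move: krw krz; clear; lra.
have lLz6 : \sum_(a <- [:: 2 * (ka' * rho'); 2 * (ka' * rho'); 2 * (ka' * rho')]) a <= 27 / 4 * q.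
  by rewrite !big_cons big_nil; move: krw krz; clear; lra.
have lenLw := local_chain_len t rho0 ka0 hal; have lenLz := local_chain_len s rho'0 ka'0 hal'.
have bLw : on_chain Lw (fun w => cmod (phi w) <= cmod (phi t%:C) * expR (ep - 0)).
  by rewrite subr0; apply: on_chainW Lw_far => w [].
have bLz : on_chain Lz (fun z => cmod (psi z) <= cmod (psi s%:C) * expR (ep' - 0)).
  by rewrite subr0; apply: on_chainW Lz_far => w [].
have bRw : on_chain Rw (fun w => cmod (phi w) <= cmod (phi t%:C) * expR (ep - 3 / 4 * (Q * q ^+ 2))).
  by apply: on_chainW Rw_far => w [].
have bRz : on_chain Rz (fun w => cmod (psi w) <= cmod (psi s%:C) * expR (ep' - 3 / 4 * (Q' * q ^+ 2))).
  by apply: on_chainW Rz_far => w [].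
have A0 : 0 <= A by rewrite /A !mulr_ge0 ?expR_ge0 ?invr_ge0 ?(ltW d0).
have eRw : \sum_(a <- [:: 2 * pi * cmod ((tn +i* q) - v%:C)]) a = lw by rewrite big_seq1.
have eRz : \sum_(a <- [:: (sn - u) * (201 / 200 * 3); (sn - u) * (201 / 200 * 3)]) a = lz.
  by rewrite !big_cons big_nil /lz; clear; lra.
have lw0 : 0 <= lw by rewrite /lw !mulr_ge0 ?cmod_ge0 ?pi_ge0.
have lz0 : 0 <= lz by rewrite /lz; apply: mulr_ge0; [rewrite subr_ge0; exact: ltW|clear; lra].
apply: (le_trans (cmodD _ _)); rewrite mulrDr mulrDr -addrA; apply: lerD.
  apply: (le_trans (b _ _ _ _ _ _ gLw gRz lenLw lenRz Lwf Rzf cRz bLw bRz)).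
  by rewrite oppr0 add0r; apply: ler_wpM2l => //; apply: ler_wpM2l; rewrite ?expR_ge0// eRz; apply: ler_wpM2r.
apply: (le_trans (cmodD _ _)); apply: lerD.
  apply: (le_trans (b _ _ _ _ _ _ gRw gLz lenRw lenLz Rwf Lzf cLz bRw bLz)).
  rewrite subr0; apply: ler_wpM2l => //; apply: ler_wpM2l; rewrite ?expR_ge0// eRw mulrC.
  by apply: ler_wpM2r.
apply: (le_trans (b _ _ _ _ _ _ gRw gRz lenRw lenRz Rwf Rzf cRz bRw bRz)).
by rewrite eRw eRz.
Qed.
End SaddleContours.

(** * The local part as the six integrals of F_n *)

Section MainTermSplit.
Context {R : realType}.
Implicit Types (w z c : R[i]) (A B : R[i] -> R[i]) (g : R -> R[i]) (ka rho al : R).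

Lemma hcont_affine c (ka : R) w : hcont (fun w => c + ka%:C * w) w.
Proof. by apply: hcontD; [exact: hcont_cst|apply: hcontM; [exact: hcont_cst|exact: hcont_id]]. Qed.

(** Dividing the denominator by ka' makes it a Cauchy kernel at the affine image [h w]. *)
Lemma scaled_cauchy_hcont g B c (ka ka' : R) w : gpath g ->
  (forall x, 0 <= x <= 1 -> hcont B (g x)) -> ka' != 0 ->
  (forall x, 0 <= x <= 1 -> c + ka%:C * w - ka'%:C * g x != 0) ->
  hcont (fun w => path_int g (fun z => B z / (c + ka%:C * w - ka'%:C * z))) w.
Proof.
move=> gg cB k0 nz; have kc : ka'%:C != 0 :> R[i] by rewrite (realC_neq k0).
pose h w := (c + ka%:C * w) / ka'%:C.
apply: (@hcont_ext _ (fun w => path_int g (fun z => (h w - z)^-1 * (B z / ka'%:C)))).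
  move=> w'; congr path_int; apply/funext => z.
  have -> : c + ka%:C * w' - ka'%:C * z = ka'%:C * (h w' - z).
    by rewrite mulrBr /h mulrCA divff// mulr1.
  by rewrite invfM; ring.
apply: (@hcont_comp _ (fun w => path_int g (fun z => (w - z)^-1 * (B z / ka'%:C))) h).
  by apply: hcontM; [exact: hcont_affine|exact: hcont_cst].
apply: cauchy_hcont => // [x hx|x hx].
  by apply: hcontM; [exact: cB|exact: hcont_cst].
apply: contraTneq (nz x hx) => ->.
by rewrite /h mulrCA divff// mulr1 subrr eqxx.
Qed.

Lemma scaled_kernel_hcont B c (ka ka' : R) w z : hcont B z ->
  c + ka%:C * w - ka'%:C * z != 0 ->
  hcont (fun z => B z / (c + ka%:C * w - ka'%:C * z)) z.
Proof.
move=> cB nz; apply: hcontM => //; apply: hcontV => //.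
apply: hcontB; first exact: hcont_cst.
by apply: hcontM; [exact: hcont_cst|exact: hcont_id].
Qed.

Lemma hcont_gauss (w : R[i]) : hcont (fun w => cexp (w ^+ 2)) w.
Proof. by apply: hcont_exp; apply: hcontX; exact: hcont_id. Qed.

Section Split.
Context (A B : R[i] -> R[i]) (c : R[i]) (ka ka' : R) (W Z : R[i] -> Prop).
Context (cA : forall w, W w -> hcont A w) (cB : forall z, Z z -> hcont B z).
Context (k0 : ka' != 0).
Context (nz : forall w z, W w -> Z z -> c + ka%:C * w - ka'%:C * z != 0).
Definition on_path g (P : R[i] -> Prop) := forall x, 0 <= x <= 1 -> P (g x).
Let Ph w z := A w * B z / (c + ka%:C * w - ka'%:C * z).

Lemma split_inner g w : on_path g Z -> gpath g -> W w ->
  path_int g (Ph w) = A w * path_int g (fun z => B z / (c + ka%:C * w - ka'%:C * z)).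
Proof.
move=> gZ gg Ww; rewrite -path_intZ//.
  by congr path_int; apply/funext => z; rewrite /Ph mulrA.
by move=> x hx; apply: scaled_kernel_hcont; [exact/cB/gZ|exact/nz/gZ].
Qed.

Let Ph_hcont w z : W w -> Z z -> hcont (Ph w) z.
Proof.
move=> Ww Zz; apply: (@hcont_ext _ (fun z => A w * (B z / (c + ka%:C * w - ka'%:C * z)))).
  by move=> z'; rewrite /Ph mulrA.
by apply: hcontM; [exact: hcont_cst|apply: scaled_kernel_hcont; [exact: cB|exact: nz]].
Qed.

Lemma split_outer_hcont g w : on_path g Z -> gpath g -> W w ->
  hcont (fun w => A w * path_int g (fun z => B z / (c + ka%:C * w - ka'%:C * z))) w.
Proof.
move=> gZ gg Ww; apply: hcontM; first exact: cA.
by apply: scaled_cauchy_hcont => // x hx; [exact/cB/gZ|exact/nz/gZ].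
Qed.

Lemma split_gauss_inner h w : gpath h ->
  path_int h (fun z => cexp (w ^+ 2 + z ^+ 2) / c) =
  cexp (w ^+ 2) * path_int h (fun z => cexp (z ^+ 2) / c).
Proof.
move=> gh; rewrite -path_intZ//; last first.
  by move=> x hx; apply: hcontM; [exact: hcont_gauss|exact: hcont_cst].
by apply: path_int_ext => x _; rewrite cexpD mulrA.
Qed.

Lemma split_diff_inner h w : on_path h Z -> gpath h ->
  path_int h (fun z => (A w * B z - cexp (w ^+ 2 + z ^+ 2)) / c) =
  A w * path_int h (fun z => B z / c) - cexp (w ^+ 2) * path_int h (fun z => cexp (z ^+ 2) / c).
Proof.
move=> hZ gh.
have cBc x : 0 <= x <= 1 -> hcont (fun z => B z / c) (h x).
  by move=> hx; apply: hcontM; [exact/cB/hZ|exact: hcont_cst].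
have cG x : hcont (fun z => cexp (z ^+ 2) / c) (h x).
  by apply: hcontM; [exact: hcont_gauss|exact: hcont_cst].
rewrite -mulNr -!path_intZ// -path_intD//.
- by apply: path_int_ext => x _; rewrite cexpD; ring.
- by move=> x hx; apply: hcontM; [exact: hcont_cst|exact: cBc].
- by move=> x hx; apply: hcontM; [exact: hcont_cst|exact: cG].
Qed.

Lemma split_ratio_inner h w : on_path h Z -> gpath h -> W w ->
  path_int h (fun z => Ph w z - A w * B z / c) =
  A w * path_int h (fun z => B z / (c + ka%:C * w - ka'%:C * z)) - A w * path_int h (fun z => B z / c).
Proof.
move=> hZ gh Ww.
have cBc x : 0 <= x <= 1 -> hcont (fun z => B z / c) (h x).
  by move=> hx; apply: hcontM; [exact/cB/hZ|exact: hcont_cst].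
rewrite -split_inner// -mulNr -path_intZ// -path_intD//.
- by apply: path_int_ext => x _; ring.
- by move=> x hx; apply: Ph_hcont => //; exact: hZ.
- by move=> x hx; apply: hcontM; [exact: hcont_cst|exact: cBc].
Qed.

(** A telescoping sum: the kernel is frozen at 1 / c, then A B is replaced by the Gaussian.
    Additivity of the outer integral rests on the continuity in w of each inner integral. *)
Lemma split_gauss g h : c != 0 -> on_path g W -> gpath g -> on_path h Z -> gpath h ->
  path_int g (fun w => path_int h (Ph w)) =
  path_int g (fun w => path_int h (fun z => cexp (w ^+ 2 + z ^+ 2) / c)) +
  path_int g (fun w => path_int h (fun z => (A w * B z - cexp (w ^+ 2 + z ^+ 2)) / c)) +
  path_int g (fun w => path_int h (fun z => Ph w z - A w * B z / c)).
Proof.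
move=> c0 gW gg hZ gh.
pose b := path_int h (fun z => B z / c); pose e := path_int h (fun z => cexp (z ^+ 2) / c).
pose a w := A w * path_int h (fun z => B z / (c + ka%:C * w - ka'%:C * z)).
pose f1 w := cexp (w ^+ 2) * e; pose f2 w := A w * b - cexp (w ^+ 2) * e.
pose f3 w := a w - A w * b.
have eL : path_int g (fun w => path_int h (Ph w)) = path_int g a.
  by apply: path_int_ext => x hx; rewrite split_inner//; exact: gW.
have eR : path_int g (fun w => path_int h (fun z => Ph w z - A w * B z / c)) = path_int g f3.
  by apply: path_int_ext => x hx; rewrite split_ratio_inner//; exact: gW.
have cc (f : R[i] -> R[i]) k x : hcont f (g x) -> hcont (fun w => f w * k) (g x).
  by move=> hf; apply: hcontM => //; exact: hcont_cst.
have ca x : 0 <= x <= 1 -> hcont a (g x).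
  by move=> hx; apply: split_outer_hcont => //; exact: gW.
have cAg x : 0 <= x <= 1 -> hcont A (g x) by move=> hx; exact/cA/gW.
have cE x : hcont (fun w => cexp (w ^+ 2)) (g x) by exact: hcont_gauss.
have c1 x : 0 <= x <= 1 -> hcont f1 (g x) by move=> hx; exact/cc/cE.
have c2 x : 0 <= x <= 1 -> hcont f2 (g x).
  by move=> hx; apply: hcontB; [exact/cc/cAg|exact/cc/cE].
have c3 x : 0 <= x <= 1 -> hcont f3 (g x).
  by move=> hx; apply: hcontB; [exact: ca|exact/cc/cAg].
have c12 x : 0 <= x <= 1 -> hcont (fun w => f1 w + f2 w) (g x).
  by move=> hx; apply: hcontD; [exact: c1|exact: c2].
transitivity (path_int g f1 + path_int g f2 + path_int g f3); last first.
  congr (_ + _ + _); last by rewrite eR.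
    by apply: path_int_ext => x _; rewrite split_gauss_inner.
  by apply: path_int_ext => x _; rewrite split_diff_inner.
rewrite eL; transitivity (path_int g (fun w => (f1 w + f2 w) + f3 w)).
  by apply: path_int_ext => x _; rewrite /f1 /f2 /f3; ring.
transitivity (path_int g (fun w => f1 w + f2 w) + path_int g f3).
  exact: path_intD.
by congr (_ + _); apply: path_intD.
Qed.
End Split.

Lemma mulD3 (k p K a b c a' b' c' : R[i]) : k * (p * a) = K * a' -> k * (p * b) = K * b' ->
  k * (p * c) = K * c' -> k * (p * (a + (b + c))) = K * (a' + (b' + c')).
Proof. by rewrite !mulrDr => -> -> ->. Qed.

(** The substitutions w -> t + ka w and z -> s + ka' z produce ka ka', and normalizing phi and psi
    at the saddle points produces phi t psi s. The product of the two segments is split further by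
    [split_gauss]. *)
Lemma main_double_int phi psi (t s ka rho al ka' rho' al' : R) (eg Ph : R[i] -> R[i] -> R[i]) :
  0 <= rho -> 0 <= al <= pi -> 0 <= rho' -> 0 <= al' <= pi -> ka' != 0 -> t - s != 0 ->
  phi t%:C != 0 -> psi s%:C != 0 ->
  (forall w, near_axis rho al w -> hcont phi (t%:C + ka%:C * w)) ->
  (forall z, near_axis rho' al' z -> hcont psi (s%:C + ka'%:C * z)) ->
  (forall w z, near_axis rho al w -> near_axis rho' al' z ->
    [/\ (t - s)%:C + ka%:C * w - ka'%:C * z != 0,
        eg w z = (phi (t%:C + ka%:C * w) / phi t%:C) * (psi (s%:C + ka'%:C * z) / psi s%:C)
      & Ph w z = eg w z / ((t - s)%:C + ka%:C * w - ka'%:C * z)]) ->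
  let e0 := fun w z : R[i] => cexp (w ^+ 2 + z ^+ 2) in
  let ts := (t - s)%:C in
  double_int (local_chain t ka rho al) (local_chain s ka' rho' al') phi psi =
  ka%:C * ka'%:C * (phi t%:C * psi s%:C) *
  (int_k rho (fun w => int_k rho' (fun z => e0 w z / ts)) +
   int_k rho (fun w => int_k rho' (fun z => (eg w z - e0 w z) / ts)) +
   int_k rho (fun w => int_k rho' (fun z => Ph w z - eg w z / ts)) +
   int_k rho (fun w => int_c rho' al' (Ph w)) +
   int_c rho al (fun w => int_k rho' (Ph w)) +
   int_c rho al (fun w => int_c rho' al' (Ph w))).
Proof.
move=> r0 ha r0' ha' k0 tsn fn gn cphi cpsi hE e0 ts.
pose A w := phi (t%:C + ka%:C * w) / phi t%:C.
pose B z := psi (s%:C + ka'%:C * z) / psi s%:C.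
have cA w : near_axis rho al w -> hcont A w.
  move=> hw; apply: hcontM; last exact: hcont_cst.
  by apply: (@hcont_comp _ phi); [exact: hcont_affine|exact: cphi].
have cB z : near_axis rho' al' z -> hcont B z.
  move=> hz; apply: hcontM; last exact: hcont_cst.
  by apply: (@hcont_comp _ psi); [exact: hcont_affine|exact: cpsi].
have nz w z : near_axis rho al w -> near_axis rho' al' z -> ts + ka%:C * w - ka'%:C * z != 0.
  by move=> hw hz; have [] := hE w z hw hz.
have [W1 [W2 [W3 _]]] := local_paths_near_axis r0 ha.
have [Z1 [Z2 [Z3 _]]] := local_paths_near_axis r0' ha'.
set k := segment_path (0 +i* - rho) (0 +i* rho) in W2.
set K := segment_path (0 +i* - rho') (0 +i* rho') in Z2.
set c1 := circle_arc rho (- al) (- (pi / 2)) in W1; set c2 := circle_arc rho (pi / 2) al in W3.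
set C1 := circle_arc rho' (- al') (- (pi / 2)) in Z1; set C2 := circle_arc rho' (pi / 2) al' in Z3.
have gk : gpath k by exact: gpath_segment.
have gK : gpath K by exact: gpath_segment.
have gc1 : gpath c1 by exact: gpath_arc.
have gc2 : gpath c2 by exact: gpath_arc.
have gC1 : gpath C1 by exact: gpath_arc.
have gC2 : gpath C2 by exact: gpath_arc.
pose a h w := A w * path_int h (fun z => B z / (ts + ka%:C * w - ka'%:C * z)).
have ca h w : on_path h (near_axis rho' al') -> gpath h -> near_axis rho al w -> hcont (a h) w.
  by move=> *; apply: (split_outer_hcont cA cB k0 nz).
have inner h w : on_path h (near_axis rho' al') -> gpath h -> near_axis rho al w ->
    path_int h (Ph w) = a h w.
  move=> hZ gh hw; rewrite /a -(split_inner A cB nz hZ gh hw).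
  by apply: path_int_ext => x hx; have [_ e1 ->] := hE w (h x) hw (hZ x hx); rewrite e1.
pose Kc : R[i] := ka%:C * ka'%:C * (phi t%:C * psi s%:C).
have outer h w : on_path h (near_axis rho' al') -> gpath h -> near_axis rho al w ->
    ka%:C * (phi (t%:C + ka%:C * w) * path_int h (fun z =>
      ka'%:C * ((t%:C + ka%:C * w - (s%:C + ka'%:C * z))^-1 * psi (s%:C + ka'%:C * z)))) =
    Kc * a h w.
  move=> hZ gh hw.
  have -> : path_int h (fun z =>
      ka'%:C * ((t%:C + ka%:C * w - (s%:C + ka'%:C * z))^-1 * psi (s%:C + ka'%:C * z))) =
      ka'%:C * psi s%:C * path_int h (fun z => B z / (ts + ka%:C * w - ka'%:C * z)).
    rewrite -path_intZ//; last first.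
      by move=> x hx; apply: scaled_kernel_hcont; [exact/cB/hZ|exact/nz/hZ].
    apply: path_int_ext => x _; rewrite /B /ts rmorphB /=.
    have -> : t%:C + ka%:C * w - (s%:C + ka'%:C * h x) = t%:C - s%:C + ka%:C * w - ka'%:C * h x by ring.
    by rewrite [RHS]mulrA -[ka'%:C * _ * _]mulrA [psi s%:C * _]mulrC divfK// -mulrA [_ * _^-1]mulrC.
  rewrite /Kc /a /A; move: (path_int h _) => I; field.
  exact: fn.
have lin g : on_path g (near_axis rho al) -> gpath g ->
    path_int g (fun w => ka%:C * (phi (t%:C + ka%:C * w) * chain_int (local_chain s ka' rho' al')
      (fun z => (t%:C + ka%:C * w - z)^-1 * psi z))) =
    Kc * (path_int g (a K) + (path_int g (a C1) + path_int g (a C2))).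
  move=> gW gg.
  have caK x : 0 <= x <= 1 -> hcont (a K) (g x) by move=> hx; apply: ca => //; exact: gW.
  have caC1 x : 0 <= x <= 1 -> hcont (a C1) (g x) by move=> hx; apply: ca => //; exact: gW.
  have caC2 x : 0 <= x <= 1 -> hcont (a C2) (g x) by move=> hx; apply: ca => //; exact: gW.
  have caC x : 0 <= x <= 1 -> hcont (fun w => a C1 w + a C2 w) (g x).
    by move=> hx; apply: hcontD; [exact: caC1|exact: caC2].
  transitivity (path_int g (fun w => Kc * (a K w + (a C1 w + a C2 w)))).
    apply: path_int_ext => x hx; rewrite local_chain_int /int_k /int_c -/K -/C1 -/C2.
    have hw := gW x hx.
    by apply: mulD3; exact: outer.
  transitivity (Kc * path_int g (fun w => a K w + (a C1 w + a C2 w))).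
    by apply: (path_intZ _ gg) => x hx; apply: hcontD; [exact: caK|exact: caC].
  congr (_ * _); transitivity (path_int g (a K) + path_int g (fun w => a C1 w + a C2 w)).
    exact: (path_intD gg caK caC).
  by congr (_ + _); exact: (path_intD gg caC1 caC2).
have kK := split_gauss cA cB k0 nz (realC_neq tsn) W2 gk Z2 gK.
set I1 := int_k rho _; set I2 := int_k rho _; set I3 := int_k rho _.
have eI2 : I2 = path_int k (fun w => path_int K (fun z => (A w * B z - cexp (w ^+ 2 + z ^+ 2)) / ts)).
  apply: path_int_ext => y hy; apply: path_int_ext => x hx.
  by have [_ -> _] := hE _ _ (W2 y hy) (Z2 x hx).
have eI3 : I3 = path_int k (fun w => path_int K (fun z =>
    A w * B z / (ts + ka%:C * w - ka'%:C * z) - A w * B z / ts)).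
  apply: path_int_ext => y hy; apply: path_int_ext => x hx.
  by have [_ e1 ->] := hE _ _ (W2 y hy) (Z2 x hx); rewrite e1.
have e123 : path_int k (a K) = I1 + I2 + I3.
  rewrite eI2 eI3; apply: etrans kK; apply: path_int_ext => x hx.
  exact: (esym (split_inner A cB nz Z2 gK (W2 x hx))).
have eC g : on_path g (near_axis rho al) -> gpath g ->
    path_int g (fun w => int_c rho' al' (Ph w)) = path_int g (a C1) + path_int g (a C2).
  move=> gW gg; transitivity (path_int g (fun w => a C1 w + a C2 w)).
    by apply: path_int_ext => x hx; exact: (congr2 +%R (inner _ _ Z1 gC1 (gW x hx)) (inner _ _ Z3 gC2 (gW x hx))).
  have caC1 x : 0 <= x <= 1 -> hcont (a C1) (g x).
    by move=> hx; exact: (ca C1 (g x) Z1 gC1 (gW x hx)).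
  have caC2 x : 0 <= x <= 1 -> hcont (a C2) (g x).
    by move=> hx; exact: (ca C2 (g x) Z3 gC2 (gW x hx)).
  exact: (path_intD gg caC1 caC2).
have eK g : on_path g (near_axis rho al) -> gpath g ->
    path_int g (fun w => int_k rho' (Ph w)) = path_int g (a K).
  by move=> gW gg; apply: path_int_ext => x hx; exact: (inner K (g x) Z2 gK (gW x hx)).
have e4 := eC k W2 gk.
have e5 : int_c rho al (fun w => int_k rho' (Ph w)) = path_int c1 (a K) + path_int c2 (a K).
  exact: (congr2 +%R (eK c1 W1 gc1) (eK c2 W3 gc2)).
have e6 : int_c rho al (fun w => int_c rho' al' (Ph w)) =
    (path_int c1 (a C1) + path_int c1 (a C2)) + (path_int c2 (a C1) + path_int c2 (a C2)).
  exact: (congr2 +%R (eC c1 W1 gc1) (eC c2 W3 gc2)).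
rewrite /double_int local_chain_int.
transitivity (Kc * (path_int k (a K) + (path_int k (a C1) + path_int k (a C2))) +
   (Kc * (path_int c1 (a K) + (path_int c1 (a C1) + path_int c1 (a C2))) +
    Kc * (path_int c2 (a K) + (path_int c2 (a C1) + path_int c2 (a C2))))).
  exact: (congr2 +%R (lin k W2 gk) (congr2 +%R (lin c1 W1 gc1) (lin c2 W3 gc2))).
have sum6 (x1 x2 x3 x4 x5 x6 kK' kC1 kC2 c1K c1C1 c1C2 c2K c2C1 c2C2 : R[i]) :
    kK' = x1 + x2 + x3 -> x4 = kC1 + kC2 -> x5 = c1K + c2K ->
    x6 = (c1C1 + c1C2) + (c2C1 + c2C2) ->
    Kc * (kK' + (kC1 + kC2)) + (Kc * (c1K + (c1C1 + c1C2)) + Kc * (c2K + (c2C1 + c2C2))) =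
    Kc * (x1 + x2 + x3 + x4 + x5 + x6).
  by move=> -> -> -> ->; ring.
exact: (sum6 _ _ _ _ _ _ _ _ _ _ _ _ _ _ _ e123 e4 e5 e6).
Qed.
End MainTermSplit.

(** * Estimates at the critical points *)

Section SaddlePoint.
Context {R : realType}.
Implicit Types (w z : R[i]) (q u v s t y e : R).

Lemma fprime_real (x : forall n, 'I_n -> R) (n m : nat) v e y : (0 < n)%N ->
  n%:R * (1 - e) = m%:R ->
  fprime (cauchy_transform_n x n) v e y%:C =
  (n%:R^-1 * (\sum_i (y - x n i)^-1 - m%:R / (y - v)))%:C.
Proof.
move=> n0 em; have nR : n%:R != 0 :> R by rewrite pnatr_eq0 -lt0n.
have -> : m%:R / (y - v) = n%:R * ((1 - e) / (y - v)) by rewrite -em mulrA.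
rewrite mulrBr mulKf// /fprime /cauchy_transform_n natCE.
rewrite !(rmorphB, rmorphM, fmorphV, rmorph_sum) /=; congr (_ * _ - _).
by apply: eq_bigr => i _; rewrite fmorphV rmorphB.
Qed.

Lemma cderive_fprime_real (x : forall n, 'I_n -> R) (n m : nat) v e y : (0 < n)%N ->
  n%:R * (1 - e) = m%:R -> (forall i, x n i < y) -> v < y ->
  cderive (fprime (cauchy_transform_n x n) v e) y%:C =
  (n%:R^-1 * (m%:R * (y - v) ^- 2 - \sum_i (y - x n i) ^- 2))%:C.
Proof.
move=> n0 em xy vy; have nR : n%:R != 0 :> R by rewrite pnatr_eq0 -lt0n.
rewrite cderive_fprime; first last.
- by apply: realC_neq; rewrite gt_eqF.
- by move=> i; apply: realC_neq; rewrite gt_eqF.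
rewrite -em mulrBr -mulrA mulKf// addrC natCE.
rewrite !(rmorphB, rmorphM, fmorphV, rmorphXn, rmorph_sum) /=; congr (_ - _ * _).
by apply: eq_bigr => i _; rewrite fmorphV rmorphXn rmorphB.
Qed.

(* With [T = y0 - v] and [d i = y0 - x i], the root condition turns
   [m / T ^ 2 - sum 1 / d ^ 2] into [- sum (x i - v) / d ^ 2 / T]. *)
Lemma circle_condition (n : nat) (x : 'I_n -> R) v y (m : nat) q e : (0 < n)%N ->
  v < y -> (forall i, x i < y) -> \sum_i (y - x i)^-1 = m%:R / (y - v) ->
  n%:R * e <= m%:R * (y - v) ^- 2 - \sum_i (y - x i) ^- 2 ->
  q ^+ 2 <= e * (y - v) ^+ 4 ->
  \sum_i (x i - v) / cmod ((y +i* q) - (x i)%:C) ^+ 2 <= 0.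
Proof.
move=> n0 vy xy crit he hq; set T := y - v; have T0 : 0 < T by rewrite subr_gt0.
have nR : 0 < n%:R :> R by rewrite ltr0n.
have e1 : \sum_i (x i - v) / (y - x i) ^+ 2 =
    - T * (m%:R * T ^- 2 - \sum_i (y - x i) ^- 2).
  have -> : m%:R * T ^- 2 = T^-1 * \sum_i (y - x i)^-1.
    by rewrite crit -/T expr2 invfM; ring.
  transitivity (T * (\sum_i (y - x i) ^- 2) - \sum_i (y - x i)^-1).
    rewrite mulr_sumr -sumrB; apply: eq_bigr => i _; have di : 0 < y - x i by rewrite subr_gt0.
    have -> : x i - v = T - (y - x i) by rewrite /T; ring.
    by field; rewrite gt_eqF.
  by field; rewrite gt_eqF.
(* Adding q^2 to (y - x_i)^2 lowers the terms with x_i >= v. The others increase by at most q^2 / (y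
   - x_i)^3, and there y - x_i >= T. *)
have step i : (x i - v) / cmod ((y +i* q) - (x i)%:C) ^+ 2 <=
    (x i - v) / (y - x i) ^+ 2 + q ^+ 2 * T ^- 3.
  have di : 0 < y - x i by rewrite subr_gt0.
  set D := y - x i in di *.
  have -> : cmod ((y +i* q) - (x i)%:C) ^+ 2 = D ^+ 2 + q ^+ 2.
    by rewrite cmod_sqr ReB ImB ReC ImC /= subr0.
  have q2 := sqr_ge0 q; have D2 : 0 < D ^+ 2 by rewrite exprn_gt0.
  have Dq : 0 < D ^+ 2 + q ^+ 2 by rewrite ltr_wpDr.
  have pT : 0 <= q ^+ 2 * T ^- 3 by rewrite mulr_ge0// invr_ge0 exprn_ge0// ltW.
  have [xv|xv] := leP v (x i).
    apply: ler_wpDr => //; apply: ler_wpM2l; first by rewrite subr_ge0.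
    by rewrite lef_pV2 ?posrE// lerDl.
  have TD : T <= D by rewrite /T /D; lra.
  have vD : v - x i <= D by rewrite /D; lra.
  rewrite -lerBlDl -mulrBr.
  have -> : (x i - v) * ((D ^+ 2 + q ^+ 2)^-1 - (D ^+ 2)^-1) =
      (v - x i) * (q ^+ 2 / ((D ^+ 2 + q ^+ 2) * D ^+ 2)).
    by field; rewrite !gt_eqF.
  have h : q ^+ 2 / ((D ^+ 2 + q ^+ 2) * D ^+ 2) <= q ^+ 2 / (D ^+ 2 * D ^+ 2).
    apply: ler_wpM2l => //; rewrite lef_pV2 ?posrE ?mulr_gt0//.
    by apply: ler_wpM2r; [exact: ltW|rewrite lerDl].
  have h0 : 0 <= q ^+ 2 / ((D ^+ 2 + q ^+ 2) * D ^+ 2).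
    by rewrite divr_ge0// mulr_ge0 ?ltW.
  apply: (@le_trans _ _ (D * (q ^+ 2 / (D ^+ 2 * D ^+ 2)))).
    by apply: ler_pM => //; rewrite subr_ge0 ltW.
  have -> : D * (q ^+ 2 / (D ^+ 2 * D ^+ 2)) = q ^+ 2 * D ^- 3 by field; rewrite gt_eqF.
  apply: ler_wpM2l => //; rewrite lef_pV2 ?posrE ?exprn_gt0//.
  by apply: lerXn2r; rewrite ?nnegrE//; exact: ltW.
apply: (le_trans (ler_sum _ (fun i _ => step i))); rewrite big_split/= e1 sumr_const card_ord.
have : T * (n%:R * e) <= T * (m%:R * T ^- 2 - \sum_i (y - x i) ^- 2) by apply: ler_wpM2l => //; exact: ltW.
have : q ^+ 2 * T ^- 3 <= T * e.
  rewrite ler_pdivrMr ?exprn_gt0//; apply: le_trans hq _.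
  by rewrite le_eqVlt; apply/orP; left; apply/eqP; rewrite -/T; ring.
rewrite -mulr_natl => h1 h2; rewrite mulNr.
have := ler_wpM2l (ltW nR) h1; lra.
Qed.

(** The points t and s are only approximately critical for f_n and \tilde f_n, so the linear term is
    kept in the error, with |w - y| <= 2 q. The cubic part uses 2 (9 / 8)^3 <= 3. *)
Lemma local_expansion (n : nat) (x : 'I_n -> R) v y (m : nat) q be ga : (0 < n)%N -> (m <= n)%N ->
  0 < q -> 9 / 4 * q <= be -> 9 / 4 * q <= ga -> (forall i, be <= y - x i) -> ga <= y - v ->
  forall w, cmod (w - y%:C) <= 9 / 8 * q ->
  exists2 e, weight x v m w = weight x v m y%:C *
      cexp ((2^-1 * (m%:R * (y - v) ^- 2 - \sum_i (y - x i) ^- 2))%:C * (w - y%:C) ^+ 2 + e)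
    & cmod e <= n%:R * (`|n%:R^-1 * (\sum_i (y - x i)^-1 - m%:R / (y - v))| * (2 * q)
        + 3 * (be ^- 3 + ga ^- 3) * q ^+ 3).
Proof.
move=> n0 mn q0 qbe qga hbe hga w hw.
have be0 : 0 < be by lra.
have ga0 : 0 < ga by lra.
have [i||i||e ew he] := @weight_expansion _ n x v y m w.
- by have := hbe i; lra.
- by lra.
- by have := hbe i; lra.
- by lra.
exists ((\sum_i (y - x i)^-1 - m%:R / (y - v))%:C * (w - y%:C) + e).
  by rewrite ew; congr (_ * cexp _); ring.
have c0 := cmod_ge0 (w - y%:C).
apply: (le_trans (cmodD _ _)); rewrite [leRHS]mulrDr; apply: lerD.
  rewrite cmodM cmodR mulrA; set S := _ - _; apply: ler_pM => //; last by lra.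
  by rewrite normrM mulrA ger0_norm ?invr_ge0// divff ?mul1r// pnatr_eq0 -lt0n.
have sb : \sum_i (y - x i) ^- 3 <= n%:R * be ^- 3.
  have -> : n%:R * be ^- 3 = \sum_(i < n) be ^- 3 by rewrite sumr_const card_ord mulr_natl.
  apply: ler_sum => i _; rewrite lef_pV2 ?posrE ?exprn_gt0//; last exact: lt_le_trans (hbe i).
  by apply: lerXn2r; rewrite ?nnegrE ?(ltW be0) ?(le_trans (ltW be0)).
have sg : m%:R * (y - v) ^- 3 <= n%:R * ga ^- 3.
  apply: ler_pM; rewrite ?ler_nat// ?invr_ge0 ?exprn_ge0 ?(le_trans (ltW ga0))//.
  rewrite lef_pV2 ?posrE ?exprn_gt0//; last exact: lt_le_trans hga.
  by apply: lerXn2r; rewrite ?nnegrE ?(ltW ga0)// (le_trans (ltW ga0)).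
have c3 : cmod (w - y%:C) ^+ 3 <= (9 / 8 * q) ^+ 3.
  by apply: lerXn2r; rewrite ?nnegrE// mulr_ge0// ltW.
have b0 : 0 <= be ^- 3 by rewrite invr_ge0 exprn_ge0// ltW.
have g0 : 0 <= ga ^- 3 by rewrite invr_ge0 exprn_ge0// ltW.
have nb0 : 0 <= n%:R * (be ^- 3 + ga ^- 3) by rewrite mulr_ge0 ?addr_ge0.
have q3 : 0 <= q ^+ 3 by rewrite exprn_ge0// ltW.
apply: (le_trans he); apply: (@le_trans _ _ (2 * (n%:R * (be ^- 3 + ga ^- 3)) * (9 / 8 * q) ^+ 3)).
  have S0 : 0 <= \sum_i (y - x i) ^- 3 + m%:R * (y - v) ^- 3.
    apply: addr_ge0; last by rewrite mulr_ge0// invr_ge0 exprn_ge0// (le_trans (ltW ga0)).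
    by apply: sumr_ge0 => i _; rewrite invr_ge0 exprn_ge0// (le_trans (ltW be0)).
  apply: ler_pM; [exact: mulr_ge0|exact: exprn_ge0| |exact: c3].
  by apply: ler_wpM2l => //; rewrite mulrDr; exact: lerD.
have := mulr_ge0 nb0 q3; clear; lra.
Qed.
End SaddlePoint.

(** * Powers of n and numerical constants *)

Section Scales.
Context {R : realType}.
Implicit Types (a b theta : R) (n : nat).

Lemma npow_gt0 n a : (0 < n)%N -> 0 < npow n a.
Proof. by move=> n0; rewrite /npow powR_gt0 ?ltr0n. Qed.

Lemma npowD n a b : (0 < n)%N -> npow n (a + b) = npow n a * npow n b.
Proof. by move=> n0; rewrite /npow powRD// pnatr_eq0 -lt0n n0 implybT. Qed.

Lemma npow1 n : npow n 1 = n%:R :> R.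
Proof. by rewrite /npow powRr1// ler0n. Qed.

Lemma npowN n a : npow n (- a) = (npow n a)^-1.
Proof. by rewrite /npow powRN. Qed.

(** All powers of n become monomials in n, p = n^(-1/2) and q = n^(-theta), so that later identities
    are rational. *)
Lemma npow_scales n theta : (0 < n)%N ->
  let p := npow n (- 2^-1) in let q := npow n (- theta) in
  [/\ p ^+ 2 * n%:R = 1, npow n (2^-1 - theta) = q / p, npow n (1 - 3 * theta) = n%:R * q ^+ 3,
      npow n (1 - 2 * theta) = n%:R * q ^+ 2
    & [/\ npow n (1 - theta) = n%:R * q, npow n theta = q^-1, npow n (2 * theta) = q ^- 2,
      npow n (- 1 + 3 * theta) = (n%:R * q ^+ 3)^-1 & npow n (- 2^-1 + theta) = p / q]].
Proof.
move=> n0 p q; have n1 : n%:R != 0 :> R by rewrite pnatr_eq0 -lt0n.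
have pq a : npow n a != 0 by rewrite gt_eqF// npow_gt0.
have sq a : npow n (2 * a) = npow n a ^+ 2 by rewrite mulr_natl mulr2n npowD.
have cu a : npow n (3 * a) = npow n a ^+ 3.
  by have -> : 3 * a = a + 2 * a by [ring]; rewrite npowD// sq -exprS.
have e1 : npow n theta = q^-1 by rewrite /q npowN invrK.
have e2 : npow n (1 - 3 * theta) = n%:R * q ^+ 3.
  by rewrite npowD// npow1; congr (_ * _); rewrite /q -cu; congr npow; ring.
split.
- by rewrite -sq mulrN divff// -[in LHS]npow1 -npowD// addNr /npow powRr0.
- by rewrite npowD// mulrC; congr (_ * _); rewrite /p npowN invrK.
- exact: e2.
- by rewrite npowD// npow1; congr (_ * _); rewrite /q -sq; congr npow; ring.
- split.
  + by rewrite npowD// npow1.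
  + exact: e1.
  + by rewrite sq e1 exprVn.
  + by rewrite -e2 -npowN; congr npow; ring.
  + by rewrite npowD// e1.
Qed.

Lemma weight_real (n : nat) (x : 'I_n -> R) (v : R) (m : nat) (y : R) :
  (forall i, x i < y) -> v < y ->
  weight x v m y%:C = (cmod (weight x v m y%:C))%:C /\ 0 < cmod (weight x v m y%:C).
Proof.
move=> xy vy.
have e : weight x v m y%:C = (\prod_i (y - x i) / (y - v) ^+ m)%:C.
  rewrite /weight rmorphM rmorph_prod fmorphV rmorphXn rmorphB /=; congr (_ / _).
  by apply: eq_bigr => i _; rewrite rmorphB.
have c0 : 0 < \prod_i (y - x i) / (y - v) ^+ m.
  rewrite divr_gt0 ?exprn_gt0 ?subr_gt0//; apply: prodr_gt0 => i _.
  by rewrite subr_gt0.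
by rewrite e cmodR ger0_norm// ltW.
Qed.

Lemma inv_weight_real (n : nat) (x : 'I_n -> R) (u : R) (k : nat) (y : R) :
  (forall i, x i < y) -> u < y ->
  inv_weight x u k y%:C = (cmod (inv_weight x u k y%:C))%:C /\ 0 < cmod (inv_weight x u k y%:C).
Proof.
move=> xy uy; have [e c] := weight_real k xy uy.
by rewrite inv_weightE cmodV {1}e fmorphV invr_gt0.
Qed.

(** The origin of the constants of G_n. After division by (2 pi)^2 the three coefficients are at
    most 6.98, 6.75 and 7.75, by pi >= 3; they are bounded by 8, 8 and 16. The factor 24 / 5 is 3
    for the exponential of the errors times 8 / 5 for the distance of the contours. *)
Lemma rest_numeric (n e0 Ee d X e1 e2 e12 q lw lz a c rest : R) :
  0 < n -> 0 < e0 -> 0 < q -> 0 < d -> 0 <= Ee <= 3 -> 0 < X -> 0 < a -> 0 < c ->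
  0 <= e1 <= X -> 0 <= e2 <= X -> 0 <= e12 <= X * X ->
  0 <= lz <= 31 / 4 * a -> 0 <= lw <= 2 * pi * (5 / 4 * c) ->
  rest <= e0 * Ee / (5 / 8 * d) * (e2 * (27 / 4 * q * lz) + e1 * (27 / 4 * q * lw) + e12 * (lw * lz)) ->
  n * (rest / (2 * pi) ^+ 2) <
  e0 / d * (X * (n * q) * (8 * a + 8 * c + 16 * X * q^-1 * c * a)).
Proof.
move=> n0 e00 q0 d0 /andP[Ee0 Ee3] X0 a0 c0 /andP[e10 e1X] /andP[e20 e2X] /andP[e120 e12X]
  /andP[lz0 lza] /andP[lw0 lwc] hr.
have p3 := @pi_ge3 R; have p0 : 0 < pi :> R by lra.
have Y0 : 0 < e0 / d by rewrite divr_gt0.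
set Y := e0 / d in Y0 *.
have t1 : e2 * (27 / 4 * q * lz) <= X * (27 / 4 * q * (31 / 4 * a)).
  by apply: ler_pM => //; [rewrite !mulr_ge0// ltW|apply: ler_wpM2l => //; rewrite mulr_ge0// ltW].
have t2 : e1 * (27 / 4 * q * lw) <= X * (27 / 4 * q * (2 * pi * (5 / 4 * c))).
  by apply: ler_pM => //; [rewrite !mulr_ge0// ltW|apply: ler_wpM2l => //; rewrite mulr_ge0// ltW].
have t3 : e12 * (lw * lz) <= X * X * (2 * pi * (5 / 4 * c) * (31 / 4 * a)).
  by apply: ler_pM => //; [rewrite mulr_ge0|apply: ler_pM].
have t0 : e0 * Ee / (5 / 8 * d) <= 24 / 5 * Y.
  have -> : e0 * Ee / (5 / 8 * d) = 8 / 5 * (Y * Ee) by rewrite /Y; field; rewrite gt_eqF.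
  by have := ler_wpM2l (ltW Y0) Ee3; clear; lra.
clearbody Y.
set S := X * (27 / 4 * q * (31 / 4 * a)) + X * (27 / 4 * q * (2 * pi * (5 / 4 * c))) +
  X * X * (2 * pi * (5 / 4 * c) * (31 / 4 * a)).
have hS : rest <= 24 / 5 * Y * S.
  apply: (le_trans hr); apply: ler_pM => //.
  - by apply: divr_ge0; [exact: (mulr_ge0 (ltW e00))|move: d0; clear; lra].
  - have q27 : 0 <= 27 / 4 * q by move: q0; clear; lra.
    by rewrite !addr_ge0// mulr_ge0// mulr_ge0.
  - by rewrite /S !lerD.
set i := (pi : R)^-1; have i0 : 0 < i by rewrite invr_gt0.
have i3 : i <= 3^-1 by rewrite /i lef_pV2 ?posrE.
have i9 : i ^+ 2 <= 9^-1.
  by have := ler_pM (ltW i0) (ltW i0) i3 i3; rewrite -expr2; clear; lra.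
have M1 : 0 < n * Y * X * q * a by rewrite !mulr_gt0.
have M2 : 0 < n * Y * X * q * c by rewrite !mulr_gt0.
have M3 : 0 < n * Y * X * X * c * a by rewrite !mulr_gt0.
have eR : Y * (X * (n * q) * (8 * a + 8 * c + 16 * X * q^-1 * c * a)) =
    8 * (n * Y * X * q * a) + 8 * (n * Y * X * q * c) + 16 * (n * Y * X * X * c * a).
  by field; rewrite gt_eqF.
have eL : n * (24 / 5 * Y * S / (2 * pi) ^+ 2) =
    24 / 5 * (27 * 31 / 64) * (n * Y * X * q * a * i ^+ 2) + 24 / 5 * (135 / 32) * (n * Y * X * q * c * i)
    + 24 / 5 * (155 / 32) * (n * Y * X * X * c * a * i).
  by rewrite /S /i; move: (pi) p0 => P P0; field; rewrite gt_eqF.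
rewrite eR; apply: (@le_lt_trans _ _ (n * (24 / 5 * Y * S / (2 * pi) ^+ 2))).
  have h : rest / (2 * pi) ^+ 2 <= 24 / 5 * Y * S / (2 * pi) ^+ 2.
    by apply: ler_wpM2r hS; rewrite invr_ge0 sqr_ge0.
  exact: (ler_wpM2l (ltW n0) h).
rewrite eL; have := ler_wpM2l (ltW M1) i9; have := ler_wpM2l (ltW M2) i3; have := ler_wpM2l (ltW M3) i3.
by move: M1 M2 M3; clear; lra.
Qed.
End Scales.

(** * The error bound for fixed n *)

(* The hypotheses for a fixed n, in the form used below: k = n - r_n - 1 and
   m + 1 = n - s_n + 1 are the exponents in [J_n], ev = (s_n - 1) / n and
   eu = (r_n + 1) / n, while sn stands for \tilde s_n. *)
Record regime (R : realType) (x : forall n, 'I_n -> R) (n k m : nat)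
    (b chi xi u v t s tn sn ev eu theta : R) : Prop := Regime {
  rg_n : (0 < n)%N;
  rg_inj : injective (x n);
  rg_k : (2 <= k < n)%N;
  rg_m : (m < n)%N;
  rg_ev : n%:R * (1 - ev) = m.+1%:R;
  rg_eu : n%:R * (1 - eu) = k%:R;
  rg_xi : 0 < xi;
  rg_x : forall i, x n i < b + 4 * xi;
  rg_bs : b + 4 * xi < s - 4 * xi;
  rg_st : s + 4 * xi < t - 4 * xi;
  rg_cb : chi + 4 * xi < b - 4 * xi;
  rg_u : chi - 4 * xi < u < chi + 4 * xi;
  rg_v : chi - 4 * xi < v < chi + 4 * xi;
  rg_uv : `|v - u| < xi / 2;
  rg_pq : 2 * npow n (- 2^-1) < npow n (- theta);
  rg_q : npow n (- theta) < xi;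
  rg_tn : `|tn - t| < npow n (- 2^-1);
  rg_sn : `|sn - s| < npow n (- 2^-1);
  rg_tn0 : \sum_i (tn - x n i)^-1 = m.+1%:R / (tn - v);
  rg_sn0 : \sum_i (sn - x n i)^-1 = k%:R / (sn - u);
  rg_circ : \sum_i (x n i - v) / cmod ((tn +i* npow n (- theta)) - (x n i)%:C) ^+ 2 <= 0;
  rg_ft : 0 < m.+1%:R * (t - v) ^- 2 - \sum_i (t - x n i) ^- 2;
  rg_fs : 0 < \sum_i (s - x n i) ^- 2 - k%:R * (s - u) ^- 2;
  rg_E : npow n (1 - 3 * theta) *
    (2 * npow n (2 * theta) * cmod (fprime (cauchy_transform_n x n) v ev t%:C)
       + 2 ^+ 6 / (t - b) ^+ 3 + 2 ^+ 5 / (t - chi) ^+ 3 +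
     (2 * npow n (2 * theta) * cmod (fprime (cauchy_transform_n x n) u eu s%:C)
       + 2 ^+ 9 / (s - b) ^+ 3 + 2 ^+ 6 / (s - chi) ^+ 3)) < 1 }.

Section CubicErrors.
Context {R : realType}.
Implicit Types (a c d P Q : R).

Lemma error_merge (n0 q0 a c P Q P' Q' : R) : 0 < n0 -> 0 < q0 -> 0 <= a -> 3 * P <= P' -> 3 * Q <= Q' ->
  n0 * (a * (2 * q0) + 3 * (P + Q) * q0 ^+ 3) <=
  n0 * q0 ^+ 3 * (2 * q0 ^- 2 * a + P' + Q').
Proof.
move=> n00 q00 a0 h1 h2; rewrite -[leRHS]mulrA; apply: ler_wpM2l; first exact: ltW.
have -> : q0 ^+ 3 * (2 * q0 ^- 2 * a + P' + Q') = a * (2 * q0) + (P' + Q') * q0 ^+ 3.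
  by field; rewrite gt_eqF.
rewrite lerD2l; apply: ler_wpM2r; first by rewrite exprn_ge0// ltW.
by lra.
Qed.

(** Replaces a guaranteed distance c by the reference distance a of (N3). It is applied with d = 4 /
    3 and d = 2, and 3 d^3 is then below the powers of 2 in E_{2,n} and \tilde E_{2,n}. *)
Lemma cube_margin (a c d : R) (j : R) : 0 < a -> a <= d * c -> 0 < c -> 0 <= j -> 3 * d ^+ 3 <= j ->
  3 * c ^- 3 <= j / a ^+ 3.
Proof.
move=> a0 ac c0 j0 dj; rewrite ler_pdivlMr ?exprn_gt0//.
apply: (@le_trans _ _ (3 * c ^- 3 * (d * c) ^+ 3)).
  apply: ler_wpM2l; first by rewrite mulr_ge0// invr_ge0 exprn_ge0// ltW.
  by apply: lerXn2r; rewrite ?nnegrE ?(le_trans (ltW a0))// ltW.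
apply: le_trans dj; rewrite le_eqVlt; apply/orP; left; apply/eqP.
by field; rewrite gt_eqF.
Qed.
End CubicErrors.

Section FixedN.
Context {R : realType} (x : forall n, 'I_n -> R) (n k m : nat)
  (b chi xi u v t s tn sn ev eu theta : R)
  (rg : regime x n k m b chi xi u v t s tn sn ev eu theta).

Arguments x : clear implicits.
Let p := npow n (- 2^-1) : R.
Let q := npow n (- theta) : R.
Let fn' := fprime (cauchy_transform_n x n) v ev.
Let ftn' := fprime (cauchy_transform_n x n) u eu.
Let D := D_of fn' t.
Let Dt := D_of ftn' s.
Let phi := weight (x n) v m.+1.
Let psi := inv_weight (x n) u k.
Let Qw := 2^-1 * (m.+1%:R * (t - v) ^- 2 - \sum_i (t - x n i) ^- 2).
Let Qz := 2^-1 * (\sum_i (s - x n i) ^- 2 - k%:R * (s - u) ^- 2).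
Let E := 2 * npow n (2 * theta) * cmod (fn' t%:C) + 2 ^+ 6 / (t - b) ^+ 3 + 2 ^+ 5 / (t - chi) ^+ 3.
Let Et := 2 * npow n (2 * theta) * cmod (ftn' s%:C) + 2 ^+ 9 / (s - b) ^+ 3 + 2 ^+ 6 / (s - chi) ^+ 3.
Let ka := p * D^-1.
Let kat := p * Dt^-1.

Lemma regime_order : [/\ forall i, x n i < s - q, u < s - q, v < t - q, 0 < p /\ 0 < q
  & [/\ b < s, s < t, chi < b, chi < s & 8 * xi < t - s]].
Proof.
have [hx hbs hst hcb hu] := And5 (rg_x rg) (rg_bs rg) (rg_st rg) (rg_cb rg) (rg_u rg).
have hv := rg_v rg; have hxi := rg_xi rg; have hq := rg_q rg; have n0 := rg_n rg.
have p0 : 0 < p by apply: npow_gt0.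
have q0 : 0 < q by apply: npow_gt0.
rewrite -/q in hq; move: hbs hst hcb hu hv hxi hq q0 => hbs hst hcb hu hv hxi hq q0.
split=> // [i|||].
- by move: (hx i) hbs hxi hq; lra.
- by move: hu hcb hbs hxi hq; lra.
- by move: hv hcb hbs hst hxi hq; lra.
- by move: hcb hbs hst hxi => *; split; lra.
Qed.

Lemma regime_lt : [/\ forall i, x n i < t, v < t, forall i, x n i < s & u < s].
Proof.
have [hx hu hv [_ q0] [_ st _ _ _]] := regime_order.
split=> [i||i|]; [have := hx i| |have := hx i|]; move: hu hv q0 st; lra.
Qed.

(** n D^2 is the quadratic coefficient of n f_n at t. At s the second derivative is negative, but
    [psi] is a reciprocal, so n Dt^2 is its quadratic coefficient, again positive. *)
Lemma regime_D : [/\ 0 < D, n%:R * D ^+ 2 = Qw, 0 < Dt & n%:R * Dt ^+ 2 = Qz].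
Proof.
have [xt vt xs us] := regime_lt; have n0 := rg_n rg.
have nR : 0 < n%:R :> R by rewrite ltr0n.
have h (c : R) : 0 < c -> 0 < Num.sqrt (2^-1 * (n%:R^-1 * c)) /\
    n%:R * Num.sqrt (2^-1 * (n%:R^-1 * c)) ^+ 2 = 2^-1 * c.
  move=> c0; have h : 0 < 2^-1 * (n%:R^-1 * c) by rewrite !mulr_gt0// invr_gt0.
  by rewrite sqrtr_gt0; split=> //; rewrite sqr_sqrtr ?ltW//; field; rewrite gt_eqF.
rewrite /D /Dt /D_of /fn' /ftn' (cderive_fprime_real n0 (rg_ev rg) xt vt)
  (cderive_fprime_real n0 (rg_eu rg) xs us) !cmodR.
have ft := rg_ft rg; have fs := rg_fs rg.
rewrite (gtr0_norm (mulr_gt0 _ ft)) ?invr_gt0// -normrN -mulrN opprB.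
rewrite (gtr0_norm (mulr_gt0 _ fs)) ?invr_gt0//.
by have [h1 h2] := h _ ft; have [h3 h4] := h _ fs.
Qed.

Lemma regime_q3 : npow n (1 - 3 * theta) = n%:R * q ^+ 3.
Proof. by have [_ _ -> _ _] := npow_scales theta (rg_n rg). Qed.

Lemma regime_E_ge0 : 0 <= E /\ 0 <= Et.
Proof.
have [_ _ _ _ [bs st cb cs _]] := regime_order.
have n0 := rg_n rg.
have h (c d : R) (j : nat) : d < c -> 0 <= 2 ^+ j / (c - d) ^+ 3.
  by move=> dc; rewrite divr_ge0// exprn_ge0// subr_ge0 ltW.
have g z : 0 <= 2 * npow n (2 * theta) * cmod z :> R.
  by rewrite !mulr_ge0// ?cmod_ge0// ltW// npow_gt0.
by split; rewrite !addr_ge0 ?g ?h// ?(lt_trans bs st) ?(lt_trans cs st)//; apply: lt_trans st.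
Qed.

(** The last inequality of (N3): on the local contours the errors in the two exponents add up to
    less than 1. *)
Lemma regime_eps : 0 <= n%:R * q ^+ 3 * E /\ 0 <= n%:R * q ^+ 3 * Et /\
  n%:R * q ^+ 3 * E + n%:R * q ^+ 3 * Et < 1.
Proof.
have [E0 Et0] := regime_E_ge0; have [_ _ _ [_ q0] _] := regime_order.
have nq : 0 <= n%:R * q ^+ 3 by rewrite mulr_ge0// exprn_ge0// ltW.
split; first exact: mulr_ge0.
split; first exact: mulr_ge0.
by have := rg_E rg; rewrite regime_q3 -mulrDr.
Qed.

Lemma regime_expansion_w w : cmod (w - t%:C) <= 9 / 8 * q ->
  exists2 e, phi w = phi t%:C * cexp (Qw%:C * (w - t%:C) ^+ 2 + e) & cmod e <= n%:R * q ^+ 3 * E.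
Proof.
have [hx hu hv [_ q0] [bs st cb cs st8]] := regime_order; have n0 := rg_n rg.
have hbs := rg_bs rg; have hst := rg_st rg; have hcb := rg_cb rg; have hxi := rg_xi rg.
have hq := rg_q rg; rewrite -/q in hq.
have bt : 0 < t - b by rewrite subr_gt0 (lt_trans bs).
have ct : 0 < t - chi by rewrite subr_gt0 (lt_trans cs).
move=> hw; have [||i||e ew he] := @local_expansion R n (x n) v t m.+1 q (3 / 4 * (t - b))
    (3 / 4 * (t - chi)) n0 (rg_m rg) q0 _ _ _ _ w hw.
- by move: hq hbs hst hxi; lra.
- by move: hq hbs hst hcb hxi; lra.
- by move: (rg_x rg i) hbs hst hxi; lra.
- by move: (rg_v rg) hbs hst hcb hxi; lra.
exists e => //; apply: (le_trans he).
have [_ _ _ _ [_ _ e2 _ _]] := npow_scales theta n0.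
rewrite /E e2 /fn' (@fprime_real R x n m.+1 v ev t n0 (rg_ev rg)) cmodR.
by apply: error_merge; rewrite ?ltr0n//; apply: (cube_margin (d := 4 / 3)); lra.
Qed.

Lemma regime_expansion_z w : cmod (w - s%:C) <= 9 / 8 * q ->
  exists2 e, psi w = psi s%:C * cexp (Qz%:C * (w - s%:C) ^+ 2 + e) & cmod e <= n%:R * q ^+ 3 * Et.
Proof.
have [hx hu hv [_ q0] [bs st cb cs st8]] := regime_order; have n0 := rg_n rg.
have hbs := rg_bs rg; have hst := rg_st rg; have hcb := rg_cb rg; have hxi := rg_xi rg.
have hq := rg_q rg; rewrite -/q in hq.
have bt : 0 < s - b by rewrite subr_gt0.
have ct : 0 < s - chi by rewrite subr_gt0.
have kn : (k <= n)%N by case/andP: (rg_k rg) => _ /ltnW.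
(* The gap s - b is only known to exceed 8 xi, and a particle may exceed b by almost 4 xi, hence the
   factor 1 / 2. The gaps t - b, t - chi and s - chi exceed 16 xi, which allows 3 / 4. *)
move=> hw; have [||i||e ew he] := @local_expansion R n (x n) u s k q (1 / 2 * (s - b))
    (3 / 4 * (s - chi)) n0 kn q0 _ _ _ _ w hw.
- by move: hq hbs hst hxi; lra.
- by move: hq hbs hst hcb hxi; lra.
- by move: (rg_x rg i) hbs hst hxi; lra.
- by move: (rg_u rg) hbs hst hcb hxi; lra.
exists (- e).
  rewrite /psi !inv_weightE ew invfM -cexpN; congr (_ * cexp _).
  rewrite opprD -mulNr; congr (_ * _ + _).
  by rewrite -rmorphN; congr (_%:C); rewrite /Qz -mulrN opprB.
rewrite cmodN; apply: (le_trans he).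
have [_ _ _ _ [_ _ e2 _ _]] := npow_scales theta n0.
rewrite /Et e2 /ftn' (@fprime_real R x n k u eu s n0 (rg_eu rg)) cmodR.
apply: error_merge; rewrite ?ltr0n//.
  by apply: (cube_margin (d := 2)); lra.
by apply: (cube_margin (d := 4 / 3)); lra.
Qed.
End FixedN.

(** * Rescaled coordinates at the saddle points *)

Section LocalParameters.
Context {R : realType}.
Implicit Types (z w : R[i]) (t s y D theta : R).

Lemma polar_form z : z != 0 -> (cmod z)%:C * cexp (0 +i* carg z) = z.
Proof.
move=> z0; rewrite cexp_imag; apply: eqC.
  by rewrite Re_scale /= cos_carg.
by rewrite Im_scale /= sin_carg.
Qed.

Lemma local_params theta (n : nat) (root y D : R) : (0 < n)%N -> 0 < D ->
  let ka := npow n (- 2^-1) * D^-1 in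
  let rho := rho_of theta n root y D in
  let al := alpha_of theta n root y in
  [/\ 0 < ka, 0 < rho, 0 <= al <= pi
    & ka%:C * (rho%:C * cexp (0 +i* al)) = (root - y) +i* npow n (- theta)].
Proof.
move=> n0 D0 ka rho al; have [_ e1 _ _ [_ e2 _ _ _]] := npow_scales theta n0.
have p0 : 0 < npow n (- 2^-1) :> R by apply: npow_gt0.
have q0 : 0 < npow n (- theta) :> R by apply: npow_gt0.
set c := corner theta n root y; have Ic : 0 < Im c by [].
have c0 : c != 0 by apply: contraTneq Ic => ->; rewrite Im0 ltxx.
have cc : 0 < cmod c by rewrite cmod_gt0.
have er : rho = cmod c * D / npow n (- 2^-1).
  rewrite /rho /rho_of /b_of -/c e1 e2; field.
  by rewrite !gt_eqF.
split.
- by rewrite mulr_gt0 ?invr_gt0.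
- by rewrite er !mulr_gt0 ?invr_gt0.
- rewrite /al /alpha_of -/c (carg_Im_gt0 Ic).
  have := atan_gtNpi2 (Re c / Im c); have := atan_ltpi2 (Re c / Im c); lra.
- rewrite mulrA -rmorphM /=; have -> : ka * rho = cmod c.
    by rewrite er /ka; field; rewrite !gt_eqF.
  by rewrite /al /alpha_of -/c polar_form.
Qed.

(** The squares subtracted in [g_n] cancel those of [exp_g], and so do the powers of n. What remains
    are values of [flog], whose exponentials do not depend on the branch. *)
Lemma exp_g_weights (x : forall n, 'I_n -> R) theta t s (n m k : nat) v u D Dt w z : (0 < n)%N ->
  let w' := t%:C + (npow n (- 2^-1) * D^-1)%:C * w in
  let z' := s%:C + (npow n (- 2^-1) * Dt^-1)%:C * z in
  (forall i, x n i < t) -> v < t -> (forall i, x n i < s) -> u < s ->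
  (forall i, w' != (x n i)%:C) -> w' != v%:C -> (forall i, z' != (x n i)%:C) -> z' != u%:C ->
  exp_g theta t s n (flog x n m v) (flog x n k u) D Dt w z =
  (weight (x n) v m w' / weight (x n) v m t%:C) *
  (inv_weight (x n) u k z' / inv_weight (x n) u k s%:C).
Proof.
move=> n0 w' z' xt vt xs us xw vw xz uz.
have np : (npow n (1 - 3 * theta))%:C != 0 :> R[i].
  by rewrite (realC_neq (b := 0)) ?gt_eqF// npow_gt0.
rewrite /exp_g /g_n mulrA -rmorphM /= divff ?gt_eqF ?npow_gt0// mul1r -/w' -/z'.
set a := n%:R * _; set b := n%:R * _; set c := n%:R * _; set d := n%:R * _.
have -> : w ^+ 2 + z ^+ 2 + (a - b - w ^+ 2 - c + d - z ^+ 2) = (a - b) - (c - d) by ring.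
rewrite !cexpB /a /b /c /d !cexp_flog// ?(inv_weightE _ _ _ z') ?(inv_weightE _ _ _ s%:C).
- by congr (_ * _); exact: invfM.
all: by move=> *; apply: realC_neq; rewrite gt_eqF.
Qed.

Lemma twopii_sqr : (0 +i* (2 * pi)) ^+ 2 = (- (2 * pi) ^+ 2)%:C :> R[i].
Proof. by apply: eqC; rewrite ?expr2 /=; ring. Qed.
End LocalParameters.

(** * Assembly of the error bound *)

Section ErrorBound.
Context {R : realType}.

Definition weight_ratio (n : nat) (x : 'I_n -> R) (u v t s : R) (k m : nat) : R :=
  cmod (weight x v m t%:C) * cmod (inv_weight x u k s%:C).

Lemma ex_weight_ratio (x : forall n, 'I_n -> R) (n : nat) (u v t s : R) (k m : nat) : (0 < n)%N ->
  (forall i, x n i < t) -> v < t -> (forall i, x n i < s) -> u < s ->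
  cexp (n%:R * flog x n m v t%:C - n%:R * flog x n k u s%:C) =
    (weight_ratio (x n) u v t s k m)%:C /\ 0 < weight_ratio (x n) u v t s k m.
Proof.
move=> n0 xt vt xs us; rewrite /weight_ratio.
have [ep p0] := weight_real m xt vt; have [es s0] := inv_weight_real k xs us.
split; last exact: mulr_gt0.
rewrite rmorphM /= -ep -es inv_weightE cexpB !cexp_flog//.
all: by move=> *; apply: realC_neq; rewrite gt_eqF.
Qed.

Lemma cmod_sum6 (a b c d e f : R[i]) :
  cmod (a + b + c + d + e + f) <= cmod a + cmod b + cmod c + cmod d + cmod e + cmod f.
Proof.
by do 5?[apply: (le_trans (cmodD _ _)); rewrite lerD2r].
Qed.

(** The prefactor of F_n is the inverse of n^(1-3 theta) pi / (t - s), so the right side is c times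
    the sum of the six moduli and the triangle inequality concludes. *)
Lemma F_n_bound theta (t s : R) (n : nat) f ft D Dt tn sn (c : R) (S : R[i]) :
  (0 < n)%N -> s < t -> 0 <= c ->
  let rho := rho_of theta n tn t D in
  let rhot := rho_of theta n sn s Dt in
  let al := alpha_of theta n tn t in
  let alt := alpha_of theta n sn s in
  let eg := exp_g theta t s n f ft D Dt in
  let Ph := Phi_n theta t s n f ft D Dt in
  let e0 := fun w z : R[i] => cexp (w ^+ 2 + z ^+ 2) in
  let ts := (t - s)%:C in
  S = int_k rho (fun w => int_k rhot (fun z => e0 w z / ts)) +
   int_k rho (fun w => int_k rhot (fun z => (eg w z - e0 w z) / ts)) +
   int_k rho (fun w => int_k rhot (fun z => Ph w z - eg w z / ts)) +
   int_k rho (fun w => int_c rhot alt (Ph w)) +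
   int_c rho al (fun w => int_k rhot (Ph w)) +
   int_c rho al (fun w => int_c rhot alt (Ph w)) ->
  cmod (- (c%:C * S) - (c * (pi / (t - s)))%:C) <=
  c * (pi / (t - s)) * (npow n (1 - 3 * theta) * F_n theta t s n f ft D Dt tn sn).
Proof.
move=> n0 st c0 rho rhot al alt eg Ph e0 ts ->.
have [_ _ e3 _ [_ _ _ e4 _]] := npow_scales theta n0.
rewrite /F_n -/rho -/rhot -/al -/alt -/eg -/Ph -/e0 -/ts; cbv zeta.
move: (int_k rho (fun w => int_k rhot (fun z => e0 w z / ts)))
  (int_k rho (fun w => int_k rhot (fun z => (eg w z - e0 w z) / ts)))
  (int_k rho (fun w => int_k rhot (fun z => Ph w z - eg w z / ts)))
  (int_k rho (fun w => int_c rhot alt (Ph w)))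
  (int_c rho al (fun w => int_k rhot (Ph w)))
  (int_c rho al (fun w => int_c rhot alt (Ph w))) => a1 a2 a3 a4 a5 a6.
have -> : - (c%:C * (a1 + a2 + a3 + a4 + a5 + a6)) - (c * (pi / (t - s)))%:C =
    c%:C * ((- a1 - (pi / (t - s))%:C) + - a2 + - a3 + - a4 + - a5 + - a6).
  by rewrite rmorphM /=; ring.
rewrite cmodM cmodR ger0_norm//.
have q3 : npow n (1 - 3 * theta) != 0 by rewrite gt_eqF// npow_gt0.
have ts0 : t - s != 0 by rewrite gt_eqF// subr_gt0.
set T := cmod (- a1 - _) + _ + _ + _ + _ + _.
have -> : c * (pi / (t - s)) * (npow n (1 - 3 * theta) * (npow n (-1 + 3 * theta) * ((t - s) / pi) * T)) = c * T.
  rewrite e4 -e3; move: (pi) (@pi_gt0 R) => P P0; field.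
  by rewrite q3 ts0 gt_eqF.
by apply: ler_wpM2l => //; exact: cmod_sum6.
Qed.

(** All perturbations are multiples of xi, and the gaps are larger multiples: in the third bound
    they cost at most 21 / 8 xi, while t - s > 8 xi, so 5 / 8 of t - s is left. *)
Lemma contour_arith (b chi xi u v t s tn sn p q : R) : 0 < xi -> 0 < p -> 0 < q -> q < xi ->
  2 * p < q -> `|tn - t| < p -> `|sn - s| < p ->
  chi - 4 * xi < u < chi + 4 * xi -> chi - 4 * xi < v < chi + 4 * xi -> `|v - u| < xi / 2 ->
  b + 4 * xi < s - 4 * xi -> s + 4 * xi < t - 4 * xi -> chi + 4 * xi < b - 4 * xi ->
  [/\ 10 * q <= sn - u, 0 < 5 / 8 * (t - s),
      5 / 8 * (t - s) <= (t - q / 2 - v) - (s - u + 9 / 8 * q) - `|u - v|,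
      0 <= (sn - u) * (603 / 100) <= 31 / 4 * (s - chi)
    & cmod ((tn +i* q) - v%:C) <= 5 / 4 * (t - chi)].
Proof.
move=> xi0 p0 q0 qxi pq; rewrite !ltr_norml => /andP[t1 t2] /andP[s1 s2] /andP[u1 u2] /andP[v1 v2]
  /andP[uv1 uv2] hbs hst hcb.
split; [lra|lra| |apply/andP; split; lra|].
  have : `|u - v| <= xi / 2 by rewrite ler_norml; lra.
  lra.
apply: (le_trans (cmod_le_ReIm _)); rewrite ReB ImB ReC ImC /= subr0 !ger0_norm; lra.
Qed.

Lemma quarter_le (nn q y mu : R) : 0 <= nn * q ^+ 2 * mu -> nn * q ^+ 2 * mu <= nn * q ^+ 2 * y ->
  4^-1 * (nn * q ^+ 2) * mu <= 3 / 4 * (nn * y * q ^+ 2).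
Proof. lra. Qed.

(** The two scalings by n^(-1/2) cancel the n in front of J_n, and (2 pi i)^2 < 0 explains the minus
    signs of the six integrals. In the rest the exponents 3 / 4 are weakened to the 1 / 4 of the
    statement. *)
Lemma main_error_assembly (n : nat) (theta chi t s D Dt e0 ka kat ep ept lw lz Jr X M B : R)
    (rest S dbl : R[i]) :
  (0 < n)%N -> s < t -> chi < s -> 0 < D -> 0 < Dt -> 0 < e0 -> ep + ept < 1 ->
  ka = npow n (- 2^-1) * D^-1 -> kat = npow n (- 2^-1) * Dt^-1 ->
  X = expR (- (4^-1 * npow n (1 - 2 * theta) * Num.min (D ^+ 2) (Dt ^+ 2))) ->
  M = e0 / (4 * pi * (t - s) * D * Dt) ->
  0 <= lz <= 31 / 4 * (s - chi) -> 0 <= lw <= 2 * pi * (5 / 4 * (t - chi)) ->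
  (- (2 * pi) ^+ 2)%:C * Jr%:C = dbl + rest -> dbl = ka%:C * kat%:C * e0%:C * S ->
  cmod rest <= e0 * expR (ep + ept) / (5 / 8 * (t - s)) *
    (expR (- (3 / 4 * (n%:R * Dt ^+ 2 * npow n (- theta) ^+ 2))) * (27 / 4 * npow n (- theta) * lz) +
     expR (- (3 / 4 * (n%:R * D ^+ 2 * npow n (- theta) ^+ 2))) * (27 / 4 * npow n (- theta) * lw) +
     expR (- (3 / 4 * (n%:R * D ^+ 2 * npow n (- theta) ^+ 2)) - 3 / 4 * (n%:R * Dt ^+ 2 * npow n (- theta) ^+ 2)) *
       (lw * lz)) ->
  cmod (- ((e0 / ((2 * pi) ^+ 2 * D * Dt))%:C * S) - (e0 / ((2 * pi) ^+ 2 * D * Dt) * (pi / (t - s)))%:C) <=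
    e0 / ((2 * pi) ^+ 2 * D * Dt) * (pi / (t - s)) * B ->
  cmod (n%:R * Jr%:C - M%:C) < M * B + e0 / (t - s) * (X * npow n (1 - theta) * G_n theta chi t s n D Dt).
Proof.
move=> n0 st cs D0 Dt0 E0 epl eka ekat eX eM hlz hlw Jeq hmain hrest hF.
have nR : 0 < n%:R :> R by rewrite ltr0n.
set p := npow n (- 2^-1) in eka ekat; set q := npow n (- theta) in hrest.
have p0 : 0 < p by apply: npow_gt0.
have q0 : 0 < q by apply: npow_gt0.
have ts0 : t - s != 0 by rewrite gt_eqF// subr_gt0.
have [ep2 _ q3 q2 [q1 qV _ _ _]] := npow_scales theta n0.
set mu := Num.min _ _ in eX.
have [mu0 muD muDt] : [/\ 0 < mu, mu <= D ^+ 2 & mu <= Dt ^+ 2].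
  by rewrite /mu lt_min !exprn_gt0// ge_min lexx ge_min lexx orbT.
have q20 : 0 <= q ^+ 2 by exact: sqr_ge0.
have nmu : 0 <= n%:R * q ^+ 2 * mu by exact: (mulr_ge0 (mulr_ge0 (ltW nR) q20) (ltW mu0)).
have leX (y : R) : mu <= y -> expR (- (3 / 4 * (n%:R * y * q ^+ 2))) <= X.
  move=> hy; rewrite eX q2 ler_expR lerN2.
  have : n%:R * q ^+ 2 * mu <= n%:R * q ^+ 2 * y by exact: (ler_wpM2l (mulr_ge0 (ltW nR) q20) hy).
  exact: quarter_le.
have X0 : 0 < X by rewrite eX expR_gt0.
have st0 : 0 < t - s by rewrite subr_gt0.
have hnum := rest_numeric (n := n%:R) (Ee := expR (ep + ept)) (e1 := expR (- (3 / 4 * (n%:R * D ^+ 2 * q ^+ 2))))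
  (e2 := expR (- (3 / 4 * (n%:R * Dt ^+ 2 * q ^+ 2)))) nR E0 q0 st0 _ X0 _ _ _ _ _ hlz _ hrest.
have {}hnum : n%:R * (cmod rest / (2 * pi) ^+ 2) < e0 / (t - s) * (X * npow n (1 - theta) * G_n theta chi t s n D Dt).
  rewrite /G_n -/mu -eX q1 qV -/q; have := hnum; clear hnum => hnum.
  have -> : X * (n%:R * q) * (2 ^+ 3 * (s - chi) + 2 ^+ 3 * (t - chi) + 2 ^+ 4 * X * q^-1 * (t - chi) * (s - chi)) =
    X * (n%:R * q) * (8 * (s - chi) + 8 * (t - chi) + 16 * X * q^-1 * (t - chi) * (s - chi)) by ring.
  apply: hnum.
  - rewrite expR_ge0 /=; apply: (le_trans _ expR1_le3); rewrite ler_expR; exact: ltW.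
  - by rewrite subr_gt0.
  - by rewrite subr_gt0 (lt_trans cs).
  - by rewrite expR_ge0 /=; exact: leX.
  - by rewrite expR_ge0 /=; exact: leX.
  - by rewrite expR_ge0 /= expRD; apply: ler_pM; rewrite ?expR_ge0//; exact: leX.
  - exact: hlw.
set c := e0 / ((2 * pi) ^+ 2 * D * Dt) in hF.
have pp : 0 < pi :> R := pi_gt0 R.
have P2 : (2 * pi) ^+ 2 != 0 :> R by rewrite expf_neq0// mulf_neq0// gt_eqF.
have ec2 : c * (pi / (t - s)) = M.
  rewrite eM /c; move: (pi) pp => P P0; field.
  by rewrite ts0 !gt_eqF.
have enk : n%:R * (ka * kat * e0) / (2 * pi) ^+ 2 = c.
  have -> : ka * kat * e0 = p ^+ 2 * (e0 / (D * Dt)).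
    by rewrite eka ekat; field; rewrite !gt_eqF.
  rewrite mulrA [n%:R * _]mulrC ep2 /c; move: (pi) pp => P P0; field.
  by rewrite !gt_eqF.
have PP0 : 0 <= (2 * pi) ^+ 2 :> R by exact: sqr_ge0.
clearbody c; move: P2 enk Jeq PP0 hnum; move: ((2 * pi) ^+ 2) => PP P2 enk Jeq PP0 hnum.
have eJ : n%:R * Jr%:C = - (c%:C * S) - (n%:R / PP)%:C * rest.
  have PC : (PP)%:C != 0 :> R[i] by rewrite (realC_neq (b := 0)).
  apply: (mulfI PC).
  have -> : (PP)%:C * (n%:R * Jr%:C) =
      - (n%:R : R[i]) * ((- PP)%:C * Jr%:C).
    by rewrite rmorphN /=; ring.
  rewrite Jeq hmain -enk natCE !rmorphM fmorphV /= ; field.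
  exact: PC.
have -> : n%:R * Jr%:C - M%:C =
    (- (c%:C * S) - (c * (pi / (t - s)))%:C) - (n%:R / PP)%:C * rest.
  by rewrite eJ ec2; ring.
rewrite -ec2; apply: (le_lt_trans (cmodB _ _)); apply: ler_ltD; first exact: hF.
rewrite cmodM cmodR ger0_norm; last by rewrite divr_ge0.
by rewrite mulrAC -mulrA.
Qed.

Section FixedN.
Context (x : forall n, 'I_n -> R) (n k m : nat)
  (b chi xi u v t s tn sn ev eu theta : R)
  (rg : regime x n k m b chi xi u v t s tn sn ev eu theta).
Arguments x : clear implicits.
Let p := npow n (- 2^-1) : R.
Let q := npow n (- theta) : R.
Let fn' := fprime (cauchy_transform_n x n) v ev.
Let ftn' := fprime (cauchy_transform_n x n) u eu.
Let D := D_of fn' t.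
Let Dt := D_of ftn' s.
Let phi := weight (x n) v m.+1.
Let psi := inv_weight (x n) u k.
Let f := flog x n m.+1 v.
Let ft := flog x n k u.
Let ka := p * D^-1.
Let kat := p * Dt^-1.
Let ep := n%:R * q ^+ 3 *
  (2 * npow n (2 * theta) * cmod (fn' t%:C) + 2 ^+ 6 / (t - b) ^+ 3 + 2 ^+ 5 / (t - chi) ^+ 3).
Let ept := n%:R * q ^+ 3 *
  (2 * npow n (2 * theta) * cmod (ftn' s%:C) + 2 ^+ 9 / (s - b) ^+ 3 + 2 ^+ 6 / (s - chi) ^+ 3).
Let e0 := weight_ratio (x n) u v t s k m.+1.

Let order : [/\ forall i, x n i < s - q, u < s - q, v < t - q, 0 < p /\ 0 < q
  & [/\ b < s, s < t, chi < b, chi < s & 8 * xi < t - s]].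
Proof. exact: (regime_order rg). Qed.

Let bounds : [/\ 2 * p < q, q < xi, `|tn - t| < p & `|sn - s| < p].
Proof. by split; [exact: rg_pq rg|exact: rg_q rg|exact: rg_tn rg|exact: rg_sn rg]. Qed.

Lemma regime_scales : [/\ 0 < p, 0 < q, `|tn - t| < q / 2, `|sn - s| < q / 2 & p < xi / 2].
Proof.
by have [_ _ _ [p0 q0] _] := order; have [h1 h2 h3 h4] := bounds; split=> //; lra.
Qed.

Lemma regime_local_w w : near_axis (rho_of theta n tn t D) (alpha_of theta n tn t) w ->
  [/\ cmod (ka%:C * w) <= 9 / 8 * q, `|ka * Re w| <= q / 2, Re ((ka%:C * w) ^+ 2) <= 0,
     forall i, x n i < Re (t%:C + ka%:C * w) & v < Re (t%:C + ka%:C * w)].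
Proof.
have [D0 _ _ _] := regime_D rg; have [xs us vt [p0 q0] [_ st _ _ _]] := order.
have [_ _ htn _ _] := regime_scales.
have [k0 r0 ha e] := local_params theta tn t (rg_n rg) D0.
have [_ _ h] := near_axis_bounds q0 (ltW k0) (ltW r0) e htn.
move=> /h [h1 h2 h3]; have {}h2 : `|ka * Re w| <= q / 2 := h2.
split=> // [i|]; rewrite ReD ReC Re_scale.
  by move: h2; rewrite ler_norml => /andP[h2 _]; have := xs i; lra.
by move: h2; rewrite ler_norml => /andP[h2 _]; lra.
Qed.

Lemma regime_local_z z : near_axis (rho_of theta n sn s Dt) (alpha_of theta n sn s) z ->
  [/\ cmod (kat%:C * z) <= 9 / 8 * q, `|kat * Re z| <= q / 2, Re ((kat%:C * z) ^+ 2) <= 0,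
     forall i, x n i < Re (s%:C + kat%:C * z) & u < Re (s%:C + kat%:C * z)].
Proof.
have [_ _ D0 _] := regime_D rg; have [xs us vt [p0 q0] [_ st _ _ _]] := order.
have [_ _ _ hsn _] := regime_scales.
have [k0 r0 ha e] := local_params theta sn s (rg_n rg) D0.
have [_ _ h] := near_axis_bounds q0 (ltW k0) (ltW r0) e hsn.
move=> /h [h1 h2 h3]; have {}h2 : `|kat * Re z| <= q / 2 := h2.
split=> // [i|]; rewrite ReD ReC Re_scale.
  by move: h2; rewrite ler_norml => /andP[h2 _]; have := xs i; lra.
by move: h2; rewrite ler_norml => /andP[h2 _]; lra.
Qed.

Lemma regime_exp_g w z : near_axis (rho_of theta n tn t D) (alpha_of theta n tn t) w ->
  near_axis (rho_of theta n sn s Dt) (alpha_of theta n sn s) z ->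
  exp_g theta t s n f ft D Dt w z =
  (phi (t%:C + ka%:C * w) / phi t%:C) * (psi (s%:C + kat%:C * z) / psi s%:C).
Proof.
move=> /regime_local_w[_ _ _ xw vw] /regime_local_z[_ _ _ xz uz].
have [xt vt xs us] := regime_lt rg.
have ne (y : R) (z' : R[i]) : y < Re z' -> z' != y%:C.
  by move=> h; apply: contraTneq h => ->; rewrite ReC ltxx.
by apply: exp_g_weights => //; try (move=> i; exact: ne); try exact: ne; exact: (rg_n rg).
Qed.

Lemma regime_denominator w z : near_axis (rho_of theta n tn t D) (alpha_of theta n tn t) w ->
  near_axis (rho_of theta n sn s Dt) (alpha_of theta n sn s) z ->
  (t - s) / 2 <= cmod ((t - s)%:C + ka%:C * w - kat%:C * z).
Proof.
move=> /regime_local_w[_ hw _ _ _] /regime_local_z[_ hz _ _ _].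
have [_ _ _ _ [_ _ _ _ st8]] := order.
apply: le_trans (Re_le _); rewrite ReB ReD ReC !Re_scale.
have [_ h1 _ _] := bounds; have h2 := rg_xi rg.
move: hw hz; rewrite !ler_norml => /andP[h3 h4] /andP[h5 h6]; lra.
Qed.

Lemma residue_main_error (X M : R) :
  X = expR (- (4^-1 * npow n (1 - 2 * theta) * Num.min (D ^+ 2) (Dt ^+ 2))) ->
  M = e0 / (4 * pi * (t - s) * D * Dt) ->
  cmod (n%:R * (J_residues (x n) u v k m)%:C - M%:C) <
  M * (npow n (1 - 3 * theta) * F_n theta t s n f ft D Dt tn sn) +
  e0 / (t - s) * (X * npow n (1 - theta) * G_n theta chi t s n D Dt).
Proof.
move=> eX eM.
have n0 := rg_n rg; have nR : 0 < n%:R :> R by rewrite ltr0n.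
have [D0 eD Dt0 eDt] := regime_D rg.
have [p0 q0 htn hsn pxi] := regime_scales.
have [xs us vt _ [bs st cb cs st8]] := order.
have [xt vt' xs' us'] := regime_lt rg.
have [k0 r0 ha ec] := local_params theta tn t n0 D0.
have [k0' r0' ha' ec'] := local_params theta sn s n0 Dt0.
have [ep0 [ept0 epl]] := regime_eps rg.
have [pq qxi htn' hsn'] := bounds; have xi0 := rg_xi rg.
have [qS d0 hd hlz hlw] := contour_arith xi0 p0 q0 qxi pq htn' hsn' (rg_u rg) (rg_v rg) (rg_uv rg)
  (rg_bs rg) (rg_st rg) (rg_cb rg).
have [Qw0 Qz0] : 0 <= n%:R * D ^+ 2 /\ 0 <= n%:R * Dt ^+ 2.
  by split; rewrite mulr_ge0 ?sqr_ge0.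
have ew w : cmod (w - t%:C) <= 9 / 8 * q -> exists2 e, phi w = phi t%:C *
    cexp ((n%:R * D ^+ 2)%:C * (w - t%:C) ^+ 2 + e) & cmod e <= ep.
  by move=> hw; rewrite /D eD; exact: (regime_expansion_w rg hw).
have ez w : cmod (w - s%:C) <= 9 / 8 * q -> exists2 e, psi w = psi s%:C *
    cexp ((n%:R * Dt ^+ 2)%:C * (w - s%:C) ^+ 2 + e) & cmod e <= ept.
  by move=> hw; rewrite /Dt eDt; exact: (regime_expansion_z rg hw).
have [rest Jeq hrest] := @saddle_contours R n (x n) u v t s tn sn q _ _ _ _ (5 / 8 * (t - s))
  ka _ _ kat _ _ k m (rg_inj rg) (rg_k rg) q0 d0 xs us vt qS hd (ltW k0) (ltW r0) ha ec htn
  (ltW k0') (ltW r0') ha' ec' hsn Qw0 Qz0 ew ez (rg_circ rg) (rg_sn0 rg).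
move: Jeq hrest; cbv zeta; rewrite -/phi -/psi twopii_sqr => Jeq hrest.
have [_ E0] := ex_weight_ratio k m.+1 n0 xt vt' xs' us'; rewrite -/e0 in E0.
have [ephi phi0] := weight_real m.+1 xt vt'; have [epsi psi0] := inv_weight_real k xs' us'.
have ee : phi t%:C * psi s%:C = e0%:C by rewrite /e0 /weight_ratio rmorphM /= -ephi -epsi.
set Lw := local_chain _ _ _ _ in Jeq; set Lz := local_chain _ _ _ _ in Jeq.
have ts0 : t - s != 0 by rewrite gt_eqF// subr_gt0.
have pn : phi t%:C != 0 by rewrite -cmod_gt0.
have sn' : psi s%:C != 0 by rewrite -cmod_gt0.
have cphi w : near_axis (rho_of theta n tn t D) (alpha_of theta n tn t) w ->
    hcont phi (t%:C + ka%:C * w).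
  move=> /regime_local_w[_ _ _ _ h]; apply: weight_hcont.
  by apply: contraTneq h => ->; rewrite ReC ltxx.
have cpsi z : near_axis (rho_of theta n sn s Dt) (alpha_of theta n sn s) z ->
    hcont psi (s%:C + kat%:C * z).
  move=> /regime_local_z[_ _ _ h _]; apply: inv_weight_hcont.
  - exact: (rg_inj rg).
  - by case/andP: (rg_k rg).
  - by move=> i _; apply: contraTneq (h i) => ->; rewrite ReC ltxx.
have hE w z : near_axis (rho_of theta n tn t D) (alpha_of theta n tn t) w ->
    near_axis (rho_of theta n sn s Dt) (alpha_of theta n sn s) z ->
    [/\ (t - s)%:C + ka%:C * w - kat%:C * z != 0,
      exp_g theta t s n f ft D Dt w z =
        (phi (t%:C + ka%:C * w) / phi t%:C) * (psi (s%:C + kat%:C * z) / psi s%:C)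
    & Phi_n theta t s n f ft D Dt w z =
        exp_g theta t s n f ft D Dt w z / ((t - s)%:C + ka%:C * w - kat%:C * z)].
  move=> hw hz; split; [|exact: regime_exp_g|by []].
  rewrite -cmod_gt0; apply: lt_le_trans (regime_denominator hw hz).
  by rewrite divr_gt0// subr_gt0.
have hmain := main_double_int (ltW r0) ha (ltW r0') ha' (lt0r_neq0 k0') ts0 pn sn' cphi cpsi hE.
move: hmain; cbv zeta; rewrite ee; set S : R[i] := (X in _ * X) => hmain.
have c0 : 0 <= e0 / ((2 * pi) ^+ 2 * D * Dt).
  exact: (divr_ge0 (ltW E0) (mulr_ge0 (mulr_ge0 (sqr_ge0 _) (ltW D0)) (ltW Dt0))).
have hF := F_n_bound n0 st c0 (erefl S).
apply: (main_error_assembly n0 st cs D0 Dt0 E0 epl erefl erefl eX eM hlz _ Jeq hmain hrest hF).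
have P0 : 0 <= 2 * pi :> R by rewrite mulr_ge0 ?pi_ge0.
by rewrite (mulr_ge0 P0 (cmod_ge0 _)) /=; exact: (ler_wpM2l P0 hlw).
Qed.
End FixedN.
End ErrorBound.

(** * Gaussian integrals *)

Section GaussIntegral.
Context {R : realType}.
Implicit Types (x y rho : R).
Notation gauss_int := (@gauss_integral_proof.integral0_gauss R).

Let gauss_cont (x : R) : {for x, continuous (@gauss_fun R)}.
Proof. exact: continuous_gauss_fun. Qed.

Let gauss_ibl (a b : R) : ibl a b (@gauss_fun R).
Proof. by apply: ibl_cont => y _; exact: gauss_cont. Qed.

Lemma gauss_int_der x : 0 < x -> is_derive x 1 gauss_int (gauss_fun x).
Proof.
move=> x0; have [d e] : derivable gauss_int x 1 /\ derive1 gauss_int x = gauss_fun x.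
  apply: (@continuous_FTC1 R gauss_fun (BLeft 0) _ (x + 1) _ _ _ _).
  - by rewrite ltrDl.
  - exact: gauss_ibl.
  - by rewrite /= lte_fin.
  - by move=> ?; exact: continuous_gauss_fun.
by apply: (DeriveDef d); rewrite -derive1E.
Qed.

Lemma gauss_int_neg x : x <= 0 -> gauss_int x = 0.
Proof.
rewrite /gauss_integral_proof.integral0_gauss le_eqVlt => /orP[/eqP ->|x0].
  by rewrite set_itv1 Rintegral_set1.
by rewrite set_itv_ge ?Rintegral_set0// bnd_simp -ltNge.
Qed.

Lemma gauss_int_bounds x : 0 <= x -> 0 <= gauss_int x <= x.
Proof.
move=> x0; rewrite gauss_integral_proof.integral0_gauss_ge0 /=.
have := @le_Rint R 0 x (@gauss_fun R) (fun=> 1) _ _ _; rewrite Rint_cst// mul1r subr0; apply.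
- exact: gauss_ibl.
- by apply: ibl_cont => y _; exact: rcont_cst.
- by move=> y _; exact: gauss_fun_le1.
Qed.

Lemma gauss_int_abs x : `|gauss_int x| <= `|x|.
Proof.
have [x0|x0] := leP 0 x; first by have /andP[h1 h2] := gauss_int_bounds x0; rewrite !ger0_norm.
by rewrite gauss_int_neg ?normr0// ltW.
Qed.

Lemma gauss_int_cont x : {for x, continuous gauss_int}.
Proof.
have [x0|x0|<-] := ltgtP 0 x.
- exact: rder_cont (gauss_int_der x0).
- apply: (@rcont_near _ (fun=> 0)); last exact: rcont_cst.
  have : \forall y \near x, y < 0 by apply: lt_nbhsl.
  by apply: filterS => y /ltW /gauss_int_neg/esym.
- apply/cvgrPdist_lt => e e0; rewrite (gauss_int_neg (lexx 0)).
  have : \forall y \near (0 : R), `|y| < e by exact: nbhs0_lt.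
  by apply: filterS => y ye; rewrite sub0r normrN; exact: le_lt_trans (gauss_int_abs y) ye.
Qed.

Lemma gauss_int_lt x y : 0 <= x -> x < y -> gauss_int x < gauss_int y.
Proof.
move=> x0 xy.
have dd c : c \in `]x, y[ -> is_derive c 1 gauss_int (gauss_fun c).
  by rewrite in_itv/= => /andP[xc _]; apply: gauss_int_der; exact: le_lt_trans xc.
have [|c _ e] := MVT xy dd.
  by apply: within_cont => c _; exact: gauss_int_cont.
by rewrite -subr_gt0 e mulr_gt0 ?expR_gt0// subr_gt0.
Qed.

(** The limit at infinity is that of the square; strictness comes from passing through the larger
    value at x + 1. *)
Lemma gauss_int_sqr_lt x : 0 <= x -> gauss_int x ^+ 2 < pi / 4.
Proof.
move=> x0; have [g0 _] := andP (gauss_int_bounds x0).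
have x1 : x < x + 1 by rewrite ltrDl.
have x10 : 0 <= x + 1 by rewrite (le_trans x0)// ltW.
have lt1 := gauss_int_lt x0 x1.
apply: (@lt_le_trans _ _ (gauss_int (x + 1) ^+ 2)).
  by rewrite ltr_sqr ?nnegrE// (le_trans g0)// ltW.
rewrite leNgt; apply/negP => h.
have n1 := cvgr_lt _ (@gauss_integral_proof.cvg_integral0_gauss_sqr R) _ h.
have n2 : \forall y \near +oo, x + 1 < y by apply: nbhs_pinfty_gt; exact: num_real.
near (pinfty_nbhs R) => y.
have h1 : gauss_int y ^+ 2 < gauss_int (x + 1) ^+ 2 by near: y; exact: n1.
have h2 : x + 1 < y by near: y; exact: n2.
have := gauss_int_lt x10 h2; rewrite -ltr_sqr ?nnegrE ?gauss_integral_proof.integral0_gauss_ge0//.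
by rewrite ltNge (ltW h1).
Unshelve. all: by end_near. Qed.

(** [K] has derivative 2 gauss_fun y (gauss_int y - y) <= 0 and limit pi / 4, so it stays above pi /
    4. *)
Lemma gauss_int_tail x : 0 < x -> pi / 4 - gauss_int x ^+ 2 <= gauss_fun x.
Proof.
move=> x0; pose K y := gauss_int y ^+ 2 + gauss_fun y.
have dK y : 0 < y -> is_derive y 1 K (2 * gauss_fun y * (gauss_int y - y)).
  move=> y0; apply: (rder_eq (d := 2%:R * gauss_int y ^+ 1 * gauss_fun y + expR (- y ^+ 2) * (- (2%:R * y ^+ 1 * 1)))).
    apply: rderD; first by apply: rderX; exact: gauss_int_der.
    by apply: (@rder_exp _ (fun y => - y ^+ 2)); apply: rderN; apply: rderX; exact: rder_id.
  by rewrite /gauss_fun; ring.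
have Kdec y : x < y -> K y <= K x.
  move=> xy; have dd c : c \in `]x, y[ -> is_derive c 1 K (2 * gauss_fun c * (gauss_int c - c)).
    by rewrite in_itv/= => /andP[xc _]; apply: dK; exact: lt_trans xc.
  have [|c /andP[xc _] e] := MVT xy dd.
    by apply: within_cont => c /andP[xc _]; apply: (rder_cont (dK c _)); exact: lt_le_trans xc.
  rewrite -subr_le0 e pmulr_lle0 ?subr_gt0// pmulr_rle0; last by rewrite mulr_gt0// expR_gt0.
  rewrite subr_le0; have c0 : 0 <= c by apply: (le_trans (ltW x0)); exact: ltW.
  by have /andP[] := gauss_int_bounds c0.
have cK : K y @[y --> +oo] --> pi / 4 + 0.
  by apply: cvgD; [exact: gauss_integral_proof.cvg_integral0_gauss_sqr|exact: cvg_gauss_fun].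
rewrite addr0 in cK; rewrite lerBlDl leNgt; apply/negP => h.
have n1 := cvgr_gt _ cK _ h.
have n2 : \forall y \near +oo, x < y by apply: nbhs_pinfty_gt; exact: num_real.
near (pinfty_nbhs R) => y.
have h1 : K x < K y by near: y; exact: n1.
have h2 : x < y by near: y; exact: n2.
by have := Kdec y h2; rewrite leNgt => /negP; apply.
Unshelve. all: by end_near. Qed.

(** This is |exp (z^2)| |dz| on the segment from - i rho to i rho, in the parameter y of
    [segment_path]. *)
Definition gauss_density rho y := 2 * rho * gauss_fun (rho * (2 * y - 1)).

Lemma gauss_density_int rho : 0 < rho -> (forall y, {for y, continuous (gauss_density rho)}) /\
  \int[lebesgue_measure]_(y in `[0, 1]) gauss_density rho y = 2 * gauss_int rho.
Proof.
move=> r0; pose G := gauss_density rho.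
have cG y : {for y, continuous G}.
  apply: rcontM; first exact: rcont_cst.
  apply: (@rcont_comp _ (@gauss_fun R) (fun y => rho * (2 * y - 1))); last exact: gauss_cont.
  apply: rcontM; first exact: rcont_cst.
  apply: rcontB; last exact: rcont_cst.
  by apply: rcontM; [exact: rcont_cst|exact: rcont_id].
split; first exact: cG.
have gl y : is_derive y 1 (fun y => rho * (2 * y - 1)) (rho * 2).
  by apply: (rder_eq (d := rho * (2 * 1 - 0))); ring.
(* [gauss_int] is constant on the negative half-line, so it is a primitive only where its argument
   is positive; the other half uses that the Gaussian is even. *)
rewrite (@Rint_cat R 0 (1 / 2) 1); [|lra|by apply: ibl_cont => y _; exact: cG ..].
have cc (h : R -> R) y (d : R) : is_derive y 1 h d -> {for y, continuous (fun y => gauss_int (h y))}.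
  by move=> hd; apply: rcont_comp; [exact: rder_cont hd|exact: gauss_int_cont].
have glN y : is_derive y 1 (fun y => - (rho * (2 * y - 1))) (- (rho * 2)) by apply: rderN; exact: gl.
have e1 : \int[lebesgue_measure]_(y in `[1 / 2, 1]) G y = gauss_int rho.
  transitivity (gauss_int (rho * (2 * 1 - 1)) - gauss_int (rho * (2 * (1 / 2) - 1))); last first.
    have -> : rho * (2 * (1 / 2) - 1) = 0 by field.
    have -> : rho * (2 * 1 - 1) = rho by ring.
    by rewrite (gauss_int_neg (lexx 0)) subr0.
  apply: (@FTC R (1 / 2) 1 G (fun y => gauss_int (rho * (2 * y - 1)))).
  - lra.
  - by move=> y _; exact: cG.
  - by move=> y _; apply: cc; exact: gl.
  - move=> y hy; apply: (rder_eq (d := gauss_fun (rho * (2 * y - 1)) * (rho * 2))); last by rewrite /G /gauss_density; ring.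
    apply: (rder_comp (gauss_int_der _) (gl y)).
    by rewrite mulr_gt0//; lra.
have e2 : \int[lebesgue_measure]_(y in `[0, 1 / 2]) G y = gauss_int rho.
  transitivity (- gauss_int (- (rho * (2 * (1 / 2) - 1))) - - gauss_int (- (rho * (2 * 0 - 1)))); last first.
    have -> : - (rho * (2 * (1 / 2) - 1)) = 0 by field.
    have -> : - (rho * (2 * 0 - 1)) = rho by ring.
    by rewrite (gauss_int_neg (lexx 0)) oppr0 sub0r opprK.
  apply: (@FTC R 0 (1 / 2) G (fun y => - gauss_int (- (rho * (2 * y - 1))))).
  - lra.
  - by move=> y _; exact: cG.
  - by move=> y _; apply: rcontN; apply: cc; exact: glN.
  - move=> y hy; apply: (rder_eq (d := - (gauss_fun (- (rho * (2 * y - 1))) * (- (rho * 2))))).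
      apply: (rderN (rder_comp (gauss_int_der _) (glN y))).
      by rewrite -mulrN mulr_gt0//; lra.
    by rewrite /G /gauss_density /gauss_fun sqrrN; ring.
by rewrite e1 e2; ring.
Qed.

Lemma gauss_segment_sqr rho y :
  segment_path (0 +i* - rho) (0 +i* rho) y ^+ 2 = (- (rho * (2 * y - 1)) ^+ 2)%:C :> R[i].
Proof.
have -> : segment_path (0 +i* - rho) (0 +i* rho) y = 0 +i* (rho * (2 * y - 1)).
  by apply: eqC => /=; ring.
by apply: eqC; rewrite ?expr2 /=; ring.
Qed.

Lemma gauss_segment rho : 0 < rho ->
  path_int (segment_path (0 +i* - rho) (0 +i* rho)) (fun z => cexp (z ^+ 2)) =
  0 +i* (2 * gauss_int rho).
Proof.
move=> r0; have [cG eI] := gauss_density_int r0.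
have eG : path_int (segment_path (0 +i* - rho) (0 +i* rho)) (fun z => cexp (z ^+ 2)) =
    cint 0 1 (fun y => (0 +i* 1) * (gauss_density rho y)%:C).
  congr (cintegral _ _ _); apply/funext => y.
  rewrite (cder_path_deriv (cder_segment _ _ _)) gauss_segment_sqr cexpR.
  by rewrite /gauss_density /gauss_fun; apply: eqC => /=; ring.
rewrite eG cintZ; last by apply: cibl_cont => y _; apply: ccont_real; exact: cG.
by rewrite cint_real eI; apply: eqC => /=; ring.
Qed.
End GaussIntegral.

(** * Bounds for the six integrals *)

Section PieceBounds.
Context {R : realType}.
Implicit Types (w z : R[i]) (A B F : R[i] -> R[i]) (g h : R -> R[i]) (rho al : R).
Notation gauss_int := (@gauss_integral_proof.integral0_gauss R).

Lemma hder_cexp z : hder (@cexp R) z (cexp z).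
Proof. by split=> g x e <- hg; exact: cder_exp. Qed.

(** Integration of exp along the segment from 0 to z, where its modulus is at most exp 1 <= 3. *)
Lemma cexp_sub1 z : cmod z <= 1 -> cmod (cexp z - 1) <= 3 * cmod z.
Proof.
move=> z1; have ez : path_int (segment_path 0 z) (@cexp R) = cexp z - 1.
  rewrite (path_int_FTC (F := @cexp R) (gpath_segment 0 z)).
  - by rewrite /segment_path mul1r mul0r subr0 !add0r cexp0.
  - by move=> x _; apply: hcont_exp; exact: hcont_id.
  - by move=> x _; apply: hcont_exp; exact: hcont_id.
  - by move=> x _; exact: hder_cexp.
rewrite -ez; apply: (path_int_le_cst (gpath_segment 0 z)).
  by move=> x _; apply: hcont_exp; exact: hcont_id.
move=> x /andP[/ltW x0 /ltW x1]; rewrite cmod_segment_deriv subr0 cmod_cexp.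
apply: ler_wpM2r; first exact: cmod_ge0.
apply: (le_trans _ expR1_le3); rewrite ler_expR.
rewrite /segment_path subr0 add0r Re_scale.
apply: (le_trans (ler_norm _)); rewrite normrM (ger0_norm x0).
by apply: mulr_ile1 => //; exact: le_trans (Re_le_cmod z) z1.
Qed.

Definition gauss_weight z : R := cmod (cexp (z ^+ 2)).

(* [L] bounds the integral of [|exp (z ^ 2)| |dz|] along the curve. *)
Definition profile g (L : R) := exists G : R -> R, [/\ ibl 0 1 G,
  \int[lebesgue_measure]_(x in `[0, 1]) G x = L
  & forall x, 0 < x < 1 -> gauss_weight (g x) * cmod (path_deriv g x) <= G x].

Lemma gauss_weight_ge0 z : 0 <= gauss_weight z. Proof. exact: cmod_ge0. Qed.

Lemma profile_ge0 g L : profile g L -> 0 <= L.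
Proof.
move=> [G [iG <- hG]].
have := @le_Rint R 0 1 (fun=> 0) G _ iG _; rewrite Rint_cst// mul0r; apply.
  by apply: ibl_cont => y _; exact: rcont_cst.
by move=> x hx; apply: (le_trans _ (hG x hx)); rewrite mulr_ge0 ?cmod_ge0.
Qed.

Lemma RintZ (G : R -> R) (c : R) : ibl 0 1 G ->
  \int[lebesgue_measure]_(x in `[0, 1]) (c * G x) = c * \int[lebesgue_measure]_(x in `[0, 1]) G x.
Proof. by move=> iG; rewrite RintegralZl. Qed.

(** The inner integral is bounded first, keeping the Gaussian weight of g x as a factor for the
    outer one; the bound becomes a product of two profiles. *)
Lemma nested_path_le g h (H : R[i] -> R[i] -> R[i]) F (K Lg Lh : R) :
  gpath g -> gpath h -> profile g Lg -> profile h Lh -> 0 <= K ->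
  (forall x, 0 <= x <= 1 -> hcont F (g x)) ->
  (forall x, 0 <= x <= 1 -> F (g x) = path_int h (H (g x))) ->
  (forall x y, 0 <= x <= 1 -> 0 <= y <= 1 -> hcont (H (g x)) (h y)) ->
  (forall x y, 0 <= x <= 1 -> 0 <= y <= 1 ->
    cmod (H (g x) (h y)) <= K * (gauss_weight (g x) * gauss_weight (h y))) ->
  cmod (path_int g F) <= K * (Lg * Lh).
Proof.
move=> gg gh pg ph K0 cF eF cH bH; have Lh0 := profile_ge0 ph.
have [Gg [ig Ig hg]] := pg; have [Gh [ih Ih hh]] := ph.
have inn x : 0 <= x <= 1 -> cmod (F (g x)) <= K * gauss_weight (g x) * Lh.
  move=> hx; rewrite eF// -Ih -RintZ//; apply: path_int_le => //.
  - by move=> y hy; exact: cH.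
  - exact: iblZ.
  - move=> y hy; have hy' : 0 <= y <= 1 by case/andP: hy => /ltW -> /ltW ->.
    apply: (@le_trans _ _ (K * (gauss_weight (g x) * gauss_weight (h y)) * cmod (path_deriv h y))).
      by apply: ler_wpM2r; [exact: cmod_ge0|exact: bH].
    rewrite !mulrA -(mulrA (K * _)); apply: ler_wpM2l; last exact: hh.
    by rewrite mulr_ge0// gauss_weight_ge0.
have -> : K * (Lg * Lh) = \int[lebesgue_measure]_(x in `[0, 1]) ((K * Lh) * Gg x).
  by rewrite RintZ// Ig; ring.
apply: path_int_le => //; first exact: iblZ.
move=> x hx; have hx' : 0 <= x <= 1 by case/andP: hx => /ltW -> /ltW ->.
apply: (@le_trans _ _ (K * gauss_weight (g x) * Lh * cmod (path_deriv g x))).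
  by apply: ler_wpM2r; [exact: cmod_ge0|exact: inn].
have -> : K * gauss_weight (g x) * Lh * cmod (path_deriv g x) =
  K * Lh * (gauss_weight (g x) * cmod (path_deriv g x)) by ring.
by apply: ler_wpM2l; [rewrite mulr_ge0|exact: hg].
Qed.

Lemma segment_profile rho : 0 < rho ->
  profile (segment_path (0 +i* - rho) (0 +i* rho)) (2 * gauss_int rho).
Proof.
move=> r0; have [cG eI] := gauss_density_int r0.
exists (gauss_density rho); split=> //; first by apply: ibl_cont => y _; exact: cG.
move=> x _; rewrite cmod_segment_deriv /gauss_weight gauss_segment_sqr cexpR cmodR.
rewrite ger0_norm ?expR_ge0//.
have -> : (0 +i* rho) - (0 +i* - rho) = 0 +i* (2 * rho) :> R[i] by apply: eqC => /=; ring.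
by rewrite cmod_imag ger0_norm ?mulr_ge0 ?(ltW r0)// /gauss_density mulrC.
Qed.

(** On the arc |Re z| <= rho / 2, so Re (z^2) = 2 (Re z)^2 - rho^2 <= - rho^2 / 2; the arc has
    length at most 2 rho. *)
Lemma arc_profile rho al (a b : R) : 0 <= rho -> `|cos al| <= 2^-1 -> `|b - a| <= 2 ->
  on_path (circle_arc rho a b) (near_axis rho al) ->
  profile (circle_arc rho a b) (2 * rho * expR (- (rho ^+ 2 / 2))).
Proof.
move=> r0 hc hab hn; exists (fun=> 2 * rho * expR (- (rho ^+ 2 / 2))); split.
- by apply: ibl_cont => y _; exact: rcont_cst.
- by rewrite Rint_cst// subr0 mulr1.
move=> x hx; have hx' : 0 <= x <= 1 by case/andP: hx => /ltW -> /ltW ->.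
rewrite cmod_arc_deriv// mulrC; apply: ler_pM; rewrite ?mulr_ge0 ?gauss_weight_ge0//.
  by rewrite mulrC; apply: ler_wpM2r.
set z := circle_arc rho a b x; have cz : cmod z = rho by rewrite cmod_circle_arc.
rewrite /gauss_weight cmod_cexp ler_expR expr2 ReM -!expr2.
have := cmod_sqr z; rewrite cz => e1.
have h : `|Re z| <= rho / 2.
  have [[-> _]|[_ h]] := hn x hx'; first by rewrite normr0 divr_ge0.
  by apply: (le_trans h); apply: ler_wpM2l.
have : Re z ^+ 2 <= (rho / 2) ^+ 2.
  by rewrite -real_normK ?num_real// ler_sqr ?nnegrE ?normr_ge0 ?divr_ge0.
move: e1; clear; lra.
Qed.

Section Pieces.
Context (A B : R[i] -> R[i]) (eg Ph : R[i] -> R[i] -> R[i]) (dl ka ka' rho al rho' al' q eps : R).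
Context (dl0 : 0 < dl) (k0' : ka' != 0) (r0 : 0 < rho) (r0' : 0 < rho')
  (ha : 0 <= al <= pi) (ha' : 0 <= al' <= pi) (hc : `|cos al| <= 2^-1) (hc' : `|cos al'| <= 2^-1)
  (cA : forall w, near_axis rho al w -> hcont A w)
  (cB : forall z, near_axis rho' al' z -> hcont B z)
  (eps1 : 0 <= eps <= 1) (q0 : 0 <= q)
  (hE : forall w z, near_axis rho al w -> near_axis rho' al' z ->
    [/\ eg w z = A w * B z, Ph w z = eg w z / (dl%:C + ka%:C * w - ka'%:C * z),
      dl / 2 <= cmod (dl%:C + ka%:C * w - ka'%:C * z),
      cmod (ka%:C * w) <= 9 / 8 * q /\ cmod (ka'%:C * z) <= 9 / 8 * q
    & exists2 e, A w * B z = cexp (w ^+ 2 + z ^+ 2 + e) & cmod e <= eps]).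

Let k := segment_path (0 +i* - rho) (0 +i* rho) : R -> R[i].
Let K := segment_path (0 +i* - rho') (0 +i* rho') : R -> R[i].
Let c1 := circle_arc rho (- al) (- (pi / 2)) : R -> R[i].
Let c2 := circle_arc rho (pi / 2) al : R -> R[i].
Let C1 := circle_arc rho' (- al') (- (pi / 2)) : R -> R[i].
Let C2 := circle_arc rho' (pi / 2) al' : R -> R[i].
Let W := near_axis rho al.
Let Z := near_axis rho' al'.
Let lw := 2 * rho * expR (- (rho ^+ 2 / 2)).
Let lz := 2 * rho' * expR (- (rho' ^+ 2 / 2)).
Let a h w := A w * path_int h (fun z => B z / (dl%:C + ka%:C * w - ka'%:C * z)).

Let nz w z : W w -> Z z -> dl%:C + ka%:C * w - ka'%:C * z != 0.
Proof.
move=> hw hz; have [_ _ h _ _] := hE hw hz.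
by rewrite -cmod_gt0; apply: lt_le_trans h; rewrite divr_gt0.
Qed.

Let AB_le w z : W w -> Z z -> cmod (A w * B z) <= 3 * (gauss_weight w * gauss_weight z).
Proof.
move=> hw hz; have [_ _ _ _ [e -> he]] := hE hw hz.
rewrite !cexpD !cmodM mulrC /gauss_weight; apply: ler_wpM2r; first by rewrite mulr_ge0 ?cmod_ge0.
rewrite cmod_cexp; apply: (le_trans _ expR1_le3); rewrite ler_expR.
by apply: (le_trans (Re_le e)); apply: (le_trans he); case/andP: eps1.
Qed.

Let AB_diff w z : W w -> Z z ->
  cmod (A w * B z - cexp (w ^+ 2 + z ^+ 2)) <= 3 * eps * (gauss_weight w * gauss_weight z).
Proof.
move=> hw hz; have [_ _ _ _ [e -> he]] := hE hw hz.
rewrite cexpD -{2}[cexp (w ^+ 2 + z ^+ 2)]mulr1 -mulrBr cmodM cexpD cmodM mulrC.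
apply: ler_wpM2r; first by rewrite mulr_ge0 ?cmod_ge0.
apply: (le_trans (cexp_sub1 _)); first by apply: (le_trans he); case/andP: eps1.
by apply: ler_wpM2l.
Qed.

Let Ph_piece g h Lg Lh : on_path g W -> gpath g -> profile g Lg ->
  on_path h Z -> gpath h -> profile h Lh -> cmod (path_int g (a h)) <= 6 / dl * (Lg * Lh).
Proof.
move=> gW gg pg hZ gh ph.
apply: (nested_path_le (H := fun w z => A w * B z / (dl%:C + ka%:C * w - ka'%:C * z)) gg gh pg ph).
- by rewrite divr_ge0// ltW.
- by move=> x hx; apply: (split_outer_hcont cA cB k0' nz hZ gh); exact: gW.
- by move=> x hx; rewrite (split_inner A cB nz hZ gh (gW x hx)).
- move=> x y hx hy; apply: (@hcont_ext _ (fun z => A (g x) * (B z / (dl%:C + ka%:C * g x - ka'%:C * z)))).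
    by move=> z; rewrite mulrA.
  apply: hcontM; first exact: hcont_cst.
  by apply: scaled_kernel_hcont; [exact/cB/hZ|apply: nz; [exact: gW|exact: hZ]].
- move=> x y hx hy; have [_ _ hd _ _] := hE (gW x hx) (hZ y hy).
  rewrite cmodM cmodV.
  have -> : 6 / dl * (gauss_weight (g x) * gauss_weight (h y)) =
     3 * (gauss_weight (g x) * gauss_weight (h y)) * (dl / 2)^-1 by field; rewrite gt_eqF.
  apply: ler_pM; rewrite ?cmod_ge0 ?invr_ge0 ?cmod_ge0//.
    by apply: AB_le; [exact: gW|exact: hZ].
  by rewrite lef_pV2// posrE ?divr_gt0// (lt_le_trans _ hd)// divr_gt0.
Qed.

Let near6 : [/\ on_path c1 W, on_path k W & on_path c2 W] /\
  [/\ on_path C1 Z, on_path K Z & on_path C2 Z].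
Proof.
have [W1 [W2 [W3 _]]] := local_paths_near_axis (ltW r0) ha.
by have [Z1 [Z2 [Z3 _]]] := local_paths_near_axis (ltW r0') ha'.
Qed.

Let arc_len (t : R) : 0 <= t <= pi -> `|- (pi / 2) - - t| <= 2 /\ `|t - pi / 2| <= 2.
Proof. by move=> ht; have p2 := @pihalf_lt2 R; split; rewrite ler_norml; lra. Qed.

(** Each segment gives i times a real Gaussian integral; the square of i is the minus sign that the
    definition of I_{1,n} compensates. *)
Lemma main_piece : int_k rho (fun w => int_k rho' (fun z => cexp (w ^+ 2 + z ^+ 2) / dl%:C)) =
  (- (4 * (gauss_int rho * gauss_int rho') / dl))%:C.
Proof.
have dC : dl%:C != 0 :> R[i] by apply: (realC_neq (b := 0)); rewrite gt_eqF.
transitivity (path_int k (fun w => path_int K (fun z => cexp (z ^+ 2) / dl%:C) * cexp (w ^+ 2))).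
  apply: path_int_ext => x _; rewrite mulrC.
  exact: (split_gauss_inner dl%:C (k x) (gpath_segment _ _)).
have eK : path_int K (fun z => cexp (z ^+ 2) / dl%:C) = (dl%:C)^-1 * (0 +i* (2 * gauss_int rho')).
  rewrite -(gauss_segment r0') -path_intZ; [|exact: gpath_segment|by move=> x _; exact: hcont_gauss].
  by apply: path_int_ext => x _; rewrite mulrC.
rewrite path_intZ; [|exact: gpath_segment|by move=> x _; exact: hcont_gauss].
rewrite eK (gauss_segment r0) -[LHS]mulrA.
have -> : (0 +i* (2 * gauss_int rho')) * (0 +i* (2 * gauss_int rho)) =
    (- (4 * (gauss_int rho * gauss_int rho')))%:C :> R[i] by apply: eqC => /=; ring.
by rewrite -fmorphV -rmorphM /= mulrC mulNr.
Qed.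

Lemma diff_piece : cmod (int_k rho (fun w => int_k rho' (fun z =>
    (eg w z - cexp (w ^+ 2 + z ^+ 2)) / dl%:C))) <=
  3 * eps / dl * (2 * gauss_int rho * (2 * gauss_int rho')).
Proof.
have [[_ W2 _] [_ Z2 _]] := near6; have gk := gpath_segment (0 +i* - rho) (0 +i* rho).
have gK := gpath_segment (0 +i* - rho') (0 +i* rho').
have -> : int_k rho (fun w => int_k rho' (fun z => (eg w z - cexp (w ^+ 2 + z ^+ 2)) / dl%:C)) =
    path_int k (fun w => A w * path_int K (fun z => B z / dl%:C)
      - cexp (w ^+ 2) * path_int K (fun z => cexp (z ^+ 2) / dl%:C)).
  apply: path_int_ext => x hx; rewrite -(split_diff_inner A dl%:C cB (k x) Z2 gK).
  by apply: path_int_ext => y hy; have [-> _ _ _ _] := hE (W2 x hx) (Z2 y hy).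
apply: (nested_path_le (H := fun w z => (A w * B z - cexp (w ^+ 2 + z ^+ 2)) / dl%:C) gk gK
  (segment_profile r0) (segment_profile r0')).
- by rewrite divr_ge0 ?(ltW dl0)// mulr_ge0//; case/andP: eps1.
- move=> x hx; apply: hcontB; (apply: hcontM; last exact: hcont_cst).
    by apply: cA; exact: W2.
  exact: hcont_gauss.
- by move=> x hx; rewrite (split_diff_inner A dl%:C cB _ Z2 gK).
- move=> x y hx hy; apply: hcontM; last exact: hcont_cst.
  apply: hcontB; first by apply: hcontM; [exact: hcont_cst|exact/cB/Z2].
  by apply: hcont_exp; apply: hcontD; [exact: hcont_cst|apply: hcontX; exact: hcont_id].
- move=> x y hx hy; rewrite cmodM cmodV cmodR gtr0_norm// mulrAC.
  by apply: ler_wpM2r; [rewrite invr_ge0 ltW|apply: AB_diff; [exact: W2|exact: Z2]].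
Qed.

(** For the denominator N one has 1 / N - 1 / dl = (dl - N) / (N dl), with |dl - N| <= 9 / 4 q and
    |N| >= dl / 2; the factor 3 of [AB_le] makes it 27 / 2. *)
Lemma ratio_piece : cmod (int_k rho (fun w => int_k rho' (fun z => Ph w z - eg w z / dl%:C))) <=
  27 / 2 * q / dl ^+ 2 * (2 * gauss_int rho * (2 * gauss_int rho')).
Proof.
have [[_ W2 _] [_ Z2 _]] := near6; have gk := gpath_segment (0 +i* - rho) (0 +i* rho).
have gK := gpath_segment (0 +i* - rho') (0 +i* rho').
have dC : dl%:C != 0 :> R[i] by apply: (realC_neq (b := 0)); rewrite gt_eqF.
have -> : int_k rho (fun w => int_k rho' (fun z => Ph w z - eg w z / dl%:C)) =
    path_int k (fun w => a K w - A w * path_int K (fun z => B z / dl%:C)).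
  apply: path_int_ext => x hx; rewrite -(split_ratio_inner A cB nz Z2 gK (W2 x hx)).
  by apply: path_int_ext => y hy; have [e1 -> _ _ _] := hE (W2 x hx) (Z2 y hy); rewrite e1.
apply: (nested_path_le (H := fun w z => A w * B z / (dl%:C + ka%:C * w - ka'%:C * z) - A w * B z / dl%:C)
  gk gK (segment_profile r0) (segment_profile r0')).
- by rewrite divr_ge0 ?sqr_ge0// mulr_ge0// divr_ge0.
- move=> x hx; apply: hcontB; first by apply: (split_outer_hcont cA cB k0' nz Z2 gK); exact: W2.
  by apply: hcontM; [apply: cA; exact: W2|exact: hcont_cst].
- by move=> x hx; rewrite (split_ratio_inner A cB nz Z2 gK (W2 x hx)).
- move=> x y hx hy; apply: hcontB.
    apply: (@hcont_ext _ (fun z => A (k x) * (B z / (dl%:C + ka%:C * k x - ka'%:C * z)))).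
      by move=> z; rewrite mulrA.
    apply: hcontM; first exact: hcont_cst.
    by apply: scaled_kernel_hcont; [exact/cB/Z2|apply: nz; [exact: W2|exact: Z2]].
  apply: hcontM; last exact: hcont_cst.
  by apply: hcontM; [exact: hcont_cst|exact/cB/Z2].
- move=> x y hx hy; have [_ _ hd [hw hz] _] := hE (W2 x hx) (Z2 y hy).
  have n0 := nz (W2 x hx) (Z2 y hy); set N := dl%:C + _ - _ in hd n0 *.
  have -> : A (k x) * B (K y) / N - A (k x) * B (K y) / dl%:C =
      A (k x) * B (K y) * ((ka'%:C * K y - ka%:C * k x) / (N * dl%:C)).
    rewrite -mulrBr; congr (_ * _).
    have -> : ka'%:C * K y - ka%:C * k x = dl%:C - N by rewrite /N; ring.
    by field; rewrite dC n0.
  rewrite cmodM [leRHS]mulrC; have -> : gauss_weight (k x) * gauss_weight (K y) * (27 / 2 * q / dl ^+ 2) =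
    3 * (gauss_weight (k x) * gauss_weight (K y)) * ((9 / 4 * q) / (dl / 2 * dl)) by field; rewrite gt_eqF.
  apply: ler_pM; rewrite ?cmod_ge0//; first by apply: AB_le; [exact: W2|exact: Z2].
  rewrite cmodM cmodV cmodM cmodR (gtr0_norm dl0).
  apply: ler_pM; rewrite ?cmod_ge0 ?invr_ge0 ?mulr_ge0 ?cmod_ge0 ?(ltW dl0)//.
    by apply: (le_trans (cmodB _ _)); move: hw hz; lra.
  have d2 : 0 < dl / 2 by rewrite divr_gt0.
  rewrite lef_pV2 ?posrE ?mulr_gt0// ?(lt_le_trans d2)//.
  by apply: ler_wpM2r; [exact: ltW|].
Qed.

Let aC g : on_path g W -> gpath g ->
  path_int g (fun w => int_c rho' al' (Ph w)) = path_int g (a C1) + path_int g (a C2).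
Proof.
have [_ [Z1 _ Z3]] := near6; move=> gW gg.
have e h x : on_path h Z -> gpath h -> 0 <= x <= 1 -> path_int h (Ph (g x)) = a h (g x).
  move=> hZ gh hx; rewrite /a -(split_inner A cB nz hZ gh (gW x hx)).
  by apply: path_int_ext => y hy; have [e1 -> _ _ _] := hE (gW x hx) (hZ y hy); rewrite e1.
have cC1 x : 0 <= x <= 1 -> hcont (a C1) (g x).
  by move=> hx; apply: (split_outer_hcont cA cB k0' nz Z1 (gpath_arc _ _ _)); exact: gW.
have cC2 x : 0 <= x <= 1 -> hcont (a C2) (g x).
  by move=> hx; apply: (split_outer_hcont cA cB k0' nz Z3 (gpath_arc _ _ _)); exact: gW.
transitivity (path_int g (fun w => a C1 w + a C2 w)).
  apply: path_int_ext => x hx.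
  exact: (congr2 +%R (e C1 x Z1 (gpath_arc _ _ _) hx) (e C2 x Z3 (gpath_arc _ _ _) hx)).
exact: (path_intD gg cC1 cC2).
Qed.

Let profiles : [/\ profile c1 lw, profile c2 lw, profile C1 lz & profile C2 lz].
Proof.
have [[W1 _ W3] [Z1 _ Z3]] := near6; have [h1 h2] := arc_len ha; have [h3 h4] := arc_len ha'.
split.
- exact: (arc_profile (ltW r0) hc h1 W1).
- exact: (arc_profile (ltW r0) hc h2 W3).
- exact: (arc_profile (ltW r0') hc' h3 Z1).
- exact: (arc_profile (ltW r0') hc' h4 Z3).
Qed.

Lemma segment_arc_piece : cmod (int_k rho (fun w => int_c rho' al' (Ph w))) <=
  6 / dl * (2 * gauss_int rho * (2 * lz)).
Proof.
have [[W1 W2 W3] [Z1 Z2 Z3]] := near6; have [p1 p2 p3 p4] := profiles.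
have gk := gpath_segment (0 +i* - rho) (0 +i* rho).
have eq := aC W2 gk; apply: (@le_trans _ _ (cmod (path_int k (a C1) + path_int k (a C2)))).
  by rewrite -eq.
apply: (le_trans (cmodD _ _)).
have := lerD (Ph_piece W2 gk (segment_profile r0) Z1 (gpath_arc _ _ _) p3)
  (Ph_piece W2 gk (segment_profile r0) Z3 (gpath_arc _ _ _) p4).
by move=> h; apply: (le_trans h); rewrite le_eqVlt; apply/orP; left; apply/eqP; ring.
Qed.

Lemma arc_segment_piece : cmod (int_c rho al (fun w => int_k rho' (Ph w))) <=
  6 / dl * (2 * lw * (2 * gauss_int rho')).
Proof.
have [[W1 W2 W3] [Z1 Z2 Z3]] := near6; have [p1 p2 p3 p4] := profiles.
have gK := gpath_segment (0 +i* - rho') (0 +i* rho').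
have e g : on_path g W -> path_int g (fun w => int_k rho' (Ph w)) = path_int g (a K).
  move=> gW; apply: path_int_ext => x hx; rewrite /a -(split_inner A cB nz Z2 gK (gW x hx)).
  by apply: path_int_ext => y hy; have [e1 -> _ _ _] := hE (gW x hx) (Z2 y hy); rewrite e1.
apply: (@le_trans _ _ (cmod (path_int c1 (a K) + path_int c2 (a K)))).
  by rewrite -(e c1 W1) -(e c2 W3).
apply: (le_trans (cmodD _ _)).
have := lerD (Ph_piece W1 (gpath_arc _ _ _) p1 Z2 gK (segment_profile r0'))
  (Ph_piece W3 (gpath_arc _ _ _) p2 Z2 gK (segment_profile r0')).
by move=> h; apply: (le_trans h); rewrite le_eqVlt; apply/orP; left; apply/eqP; ring.
Qed.

Lemma arc_arc_piece : cmod (int_c rho al (fun w => int_c rho' al' (Ph w))) <=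
  6 / dl * (2 * lw * (2 * lz)).
Proof.
have [[W1 W2 W3] [Z1 Z2 Z3]] := near6; have [p1 p2 p3 p4] := profiles.
apply: (@le_trans _ _ (cmod ((path_int c1 (a C1) + path_int c1 (a C2)) + (path_int c2 (a C1) + path_int c2 (a C2))))).
  rewrite le_eqVlt; apply/orP; left; apply/eqP.
  exact: (congr1 (@cmod R) (congr2 +%R (aC W1 (gpath_arc _ _ _)) (aC W3 (gpath_arc _ _ _)))).
apply: (le_trans (cmodD _ _)); apply: (le_trans (lerD (cmodD _ _) (cmodD _ _))).
have := lerD (lerD (Ph_piece W1 (gpath_arc _ _ _) p1 Z1 (gpath_arc _ _ _) p3)
  (Ph_piece W1 (gpath_arc _ _ _) p1 Z3 (gpath_arc _ _ _) p4))
  (lerD (Ph_piece W3 (gpath_arc _ _ _) p2 Z1 (gpath_arc _ _ _) p3)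
  (Ph_piece W3 (gpath_arc _ _ _) p2 Z3 (gpath_arc _ _ _) p4)).
by move=> h; apply: (le_trans h); rewrite le_eqVlt; apply/orP; left; apply/eqP; ring.
Qed.
End Pieces.
End PieceBounds.

(** * Positivity and upper bound of F_n *)

Section FnBounds.
Context {R : realType}.
Notation gauss_int := (@gauss_integral_proof.integral0_gauss R).

(** The product of the two integrals is at most half the sum of their squares, each of which is
    below pi / 4. *)
Lemma gauss_prod_lt (r r' : R) : 0 <= r -> 0 <= r' -> 4 * (gauss_int r * gauss_int r') < pi.
Proof.
move=> r0 r0'; have h := gauss_int_sqr_lt r0; have h' := gauss_int_sqr_lt r0'.
have := sqr_ge0 (gauss_int r - gauss_int r').
have -> : (gauss_int r - gauss_int r') ^+ 2 =
  gauss_int r ^+ 2 + gauss_int r' ^+ 2 - 2 * (gauss_int r * gauss_int r') by ring.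
by move: h h'; clear; lra.
Qed.

Lemma gauss_int_le1 (r : R) : 0 <= r -> 0 <= gauss_int r <= 1.
Proof.
move=> r0; have [g0 _] := andP (gauss_int_bounds r0); rewrite g0 /=.
rewrite -(@ler_pXn2r _ 2) ?nnegrE// expr1n; apply: (le_trans (ltW (gauss_int_sqr_lt r0))).
by have p2 := @pihalf_lt2 R; lra.
Qed.

(** The product is at least the square of the integral for the smaller radius, to which
    [gauss_int_tail] applies. *)
Lemma gauss_prod_ge (r r' y : R) : 0 < r -> 0 < r' -> y <= r ^+ 2 -> y <= r' ^+ 2 ->
  pi - 4 * (gauss_int r * gauss_int r') <= 4 * expR (- y).
Proof.
wlog rr : r r' / r <= r'.
  move=> h r0 r0' h1 h2; have [rr|rr] := leP r r'; first exact: h.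
  by rewrite [gauss_int r * _]mulrC; apply: h => //; exact: ltW.
move=> r0 r0' hy _; have := gauss_int_tail r0; have [g0 _] := andP (gauss_int_bounds (ltW r0)).
have h : gauss_int r ^+ 2 <= gauss_int r * gauss_int r'.
  rewrite expr2; apply: ler_wpM2l => //; move: rr; rewrite le_eqVlt => /orP[/eqP ->//|rr].
  by apply/ltW/gauss_int_lt => //; exact: ltW.
have : gauss_fun r <= expR (- y) by rewrite /gauss_fun ler_expR lerN2.
by move: h; clear; lra.
Qed.

Lemma two_lt_le (y z : R) : 0 < y -> 2 * y < z -> y <= z.
Proof. lra. Qed.

Lemma square_split (a c z : R) : 9 / 8 * a * z * (9 / 8 * c * z) = 81 / 64 * (a * c) * (z * z).
Proof. by field. Qed.

Lemma eq_ler (y z : R) : y = z -> y <= z.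
Proof. by move=> ->. Qed.

(** Here tau is n^(1-3 theta), y is n^(1-2 theta) and X an exponential. Divided by tau, the second
    modulus leaves a multiple of EE and the third one is bounded because q <= tau; the other four
    keep the factor X y / tau. *)
Lemma F_numeric (d tau a1 a2 a3 a4 a5 a6 X y EE eps q r r' D D' g g' lw lz : R) :
  0 < d -> 0 < tau -> 1 <= y -> 0 < X <= 1 -> 0 <= D -> 0 <= D' -> 0 <= g <= 1 -> 0 <= g' <= 1 ->
  a1 <= 4 * X / d -> a2 <= 3 * eps / d * (2 * g * (2 * g')) ->
  a3 <= 27 / 2 * q / d ^+ 2 * (2 * g * (2 * g')) ->
  a4 <= 6 / d * (2 * g * (2 * lz)) -> a5 <= 6 / d * (2 * lw * (2 * g')) ->
  a6 <= 6 / d * (2 * lw * (2 * lz)) ->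
  0 <= lw <= 2 * r * X -> 0 <= lz <= 2 * r' * X -> 0 <= r <= 9 / 8 * D * y ->
  0 <= r' <= 9 / 8 * D' * y -> r * r' <= 81 / 64 * (D * D') * y ->
  eps = tau * EE -> 0 <= EE -> 0 <= q <= tau ->
  0 <= a1 + a2 + a3 + a4 + a5 + a6 ->
  tau^-1 * (d / pi) * (a1 + a2 + a3 + a4 + a5 + a6) <=
  12 * EE + 54 / d + X * y / tau * (4 + 54 * (D + D') + 122 * (D * D')).
Proof.
move=> d0 t0 y1 /andP[X0 X1] D0 D0' /andP[g0 g1] /andP[g0' g1'] h1 h2 h3 h4 h5 h6
  /andP[lw0 hlw] /andP[lz0 hlz] /andP[r0 hr] /andP[r0' hr'] hrr ee EE0 /andP[q0 qt] S0; rewrite ee in h2.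
have y0 : 0 <= y by exact: le_trans y1.
have gg : 2 * g * (2 * g') <= 4.
  by have := ler_pM g0 g0' g1 g1'; rewrite mulr1; clear; lra.
have gg0 : 0 <= 2 * g * (2 * g') by rewrite !mulr_ge0.
have i0 : 0 <= d^-1 by rewrite invr_ge0 ltW.
have XyD : r * X <= 9 / 8 * D * y * X by apply: ler_wpM2r => //; exact: ltW.
have XyD' : r' * X <= 9 / 8 * D' * y * X by apply: ler_wpM2r => //; exact: ltW.
have b1 : a1 <= d^-1 * (4 * X * y).
  apply: (le_trans h1); rewrite [leRHS]mulrC; apply: ler_wpM2r => //.
  by rewrite -[leLHS]mulr1; apply: ler_wpM2l => //; rewrite mulr_ge0// ltW.
have b2 : a2 <= d^-1 * (12 * tau * EE).
  apply: (le_trans h2); have : 3 * (tau * EE) * (2 * g * (2 * g')) <= 3 * (tau * EE) * 4.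
    by apply: ler_wpM2l => //; rewrite !mulr_ge0// ltW.
  move=> h; have := ler_wpM2l i0 h; set Y := 2 * g * _; move=> {}h.
  have -> : 3 * (tau * EE) / d * Y = d^-1 * (3 * (tau * EE) * Y) by ring.
  by apply: (le_trans h); rewrite le_eqVlt; apply/orP; left; apply/eqP; ring.
have b3 : a3 <= d^-1 * (54 * tau / d).
  apply: (le_trans h3); have : q * (2 * g * (2 * g')) <= tau * 4 by apply: ler_pM.
  move=> h; have := ler_wpM2l (mulr_ge0 i0 i0) h; set Y := 2 * g * _; move=> {}h.
  have -> : 27 / 2 * q / d ^+ 2 * Y = 27 / 2 * (d^-1 * d^-1 * (q * Y)).
    by field; rewrite gt_eqF.
  have -> : d^-1 * (54 * tau / d) = 27 / 2 * (d^-1 * d^-1 * (tau * 4)) by field; rewrite gt_eqF.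
  by apply: ler_wpM2l h; rewrite divr_ge0.
have b4 : a4 <= d^-1 * (54 * D' * y * X).
  apply: (le_trans h4).
  have : g * lz <= 1 * (2 * r' * X) by apply: ler_pM.
  have -> : 6 / d * (2 * g * (2 * lz)) = d^-1 * (24 * (g * lz)) by ring.
  by move=> h; apply: ler_wpM2l => //; move: h XyD'; clear; lra.
have b5 : a5 <= d^-1 * (54 * D * y * X).
  apply: (le_trans h5).
  have : lw * g' <= 2 * r * X * 1 by apply: ler_pM.
  have -> : 6 / d * (2 * lw * (2 * g')) = d^-1 * (24 * (lw * g')) by ring.
  by move=> h; apply: ler_wpM2l => //; move: h XyD; clear; lra.
have b6 : a6 <= d^-1 * (122 * (D * D') * y * X).
  apply: (le_trans h6).
  have : lw * lz <= (2 * r * X) * (2 * r' * X) by apply: ler_pM.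
  have -> : 6 / d * (2 * lw * (2 * lz)) = d^-1 * (24 * (lw * lz)) by ring.
  move=> h; apply: ler_wpM2l => //.
  have XX : X * X <= X by rewrite -[leRHS]mulr1; apply: ler_wpM2l => //; exact: ltW.
  have h7 : (r * r') * (X * X) <= 81 / 64 * (D * D') * y * X.
    by apply: ler_pM => //; rewrite mulr_ge0// ltW.
  have h8 : 0 <= D * D' * y * X by rewrite !mulr_ge0// ltW.
  by move: h h7 h8; clear; lra.
set T := 4 * X * y + 12 * tau * EE + 54 * tau / d + 54 * D' * y * X + 54 * D * y * X + 122 * (D * D') * y * X.
have hS : a1 + a2 + a3 + a4 + a5 + a6 <= d^-1 * T by rewrite /T !mulrDr !lerD.
have pi1 : (pi : R)^-1 <= 1 by rewrite invf_le1 ?pi_gt0//; have := @pi_ge2 R; clear; lra.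
set S := _ + a6 in hS S0 *.
have -> : 12 * EE + 54 / d + X * y / tau * (4 + 54 * (D + D') + 122 * (D * D')) = tau^-1 * T.
  by rewrite /T; field; rewrite !gt_eqF.
rewrite -mulrA; apply: ler_wpM2l; first by rewrite invr_ge0 ltW.
apply: (@le_trans _ _ (d * S)).
  by rewrite mulrAC; rewrite -[leRHS]mulr1; apply: ler_wpM2l => //; rewrite mulr_ge0// ltW.
by move: hS; rewrite -(ler_pM2l d0) mulrA divff ?gt_eqF// mul1r.
Qed.

(** The real part of the corner is below half its imaginary part, which is at most its modulus. *)
Lemma cos_corner theta (n : nat) (root y : R) : `|root - y| < npow n (- theta) / 2 ->
  0 < npow n (- theta) :> R -> `|cos (alpha_of theta n root y)| <= 2^-1.
Proof.
move=> h q0; set c := corner theta n root y.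
have c0 : c != 0 by apply: contraTneq q0 => /(congr1 (@Im R)) /= ->; rewrite ltxx.
have cc : 0 < cmod c by rewrite cmod_gt0.
have qc : npow n (- theta) <= cmod c by apply: (le_trans (ler_norm _)); exact: (Im_le_cmod c).
have e := cos_carg c0; rewrite -(ler_pM2l cc) -[X in X * `|_|](gtr0_norm cc) -normrM e /=.
by move: h qc; clear; lra.
Qed.

Lemma F_nE theta (t s : R) (n : nat) f ft D Dt tn sn :
  let rho := rho_of theta n tn t D in
  let rhot := rho_of theta n sn s Dt in
  let al := alpha_of theta n tn t in
  let alt := alpha_of theta n sn s in
  let eg := exp_g theta t s n f ft D Dt in
  let Ph := Phi_n theta t s n f ft D Dt in
  F_n theta t s n f ft D Dt tn sn =
  npow n (- 1 + 3 * theta) * ((t - s) / pi) *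
  (cmod (- int_k rho (fun w => int_k rhot (fun z => cexp (w ^+ 2 + z ^+ 2) / (t - s)%:C))
      - (pi / (t - s))%:C) +
   cmod (int_k rho (fun w => int_k rhot (fun z => (eg w z - cexp (w ^+ 2 + z ^+ 2)) / (t - s)%:C))) +
   cmod (int_k rho (fun w => int_k rhot (fun z => Ph w z - eg w z / (t - s)%:C))) +
   cmod (int_k rho (fun w => int_c rhot alt (Ph w))) +
   cmod (int_c rho al (fun w => int_k rhot (Ph w))) +
   cmod (int_c rho al (fun w => int_c rhot alt (Ph w)))).
Proof.
cbv zeta; congr (_ * _).
by congr (_ + _ + _ + _ + _ + _); exact: cmodN.
Qed.

Lemma cmod_main_piece (g g' d : R) : 4 * (g * g') < pi -> 0 < d ->
  cmod (- (- (4 * (g * g') / d))%:C - (pi / d)%:C) = (pi - 4 * (g * g')) / d.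
Proof.
move=> h d0; rewrite -rmorphN -rmorphB /= opprK cmodR distrC -mulrBl ger0_norm//.
by rewrite divr_ge0 ?(ltW d0)// subr_ge0 ltW.
Qed.

Section Regime.
Context (x : forall n, 'I_n -> R) (n k m : nat)
  (b chi xi u v t s tn sn ev eu theta : R)
  (rg : regime x n k m b chi xi u v t s tn sn ev eu theta).
Arguments x : clear implicits.
Let p := npow n (- 2^-1) : R.
Let q := npow n (- theta) : R.
Let fn' := fprime (cauchy_transform_n x n) v ev.
Let ftn' := fprime (cauchy_transform_n x n) u eu.
Let D := D_of fn' t.
Let Dt := D_of ftn' s.
Let f := flog x n m.+1 v.
Let ft := flog x n k u.
Let phi := weight (x n) v m.+1.
Let psi := inv_weight (x n) u k.
Let ka := p * D^-1.
Let kat := p * Dt^-1.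
Let rho := rho_of theta n tn t D.
Let rhot := rho_of theta n sn s Dt.
Let al := alpha_of theta n tn t.
Let alt := alpha_of theta n sn s.
Let E := 2 * npow n (2 * theta) * cmod (fn' t%:C) + 2 ^+ 6 / (t - b) ^+ 3 + 2 ^+ 5 / (t - chi) ^+ 3.
Let Et := 2 * npow n (2 * theta) * cmod (ftn' s%:C) + 2 ^+ 9 / (s - b) ^+ 3 + 2 ^+ 6 / (s - chi) ^+ 3.
Let eps := n%:R * q ^+ 3 * E + n%:R * q ^+ 3 * Et.
Let A w := phi (t%:C + ka%:C * w) / phi t%:C.
Let B z := psi (s%:C + kat%:C * z) / psi s%:C.
Let eg := exp_g theta t s n f ft D Dt.
Let Ph := Phi_n theta t s n f ft D Dt.

Let dl := t - s.

Let facts : [/\ 0 < dl, 0 < q, 0 < rho & 0 < rhot] /\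
  [/\ kat != 0, 0 <= al <= pi, 0 <= alt <= pi, `|cos al| <= 2^-1 & `|cos alt| <= 2^-1] /\
  [/\ ka * rho = cmod ((tn - t) +i* q), ka * rho <= 9 / 8 * q,
     kat * rhot = cmod ((sn - s) +i* q) & kat * rhot <= 9 / 8 * q].
Proof.
have [D0 _ Dt0 _] := regime_D rg; have n0 := rg_n rg.
have [k0 r0 ha e] := local_params theta tn t n0 D0.
have [k0' r0' ha' e'] := local_params theta sn s n0 Dt0.
have [p0 q0 htn hsn _] := regime_scales rg.
have [_ _ _ _ [_ st _ _ _]] := regime_order rg.
have [h1 h2 _] := near_axis_bounds q0 (ltW k0) (ltW r0) e htn.
have [h3 h4 _] := near_axis_bounds q0 (ltW k0') (ltW r0') e' hsn.
have d0 : 0 < dl by rewrite subr_gt0.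
exact: (conj (And4 d0 q0 r0 r0') (conj (And5 (lt0r_neq0 k0') ha ha' (cos_corner htn q0)
  (cos_corner hsn q0)) (And4 h1 h2 h3 h4))).
Qed.

Let cA w : near_axis rho al w -> hcont A w.
Proof.
move=> hw; apply: hcontM; last exact: hcont_cst.
apply: (@hcont_comp _ phi); first exact: hcont_affine.
have [_ _ _ _ h] := regime_local_w rg hw; apply: weight_hcont.
by apply: contraTneq h => e; rewrite -/p -/D -/ka e ReC ltxx.
Qed.

Let cB z : near_axis rhot alt z -> hcont B z.
Proof.
move=> hz; apply: hcontM; last exact: hcont_cst.
apply: (@hcont_comp _ psi); first exact: hcont_affine.
have [_ _ _ h _] := regime_local_z rg hz; apply: inv_weight_hcont.
- exact: (rg_inj rg).
- by case/andP: (rg_k rg).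
- by move=> i _; apply: contraTneq (h i) => e; rewrite -/p -/Dt -/kat e ReC ltxx.
Qed.

Let eps1 : 0 <= eps <= 1.
Proof. by have [h1 [h2 /ltW h3]] := regime_eps rg; rewrite /eps addr_ge0. Qed.

(** By n p^2 = 1 the quadratic term becomes exactly w^2: this is the purpose of D_n in the
    scaling. *)
Let scaled_square (Q D0 : R) (w : R[i]) : 0 < D0 -> n%:R * D0 ^+ 2 = Q ->
  Q%:C * ((p * D0^-1)%:C * w) ^+ 2 = w ^+ 2.
Proof.
move=> d0 <-; rewrite exprMn mulrA -rmorphXn -rmorphM /=.
have [ep _ _ _ _] := npow_scales theta (rg_n rg).
have -> : n%:R * D0 ^+ 2 * (p * D0^-1) ^+ 2 = p ^+ 2 * n%:R by field; rewrite gt_eqF.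
by rewrite ep mul1r.
Qed.

Let hE w z : near_axis rho al w -> near_axis rhot alt z ->
  [/\ eg w z = A w * B z, Ph w z = eg w z / (dl%:C + ka%:C * w - kat%:C * z),
    dl / 2 <= cmod (dl%:C + ka%:C * w - kat%:C * z),
    cmod (ka%:C * w) <= 9 / 8 * q /\ cmod (kat%:C * z) <= 9 / 8 * q
  & exists2 e, A w * B z = cexp (w ^+ 2 + z ^+ 2 + e) & cmod e <= eps].
Proof.
move=> hw hz; have [hw1 _ _ _ _] := regime_local_w rg hw; have [hz1 _ _ _ _] := regime_local_z rg hz.
split; [exact: (regime_exp_g rg hw hz)|by []|exact: (regime_denominator rg hw hz)|by []|].
have [D0 eD Dt0 eDt] := regime_D rg; have [xt vt xs us] := regime_lt rg.
have [_ p0] := weight_real m.+1 xt vt; have [_ s0] := inv_weight_real k xs us.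
have pn : phi t%:C != 0 by rewrite -cmod_gt0.
have sn' : psi s%:C != 0 by rewrite -cmod_gt0.
have ew : t%:C + ka%:C * w - t%:C = ka%:C * w by rewrite addrC addKr.
have ez : s%:C + kat%:C * z - s%:C = kat%:C * z by rewrite addrC addKr.
have [|e1 h1 b1] := @regime_expansion_w _ _ _ _ _ _ _ _ _ _ _ _ _ _ _ _ _ rg (t%:C + ka%:C * w).
  by rewrite ew.
have [|e2 h2 b2] := @regime_expansion_z _ _ _ _ _ _ _ _ _ _ _ _ _ _ _ _ _ rg (s%:C + kat%:C * z).
  by rewrite ez.
exists (e1 + e2); last by apply: (le_trans (cmodD _ _)); exact: lerD.
rewrite /A /B; have -> : phi (t%:C + ka%:C * w) = phi t%:C * cexp (w ^+ 2 + e1).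
  by apply: (etrans h1); rewrite ew (scaled_square w D0 eD).
have -> : psi (s%:C + kat%:C * z) = psi s%:C * cexp (z ^+ 2 + e2).
  by apply: (etrans h2); rewrite ez (scaled_square z Dt0 eDt).
rewrite [phi _ * _]mulrC mulfK// [psi _ * _]mulrC mulfK// -cexpD; congr cexp; ring.
Qed.

(** The first modulus alone is positive: a Gaussian integral over a bounded segment is strictly
    smaller than over the whole line, so I_{1,n} differs from pi / (t - s). *)
Lemma regime_F_gt0 : 0 < F_n theta t s n f ft D Dt tn sn.
Proof.
have [[d0 q0 r0 r0'] [[k0' ha ha' hc hc'] _]] := facts; have n0 := rg_n rg.
have e1 := main_piece d0 r0 r0'.
have e2 := cmod_main_piece (gauss_prod_lt (ltW r0) (ltW r0')) d0.
have e3 := etrans (congr1 (fun z => cmod (- z - (pi / dl)%:C)) e1) e2.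
have P (a c1 c2 c3 c4 c5 c6 : R) : 0 < a -> 0 < c1 -> 0 <= c2 -> 0 <= c3 -> 0 <= c4 -> 0 <= c5 -> 0 <= c6 ->
    0 < a * (c1 + c2 + c3 + c4 + c5 + c6).
  by move=> a0 *; apply: mulr_gt0 => //; do 5?[apply: ltr_wpDr => //].
have Q0 : 0 < npow n (- 1 + 3 * theta) * (dl / pi).
  by apply: mulr_gt0; [exact: npow_gt0|exact: (divr_gt0 d0 (pi_gt0 R))].
rewrite F_nE; apply: (P _ _ _ _ _ _ _ Q0 _ (cmod_ge0 _) (cmod_ge0 _) (cmod_ge0 _) (cmod_ge0 _) (cmod_ge0 _)).
apply: lt_le_trans (eq_ler (esym e3)).
by apply: divr_gt0 => //; rewrite subr_gt0; exact: (gauss_prod_lt (ltW r0) (ltW r0')).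
Qed.

(** With mu below D^2 and Dt^2, both squared radii are at least mu y; the arcs and the Gaussian
    tails are then controlled by one exponential. *)
Lemma regime_F_le (mu y : R) : 0 < mu -> mu <= D ^+ 2 -> mu <= Dt ^+ 2 -> y = n%:R * q ^+ 2 ->
  F_n theta t s n f ft D Dt tn sn <= 12 * (E + Et) + 54 / dl +
    expR (- (mu / 2 * y)) * y / (n%:R * q ^+ 3) * (4 + 54 * (D + Dt) + 122 * (D * Dt)).
Proof.
move=> mu0 muD muDt ey; have [[d0 q0 r0 r0'] [[k0' ha ha' hc hc'] [ec1 ec2 ec3 ec4]]] := facts.
have n0 := rg_n rg; have nR : 0 < n%:R :> R by rewrite ltr0n.
have [D0 _ Dt0 _] := regime_D rg.
have [p0 _ htn hsn _] := regime_scales rg.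
have [ep _ et _ [_ _ _ em _]] := npow_scales theta n0.
have [E0 Et0] := regime_E_ge0 rg.
have q0' := ltW q0.
have kr (c D1 r : R) : 0 < D1 -> p * D1^-1 * r = c -> r = c * D1 / p.
  by move=> d1 <-; field; rewrite !gt_eqF.
have en : n%:R = (p ^+ 2)^-1.
  by rewrite -[LHS](mulKf (lt0r_neq0 (exprn_gt0 2 p0))) ep mulr1.
(* The radii are of order q / p = n^(1/2-theta), whose square is y. *)
have eqq : q / p * (q / p) = y by rewrite ey en; field; rewrite gt_eqF.
have qp0 : 0 < q / p by rewrite divr_gt0.
have qp1 : 1 <= q / p.
  by rewrite ler_pdivlMr// mul1r; exact: (two_lt_le p0 (rg_pq rg)).
have y1 : 1 <= y by rewrite -eqq; exact: mulr_ege1.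
have qpy : q / p <= y by rewrite -eqq -{1}[q / p]mulr1; apply: ler_wpM2l => //; exact: ltW.
have rb (c D1 r : R) : 0 < D1 -> p * D1^-1 * r = c -> c <= 9 / 8 * q -> 0 <= c ->
    r <= 9 / 8 * D1 * (q / p).
  move=> d1 h h2 h3; rewrite (kr c D1 r d1 h).
  have -> : 9 / 8 * D1 * (q / p) = 9 / 8 * q * (D1 / p) by ring.
  by rewrite -mulrA; apply: ler_wpM2r h2; rewrite ltW// divr_gt0.
have rsq (c D1 r : R) : 0 < D1 -> p * D1^-1 * r = c -> q ^+ 2 <= c ^+ 2 -> mu <= D1 ^+ 2 ->
    mu * y <= r ^+ 2.
  move=> d1 h h2 h3; rewrite (kr c D1 r d1 h).
  have -> : (c * D1 / p) ^+ 2 = D1 ^+ 2 * (n%:R * c ^+ 2).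
    by rewrite en; field; rewrite gt_eqF.
  apply: (ler_pM (ltW mu0) (le_trans ler01 y1) h3).
  by rewrite ey; exact: (ler_wpM2l (ltW nR) h2).
have csq (z : R) : q ^+ 2 <= cmod (z +i* q) ^+ 2 by rewrite cmod_sqr /= lerDr sqr_ge0.
have b1 := rb _ _ _ D0 erefl ec2 (mulr_ge0 (ltW (divr_gt0 p0 D0)) (ltW r0)).
have b2 := rb _ _ _ Dt0 erefl ec4 (mulr_ge0 (ltW (divr_gt0 p0 Dt0)) (ltW r0')).
have s1 := rsq _ _ _ D0 ec1 (csq _) muD; have s2 := rsq _ _ _ Dt0 ec3 (csq _) muDt.
set X := expR _.
have X01 : 0 < X <= 1.
  rewrite expR_gt0 /= -expR0 ler_expR oppr_le0.
  exact: (mulr_ge0 (ltW (divr_gt0 mu0 (ltr0Sn R 1))) (le_trans ler01 y1)).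
have Xle (r : R) : mu * y <= r ^+ 2 -> expR (- (r ^+ 2 / 2)) <= X.
  move=> h; rewrite ler_expR lerN2; have -> : mu / 2 * y = mu * y / 2 by ring.
  by apply: ler_wpM2r.
have hdl := main_piece d0 r0 r0'.
have a2 := diff_piece d0 r0 r0' ha ha' cA cB eps1 hE.
have a3 := ratio_piece d0 k0' r0 r0' ha ha' cA cB eps1 q0' hE.
have a4 := segment_arc_piece d0 k0' r0 r0' ha ha' hc hc' cA cB eps1 hE.
have a5 := arc_segment_piece d0 k0' r0 r0' ha ha' hc hc' cA cB eps1 hE.
have a6 := arc_arc_piece d0 k0' r0 r0' ha ha' hc hc' cA cB eps1 hE.
have t0 : 0 < n%:R * q ^+ 3 by rewrite mulr_gt0// exprn_gt0.
have e2 := cmod_main_piece (gauss_prod_lt (ltW r0) (ltW r0')) d0.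
have e3 := etrans (congr1 (fun z => cmod (- z - (pi / dl)%:C)) hdl) e2.
have a1 : cmod (- int_k rho (fun w => int_k rhot (fun z => cexp (w ^+ 2 + z ^+ 2) / dl%:C)) - (pi / dl)%:C)
    <= 4 * X / dl.
  apply: (le_trans (eq_ler e3)); apply: ler_wpM2r; first by rewrite invr_ge0 ltW.
  apply: (le_trans (gauss_prod_ge r0 r0' s1 s2)); apply: ler_wpM2l => //.
  rewrite ler_expR lerN2; have -> : mu / 2 * y = mu * y / 2 by ring.
  have my0 : 0 <= mu * y by exact: (mulr_ge0 (ltW mu0) (le_trans ler01 y1)).
  by rewrite ler_pdivrMr// ler_peMr// ler1n.
have w0 (r : R) : 0 < r -> mu * y <= r ^+ 2 -> 0 <= 2 * r * expR (- (r ^+ 2 / 2)) <= 2 * r * X.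
  move=> hr h; rewrite (mulr_ge0 (mulr_ge0 (ler0n _ _) (ltW hr)) (expR_ge0 _)) /=.
  exact: (ler_wpM2l (mulr_ge0 (ler0n _ _) (ltW hr)) (Xle _ h)).
have up (r D1 : R) : 0 < D1 -> r <= 9 / 8 * D1 * (q / p) -> r <= 9 / 8 * D1 * y.
  move=> d1 h; apply: (le_trans h); apply: ler_wpM2l => //.
  by rewrite mulr_ge0 ?(ltW d1)// divr_ge0.
have rr : rho * rhot <= 81 / 64 * (D * Dt) * y.
  apply: (le_trans (ler_pM (ltW r0) (ltW r0') b1 b2)).
  by rewrite -eqq; exact: (eq_ler (square_split _ _ _)).
have qt : 0 <= q <= n%:R * q ^+ 3.
  rewrite q0' /= exprS mulrCA -ey -[X in X <= _]mulr1; exact: (ler_wpM2l q0' y1).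
have rb1 : 0 <= rho <= 9 / 8 * D * y by exact: (introT andP (conj (ltW r0) (up _ _ D0 b1))).
have rb2 : 0 <= rhot <= 9 / 8 * Dt * y by exact: (introT andP (conj (ltW r0') (up _ _ Dt0 b2))).
have G1 := gauss_int_le1 (ltW r0); have G2 := gauss_int_le1 (ltW r0').
have ee : eps = n%:R * q ^+ 3 * (E + Et) := esym (mulrDr _ _ _).
have S0 (c1 c2 c3 c4 c5 c6 : R[i]) : 0 <= cmod c1 + cmod c2 + cmod c3 + cmod c4 + cmod c5 + cmod c6.
  by rewrite !addr_ge0 ?cmod_ge0.
rewrite F_nE em.
exact: (F_numeric d0 t0 y1 X01 (ltW D0) (ltW Dt0) G1 G2 a1 a2 a3 a4 a5 a6 (w0 _ r0 s1) (w0 _ r0' s2)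
  rb1 rb2 rr ee (addr_ge0 E0 Et0) qt (S0 _ _ _ _ _ _)).
Qed.
End Regime.
End FnBounds.

(** * Uniform bounds *)

Section Asymptotics.
Context {R : realType}.
Implicit Types (mu y theta : R).

(** The N-th power of h <= exp h at h = mu y / N. *)
Lemma power_exp_le mu y (N : nat) : 0 < mu -> 0 <= y -> (0 < N)%N ->
  expR (- (mu * y)) * y ^+ N <= (N%:R / mu) ^+ N.
Proof.
move=> mu0 y0 N0; have NR : 0 < N%:R :> R by rewrite ltr0n.
have h : mu * y / N%:R <= expR (mu * y / N%:R).
  by apply: (le_trans _ (expR_ge1Dx _)); rewrite lerDr.
have e : expR (mu * y) = expR (mu * y / N%:R) ^+ N.
  by rewrite -expRM_natl; congr expR; field; rewrite gt_eqF.
have h2 : (mu * y / N%:R) ^+ N <= expR (mu * y).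
  rewrite e; apply: lerXn2r; rewrite ?nnegrE ?expR_ge0//.
  exact: (divr_ge0 (mulr_ge0 (ltW mu0) y0) (ltW NR)).
have -> : y ^+ N = (N%:R / mu) ^+ N * (mu * y / N%:R) ^+ N.
  by rewrite -exprMn; congr (_ ^+ _); field; rewrite !gt_eqF.
rewrite mulrCA -[leRHS]mulr1; apply: ler_wpM2l.
  by rewrite exprn_ge0// divr_ge0 ?ltW.
have := ler_wpM2l (expR_ge0 (- (mu * y))) h2.
by rewrite -expRD addNr expR0.
Qed.

(** As theta < 1 / 2, some fixed power K of y = n^(1-2 theta) dominates n. The extra factors n^(-1+3
    theta) and n^theta are at most n, so the exponential has to beat only y^(K+1). *)
Lemma exp_beats_power mu theta : 0 < mu -> 3^-1 < theta < 2^-1 -> exists2 C : R, 0 <= C &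
  forall n, (0 < n)%N -> let q := npow n (- theta) in let y := n%:R * q ^+ 2 in
    1 <= y /\ (expR (- (mu * y)) * y / (n%:R * q ^+ 3) <= C /\ expR (- (mu * y)) * q^-1 <= C).
Proof.
move=> mu0 /andP[th1 th2].
have d0 : 0 < 1 - 2 * theta by lra.
have [K hK] : exists K : nat, 1 <= K%:R * (1 - 2 * theta).
  exists (Num.truncn (1 - 2 * theta)^-1).+1.
  have := truncnS_gt (1 - 2 * theta)^-1; rewrite -(ltr_pM2r d0) mulVf ?gt_eqF//.
  by move/ltW.
exists ((K.+1%:R / mu) ^+ K.+1); first by rewrite exprn_ge0// divr_ge0 ?ltW.
move=> n n0 q y; have n1 : 1 <= n%:R :> R by rewrite ler1n.
have [_ _ e3 e2 [_ eth _ em _]] := npow_scales theta n0.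
have ey : y = npow n (1 - 2 * theta) by rewrite e2.
have mono (a b : R) : a <= b -> npow n a <= npow n b.
  by move=> ab; rewrite /npow ler_powR.
have y1 : 1 <= y by rewrite ey -[X in X <= _](@powRr0 R n%:R); apply: mono; exact: ltW.
have y0 : 0 <= y by exact: le_trans y1.
have yK : npow n 1 <= y ^+ K.
  rewrite ey /npow -powR_mulrn ?powR_ge0// -powRrM; apply: ler_powR => //.
  by rewrite mulrC.
have E0 : 0 <= expR (- (mu * y)) by exact: expR_ge0.
have main := power_exp_le mu0 y0 (ltn0Sn K).
split=> //; split.
- rewrite -em -mulrA; apply: le_trans main; apply: ler_wpM2l => //.
  rewrite exprS; apply: ler_wpM2l => //; apply: le_trans yK; apply: mono; lra.
- rewrite -eth; apply: le_trans main; apply: ler_wpM2l => //.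
  apply: (@le_trans _ _ (y ^+ K)); first by apply: le_trans yK; apply: mono; lra.
  by rewrite exprS ler_peMl// exprn_ge0.
Qed.

Lemma eqO1_bound (f : nat -> R) : f =O_\oo (fun=> 1 : R) ->
  exists2 C : R, 0 <= C & \forall n \near \oo, `|f n| <= C.
Proof.
move=> /eqO_exP[C C0 hC]; exists C; first exact: ltW.
by apply: filterS hC => n; rewrite normr1 mulr1.
Qed.

Lemma bound_eqO1 (f : nat -> R) (C : R) : (\forall n \near \oo, `|f n| <= C) ->
  f =O_\oo (fun=> 1 : R).
Proof.
move=> h; apply/eqO_exP; exists (`|C| + 1); first by rewrite ltr_wpDl.
apply: filterS h => n hn; rewrite normr1 mulr1; apply: (le_trans hn).
by apply: (le_trans (ler_norm C)); rewrite lerDl.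
Qed.
End Asymptotics.

(** * From the conditions on xi and N to the hypotheses for fixed n *)

Section RegimeConstruction.
Context {R : realType}.

(** The shift of order p = n^(-1/2) is along (1, C), which changes 1 - e and C (y - v) by the same
    amount; the critical equation at (chi, eta) therefore persists up to 1 / n. This is why the
    positions fluctuate in the directions (1, C_n(t)) and (1, C_n(s)). *)
Lemma residual_value (C v chi eta e y mm p nn y1 y2 : R) : nn != 0 -> y != v -> y != chi ->
  C = (1 - eta) / (y - chi) -> v = chi + mm * p + y1 * nn^-1 ->
  e = eta + mm * C * p + y2 * nn^-1 ->
  C - (1 - e) / (y - v) = (y2 - C * y1) / (y - v) / nn.
Proof.
move=> n0 yv yc eC ev ee; have h : 1 - eta = C * (y - chi) by rewrite eC divfK// subr_eq0.
have -> : 1 - e = C * (y - v) + (C * y1 - y2) / nn.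
  rewrite ee; have -> : 1 - (eta + mm * C * p + y2 * nn^-1) = (1 - eta) - mm * C * p - y2 * nn^-1 by ring.
  by rewrite h ev; ring.
by field; rewrite n0 subr_eq0.
Qed.

Lemma residual_bound (C v chi eta e y mm p nn y1 y2 Cb B ga : R) : 0 < nn -> 0 < ga -> ga <= y - v ->
  y != chi -> 0 <= C <= Cb -> `|y1| <= B -> `|y2| <= B ->
  C = (1 - eta) / (y - chi) -> v = chi + mm * p + y1 * nn^-1 ->
  e = eta + mm * C * p + y2 * nn^-1 ->
  `|C - (1 - e) / (y - v)| <= (B + Cb * B) / ga / nn.
Proof.
move=> n0 g0 gy yc /andP[C0 CC] b1 b2 eC ev ee.
have yv0 : 0 < y - v by exact: lt_le_trans gy.
rewrite (residual_value _ _ yc eC ev ee) ?gt_eqF//; last by rewrite -subr_gt0.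
rewrite !normrM (@gtr0_norm _ nn^-1) ?invr_gt0// (@gtr0_norm _ (y - v)^-1) ?invr_gt0//.
apply: ler_wpM2r; first by rewrite invr_ge0 ltW.
apply: ler_pM; rewrite ?normr_ge0 ?invr_ge0 ?(ltW yv0)//; last by rewrite lef_pV2 ?posrE.
apply: (le_trans (ler_normB _ _)); apply: lerD => //.
by rewrite normrM (ger0_norm C0); apply: ler_pM.
Qed.

Lemma real_lt_complex (c d : R) (z : R[i]) : z = d%:C -> c%:C < z -> c < d.
Proof. by move=> ->; rewrite ltcR. Qed.

Lemma complex_lt_real (c d : R) (z : R[i]) : z = d%:C -> z < c%:C -> d < c.
Proof. by move=> ->; rewrite ltcR. Qed.

(** One factor of q^2 is bounded by xi, the other by the condition of (N3) with 2^-6; then xi / (b -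
    a) <= 1 / 16 since b - a > 16 xi. The claim follows from tn - v >= (t - chi) / 2. *)
Lemma circle_arith (a b chi xi t v tn q p f2 : R) : 0 < xi -> 0 < p -> 0 < q -> q < xi -> 2 * p < q ->
  `|tn - t| < p -> 0 < f2 -> v < chi + 4 * xi ->
  a + 4 * xi < chi - 4 * xi -> chi + 4 * xi < b - 4 * xi -> b + 16 * xi < t ->
  q < 2 ^- 6 * (t - chi) * (t - b) ^+ 3 * (b - a)^-1 * f2 ->
  v < tn /\ q ^+ 2 <= 4^-1 * f2 * (tn - v) ^+ 4.
Proof.
move=> xi0 p0 q0 qxi pq; rewrite ltr_norml => /andP[t1 t2] f0 hv hac hcb hbt hq.
have ba : 16 * xi < b - a by lra.
have ba0 : 0 < b - a by lra.
set T := t - chi in hq *; have T0 : 0 < T by rewrite /T; lra.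
have bT : 0 < t - b by lra.
have hT : T / 2 <= tn - v by rewrite /T; lra.
split; first by rewrite -subr_gt0; apply: lt_le_trans hT; rewrite divr_gt0.
have h1 : (t - b) ^+ 3 <= T ^+ 3.
  by apply: lerXn2r; rewrite ?nnegrE ?(ltW T0) ?(ltW bT)// /T; lra.
have h2 : (T / 2) ^+ 4 <= (tn - v) ^+ 4.
  by apply: lerXn2r; rewrite ?nnegrE ?divr_ge0 ?(ltW T0)// (le_trans _ hT)// divr_ge0// ltW.
have h3 : xi * (b - a)^-1 <= 16^-1.
  by rewrite ler_pdivrMr//; move: ba; clear; lra.
have T4 : 0 < T ^+ 4 by rewrite exprn_gt0.
apply: (@le_trans _ _ (4^-1 * f2 * (T / 2) ^+ 4)); last first.
  by apply: ler_wpM2l => //; rewrite mulr_ge0// ltW.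
have i0 : 0 <= (b - a)^-1 by rewrite invr_ge0 ltW.
apply: (@le_trans _ _ (xi * (2 ^- 6 * T * T ^+ 3 * (b - a)^-1 * f2))).
  rewrite expr2; apply: ler_pM; rewrite ?(ltW q0) ?(ltW qxi)//; apply: (le_trans (ltW hq)).
  apply: ler_wpM2r; first exact: ltW.
  by apply: ler_wpM2r => //; apply: ler_wpM2l => //; rewrite mulr_ge0 ?(ltW T0)// invr_ge0 exprn_ge0.
have -> : xi * (2 ^- 6 * T * T ^+ 3 * (b - a)^-1 * f2) = 2 ^- 6 * (xi * (b - a)^-1) * (T ^+ 4 * f2) by ring.
have Tf : 0 < T ^+ 4 * f2 by rewrite mulr_gt0.
have := ler_wpM2r (ltW Tf) h3; move: Tf; clear; lra.
Qed.

Lemma regime_intro (x : forall n, 'I_n -> R) (n : nat)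
    (a b chi eta xi t s u v tn sn theta f2t f2s : R) (r s_ : nat) :
  let ev := (s_%:R - 1) / n%:R in let eu := (r%:R + 1) / n%:R in
  let fn' := fprime (cauchy_transform_n x n) v ev in
  let ftn' := fprime (cauchy_transform_n x n) u eu in
  (1 < n)%N -> (forall i j : 'I_n, (i < j)%N -> x n j < x n i) ->
  (1 <= r <= n.-1)%N -> (1 <= s_ <= n.-1)%N -> 0 < xi ->
  s + 4 * xi < t - 4 * xi -> b + 4 * xi < s - 4 * xi -> chi + 4 * xi < b - 4 * xi ->
  a + 4 * xi < chi - 4 * xi -> 2 * xi < 1 - eta - 2 * xi ->
  (forall i : 'I_n, i = 0%N :> nat -> b - 4 * xi < x n i < b + 4 * xi) ->
  chi - 4 * xi < v < chi + 4 * xi -> chi - 4 * xi < u < chi + 4 * xi ->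
  1 - eta - 2 * xi < 1 - eu -> `|v - u| < 2^-1 * xi ->
  npow n (- 2^-1 + theta) < 2^-1 -> npow n (- theta) < xi -> n%:R^-1 < xi ->
  npow n (- theta) < 2 ^- 6 * (t - chi) * (t - b) ^+ 3 * (b - a)^-1 * f2t ->
  npow n (1 - 3 * theta) *
    (2 * npow n (2 * theta) * cmod (fn' t%:C) + 2 ^+ 6 / (t - b) ^+ 3 + 2 ^+ 5 / (t - chi) ^+ 3 +
     (2 * npow n (2 * theta) * cmod (ftn' s%:C) + 2 ^+ 9 / (s - b) ^+ 3 + 2 ^+ 6 / (s - chi) ^+ 3)) < 1 ->
  0 < f2t -> f2s < 0 ->
  (4^-1 * f2t)%:C < cderive fn' t%:C -> cderive ftn' s%:C < (4^-1 * f2s)%:C ->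
  (4^-1 * f2t)%:C < cderive fn' tn%:C ->
  fn' tn%:C = 0 -> ftn' sn%:C = 0 ->
  tn \in `]t - npow n (- 2^-1), t + npow n (- 2^-1)[ ->
  sn \in `]s - npow n (- 2^-1), s + npow n (- 2^-1)[ ->
  regime x n (n - r - 1) (n - s_) b chi xi u v t s tn sn ev eu theta.
Proof.
move=> ev eu fn' ftn' n1 hdec hr hs xi0 hst hbs hcb hac heta hx0 hv hu heu huv hpq hq hn hq2 hE
  f2t0 f2s0 L3 L3' L6 z1 z2; rewrite !in_itv/= => /andP[tn1 tn2] /andP[sn1 sn2].
have n0 : (0 < n)%N by exact: ltnW.
have nR : 0 < n%:R :> R by rewrite ltr0n.
have p0 : 0 < npow n (- 2^-1) :> R by apply: npow_gt0.
have q0 : 0 < npow n (- theta) :> R by apply: npow_gt0.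
have xb i : x n i < b + 4 * xi.
  have [i0|i0] := posnP i; first by have /andP[] := hx0 i i0.
  have /andP[_ h] := hx0 (Ordinal n0) erefl; apply: lt_trans h; exact: hdec.
have hev : n%:R * (1 - ev) = (n - s_).+1%:R.
  have sn' : (s_ <= n)%N by case/andP: hs => _ h; apply: (leq_trans h); exact: leq_pred.
  by rewrite -natr1 natrB// /ev; field; rewrite gt_eqF.
have heu' : n%:R * (1 - eu) = (n - r - 1)%:R.
  have rn' : (r + 1 <= n)%N by rewrite addn1; case/andP: hr => _ h; rewrite -(prednK n0) ltnS.
  by rewrite -subnDA natrB// natrD /eu; field; rewrite gt_eqF.
(* k = n (1 - eu) exceeds 2 n xi, hence 2, because 1 / n < xi. *)
have hk : (2 <= n - r - 1 < n)%N.
  apply/andP; split; last first.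
    by rewrite -subnDA ltn_subrL n0 addn1 /=.
  rewrite -(ler_nat R) -heu'; have : 2 * xi < 1 - eu by exact: lt_trans heu.
  move=> h; have := ltr_pM2l nR (2 * xi) (1 - eu); rewrite h => h'.
  apply: ltW; apply: lt_trans h'.
  have : 1 < n%:R * xi by rewrite -ltr_pdivrMl// mulr1.
  by clear; lra.
have hm : (n - s_ < n)%N by rewrite ltn_subrL n0 andbT; case/andP: hs.
have pq : 2 * npow n (- 2^-1) < npow n (- theta) :> R.
  have [_ _ _ _ [_ _ _ _ e]] := npow_scales theta n0.
  by move: hpq; rewrite e ltr_pdivrMr//; clear; lra.
have htn : `|tn - t| < npow n (- 2^-1) by rewrite ltr_norml; move: tn1 tn2; clear => *; lra.
have hsn : `|sn - s| < npow n (- 2^-1) by rewrite ltr_norml; move: sn1 sn2; clear => *; lra.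
have hbt : b + 16 * xi < t by move: hst hbs xi0; clear; lra.
have hsb : b + 8 * xi < s by move: hbs xi0; clear; lra.
have [v1 v2] := andP hv; have [u1 u2] := andP hu.
have [vtn hcirc] := circle_arith xi0 p0 q0 hq pq htn f2t0 v2 hac hcb hbt hq2.
have xt i : x n i < t by move: (xb i) hbt xi0; clear; lra.
have xtn i : x n i < tn by move: (xb i) hbt xi0 tn1 pq hq; clear; lra.
have xs i : x n i < s by move: (xb i) hsb xi0; clear; lra.
have vt : v < t by move: v2 hcb hbt xi0; clear; lra.
have us : u < s by move: u2 hcb hsb xi0; clear; lra.
have iR0 : 0 < n%:R^-1 :> R by rewrite invr_gt0.
have zero (c d : R) : (n%:R^-1 * (c - d))%:C = 0 :> R[i] -> c = d.
  move/(congr1 (@Re R)) => /= /eqP; rewrite mulf_eq0 gt_eqF//= subr_eq0 => /eqP //.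
have e1 := real_lt_complex (cderive_fprime_real n0 hev xt vt) L3.
have e2 := complex_lt_real (cderive_fprime_real n0 heu' xs us) L3'.
have e3 := real_lt_complex (cderive_fprime_real n0 hev xtn vtn) L6.
have c1 := zero _ _ (etrans (esym (@fprime_real R x n _ v ev tn n0 hev)) z1).
have c2 := zero _ _ (etrans (esym (@fprime_real R x n _ u eu sn n0 heu')) z2).
split => //.
- move=> i j eij; apply/val_inj; case: (ltngtP (val i) (val j)) => // h.
    by have := hdec _ _ h; rewrite eij ltxx.
  by have := hdec _ _ h; rewrite eij ltxx.
- by move: huv; rewrite mulrC.
- apply: (circle_condition n0 vtn xtn c1 _ hcirc).
  by rewrite -ler_pdivlMl// ltW.
- have : 0 < n%:R^-1 * ((n - s_).+1%:R * (t - v) ^- 2 - \sum_i (t - x n i) ^- 2).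
    by apply: lt_trans e1; rewrite mulr_gt0.
  by rewrite pmulr_rgt0.
- have : n%:R^-1 * ((n - r - 1)%:R * (s - u) ^- 2 - \sum_i (s - x n i) ^- 2) < 0.
    by apply: lt_trans e2 _; rewrite pmulr_rlt0.
  by rewrite pmulr_rlt0// subr_lt0 subr_gt0.
Qed.

Lemma kernel_tilde_diag (x : forall n, 'I_n -> R) (n : nat) (u v : R) (s : nat) : (s < n)%N ->
  kernel_tilde x n u s v s = (n%:R - s%:R) * J_residues (x n) u v (n - s - 1) (n - s).
Proof.
move=> sn; rewrite kernel_tilde_residues; congr (_ * _).
have e : (n - s)%N = (n - s - 1).+1 by rewrite subn1 prednK// subn_gt0.
rewrite -natrB; last exact: ltnW.
by rewrite {1 3}e factS natrM mulfK// pnatr_eq0 -lt0n fact_gt0.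
Qed.

Lemma phi_diag (r : nat) (u v : R) : phi r r u v = 0.
Proof. by rewrite /phi leqnn mulr0. Qed.
End RegimeConstruction.

(** * Bounds independent of n *)

Section UniformBounds.
Context {R : realType}.

Lemma cauchy_transform_n_real (x : forall n, 'I_n -> R) (n : nat) (y : R) :
  cauchy_transform_nR x n y = n%:R^-1 * \sum_i (y - x n i)^-1 /\
  cauchy_transform_n x n y%:C = (cauchy_transform_nR x n y)%:C.
Proof.
have e : cauchy_transform_n x n y%:C = (n%:R^-1 * \sum_i (y - x n i)^-1)%:C.
  rewrite /cauchy_transform_n natCE rmorphM fmorphV rmorph_sum /=; congr (_ * _).
  by apply: eq_bigr => i _; rewrite fmorphV rmorphB.
by rewrite /cauchy_transform_nR e ReC.
Qed.

Lemma fprime_nR (x : forall n, 'I_n -> R) (n : nat) (v e y : R) :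
  fprime (cauchy_transform_n x n) v e y%:C =
  (cauchy_transform_nR x n y - (1 - e) / (y - v))%:C.
Proof.
have [_ h] := cauchy_transform_n_real x n y.
by rewrite /fprime h !(rmorphB, rmorphM, fmorphV).
Qed.

Lemma cauchy_transform_nR_bounds (x : forall n, 'I_n -> R) (n : nat) (y be : R) : (0 < n)%N -> 0 < be ->
  (forall i, be <= y - x n i) -> 0 <= cauchy_transform_nR x n y <= be^-1.
Proof.
move=> n0 b0 h; have [-> _] := cauchy_transform_n_real x n y.
have nR : 0 < n%:R :> R by rewrite ltr0n.
have p i : 0 < y - x n i by exact: lt_le_trans (h i).
rewrite mulr_ge0 ?invr_ge0 ?(ltW nR)//=; last first.
  by apply: sumr_ge0 => i _; rewrite invr_ge0 ltW.
rewrite ler_pdivrMl//; have -> : n%:R * be^-1 = \sum_(i < n) be^-1 by rewrite sumr_const card_ord mulr_natl.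
by apply: ler_sum => i _; rewrite lef_pV2 ?posrE.
Qed.

Lemma D_of_sqr (g : R[i] -> R[i]) (y : R) : D_of g y ^+ 2 = 2^-1 * cmod (cderive g y%:C).
Proof. by rewrite sqr_sqrtr// mulr_ge0 ?cmod_ge0. Qed.

Lemma D_of_lower (g : R[i] -> R[i]) (y f2 : R) : (4^-1 * f2)%:C < cderive g y%:C ->
  8^-1 * f2 <= D_of g y ^+ 2.
Proof.
by rewrite D_of_sqr ltcE ReC => /andP[_ h]; have := Re_le (cderive g y%:C); move: h; clear; lra.
Qed.

Lemma D_of_lowerN (g : R[i] -> R[i]) (y f2 : R) : cderive g y%:C < (4^-1 * f2)%:C ->
  8^-1 * - f2 <= D_of g y ^+ 2.
Proof.
rewrite D_of_sqr ltcE ReC => /andP[_ h]; have := Re_le (- cderive g y%:C).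
by rewrite cmodN ReN; move: h; clear; lra.
Qed.

Lemma le_1D_sqr (d : R) : d <= 1 + d ^+ 2.
Proof. have := sqr_ge0 (d - 2^-1); lra. Qed.

(** D^2 is a difference of nonnegative terms, so its positive term alone bounds it; [le_1D_sqr] then
    removes the square. *)
Lemma regime_D_le (x : forall n, 'I_n -> R) (n k m : nat)
    (b chi xi u v t s tn sn ev eu theta : R) :
  regime x n k m b chi xi u v t s tn sn ev eu theta ->
  D_of (fprime (cauchy_transform_n x n) v ev) t <= 1 + (t - chi - 4 * xi) ^- 2 /\
  D_of (fprime (cauchy_transform_n x n) u eu) s <= 1 + (s - b - 4 * xi) ^- 2.
Proof.
move=> rg; have [D0 eD Dt0 eDt] := regime_D rg.
have nR : 0 < n%:R :> R by rewrite ltr0n (rg_n rg).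
have [hbs hst hcb hxi] := And4 (rg_bs rg) (rg_st rg) (rg_cb rg) (rg_xi rg).
have [v1 v2] := andP (rg_v rg).
have g0 : 0 < t - chi - 4 * xi by move: hbs hst hcb hxi; clear; lra.
have b0 : 0 < s - b - 4 * xi by move: hbs hxi; clear; lra.
have gv : t - chi - 4 * xi <= t - v by move: v2; clear; lra.
have inv2 (c d : R) : 0 < c -> c <= d -> d ^- 2 <= c ^- 2.
  move=> c0 cd; rewrite lef_pV2 ?posrE ?exprn_gt0// ?(lt_le_trans c0)//.
  by rewrite ler_sqr ?nnegrE ?(ltW c0)// (le_trans (ltW c0)).
have half (a c : R) : 0 <= c -> n%:R * a = 2^-1 * c -> forall e, c <= n%:R * e -> a <= e.
  move=> c0 ea e ce; rewrite -(ler_pM2l nR) ea; apply: le_trans ce.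
  by rewrite ler_piMl// invf_le1// ler1n.
split; apply: (le_trans (le_1D_sqr _)); rewrite lerD2l.
  apply: (half _ _ _ eD); first exact: ltW (rg_ft rg).
  apply: (@le_trans _ _ (m.+1%:R * (t - v) ^- 2)).
    rewrite gerBl; apply: sumr_ge0 => i _; rewrite invr_ge0; exact: sqr_ge0.
  apply: ler_pM; rewrite ?ler0n ?invr_ge0 ?sqr_ge0 ?ler_nat ?(rg_m rg)//.
  exact: inv2.
apply: (half _ _ _ eDt); first exact: ltW (rg_fs rg).
apply: (@le_trans _ _ (\sum_i (s - x n i) ^- 2)).
  by rewrite gerBl mulr_ge0 ?ler0n// invr_ge0 sqr_ge0.
have -> : n%:R * (s - b - 4 * xi) ^- 2 = \sum_(i < n) (s - b - 4 * xi) ^- 2.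
  by rewrite sumr_const card_ord mulr_natl.
apply: ler_sum => i _; apply: inv2 => //.
by move: (rg_x rg i); clear; lra.
Qed.

(** n^(2 theta) / n is the inverse of y = n q^2, hence at most 1: a derivative of order 1 / n at t
    or s keeps E_{2,n} and \tilde E_{2,n} bounded. *)
Lemma E_term_le (n : nat) (theta K c : R) : (0 < n)%N -> 0 <= K -> 1 <= n%:R * npow n (- theta) ^+ 2 ->
  c <= K / n%:R -> 2 * npow n (2 * theta) * c <= 2 * K.
Proof.
move=> n0 K0 y1 hc; have [_ _ _ _ [_ _ -> _ _]] := npow_scales theta n0.
have q0 : 0 < npow n (- theta) :> R by apply: npow_gt0.
have nR : 0 < n%:R :> R by rewrite ltr0n.
set q := npow n (- theta) in y1 q0 *.
have i0 : 0 <= q ^- 2 by rewrite invr_ge0 exprn_ge0// ltW.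
rewrite -mulrA; apply: ler_wpM2l => //; apply: (le_trans (ler_wpM2l i0 hc)).
have -> : q ^- 2 * (K / n%:R) = K * (n%:R * q ^+ 2)^-1.
  by field; rewrite !gt_eqF.
rewrite -[leRHS]mulr1; apply: ler_wpM2l => //.
by rewrite invf_le1// (lt_le_trans ltr01).
Qed.

Lemma G_n_pos_le (theta chi t s : R) (n : nat) (D Dt mu C : R) : (0 < n)%N -> chi < s -> s < t ->
  mu <= D ^+ 2 -> mu <= Dt ^+ 2 ->
  expR (- (mu / 4 * (n%:R * npow n (- theta) ^+ 2))) * (npow n (- theta))^-1 <= C ->
  0 < G_n theta chi t s n D Dt <=
    8 * (s - chi) + 8 * (t - chi) + 16 * (C * ((t - chi) * (s - chi))).
Proof.
move=> n0 cs st m1 m2 hC; rewrite /G_n.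
have [_ _ _ -> [_ -> _ _ _]] := npow_scales theta n0.
have q0 : 0 < npow n (- theta) :> R by apply: npow_gt0.
have nR : 0 < n%:R :> R by rewrite ltr0n.
set q := npow n (- theta) in hC q0 *.
have cs0 : 0 < s - chi by rewrite subr_gt0.
have ct0 : 0 < t - chi by rewrite subr_gt0 (lt_trans cs).
have prod0 : 0 <= (t - chi) * (s - chi) by rewrite mulr_ge0// ltW.
set X := expR (- (4^-1 * _ * _)).
have XC : X * q^-1 <= C.
  apply: le_trans hC; apply: ler_wpM2r; first by rewrite invr_ge0 ltW.
  rewrite ler_expR lerN2; have -> : mu / 4 * (n%:R * q ^+ 2) = 4^-1 * (n%:R * q ^+ 2) * mu by ring.
  apply: ler_wpM2l; first by apply: mulr_ge0 => //; exact: (mulr_ge0 (ltW nR) (sqr_ge0 q)).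
  by rewrite le_min m1 m2.
have X0 : 0 <= X * q^-1 by rewrite mulr_ge0 ?expR_ge0// invr_ge0 ltW.
have h1 := ler_wpM2r prod0 XC; have h2 := mulr_ge0 X0 prod0.
have -> : 2 ^+ 4 * X * q^-1 * (t - chi) * (s - chi) = 16 * (X * q^-1 * ((t - chi) * (s - chi))) by ring.
have -> : 2 ^+ 3 * (s - chi) + 2 ^+ 3 * (t - chi) = 8 * (s - chi) + 8 * (t - chi) by ring.
by apply/andP; split; move: h1 h2 cs0 ct0; clear; lra.
Qed.

Lemma F_bound_mono (E E' Et Et' d X X' D D' Dt Dt' : R) : E <= E' -> Et <= Et' -> 0 <= X <= X' ->
  0 <= D <= D' -> 0 <= Dt <= Dt' ->
  12 * (E + Et) + d + X * (4 + 54 * (D + Dt) + 122 * (D * Dt)) <=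
  12 * (E' + Et') + d + X' * (4 + 54 * (D' + Dt') + 122 * (D' * Dt')).
Proof.
move=> h1 h2 /andP[X0 h3] /andP[D0 h4] /andP[D0' h5].
have hp : D * Dt <= D' * Dt' by exact: ler_pM.
have hp0 : 0 <= D * Dt by exact: mulr_ge0.
have : X * (4 + 54 * (D + Dt) + 122 * (D * Dt)) <= X' * (4 + 54 * (D' + Dt') + 122 * (D' * Dt')).
  by apply: ler_pM => //; move: D0 D0' h4 h5 hp hp0; clear; lra.
by move: h1 h2; clear; lra.
Qed.

Lemma min_facts (f g A B : R) : 0 < f -> g < 0 -> 8^-1 * f <= A -> 8^-1 * - g <= B ->
  [/\ 0 < Num.min (8^-1 * f) (8^-1 * - g), Num.min (8^-1 * f) (8^-1 * - g) <= A
    & Num.min (8^-1 * f) (8^-1 * - g) <= B].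
Proof.
move=> f0 g0 hA hB; split; first by rewrite lt_min !mulr_gt0// oppr_gt0.
  by apply: le_trans hA; rewrite ge_min lexx.
by apply: le_trans hB; rewrite ge_min lexx orbT.
Qed.

Lemma fprime_residual_le (x : forall n, 'I_n -> R) (n : nat) (v e chi' eta' y mm y1 y2 ga be B : R) :
  (0 < n)%N -> 0 < ga -> ga <= y - v -> 0 < be -> (forall i, be <= y - x n i) -> chi' < y ->
  `|y1| <= B -> `|y2| <= B -> fprime (cauchy_transform_n x n) chi' eta' y%:C = 0 ->
  v = chi' + mm * npow n (- 2^-1) + y1 * n%:R^-1 ->
  e = eta' + mm * cauchy_transform_nR x n y * npow n (- 2^-1) + y2 * n%:R^-1 ->
  cmod (fprime (cauchy_transform_n x n) v e y%:C) <= (B + be^-1 * B) / ga / n%:R.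
Proof.
move=> n0 g0 gv b0 hb cy h1 h2 z ev ee; have nR : 0 < n%:R :> R by rewrite ltr0n.
move: z; rewrite !fprime_nR cmodR => /(congr1 (@Re R)) /= /eqP; rewrite subr_eq0 => /eqP eC.
apply: (residual_bound nR g0 gv _ (cauchy_transform_nR_bounds n0 b0 hb) h1 h2 eC ev ee).
by rewrite gt_eqF.
Qed.

Lemma regime_F_const (x : forall n, 'I_n -> R) (n k m : nat)
    (b chi xi u v t s tn sn ev eu theta mu C K1 K2 : R) :
  let fn' := fprime (cauchy_transform_n x n) v ev in
  let ftn' := fprime (cauchy_transform_n x n) u eu in
  let y := n%:R * npow n (- theta) ^+ 2 in
  regime x n k m b chi xi u v t s tn sn ev eu theta ->
  0 < mu -> mu <= D_of fn' t ^+ 2 -> mu <= D_of ftn' s ^+ 2 ->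
  1 <= y -> expR (- (mu / 2 * y)) * y / (n%:R * npow n (- theta) ^+ 3) <= C ->
  0 <= K1 -> 0 <= K2 -> cmod (fn' t%:C) <= K1 / n%:R -> cmod (ftn' s%:C) <= K2 / n%:R ->
  F_n theta t s n (flog x n m.+1 v) (flog x n k u) (D_of fn' t) (D_of ftn' s) tn sn <=
    12 * ((2 * K1 + 2 ^+ 6 / (t - b) ^+ 3 + 2 ^+ 5 / (t - chi) ^+ 3) +
          (2 * K2 + 2 ^+ 9 / (s - b) ^+ 3 + 2 ^+ 6 / (s - chi) ^+ 3)) + 54 / (t - s) +
    C * (4 + 54 * ((1 + (t - chi - 4 * xi) ^- 2) + (1 + (s - b - 4 * xi) ^- 2)) +
         122 * ((1 + (t - chi - 4 * xi) ^- 2) * (1 + (s - b - 4 * xi) ^- 2))).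
Proof.
move=> fn' ftn' y rg mu0 m1 m2 y1 hC K10 K20 h1 h2.
have [D0 _ Dt0 _] := regime_D rg; have [Dl Dtl] := regime_D_le rg.
have n0 := rg_n rg; have nR : 0 < n%:R :> R by rewrite ltr0n.
have q0 : 0 < npow n (- theta) :> R by apply: npow_gt0.
apply: (le_trans (regime_F_le rg mu0 m1 m2 erefl)).
apply: F_bound_mono.
- by rewrite !lerD2r; exact: E_term_le.
- by rewrite !lerD2r; exact: E_term_le.
- apply/andP; split; last exact: hC.
  apply: divr_ge0; last by rewrite mulr_ge0 ?exprn_ge0 ?(ltW q0).
  exact: (mulr_ge0 (expR_ge0 _) (le_trans ler01 y1)).
- by apply/andP; split; [exact: (ltW D0)|exact: Dl].
- by apply/andP; split; [exact: (ltW Dt0)|exact: Dtl].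
Qed.

(** In the partial order of R[i] the inequality 0 < z / 4 forces z to be real, so the reality of
    f''(t) is read off the hypothesis itself. *)
Lemma quarter_pos (z w : R[i]) : 0 < 4^-1 * z < w ->
  [/\ 0 < Re z, z = (Re z)%:C & (4^-1 * Re z)%:C < w].
Proof.
have e5 : 4^-1 * z = (4^-1 * Re z) +i* (4^-1 * Im z).
  have -> : (4^-1 : R[i]) = (4^-1)%:C by rewrite natCE fmorphV.
  exact: scaleCE.
rewrite e5 => /andP[h1 h2]; rewrite ltcE /= in h1; case/andP: h1 => /eqP i0 r0.
have {}i0 : Im z = 0 by apply/eqP; move/eqP: i0; rewrite mulf_eq0 gt_eqF.
have ez : z = (Re z)%:C by apply: eqC; rewrite ?ReC ?ImC.
split=> //; first by move: r0; rewrite pmulr_rgt0.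
by rewrite i0 mulr0 in h2.
Qed.

Lemma quarter_neg (z w : R[i]) : w < 4^-1 * z < 0 -> Re z < 0 /\ w < (4^-1 * Re z)%:C.
Proof.
move=> /andP[h1 h2]; have [] := @quarter_pos (- z) (- w).
  by rewrite mulrN oppr_gt0 h2 ltrN2 h1.
rewrite ReN oppr_gt0 => h3 _; rewrite mulrN rmorphN ltrN2 => h4.
by [].
Qed.
End UniformBounds.

(** * Asymptotics of J_n and the diagonal kernel *)

Theorem theorem2p3 (R : realType)
  (mu : probability (measurableTypeR R) R) (a b : R)
  (hab : a < b) (hsupp : msupport mu `<=` `[a, b])
  (hasupp : msupport mu a) (hbsupp : msupport mu b)
  (hatom : (0 < mu [set b])%E)
  (x : forall n : nat, 'I_n -> R)
  (hdecr : forall (n : nat) (i j : 'I_n), (i < j)%N -> x n j < x n i)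
  (hweak : empirical_cvg x mu)
  (chi eta t s : R) (hO : region_O mu a b chi eta)
  (hbs : b < s) (hst : s < t) :
  let f' := fprime (cauchy_transform mu a b) chi eta in
  let fts' := fun n => fprime (cauchy_transform_n x n) (chi_n x t s n) (eta_n x t s n) in
  f' t%:C = 0 -> f' s%:C = 0 ->
  forall (un vn : nat -> R) (rn sn : nat -> nat),
  (forall n, (1 < n)%N -> (1 <= rn n <= n.-1)%N /\ (1 <= sn n <= n.-1)%N) ->
  forall m mt y1 y2 yt1 yt2 : nat -> R,
  m =O_\oo (fun=> 1 : R) -> mt =O_\oo (fun=> 1 : R) ->
  y1 =O_\oo (fun=> 1 : R) -> y2 =O_\oo (fun=> 1 : R) ->
  yt1 =O_\oo (fun=> 1 : R) -> yt2 =O_\oo (fun=> 1 : R) ->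
  (forall n, (1 < n)%N ->
    [/\ vn n = chi_n x t s n + m n * npow n (- 2^-1) + y1 n * n%:R^-1,
        ((sn n)%:R - 1) / n%:R =
          eta_n x t s n + m n * cauchy_transform_nR x n t * npow n (- 2^-1)
          + y2 n * n%:R^-1,
        un n = chi_n x t s n + mt n * npow n (- 2^-1) + yt1 n * n%:R^-1
      & ((rn n)%:R + 1) / n%:R =
          eta_n x t s n + mt n * cauchy_transform_nR x n s * npow n (- 2^-1)
          + yt2 n * n%:R^-1]) ->
  let f := fun n => flog x n (n - sn n + 1) (vn n) in
  let ft := fun n => flog x n (n - rn n - 1) (un n) in
  let fn' := fun n => fprime (cauchy_transform_n x n) (vn n) (((sn n)%:R - 1) / n%:R) in
  let ftn' := fun n => fprime (cauchy_transform_n x n) (un n) (((rn n)%:R + 1) / n%:R) in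
  let D := fun n => D_of (fn' n) t in
  let Dt := fun n => D_of (ftn' n) s in
  forall (theta : R), 3^-1 < theta < 2^-1 ->
  forall (xi : R) (N : nat), 0 < xi -> (1 <= N)%N ->
  (* (N1) *)
  [/\ t - 4 * xi > s + 4 * xi, s + 4 * xi > s - 4 * xi,
      s - 4 * xi > b + 4 * xi, b + 4 * xi > b - 4 * xi
    & [/\ b - 4 * xi > chi + 4 * xi, chi + 4 * xi > chi - 4 * xi
        & chi - 4 * xi > a + 4 * xi]] ->
  [/\ 1 - 2 * xi > 1 - eta + 2 * xi, 1 - eta + 2 * xi > 1 - eta - 2 * xi
    & 1 - eta - 2 * xi > 2 * xi] ->
  (* (N2) *)
  (forall n, (N < n)%N ->
    [/\ [/\ (forall i : 'I_n, i = 0%N :> nat -> b - 4 * xi < x n i < b + 4 * xi)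
          & (forall i : 'I_n, i = n.-1 :> nat ->
               a - 4 * xi < x n i < a + 4 * xi)],
        [/\ chi - 4 * xi < chi_n x t s n < chi + 4 * xi,
            chi - 4 * xi < vn n < chi + 4 * xi
          & chi - 4 * xi < un n < chi + 4 * xi],
        [/\ 1 - eta - 2 * xi < 1 - eta_n x t s n < 1 - eta + 2 * xi,
            1 - eta - 2 * xi < 1 - ((sn n)%:R - 1) / n%:R < 1 - eta + 2 * xi
          & 1 - eta - 2 * xi < 1 - ((rn n)%:R + 1) / n%:R < 1 - eta + 2 * xi]
      & (exists i : 'I_n, x n i > Num.max (vn n) (un n)) /\
        (exists i : 'I_n, x n i < Num.min (vn n) (un n))]) ->
  (* (N3) *)
  (forall n, (N < n)%N ->
    let E := 2 * npow n (2 * theta) * cmod (fn' n t%:C)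
             + 2 ^+ 6 / (t - b) ^+ 3 + 2 ^+ 5 / (t - chi) ^+ 3 in
    let Et := 2 * npow n (2 * theta) * cmod (ftn' n s%:C)
             + 2 ^+ 9 / (s - b) ^+ 3 + 2 ^+ 6 / (s - chi) ^+ 3 in
    [/\ [/\ npow n (3^-1 - theta) < 2^-1, npow n (- 2^-1 + theta) < 2^-1
          & npow n (- theta) < xi],
        [/\ npow n (- 2^-1) < 2^-1 * xi, `|vn n - un n| < 2^-1 * xi
          & n%:R^-1 < xi],
        npow n (- theta) <
          2 ^- 6 * (t - chi) * (t - b) ^+ 3 * (b - a)^-1 * cmod (cderive f' t%:C)
      & npow n (1 - 3 * theta) * (E + Et) < 1]) ->
  (* (L1) *)
  (forall n, (N < n)%N ->
    0 < 2^-1 * cderive f' t%:C < cderive (fts' n) t%:C /\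
    cderive (fts' n) s%:C < 2^-1 * cderive f' s%:C < 0) ->
  (* (L2) *)
  (forall n, (N < n)%N ->
    sole_root_in (fts' n) t%:C xi t%:C /\ sole_root_in (fts' n) s%:C xi s%:C) ->
  (* (L3) *)
  (forall n, (N < n)%N ->
    0 < 4^-1 * cderive f' t%:C < cderive (fn' n) t%:C /\
    cderive (ftn' n) s%:C < 4^-1 * cderive f' s%:C < 0) ->
  (* (L4) : tn is t_n and sn' is s_n^* *)
  forall tn sn' : nat -> R,
  (forall n, (N < n)%N ->
    [/\ sole_root_in (fn' n) t%:C (npow n (- 2^-1)) (tn n)%:C,
        sole_root_in (fn' n) s%:C xi (sn' n)%:C,
        tn n \in `]t - npow n (- 2^-1), t + npow n (- 2^-1)[,
        `]t - npow n (- 2^-1), t + npow n (- 2^-1)[ `<=`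
          `]t - xi / 2, t + xi / 2[
      & sn' n \in `]s - xi, s + xi[]) ->
  (* (L5) : ttn is \tilde t_n and stn is \tilde s_n *)
  forall ttn stn : nat -> R,
  (forall n, (N < n)%N ->
    [/\ sole_root_in (ftn' n) t%:C xi (ttn n)%:C,
        sole_root_in (ftn' n) s%:C (npow n (- 2^-1)) (stn n)%:C,
        ttn n \in `]t - xi, t + xi[,
        stn n \in `]s - npow n (- 2^-1), s + npow n (- 2^-1)[
      & `]s - npow n (- 2^-1), s + npow n (- 2^-1)[ `<=`
          `]s - xi / 2, s + xi / 2[]) ->
  (* (L6) *)
  (forall n, (N < n)%N ->
    0 < 4^-1 * cderive f' t%:C < cderive (fn' n) (tn n)%:C /\
    cderive (ftn' n) (stn n)%:C < 4^-1 * cderive f' s%:C < 0) ->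
  (* J_n, for any admissible contours *)
  forall cJ CJ : nat -> R -> R[i],
  (forall n, (N < n)%N -> J_contours x n (un n) (vn n) (cJ n) (CJ n)) ->
  let J := fun n => J_integral x n (rn n) (sn n) (un n) (vn n) (cJ n) (CJ n) in
  let F := fun n => F_n theta t s n (f n) (ft n) (D n) (Dt n) (tn n) (stn n) in
  let G := fun n => G_n theta chi t s n (D n) (Dt n) in
  let ex := fun n => cexp (n%:R * f n t%:C - n%:R * ft n s%:C) in
  let main := fun n => ex n / (4 * pi * (t - s) * D n * Dt n)%:C in
  [/\ (forall n, (N < n)%N ->
        `|n%:R * J n - main n| <
          main n * (npow n (1 - 3 * theta) * F n)%:C +
          ex n / (t - s)%:C *
          (expR (- (4^-1 * npow n (1 - 2 * theta) *
                    Num.min (D n ^+ 2) (Dt n ^+ 2))) *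
           npow n (1 - theta) * G n)%:C),
      (forall n, (N < n)%N -> 0 < F n /\ 0 < G n),
      F =O_\oo (fun=> 1 : R), G =O_\oo (fun=> 1 : R)
    & (forall n, (N < n)%N -> rn n = sn n) ->
      forall n, (N < n)%N ->
        phi (rn n) (sn n) (un n) (vn n) = 0 /\
        (kernel_n x n (un n) (rn n) (vn n) (sn n))%:C =
          (1 - (sn n)%:R / n%:R)%:C * (n%:R * J n)].
Proof.
move=> f' fts' _ _ un vn rn sn hrs m mt y1 y2 yt1 yt2 Om Omt Oy1 Oy2 Oyt1 Oyt2 hpos f ft fn' ftn' D Dt
  theta hth xi N xi0 N1 [hts _ hbs' _ [hcb _ hac]] [_ _ heta] hN2 hN3 _ hL2 hL3 tn sn' hL4 ttn stn hL5 hL6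
  cJ CJ hJ J F G ex main.
set f2t := Re (cderive f' t%:C); set f2s := Re (cderive f' s%:C).
pose ev n := ((sn n)%:R - 1) / n%:R : R; pose eu n := ((rn n)%:R + 1) / n%:R : R.
have gt1 n : (N < n)%N -> (1 < n)%N by move=> h; exact: leq_ltn_trans h.
have hR n : (N < n)%N -> regime x n (n - rn n - 1) (n - sn n) b chi xi (un n) (vn n) t s (tn n) (stn n)
    (ev n) (eu n) theta.
  move=> Nn; have [hr hs] := hrs n (gt1 n Nn).
  have [[hx0 _] [_ hv hu] [_ _ /andP[heu _]] _] := hN2 n Nn.
  have [[_ hpq hq] [_ huv hn] hq2 hE] := hN3 n Nn.
  have [/quarter_pos[f0 ef L3] /quarter_neg[fs0 L3']] := hL3 n Nn.
  have [/quarter_pos[_ _ L6] _] := hL6 n Nn.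
  have [[_ [z1 _] _] _ htn _ _] := hL4 n Nn.
  have [_ [_ [z2 _] _] _ hstn _] := hL5 n Nn.
  have hq2' : npow n (- theta) < 2 ^- 6 * (t - chi) * (t - b) ^+ 3 * (b - a)^-1 * f2t.
    by move: hq2; rewrite [in cmod _]ef cmodR gtr0_norm.
  exact: (regime_intro (gt1 n Nn) (hdecr n) hr hs xi0 hts hbs' hcb hac heta hx0 hv hu heu huv hpq hq hn
    hq2' hE f0 fs0 L3 L3' L6 (z1 0%N isT) (z2 0%N isT) htn hstn).
have Jres n : (N < n)%N -> J n = (J_residues (x n) (un n) (vn n) (n - rn n - 1) (n - sn n))%:C.
  move=> Nn; have rg := hR n Nn.
  rewrite /J /J_integral addn1 (J_contours_eval _ (rg_inj rg) (rg_k rg) (hJ n Nn)) mulrA mulVf ?mul1r//.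
  by rewrite expf_neq0// twopii_neq0.
have exE n : (N < n)%N -> ex n = (weight_ratio (x n) (un n) (vn n) t s (n - rn n - 1) (n - sn n).+1)%:C /\
    0 < weight_ratio (x n) (un n) (vn n) t s (n - rn n - 1) (n - sn n).+1.
  move=> Nn; have rg := hR n Nn; have [xt vt xs us] := regime_lt rg.
  by rewrite /ex /f /ft addn1; exact: (ex_weight_ratio _ _ (rg_n rg) xt vt xs us).
have D0 n : (N < n)%N -> 0 < D n /\ 0 < Dt n.
  by move=> Nn; have [h1 _ h2 _] := regime_D (hR n Nn); exact: (conj h1 h2).
(* A lower bound of both D_n^2 and \tilde D_n^2 independent of n: these are half of |f_n''(t)| and
   |\tilde f_n''(s)|, which (L3) bounds below by a quarter of the limiting values. *)
pose mu1 := Num.min (8^-1 * f2t) (8^-1 * - f2s).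
have hmu n : (N < n)%N -> [/\ 0 < mu1, mu1 <= D n ^+ 2 & mu1 <= Dt n ^+ 2].
  move=> Nn; have [/quarter_pos[f0 _ L3] /quarter_neg[fs0 L3']] := hL3 n Nn.
  exact: (min_facts f0 fs0 (D_of_lower L3) (D_of_lowerN L3')).
(* One admissible index suffices to extract the inequalities that do not depend on n. *)
have n1 : (N < N.+1)%N by [].
have [mu0 _ _] := hmu _ n1.
have [bs st cb cs _] : [/\ b < s, s < t, chi < b, chi < s & 8 * xi < t - s].
  by have [_ _ _ _ h] := regime_order (hR _ n1).
have ge0 : 0 < t - chi - 4 * xi by move: hts hbs' hcb xi0; clear; lra.
have be0 : 0 < s - chi - 4 * xi by move: hbs' hcb xi0; clear; lra.
have de0 : 0 < t - b - 4 * xi by move: hts hbs' xi0; clear; lra.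
have ze0 : 0 < s - b - 4 * xi by move: hbs' xi0; clear; lra.
have nearN : \forall n \near \oo, (N < n)%N by exact: nbhs_infty_gt.
have hG C n : (N < n)%N -> expR (- (mu1 / 4 * (n%:R * npow n (- theta) ^+ 2))) * (npow n (- theta))^-1 <= C ->
    0 < G n <= 8 * (s - chi) + 8 * (t - chi) + 16 * (C * ((t - chi) * (s - chi))).
  move=> Nn hC; have [_ m1 m2] := hmu n Nn.
  exact: (G_n_pos_le (rg_n (hR n Nn)) cs st m1 m2 hC).
have hF0 n : (N < n)%N -> 0 < F n.
  move=> Nn; rewrite /F /f /ft addn1; exact: (regime_F_gt0 (hR n Nn)).
split.
- move=> n Nn; have rg := hR n Nn; have [eE e0] := exE n Nn.
  have h := residue_main_error rg erefl erefl.
  set e := weight_ratio _ _ _ _ _ _ _ in eE e0 h.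
  have eM : main n = (e / (4 * pi * (t - s) * D n * Dt n))%:C.
    by rewrite /main eE [RHS]rmorphM fmorphV.
  (* Both sides are real, so the inequality in R[i] reduces to one in R. *)
  rewrite (Jres n Nn) -cmod_normC eM eE -fmorphV -!rmorphM -rmorphD /= ltcR.
  move: h; rewrite /F /f /ft addn1; exact.
- move=> n Nn; split; first exact: hF0.
  (* For positivity any C will do, in particular the exponential expression itself. *)
  by have /andP[] := hG _ n Nn (lexx _).
- have mu2 : 0 < mu1 / 2 by rewrite divr_gt0.
  have [C C0 hC] := exp_beats_power mu2 hth.
  have [B1 B10 b1] := eqO1_bound Oy1; have [B2 B20 b2] := eqO1_bound Oy2.
  have [B3 B30 b3] := eqO1_bound Oyt1; have [B4 B40 b4] := eqO1_bound Oyt2.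
  pose B := B1 + B2 + B3 + B4.
  have B0 : 0 <= B by rewrite !addr_ge0.
  have [BB1 BB2 BB3 BB4] : [/\ B1 <= B, B2 <= B, B3 <= B & B4 <= B].
    by move: B10 B20 B30 B40; rewrite /B; clear => *; split; lra.
  pose K1 := (B + (t - b - 4 * xi)^-1 * B) / (t - chi - 4 * xi).
  pose K2 := (B + (s - b - 4 * xi)^-1 * B) / (s - chi - 4 * xi).
  have K0 (d e : R) : 0 < d -> 0 < e -> 0 <= (B + d^-1 * B) / e.
    by move=> d0 e0; rewrite divr_ge0 ?(ltW e0)// addr_ge0// mulr_ge0// invr_ge0 ltW.
  pose CF := 12 * ((2 * K1 + 2 ^+ 6 / (t - b) ^+ 3 + 2 ^+ 5 / (t - chi) ^+ 3) +
          (2 * K2 + 2 ^+ 9 / (s - b) ^+ 3 + 2 ^+ 6 / (s - chi) ^+ 3)) + 54 / (t - s) +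
    C * (4 + 54 * ((1 + (t - chi - 4 * xi) ^- 2) + (1 + (s - b - 4 * xi) ^- 2)) +
         122 * ((1 + (t - chi - 4 * xi) ^- 2) * (1 + (s - b - 4 * xi) ^- 2))).
  have hFC n : (N < n)%N -> `|y1 n| <= B1 -> `|y2 n| <= B2 -> `|yt1 n| <= B3 -> `|yt2 n| <= B4 -> `|F n| <= CF.
    move=> Nn a1 a2 a3 a4; rewrite (gtr0_norm (hF0 n Nn)).
    have rg := hR n Nn; have [e1 e2 e3 e4] := hpos n (gt1 n Nn).
    (* (L2) supplies the exact critical equations of f_(t,s),n' at t and s, from which the residuals
       of order 1 / n are computed. *)
    have [[_ [z1 _] _] [_ [z2 _] _]] := hL2 n Nn.
    have [_ [/andP[_ hc] /andP[_ hv] /andP[_ hu]] _ _] := hN2 n Nn.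
    have [_ m1 m2] := hmu n Nn; have [y0 [hX _]] := hC n (rg_n rg).
    have r1 : cmod (fn' n t%:C) <= K1 / n%:R.
      apply: (fprime_residual_le (rg_n rg) ge0 _ de0 _ _ (le_trans a1 BB1) (le_trans a2 BB2) (z1 0%N isT) e1 e2).
      - by move: hv; clear; lra.
      - by move=> i; move: (rg_x rg i); clear; lra.
      - by move: hc ge0; clear; lra.
    have r2 : cmod (ftn' n s%:C) <= K2 / n%:R.
      apply: (fprime_residual_le (rg_n rg) be0 _ ze0 _ _ (le_trans a3 BB3) (le_trans a4 BB4) (z2 0%N isT) e3 e4).
      - by move: hu; clear; lra.
      - by move=> i; move: (rg_x rg i); clear; lra.
      - by move: hc be0; clear; lra.
    rewrite /F /f /ft addn1.
    exact: (regime_F_const rg mu0 m1 m2 y0 hX (K0 _ _ de0 ge0) (K0 _ _ ze0 be0) r1 r2).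
  apply: (bound_eqO1 (C := CF)); near=> n; apply: hFC.
  + by near: n.
  + by near: n.
  + by near: n.
  + by near: n.
  + by near: n.
- have mu4 : 0 < mu1 / 4 by rewrite divr_gt0.
  have [C C0 hC] := exp_beats_power mu4 hth.
  apply: (bound_eqO1 (C := 8 * (s - chi) + 8 * (t - chi) + 16 * (C * ((t - chi) * (s - chi))))).
  apply: filterS nearN => n Nn; have [_ [_ h]] := hC n (rg_n (hR n Nn)).
  by have /andP[g0 g1] := hG C n Nn h; rewrite gtr0_norm.
- move=> hrn n Nn; rewrite (hrn n Nn) phi_diag; split=> //.
  have [_ /andP[s1 s2]] := hrs n (gt1 n Nn).
  have sn1 : (sn n < n)%N by apply: (leq_ltn_trans s2); rewrite ltn_predL; exact: ltnW (gt1 n Nn).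
  have n0 : n%:R != 0 :> R by rewrite pnatr_eq0 -lt0n; exact: ltnW (gt1 n Nn).
  rewrite (Jres n Nn) (hrn n Nn) /kernel_n phi_diag subr0 kernel_tilde_diag//.
  rewrite natCE -!rmorphM /=; congr (_%:C); field.
  exact: n0.
Unshelve. all: by end_near. Qed.
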